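(* Let $F\in\mathcal{S}$, $m\in\mathbb{Z}_{\geq0}$ and $\varepsilon>0$. For $s=\sigma+it$ with $0\le\sigma\le1$ and $|t|$ sufficiently large, and for $y_1,y_2>0$ with $y_1y_2=(Q\lambda_1^{\lambda_1}\cdots\lambda_q^{\lambda_q})^2|t|^{d_F}$, $$F^{(m)}(s)=\sum_{n\le y_1}\frac{a_F(n)(-\log n)^m}{n^s}+\sum_{r=0}^m(-1)^r\binom{m}{r}\chi_F^{(m-r)}(s)\sum_{n\le y_2}\frac{\overline{a_F(n)}(-\log n)^r}{n^{1-s}}+O\big(y_1^{1-\sigma+\varepsilon}|t|^{-1/2}\big)+O\big(y_2^{\sigma+\varepsilon}|t|^{d_F(\frac12-\sigma)-\frac12}\big).$$ In particular, choosing $y_1=y_2=(Q\lambda_1^{\lambda_1}\cdots\lambda_q^{\lambda_q})|t|^{d_F/2}$, the error terms are $O\big(|t|^{\frac{d_F}{2}(1-\sigma)-\frac12+\varepsilon}\big)$.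
   Context: The Selberg class $\mathcal{S}$ consists of $F(s)=\sum_{n\ge1}a_F(n)n^{-s}$ such that: (a) the series converges absolutely for $\mathrm{Re}\,s>1$; (b) for some integer $k\ge0$, $(s-1)^kF(s)$ is entire of finite order; (c) $\Phi(s)=Q^s\prod_{j=1}^q\Gamma(\lambda_js+\mu_j)F(s)$ satisfies $\Phi(s)=\omega\overline{\Phi(1-\bar s)}$, where $q\in\mathbb{Z}_{\ge1}$, $Q>0$, $\lambda_j>0$, $\mu_j\in\mathbb{C}$ with $\mathrm{Re}\,\mu_j\ge0$, $|\omega|=1$; (d) $a_F(n)=O(n^\varepsilon)$ for every $\varepsilon>0$; (e) $\log F(s)=\sum b_F(n)n^{-s}$ with $b_F(n)=0$ unless $n$ is a prime power, and $b_F(n)=O(n^\theta)$ for some $\theta<1/2$. $d_F=2\sum_{j}\lambda_j$ and $\chi_F(s)=\omega Q^{1-2s}\prod_{j=1}^q\frac{\Gamma(\lambda_j(1-s)+\overline{\mu_j})}{\Gamma(\lambda_js+\mu_j)}$. Implied constants depend on $F,m,\varepsilon$. *)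

(* Defs.v *)
From Stdlib Require Import Reals ZArith Znumtheory.
From Coquelicot Require Import Coquelicot.

Open Scope R_scope.

Definition Cexp (z : C) : C :=
  (exp (Re z) * cos (Im z), exp (Re z) * sin (Im z)).

(* x ^ s with the principal (real) logarithm; meaningful for 0 < x only. *)
Definition cpow (x : R) (s : C) : C := Cexp (s * ln x)%C.

(* Gauss's formula: Gamma z = lim n! n^z / (z (z + 1) ... (z + n)).
   The limit exists off the poles 0, -1, -2, ...; at a pole the value is 0,
   because division by 0 yields 0. *)
Definition Gamma_approx (z : C) (n : nat) : C :=
  (INR (fact n) * cpow (INR n) z
   / Iter.iter_nat Cmult 1 (fun k => z + INR k) 0 n)%C.

Definition CGamma (z : C) : C :=
  (real (Lim_seq (fun n => Re (Gamma_approx z n))),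
   real (Lim_seq (fun n => Im (Gamma_approx z n)))).

Definition Gamma_pole (z : C) : Prop := exists k : nat, z = RtoC (- INR k).

Fixpoint C_derive_n (f : C -> C) (m : nat) (s : C) : C :=
  match m with
  | O => f s
  | S p => C_derive (C_derive_n f p) s
  end.

Definition entire (G : C -> C) : Prop :=
  forall z : C, @ex_derive C_AbsRing C_NormedModule G z.

Definition finite_order (G : C -> C) : Prop :=
  exists A K r : R, 0 < r /\
    forall z : C, r <= Cmod z -> Cmod (G z) <= K * exp (Rpower (Cmod z) A).

(* Coefficient sequences are indexed by n >= 1, and their value at 0 is never
   used; the k-th term of the series is that of n = k + 1. *)
Definition dirichlet_term (a : nat -> C) (s : C) (k : nat) : C :=
  (a (S k) * cpow (INR (S k)) (- s))%C.

Definition dirichlet_series (a : nat -> C) (s l : C) : Prop :=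
  @is_series C_AbsRing C_NormedModule (dirichlet_term a s) l.

Definition big_O_pow (a : nat -> C) (theta : R) : Prop :=
  exists K : R, forall n : nat, (1 <= n)%nat ->
    Cmod (a n) <= K * Rpower (INR n) theta.

Definition prime_power (n : nat) : Prop :=
  exists p k : nat, prime (Z.of_nat p) /\ (1 <= k)%nat /\ n = Nat.pow p k.

(* Q^s * prod_{j = 1}^q Gamma (lambda_j s + mu_j) * F s *)
Definition completed (F : C -> C) (q : nat) (Q : R) (lambda : nat -> R)
    (mu : nat -> C) (s : C) : C :=
  (cpow Q s * Iter.iter_nat Cmult 1 (fun j => CGamma (lambda j * s + mu j)) 1 q
   * F s)%C.

(* An element F of the Selberg class, given with its Dirichlet coefficients
   and with the data (q, Q, lambda, mu, omega) of a functional equation.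
   lambda and mu are used at the indices 1, ..., q only.
   F is a meromorphic function whose only possible pole is s = 1; the value of
   the total function sel_fun at 1 is unconstrained. *)
Record selberg_class := Selberg {
  sel_fun :> C -> C;
  sel_a : nat -> C;
  sel_q : nat;
  sel_Q : R;
  sel_lambda : nat -> R;
  sel_mu : nat -> C;
  sel_omega : C;

  sel_abs_cv : forall s : C, 1 < Re s ->
    ex_series (fun k => Cmod (dirichlet_term sel_a s k));
  sel_series : forall s : C, 1 < Re s -> dirichlet_series sel_a s (sel_fun s);

  sel_continuation : exists (k : nat) (G : C -> C),
    entire G /\ finite_order G /\
    forall s : C, s <> RtoC 1 -> G s = ((s - 1) ^ k * sel_fun s)%C;

  sel_q_ge1 : (1 <= sel_q)%nat;
  sel_Q_gt0 : 0 < sel_Q;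
  sel_lambda_gt0 : forall j : nat, (1 <= j <= sel_q)%nat -> 0 < sel_lambda j;
  sel_mu_ge0 : forall j : nat, (1 <= j <= sel_q)%nat -> 0 <= Re (sel_mu j);
  sel_omega_mod : Cmod sel_omega = 1;
  (* An identity between meromorphic functions, stated at the points where
     every factor on either side is regular. *)
  sel_functional_equation : forall s : C,
    s <> RtoC 0 -> s <> RtoC 1 ->
    (forall j : nat, (1 <= j <= sel_q)%nat ->
       ~ Gamma_pole (sel_lambda j * s + sel_mu j)%C /\
       ~ Gamma_pole (sel_lambda j * (1 - Cconj s) + sel_mu j)%C) ->
    completed sel_fun sel_q sel_Q sel_lambda sel_mu s
    = (sel_omega *
       Cconj (completed sel_fun sel_q sel_Q sel_lambda sel_mu
                (1 - Cconj s)))%C;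

  sel_ramanujan : forall eps : R, 0 < eps -> big_O_pow sel_a eps;

  (* The sum L of the b-series is the branch of log F that tends to 0 as
     Re s -> +oo, since b 1 = 0. *)
  sel_euler : exists (b : nat -> C) (theta : R),
    theta < 1 / 2 /\ big_O_pow b theta /\
    (forall n : nat, (1 <= n)%nat -> ~ prime_power n -> b n = RtoC 0) /\
    forall s : C, 1 < Re s ->
      exists L : C, dirichlet_series b s L /\ Cexp L = sel_fun s
}.

Definition degree (F : selberg_class) : R :=
  2 * sum_n_m (sel_lambda F) 1 (sel_q F).

(* Q * lambda_1^lambda_1 * ... * lambda_q^lambda_q *)
Definition conductor_root (F : selberg_class) : R :=
  sel_Q F *
  Iter.iter_nat Rmult 1 (fun j => Rpower (sel_lambda F j) (sel_lambda F j))
    1 (sel_q F).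

Definition chi (F : selberg_class) (s : C) : C :=
  (sel_omega F * cpow (sel_Q F) (1 - 2 * s)
   * Iter.iter_nat Cmult 1
       (fun j => CGamma (sel_lambda F j * (1 - s) + Cconj (sel_mu F j))
                 / CGamma (sel_lambda F j * s + sel_mu F j))
       1 (sel_q F))%C.

(* sum_{n <= y} a_n (- log n)^r / n^s *)
Definition dirichlet_poly (a : nat -> C) (r : nat) (y : R) (s : C) : C :=
  sum_n_m
    (fun n => a n * ((- ln (INR n)) ^ r)%R / cpow (INR n) s)%C
    1 (Z.to_nat (Int_part y)).

Definition afe_main (F : selberg_class) (m : nat) (y1 y2 : R) (s : C) : C :=
  (dirichlet_poly (sel_a F) m y1 s
   + sum_n_m
       (fun r => ((-1) ^ r * Binomial.C m r)%R
                 * C_derive_n (chi F) (m - r) s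
                 * dirichlet_poly (fun n => Cconj (sel_a F n)) r y2 (1 - s))
       0 m)%C.

(* Main.v *)
(** Write [d] for the degree and [c] for the conductor root.
    Integrate [F (s + w) k(w) y1^w / w] over the boundary of a rectangle of
    width about 1 and height [|t|], where [k] is a holomorphic kernel with
    [k(0) = 1] that is concentrated on [|Im w| <= sqrt |t|] and decays faster
    than [F] grows. The residue at 0 is [F s]. On the right edge [F] is its
    Dirichlet series; on the left edge the functional equation gives the dual
    series times [chi s], because [chi' / chi = - ln (c^2 |t|^d) + O(1/|t|)] makes
    [chi (s + w) / chi s] nearly [(y1 y2)^(-w)]. Moving each term to
    [Re w = +- sqrt |t|] shows that the integral of [k(w) (y/n)^w / w] is the
    indicator of [n <= y] up to [exp (- sqrt |t| |ln (y/n)|)], so that sharp cut-offs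
    cost only [y^(1-sigma) / sqrt |t|] and a term [y^(-sigma)]; the latter is
    absorbed because [d >= 1].

    That [d >= 1] comes from the same identity with a kernel vanishing at 0 and
    [y1] at the first nonzero coefficient: this coefficient alone survives on the
    right edge, whereas the dual sum, of length [|t|^d], would be too short to
    compensate it.

    The error term is holomorphic in [s] for fixed [y1], [y2], and its derivatives
    are the error terms for [F^(m)], by Leibniz's and Pascal's rules. Since the
    bound holds on a neighbourhood of the strip, Cauchy's estimates conclude. *)

Require Import Defs.
From Stdlib Require Import Reals Lra Lia ZArith Classical.
From Coquelicot Require Import Coquelicot.

Open Scope R_scope.

(** * Complex derivatives and the exponential *)

(** The width [sqrt |t|] balances two losses. With a kernel of width [M] a sharp cut-off costs about
    [y / M] terms of full size, which favours a large [M]; but the logarithm of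
    [(y1 y2)^w chi (s + w) / chi s] has size [(|w| + |w|^2) / |t|], which stays bounded only for
    [|w|] up to [sqrt |t|]. Beyond that scale, both this factor and [F] itself, known in the strip
    only through its finite order, have to be beaten by the kernel; hence the exponential of a high
    even power, whose degree depends on [F], instead of a Gaussian. The size of [chi] comes from
    integrating its logarithmic derivative from the critical line, where [|chi| = 1]. Cauchy's
    estimates move [s] while [y1] and [y2] stay fixed. Therefore [y1 y2 = c^2 |t|^d] is used only up
    to a factor [exp (O(1/|t|))], and the error is kept as [y1^(- sigma)] times quantities free of
    [sigma], a form that a shift of [sigma] by [delta] changes by at most [max(y1, y2)^delta]. *)

Definition cder (f : C -> C) (z l : C) : Prop :=
  forall eps : R, 0 < eps -> exists d : R, 0 < d /\
    forall w : C, Cmod (w - z) < d ->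
      Cmod (f w - f z - l * (w - z)) <= eps * Cmod (w - z).

Lemma cder_is_derive (f : C -> C) (z l : C) :
  cder f z l <-> @is_derive C_AbsRing C_NormedModule f z l.
Proof.
  split; intros H.
  - split.
    + apply @is_linear_scal_l.
    + intros x Hx. apply @is_filter_lim_locally_unique in Hx. subst x.
      intros eps. destruct (H eps (cond_pos eps)) as [d [d0 Hd]].
      exists (mkposreal d d0). intros w Hw.
      change (Cmod (f w - f z - (w - z) * l) <= eps * Cmod (w - z)).
      rewrite (Cmult_comm (w - z)). apply Hd. exact Hw.
  - intros eps Heps. destruct H as [_ H].
    destruct (H z (fun P HP => HP) (mkposreal eps Heps)) as [d Hd].
    exists d. split. apply cond_pos. intros w Hw.
    rewrite (Cmult_comm l). apply (Hd w). exact Hw.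
Qed.

(** Products and compositions live in [AbsRing_NormedModule C_AbsRing], a structure different from
    the [C_NormedModule] of [entire]; the epsilon form of [cder] passes between the two. *)
Lemma cder_is_derive_abs (f : C -> C) (z l : C) :
  cder f z l <-> @is_derive C_AbsRing (AbsRing_NormedModule C_AbsRing) f z l.
Proof.
  split; intros H.
  - split.
    + apply @is_linear_scal_l.
    + intros x Hx. apply @is_filter_lim_locally_unique in Hx. subst x.
      intros eps. destruct (H eps (cond_pos eps)) as [d [d0 Hd]].
      exists (mkposreal d d0). intros w Hw.
      change (Cmod (f w - f z - (w - z) * l) <= eps * Cmod (w - z)).
      rewrite (Cmult_comm (w - z)). apply Hd. exact Hw.
  - intros eps Heps. destruct H as [_ H].
    destruct (H z (fun P HP => HP) (mkposreal eps Heps)) as [d Hd].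
    exists d. split. apply cond_pos. intros w Hw.
    rewrite (Cmult_comm l). apply (Hd w). exact Hw.
Qed.

Lemma cder_C_derive (f : C -> C) (z l : C) : cder f z l -> C_derive f z = l.
Proof. intros H. apply is_C_derive_unique. now apply cder_is_derive. Qed.

Lemma cder_ext_loc (f g : C -> C) (z l : C) (r : R) : 0 < r ->
  (forall w, Cmod (w - z) < r -> f w = g w) -> cder f z l -> cder g z l.
Proof.
  intros r0 E H eps Heps. destruct (H eps Heps) as [d [d0 Hd]].
  exists (Rmin d r). split. now apply Rmin_pos.
  intros w Hw. rewrite <- E, <- E.
  - apply Hd. eapply Rlt_le_trans. exact Hw. apply Rmin_l.
  - replace (z - z)%C with (RtoC 0) by ring. now rewrite Cmod_0.
  - eapply Rlt_le_trans. exact Hw. apply Rmin_r.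
Qed.

Lemma cder_ext (f g : C -> C) (z l : C) :
  (forall w, f w = g w) -> cder f z l -> cder g z l.
Proof. intros E. apply cder_ext_loc with (r := 1). lra. auto. Qed.

Lemma cder_val (f : C -> C) (z l l' : C) : l = l' -> cder f z l -> cder f z l'.
Proof. now intros ->. Qed.

Lemma cder_const (a z : C) : cder (fun _ => a) z 0.
Proof.
  intros eps Heps. exists 1. split. lra. intros w _.
  replace (a - a - 0 * (w - z))%C with (RtoC 0) by ring. rewrite Cmod_0.
  apply Rmult_le_pos. lra. apply Cmod_ge_0.
Qed.

Lemma cder_id (z : C) : cder (fun w => w) z 1.
Proof.
  intros eps Heps. exists 1. split. lra. intros w _.
  replace (w - z - 1 * (w - z))%C with (RtoC 0) by ring. rewrite Cmod_0.
  apply Rmult_le_pos. lra. apply Cmod_ge_0.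
Qed.

Lemma cder_plus (f g : C -> C) (z l m : C) :
  cder f z l -> cder g z m -> cder (fun w => f w + g w)%C z (l + m)%C.
Proof.
  rewrite 3!cder_is_derive. intros. now apply (@is_derive_plus C_AbsRing C_NormedModule).
Qed.

Lemma cder_mult (f g : C -> C) (z l m : C) :
  cder f z l -> cder g z m -> cder (fun w => f w * g w)%C z (l * g z + f z * m)%C.
Proof.
  rewrite 3!cder_is_derive_abs. intros.
  apply (@is_derive_mult C_AbsRing f g); auto. intros; apply Cmult_comm.
Qed.

Lemma cder_comp (f g : C -> C) (z l m : C) :
  cder f (g z) l -> cder g z m -> cder (fun w => f (g w)) z (l * m)%C.
Proof.
  rewrite 3!cder_is_derive_abs. intros. rewrite Cmult_comm.
  now apply (@is_derive_comp C_AbsRing (AbsRing_NormedModule C_AbsRing) f g).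
Qed.

Lemma cder_scal (f : C -> C) (a z l : C) :
  cder f z l -> cder (fun w => a * f w)%C z (a * l)%C.
Proof.
  intros H. generalize (cder_mult _ _ _ _ _ (cder_const a z) H).
  apply cder_val. ring.
Qed.

Lemma cder_opp (f : C -> C) (z l : C) : cder f z l -> cder (fun w => - f w)%C z (- l)%C.
Proof.
  intros H. generalize (cder_scal _ (-1)%C _ _ H). intros H'.
  apply cder_ext with (f := fun w => (-1 * f w)%C). intros; ring.
  revert H'. apply cder_val. ring.
Qed.

Lemma cder_minus (f g : C -> C) (z l m : C) :
  cder f z l -> cder g z m -> cder (fun w => f w - g w)%C z (l - m)%C.
Proof. intros. apply cder_plus; auto. now apply cder_opp. Qed.

Lemma Cmod_triangle_inv (a b : C) : Cmod a - Cmod b <= Cmod (a - b).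
Proof.
  assert (H := Cmod_triangle (a - b) b).
  replace (a - b + b)%C with a in H by ring. lra.
Qed.

Lemma Cmod_minus_sym (a b : C) : Cmod (a - b) = Cmod (b - a).
Proof. rewrite <- Cmod_opp. f_equal. ring. Qed.

Lemma Cmod_neq0 (a : C) : 0 < Cmod a -> a <> RtoC 0.
Proof. intros H E. rewrite E, Cmod_0 in H. lra. Qed.

Lemma cder_cinv (z : C) : z <> RtoC 0 -> cder Cinv z (- / (z * z))%C.
Proof.
  intros Hz eps Heps. assert (Hm : 0 < Cmod z) by now apply Cmod_gt_0.
  exists (Rmin (Cmod z / 2) (eps * Cmod z ^ 3 / 2)). split.
  { apply Rmin_pos. lra. assert (0 < Cmod z ^ 3) by now apply pow_lt. nra. }
  intros w Hw. assert (H1 := Rlt_le_trans _ _ _ Hw (Rmin_l _ _)).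
  assert (H2 := Rlt_le_trans _ _ _ Hw (Rmin_r _ _)).
  assert (H3 : Cmod z / 2 <= Cmod w).
  { assert (T := Cmod_triangle_inv z w). rewrite Cmod_minus_sym in T. lra. }
  assert (Hw0 : w <> RtoC 0). { apply Cmod_neq0. lra. }
  replace (/ w - / z - - / (z * z) * (w - z))%C
    with ((w - z) * ((w - z) * (/ w * / (z * z))))%C by (now field).
  rewrite !Cmod_mult, !Cmod_inv, !Cmod_mult by (auto; now apply Cmult_neq_0).
  rewrite (Rmult_comm eps). apply Rmult_le_compat_l. apply Cmod_ge_0.
  apply Rle_trans with ((eps * Cmod z ^ 3 / 2) * (/ (Cmod z / 2) * / (Cmod z * Cmod z))).
  - apply Rmult_le_compat; try apply Cmod_ge_0; try lra.
    + apply Rmult_le_pos; left; apply Rinv_0_lt_compat; nra.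
    + apply Rmult_le_compat_r. left; apply Rinv_0_lt_compat; nra.
      apply Rinv_le_contravar; lra.
  - right. field. lra.
Qed.

Lemma cder_inv (f : C -> C) (z l : C) : f z <> RtoC 0 ->
  cder f z l -> cder (fun w => / f w)%C z (- l / (f z * f z))%C.
Proof.
  intros H0 H. generalize (cder_comp _ _ _ _ _ (cder_cinv _ H0) H).
  apply cder_val. field. auto.
Qed.

Lemma cder_pow (n : nat) (z : C) : cder (fun w => w ^ S n)%C z (INR (S n) * z ^ n)%C.
Proof.
  induction n.
  - apply cder_ext with (f := fun w => w). intros; simpl; ring.
    generalize (cder_id z). apply cder_val. simpl. ring.
  - apply cder_ext with (f := fun w => (w * w ^ S n)%C). intros; simpl; ring.
    generalize (cder_mult _ _ _ _ _ (cder_id z) IHn). apply cder_val.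
    rewrite (S_INR (S n)), RtoC_plus. simpl. ring.
Qed.

Lemma cder_continuous (f : C -> C) (z l : C) :
  cder f z l -> forall eps, 0 < eps -> exists d, 0 < d /\
    forall w, Cmod (w - z) < d -> Cmod (f w - f z) < eps.
Proof.
  intros H eps Heps. destruct (H 1 Rlt_0_1) as [d [d0 Hd]].
  set (B := Cmod l + 1). assert (HB : 0 < B) by (generalize (Cmod_ge_0 l); unfold B; lra).
  exists (Rmin d (eps / B)). split. apply Rmin_pos; auto. now apply Rdiv_lt_0_compat.
  intros w Hw. assert (H1 := Rlt_le_trans _ _ _ Hw (Rmin_l _ _)).
  assert (H2 := Rlt_le_trans _ _ _ Hw (Rmin_r _ _)).
  replace (f w - f z)%C with ((f w - f z - l * (w - z)) + l * (w - z))%C by ring.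
  eapply Rle_lt_trans. apply Cmod_triangle. rewrite Cmod_mult.
  specialize (Hd w H1).
  apply Rle_lt_trans with (B * Cmod (w - z)). unfold B; lra.
  apply Rlt_le_trans with (B * (eps / B)). now apply Rmult_lt_compat_l.
  right. field. lra.
Qed.

Lemma Cexp_plus (a b : C) : Cexp (a + b) = (Cexp a * Cexp b)%C.
Proof.
  unfold Cexp. rewrite re_plus, im_plus, exp_plus, cos_plus, sin_plus.
  unfold Cmult; simpl. f_equal; ring.
Qed.

Lemma Cexp_0 : Cexp 0 = RtoC 1.
Proof. unfold Cexp, RtoC, Re, Im; simpl. rewrite exp_0, cos_0, sin_0. f_equal; ring. Qed.

Lemma Cmod_Cexp (z : C) : Cmod (Cexp z) = exp (Re z).
Proof.
  unfold Cmod, Cexp; simpl.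
  replace (_ + _) with (exp (Re z) * exp (Re z)).
  2:{ generalize (sin2_cos2 (Im z)); unfold Rsqr. intros E.
      transitivity (exp (Re z) * exp (Re z) * (sin (Im z) * sin (Im z) + cos (Im z) * cos (Im z))).
      rewrite E; ring. ring. }
  apply sqrt_square. left; apply exp_pos.
Qed.

Lemma Cexp_neq0 (z : C) : Cexp z <> RtoC 0.
Proof. apply Cmod_neq0. rewrite Cmod_Cexp. apply exp_pos. Qed.

Lemma Cexp_RtoC (x : R) : Cexp x = RtoC (exp x).
Proof. unfold Cexp, RtoC, Re, Im; simpl. rewrite cos_0, sin_0. f_equal. ring. apply Rmult_0_r. Qed.

Lemma Cexp_conj (z : C) : Cexp (Cconj z) = Cconj (Cexp z).
Proof.
  unfold Cexp, Cconj, Re, Im; simpl. rewrite cos_neg, sin_neg. f_equal. ring.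
Qed.

(** * Derivatives along curves, mean value and Gronwall inequalities *)

Definition rder (g : R -> C) (x : R) (l : C) : Prop :=
  forall eps : R, 0 < eps -> exists d : R, 0 < d /\
    forall y : R, Rabs (y - x) < d ->
      Cmod (g y - g x - l * RtoC (y - x)) <= eps * Rabs (y - x).

Lemma Im_le_Cmod (z : C) : Rabs (Im z) <= Cmod z.
Proof. eapply Rle_trans. 2: apply Rmax_Cmod. apply Rmax_r. Qed.

Lemma Cmod_le_sum (z : C) : Cmod z <= Rabs (Re z) + Rabs (Im z).
Proof.
  replace z with (RtoC (Re z) + Ci * RtoC (Im z))%C at 1.
  - eapply Rle_trans. apply Cmod_triangle. rewrite Cmod_mult, Cmod_Ci, !Cmod_R. lra.
  - destruct z; unfold Ci, RtoC, Cplus, Cmult, Re, Im; simpl. f_equal; ring.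
Qed.

Lemma rder_is_derive (g : R -> C) (x : R) (l : C) :
  rder g x l -> @is_derive R_AbsRing C_R_NormedModule g x l.
Proof.
  intros H. split.
  + apply @is_linear_scal_l.
  + intros y Hy. apply @is_filter_lim_locally_unique in Hy. subst y.
    intros eps. destruct (H eps (cond_pos eps)) as [d [d0 Hd]].
    exists (mkposreal d d0). intros w Hw.
    assert (K : Cmod (g w - g x - @scal R_AbsRing C_R_NormedModule (w - x)%R l) <= eps * Rabs (w - x)).
    { rewrite scal_R_Cmult, Cmult_comm. apply Hd. exact Hw. }
    rewrite <- Cmod_norm. exact K.
Qed.

Lemma is_derive_eps (g : R -> R) (x l : R) :
  (forall eps : R, 0 < eps -> exists d : R, 0 < d /\
    forall y : R, Rabs (y - x) < d ->
      Rabs (g y - g x - l * (y - x)) <= eps * Rabs (y - x)) -> is_derive g x l.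
Proof.
  intros H. split.
  + apply @is_linear_scal_l.
  + intros y Hy. apply @is_filter_lim_locally_unique in Hy. subst y.
    intros eps. destruct (H eps (cond_pos eps)) as [d [d0 Hd]].
    exists (mkposreal d d0). intros w Hw.
    change (Rabs (g w - g x - (w - x) * l) <= eps * Rabs (w - x)).
    rewrite (Rmult_comm (w - x)). apply Hd. exact Hw.
Qed.

Lemma is_derive_eps_inv (g : R -> R) (x l : R) : is_derive g x l ->
  (forall eps : R, 0 < eps -> exists d : R, 0 < d /\
    forall y : R, Rabs (y - x) < d ->
      Rabs (g y - g x - l * (y - x)) <= eps * Rabs (y - x)).
Proof.
  intros H eps Heps. destruct H as [_ H].
  destruct (H x (fun P HP => HP) (mkposreal eps Heps)) as [d Hd].
  exists d. split. apply cond_pos. intros w Hw.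
  rewrite (Rmult_comm l). apply (Hd w). exact Hw.
Qed.

Lemma rder_re (g : R -> C) (x : R) (l : C) :
  rder g x l -> is_derive (fun y => Re (g y)) x (Re l).
Proof.
  intros H. apply is_derive_eps. intros eps Heps. destruct (H eps Heps) as [d [d0 Hd]].
  exists d. split; auto. intros y Hy. eapply Rle_trans. 2: apply Hd; auto.
  eapply Rle_trans. 2: apply re_le_Cmod. right. f_equal.
  unfold Cminus. rewrite !re_plus, !re_opp, re_scal_r. ring.
Qed.

Lemma rder_im (g : R -> C) (x : R) (l : C) :
  rder g x l -> is_derive (fun y => Im (g y)) x (Im l).
Proof.
  intros H. apply is_derive_eps. intros eps Heps. destruct (H eps Heps) as [d [d0 Hd]].
  exists d. split; auto. intros y Hy. eapply Rle_trans. 2: apply Hd; auto.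
  eapply Rle_trans. 2: apply Im_le_Cmod. right. f_equal.
  unfold Cminus. rewrite !im_plus, !im_opp, im_scal_r. ring.
Qed.

Lemma rder_pair (g : R -> C) (x : R) (l : C) :
  is_derive (fun y => Re (g y)) x (Re l) -> is_derive (fun y => Im (g y)) x (Im l) ->
  rder g x l.
Proof.
  intros H1 H2 eps Heps.
  destruct (is_derive_eps_inv _ _ _ H1 (eps / 2)) as [d [d0 Hd]]. lra.
  destruct (is_derive_eps_inv _ _ _ H2 (eps / 2)) as [e [e0 He]]. lra.
  exists (Rmin d e). split. now apply Rmin_pos. intros y Hy.
  eapply Rle_trans. apply Cmod_le_sum.
  unfold Cminus. rewrite !re_plus, !re_opp, re_scal_r, !im_plus, !im_opp, im_scal_r.
  specialize (Hd y (Rlt_le_trans _ _ _ Hy (Rmin_l _ _))).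
  specialize (He y (Rlt_le_trans _ _ _ Hy (Rmin_r _ _))). unfold Rminus in *. lra.
Qed.

Lemma cder_line (f : C -> C) (p u l : C) (x : R) :
  cder f (p + RtoC x * u) l -> rder (fun y => f (p + RtoC y * u)%C) x (l * u)%C.
Proof.
  intros H eps Heps. set (B := Cmod u + 1).
  assert (HB : 0 < B) by (generalize (Cmod_ge_0 u); unfold B; lra).
  destruct (H (eps / B)) as [d [d0 Hd]]. now apply Rdiv_lt_0_compat.
  exists (d / B). split. now apply Rdiv_lt_0_compat. intros y Hy.
  assert (E : (p + RtoC y * u - (p + RtoC x * u))%C = (RtoC (y - x) * u)%C).
  { rewrite RtoC_minus. ring. }
  assert (L : Cmod (RtoC (y - x) * u) <= Rabs (y - x) * B).
  { rewrite Cmod_mult, Cmod_R. apply Rmult_le_compat_l. apply Rabs_pos. unfold B; lra. }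
  specialize (Hd (p + RtoC y * u)%C). rewrite E in Hd.
  replace (l * u * RtoC (y - x))%C with (l * (RtoC (y - x) * u))%C by ring.
  eapply Rle_trans. apply Hd.
  - eapply Rle_lt_trans. apply L. apply Rlt_le_trans with (d / B * B).
    apply Rmult_lt_compat_r; auto. right; field; lra.
  - apply Rle_trans with (eps / B * (Rabs (y - x) * B)).
    apply Rmult_le_compat_l; auto. left; now apply Rdiv_lt_0_compat.
    right; field; lra.
Qed.

Lemma is_derive_cont (g : R -> R) (x l : R) : is_derive g x l -> continuity_pt g x.
Proof.
  intros H. apply continuity_pt_filterlim. apply (ex_derive_continuous g). now exists l.
Qed.

(** The real mean value theorem is applied to the inner product of [g] with [D = g 1 - g 0]: its
    increment is [|D|^2] and its derivative at most [|D| M]. *)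
Lemma rder_mean_value (g : R -> C) (dg : R -> C) (M : R) :
  (forall x, 0 <= x <= 1 -> rder g x (dg x)) ->
  (forall x, 0 <= x <= 1 -> Cmod (dg x) <= M) -> Cmod (g 1 - g 0) <= M.
Proof.
  intros Hd HM. set (D := (g 1 - g 0)%C).
  set (h := fun x => Re D * Re (g x) + Im D * Im (g x)).
  assert (Hh : forall x, 0 <= x <= 1 ->
    is_derive h x (Re D * Re (dg x) + Im D * Im (dg x))).
  { intros x Hx. unfold h. apply (is_derive_plus (V := R_NormedModule)); apply is_derive_scal.
    now apply rder_re, Hd. now apply rder_im, Hd. }
  destruct (MVT_gen h 0 1 (fun x => Re D * Re (dg x) + Im D * Im (dg x))) as [c [Hc E]].
  - rewrite Rmin_left, Rmax_right by lra. intros x Hx. apply Hh. lra.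
  - rewrite Rmin_left, Rmax_right by lra. intros x Hx.
    eapply is_derive_cont. now apply Hh.
  - rewrite Rmin_left, Rmax_right in Hc by lra.
    assert (E2 : h 1 - h 0 = Cmod D ^ 2).
    { rewrite Cmod2_alt. unfold h, D, Cminus. rewrite re_plus, im_plus, re_opp, im_opp. ring. }
    rewrite E2 in E.
    assert (B : Re D * Re (dg c) + Im D * Im (dg c) <= Cmod D * Cmod (dg c)).
    { replace (Re D * Re (dg c) + Im D * Im (dg c)) with (Re (D * Cconj (dg c))).
      2:{ rewrite re_mult, re_conj, im_conj. ring. }
      eapply Rle_trans. apply Rle_abs. eapply Rle_trans. apply re_le_Cmod.
      rewrite Cmod_mult, Cmod_conj. lra. }
    assert (Q := HM c Hc). assert (P := Cmod_ge_0 D). assert (P' := Cmod_ge_0 (dg c)).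
    destruct (Req_dec (Cmod D) 0) as [E0|N0]. lra.
    assert (Cmod D * Cmod D <= Cmod D * M) by nra.
    apply Rmult_le_reg_l with (Cmod D); lra.
Qed.

Lemma segment_mean_value (f df : C -> C) (p q : C) (M : R) :
  (forall x, 0 <= x <= 1 -> cder f (p + RtoC x * (q - p)) (df (p + RtoC x * (q - p))%C)) ->
  (forall x, 0 <= x <= 1 -> Cmod (df (p + RtoC x * (q - p))%C) <= M) ->
  Cmod (f q - f p) <= M * Cmod (q - p).
Proof.
  intros H HM.
  generalize (rder_mean_value (fun y => f (p + RtoC y * (q - p))%C)
    (fun y => df (p + RtoC y * (q - p))%C * (q - p))%C (M * Cmod (q - p))).
  replace (p + 1 * (q - p))%C with q by ring.
  replace (p + 0 * (q - p))%C with p by ring. intros A. apply A.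
  - intros x Hx. apply cder_line. auto.
  - intros x Hx. rewrite Cmod_mult. apply Rmult_le_compat_r. apply Cmod_ge_0. auto.
Qed.

(** [|f|^2 exp (- 2 N x)] is nonincreasing along the segment. A bound for a logarithmic derivative
    thus controls the ratio of two values without choosing a branch of the logarithm; it serves for
    [chi (s + w) D^w]. *)
Lemma segment_gronwall (f l : C -> C) (p q : C) (M : R) :
  (forall x, 0 <= x <= 1 ->
     cder f (p + RtoC x * (q - p)) (f (p + RtoC x * (q - p)) * l (p + RtoC x * (q - p)))%C) ->
  (forall x, 0 <= x <= 1 -> Cmod (l (p + RtoC x * (q - p))%C) <= M) ->
  Cmod (f q) <= Cmod (f p) * exp (M * Cmod (q - p)).
Proof.
  intros H HM. set (g := fun x : R => f (p + RtoC x * (q - p))%C).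
  set (dg := fun x : R => (g x * l (p + RtoC x * (q - p)) * (q - p))%C).
  assert (Hg : forall x, 0 <= x <= 1 -> rder g x (dg x)).
  { intros x Hx. apply cder_line. now apply H. }
  set (N := M * Cmod (q - p)).
  set (h := fun x => (Re (g x) * Re (g x) + Im (g x) * Im (g x)) * exp (-2 * N * x)).
  set (dh := fun x => (2 * Re (g x) * Re (dg x) + 2 * Im (g x) * Im (dg x)) * exp (-2 * N * x)
     + (Re (g x) * Re (g x) + Im (g x) * Im (g x)) * (-2 * N * exp (-2 * N * x))).
  assert (Hh : forall x, 0 <= x <= 1 -> is_derive h x (dh x)).
  { intros x Hx. assert (A := rder_re _ _ _ (Hg x Hx)). assert (B := rder_im _ _ _ (Hg x Hx)).
    unfold h, dh. evar_last.
    apply (is_derive_mult (K := R_AbsRing)).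
    apply (is_derive_plus (V := R_NormedModule)).
    apply (is_derive_mult (K := R_AbsRing)); [exact A|exact A|]. intros; apply Rmult_comm.
    apply (is_derive_mult (K := R_AbsRing)); [exact B|exact B|]. intros; apply Rmult_comm.
    auto_derive. auto. reflexivity. intros; apply Rmult_comm.
    unfold mult, plus; simpl. ring. }
  assert (Hneg : forall x, 0 <= x <= 1 -> dh x <= 0).
  { intros x Hx. unfold dh.
    replace (_ + _) with (2 * ((Re (g x) * Re (dg x) + Im (g x) * Im (dg x)) -
       (Re (g x) * Re (g x) + Im (g x) * Im (g x)) * N) * exp (-2 * N * x)) by ring.
    assert (P := exp_pos (- 2 * N * x)).
    assert (B : Re (g x) * Re (dg x) + Im (g x) * Im (dg x) <=
       (Re (g x) * Re (g x) + Im (g x) * Im (g x)) * N).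
    { replace (Re (g x) * Re (dg x) + Im (g x) * Im (dg x)) with (Re (g x * Cconj (dg x))).
      2:{ rewrite re_mult, re_conj, im_conj. ring. }
      eapply Rle_trans. apply Rle_abs. eapply Rle_trans. apply re_le_Cmod.
      rewrite Cmod_mult, Cmod_conj. unfold dg. rewrite !Cmod_mult.
      replace (Re (g x) * Re (g x) + Im (g x) * Im (g x)) with (Cmod (g x) ^ 2).
      2:{ rewrite Cmod2_alt. ring. }
      unfold N. assert (Z := HM x Hx). assert (Z1 := Cmod_ge_0 (g x)).
      assert (Z2 := Cmod_ge_0 (q - p)).
      replace (Cmod (g x) * (Cmod (g x) * Cmod (l (p + RtoC x * (q - p))%C) * Cmod (q - p)))
       with (Cmod (g x) ^ 2 * (Cmod (l (p + RtoC x * (q - p))%C) * Cmod (q - p))) by ring.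
      apply Rmult_le_compat_l. apply pow2_ge_0. now apply Rmult_le_compat_r. }
    nra. }
  destruct (MVT_gen h 0 1 dh) as [c [Hc E]].
  - rewrite Rmin_left, Rmax_right by lra. intros x Hx. apply Hh. lra.
  - rewrite Rmin_left, Rmax_right by lra. intros x Hx.
    eapply is_derive_cont. now apply Hh.
  - rewrite Rmin_left, Rmax_right in Hc by lra. specialize (Hneg c Hc).
    assert (I : h 1 <= h 0) by lra. unfold h in I.
    assert (G1 : g 1 = f q) by (unfold g; f_equal; ring).
    assert (G0 : g 0 = f p) by (unfold g; f_equal; ring).
    rewrite G1, G0 in I. rewrite Rmult_0_r, exp_0, Rmult_1_r in I.
    assert (S : forall z, Re z * Re z + Im z * Im z = Cmod z * Cmod z).
    { intros z. generalize (Cmod2_alt z). intros A. simpl in A. lra. }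
    rewrite !S in I.
    assert (X : exp (-2 * N * 1) * (exp N * exp N) = 1).
    { rewrite <- !exp_plus. replace (-2 * N * 1 + (N + N)) with 0 by ring. apply exp_0. }
    fold N. assert (P1 := exp_pos N). assert (Q1 := Cmod_ge_0 (f q)). assert (Q2 := Cmod_ge_0 (f p)).
    apply Rsqr_incr_0_var. unfold Rsqr.
    + replace (Cmod (f q) * Cmod (f q)) with (Cmod (f q) * Cmod (f q) * exp (-2 * N * 1) * (exp N * exp N)).
      2:{ transitivity (Cmod (f q) * Cmod (f q) * (exp (-2 * N * 1) * (exp N * exp N))). ring. rewrite X; ring. }
      replace (Cmod (f p) * exp N * (Cmod (f p) * exp N)) with ((Cmod (f p) * Cmod (f p)) * (exp N * exp N)) by ring.
      apply Rmult_le_compat_r. nra. rewrite !Rmult_1_r in I |- *. exact I.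
    + apply Rmult_le_pos; lra.
Qed.

Lemma rder_Cexp_line (w : C) (x : R) : rder (fun y => Cexp (RtoC y * w)) x (w * Cexp (RtoC x * w))%C.
Proof.
  apply rder_pair.
  - apply is_derive_ext with (fun y => exp (y * Re w) * cos (y * Im w)).
    intros y. unfold Cexp. rewrite re_scal_l, im_scal_l. reflexivity.
    rewrite re_mult. unfold Cexp. rewrite re_scal_l, im_scal_l.
    auto_derive; auto. unfold Re, Im. simpl. ring.
  - apply is_derive_ext with (fun y => exp (y * Re w) * sin (y * Im w)).
    intros y. unfold Cexp. rewrite re_scal_l, im_scal_l. reflexivity.
    rewrite im_mult. unfold Cexp. rewrite re_scal_l, im_scal_l.
    auto_derive; auto. unfold Re, Im. simpl. ring.
Qed.

Lemma Cexp_line_bound (w : C) (x : R) : 0 <= x <= 1 -> Cmod (Cexp (RtoC x * w)) <= exp (Cmod w).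
Proof.
  intros Hx. rewrite Cmod_Cexp, re_scal_l.
  assert (x * Re w <= Cmod w).
  { assert (A := re_le_Cmod w). assert (B := Rle_abs (Re w)).
    assert (C := Cmod_ge_0 w). nra. }
  destruct H. left; now apply exp_increasing. rewrite H; lra.
Qed.

Lemma Cexp_sub1 (w : C) : Cmod (Cexp w - 1) <= Cmod w * exp (Cmod w).
Proof.
  generalize (rder_mean_value (fun y => Cexp (RtoC y * w)) (fun x => w * Cexp (RtoC x * w))%C
    (Cmod w * exp (Cmod w))).
  replace (1 * w)%C with w by ring. replace (0 * w)%C with (RtoC 0) by ring. rewrite Cexp_0.
  intros A; apply A.
  - intros; apply rder_Cexp_line.
  - intros x Hx. rewrite Cmod_mult. apply Rmult_le_compat_l. apply Cmod_ge_0.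
    now apply Cexp_line_bound.
Qed.

Lemma Cexp_sub1_lin (w : C) : Cmod (Cexp w - 1 - w) <= Cmod w ^ 2 * exp (Cmod w).
Proof.
  generalize (rder_mean_value (fun y => Cexp (RtoC y * w) - RtoC y * w)%C
    (fun x => w * (Cexp (RtoC x * w) - 1))%C
    (Cmod w ^ 2 * exp (Cmod w))).
  replace (1 * w)%C with w by ring. replace (0 * w)%C with (RtoC 0) by ring. rewrite Cexp_0.
  replace (Cexp w - w - (1 - 0))%C with (Cexp w - 1 - w)%C by ring.
  intros A; apply A.
  - intros x Hx eps Heps. destruct (rder_Cexp_line w x eps Heps) as [d [d0 Hd]].
    exists d; split; auto. intros y Hy. specialize (Hd y Hy).
    replace (Cexp (RtoC y * w) - RtoC y * w - (Cexp (RtoC x * w) - RtoC x * w) -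
      w * (Cexp (RtoC x * w) - 1) * RtoC (y - x))%C with
      (Cexp (RtoC y * w) - Cexp (RtoC x * w) - w * Cexp (RtoC x * w) * RtoC (y - x))%C; auto.
    rewrite RtoC_minus. ring.
  - intros x Hx. rewrite Cmod_mult.
    assert (B := Cexp_sub1 (RtoC x * w)).
    assert (N : Cmod (RtoC x * w) <= Cmod w).
    { rewrite Cmod_mult, Cmod_R, Rabs_right by lra. generalize (Cmod_ge_0 w); nra. }
    assert (E : exp (Cmod (RtoC x * w)) <= exp (Cmod w)).
    { destruct N as [N|N]. left; now apply exp_increasing. rewrite N; lra. }
    simpl. rewrite Rmult_1_r, Rmult_assoc. apply Rmult_le_compat_l. apply Cmod_ge_0.
    eapply Rle_trans. apply B. apply Rmult_le_compat; auto. apply Cmod_ge_0. left; apply exp_pos.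
Qed.

Lemma cder_Cexp (z : C) : cder Cexp z (Cexp z).
Proof.
  intros eps Heps. set (B := Cmod (Cexp z) * exp 1).
  assert (HB : 0 < B). { unfold B. rewrite Cmod_Cexp. apply Rmult_lt_0_compat; apply exp_pos. }
  exists (Rmin 1 (eps / B)). split. apply Rmin_pos. lra. now apply Rdiv_lt_0_compat.
  intros w Hw. assert (H1 := Rlt_le_trans _ _ _ Hw (Rmin_l _ _)).
  assert (H2 := Rlt_le_trans _ _ _ Hw (Rmin_r _ _)).
  replace (Cexp w - Cexp z - Cexp z * (w - z))%C with (Cexp z * (Cexp (w - z) - 1 - (w - z)))%C.
  2:{ replace (Cexp w) with (Cexp (z + (w - z))) by (f_equal; ring). rewrite Cexp_plus. ring. }
  rewrite Cmod_mult. eapply Rle_trans.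
  - apply Rmult_le_compat_l. apply Cmod_ge_0. apply Cexp_sub1_lin.
  - assert (E : exp (Cmod (w - z)) <= exp 1) by (left; now apply exp_increasing).
    assert (P := Cmod_ge_0 (w - z)). set (x := Cmod (w - z)) in *.
    apply Rle_trans with (B * x * x).
    + unfold B. replace (Cmod (Cexp z) * (x ^ 2 * exp x)) with (Cmod (Cexp z) * exp x * (x * x)) by ring.
      replace (Cmod (Cexp z) * exp 1 * x * x) with (Cmod (Cexp z) * exp 1 * (x * x)) by ring.
      apply Rmult_le_compat_r. nra. apply Rmult_le_compat_l; auto. apply Cmod_ge_0.
    + apply Rmult_le_compat_r; auto. apply Rle_trans with (B * (eps / B)).
      apply Rmult_le_compat_l; lra. right; field; lra.
Qed.

(** * Rectangle integrals and Goursat's lemma *)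

Definition ccont (f : C -> C) (z : C) : Prop :=
  forall eps, 0 < eps -> exists d, 0 < d /\
    forall w, Cmod (w - z) < d -> Cmod (f w - f z) < eps.

Lemma cder_ccont (f : C -> C) (z l : C) : cder f z l -> ccont f z.
Proof. exact (cder_continuous f z l). Qed.

Definition CInt (g : R -> C) (a b : R) : C := @RInt C_R_CompleteNormedModule g a b.
Definition ex_CInt (g : R -> C) (a b : R) : Prop := @ex_RInt C_R_NormedModule g a b.

Lemma ball_C (z w : C) (d : R) : Cmod (w - z) < d -> @ball C_UniformSpace z d w.
Proof.
  intros H. split.
  - change (Rabs (fst w - fst z) < d). eapply Rle_lt_trans. 2: exact H.
    change (fst w - fst z) with (Re (w - z)). apply re_le_Cmod.
  - change (Rabs (snd w - snd z) < d). eapply Rle_lt_trans. 2: exact H.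
    change (snd w - snd z) with (Im (w - z)). apply Im_le_Cmod.
Qed.

Definition scont (g : R -> C) (x : R) : Prop :=
  forall eps, 0 < eps -> exists d, 0 < d /\
    forall y, Rabs (y - x) < d -> Cmod (g y - g x) < eps.

Lemma scont_continuous (g : R -> C) (x : R) : scont g x -> @continuous R_UniformSpace C_UniformSpace g x.
Proof.
  intros H P [e He]. destruct (H e (cond_pos e)) as [d [d0 Hd]].
  exists (mkposreal d d0). intros y Hy. apply He. apply ball_C. apply Hd. exact Hy.
Qed.

Lemma ex_CInt_scont (g : R -> C) (a b : R) : a <= b ->
  (forall x, a <= x <= b -> scont g x) -> ex_CInt g a b.
Proof.
  intros Hab H. apply (@ex_RInt_continuous C_R_CompleteNormedModule).
  rewrite Rmin_left, Rmax_right by lra. intros z Hz. now apply scont_continuous, H.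
Qed.

Lemma ccont_h (f : C -> C) (x y : R) : ccont f (x, y) -> scont (fun u => f (u, y)) x.
Proof.
  intros H eps Heps. destruct (H eps Heps) as [d [d0 Hd]]. exists d; split; auto.
  intros u Hu. apply Hd. replace ((u, y) - (x, y))%C with (RtoC (u - x)).
  now rewrite Cmod_R. unfold Cminus, Cplus, Copp, RtoC; simpl. f_equal; ring.
Qed.

Lemma ccont_v (f : C -> C) (x y : R) : ccont f (x, y) -> scont (fun v => f (x, v)) y.
Proof.
  intros H eps Heps. destruct (H eps Heps) as [d [d0 Hd]]. exists d; split; auto.
  intros u Hu. apply Hd. replace ((x, u) - (x, y))%C with (Ci * RtoC (u - y))%C.
  rewrite Cmod_mult, Cmod_Ci, Cmod_R. lra.
  unfold Ci, Cmult, Cminus, Cplus, Copp, RtoC; simpl. f_equal; ring.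
Qed.

Lemma CInt_correct (g : R -> C) (a b : R) : ex_CInt g a b ->
  @is_RInt C_R_NormedModule g a b (CInt g a b).
Proof. intros H. now apply (@RInt_correct C_R_CompleteNormedModule). Qed.

Lemma CInt_unique (g : R -> C) (a b : R) (l : C) :
  @is_RInt C_R_NormedModule g a b l -> CInt g a b = l.
Proof. intros H. now apply (@is_RInt_unique C_R_CompleteNormedModule). Qed.

Lemma CInt_plus (g h : R -> C) (a b : R) : ex_CInt g a b -> ex_CInt h a b ->
  CInt (fun x => g x + h x)%C a b = (CInt g a b + CInt h a b)%C.
Proof.
  intros Hg Hh. apply CInt_unique.
  apply (@is_RInt_plus C_R_NormedModule); now apply CInt_correct.
Qed.

(** Proved on real and imaginary parts, because the scalars of the integral are real while [c] is
    complex. *)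
Lemma is_CInt_scal (c : C) (g : R -> C) (a b : R) (l : C) :
  @is_RInt C_R_NormedModule g a b l ->
  @is_RInt C_R_NormedModule (fun x => c * g x)%C a b (c * l)%C.
Proof.
  intros H.
  assert (H1 := @is_RInt_fct_extend_fst R_NormedModule R_NormedModule g a b l H).
  assert (H2 := @is_RInt_fct_extend_snd R_NormedModule R_NormedModule g a b l H).
  apply (@is_RInt_fct_extend_pair R_NormedModule R_NormedModule (fun x => c * g x)%C a b
    (fst c * fst l - snd c * snd l) (fst c * snd l + snd c * fst l)).
  - apply (@is_RInt_minus R_NormedModule (fun t => fst c * fst (g t)) (fun t => snd c * snd (g t)));
    now apply (@is_RInt_scal R_NormedModule).
  - apply (@is_RInt_plus R_NormedModule (fun t => fst c * snd (g t)) (fun t => snd c * fst (g t)));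
    now apply (@is_RInt_scal R_NormedModule).
Qed.

Lemma CInt_scal (c : C) (g : R -> C) (a b : R) : ex_CInt g a b ->
  CInt (fun x => c * g x)%C a b = (c * CInt g a b)%C.
Proof. intros H. apply CInt_unique, is_CInt_scal. now apply CInt_correct. Qed.

Lemma ex_CInt_scal (c : C) (g : R -> C) (a b : R) : ex_CInt g a b ->
  ex_CInt (fun x => c * g x)%C a b.
Proof. intros [l H]. exists (c * l)%C. now apply is_CInt_scal. Qed.

Lemma ex_CInt_plus (g h : R -> C) (a b : R) : ex_CInt g a b -> ex_CInt h a b ->
  ex_CInt (fun x => g x + h x)%C a b.
Proof. intros. now apply (@ex_RInt_plus C_R_NormedModule). Qed.

Lemma CInt_bound (g : R -> C) (a b M : R) : a <= b -> ex_CInt g a b ->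
  (forall x, a <= x <= b -> Cmod (g x) <= M) -> Cmod (CInt g a b) <= (b - a) * M.
Proof.
  intros Hab H HM. rewrite Cmod_norm.
  apply (@norm_RInt_le_const C_R_NormedModule g a b); auto.
  - intros x Hx. specialize (HM x Hx). rewrite Cmod_norm in HM. exact HM.
  - now apply CInt_correct.
Qed.

Lemma CInt_bound_fun (g : R -> C) (h : R -> R) (a b l : R) : a <= b -> ex_CInt g a b ->
  (forall x, a <= x <= b -> Cmod (g x) <= h x) -> is_RInt h a b l ->
  Cmod (CInt g a b) <= l.
Proof.
  intros Hab H HM Hl. rewrite Cmod_norm.
  apply (@norm_RInt_le C_R_NormedModule g h a b); auto.
  - intros x Hx. specialize (HM x Hx). rewrite Cmod_norm in HM. exact HM.
  - now apply CInt_correct.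
Qed.

Lemma CInt_Chasles (g : R -> C) (a b c : R) : ex_CInt g a b -> ex_CInt g b c ->
  (CInt g a b + CInt g b c)%C = CInt g a c.
Proof. intros. now apply (@RInt_Chasles C_R_CompleteNormedModule). Qed.

Lemma CInt_ext (g h : R -> C) (a b : R) : a <= b ->
  (forall x, a <= x <= b -> g x = h x) -> CInt g a b = CInt h a b.
Proof.
  intros Hab H. apply (@RInt_ext C_R_CompleteNormedModule).
  rewrite Rmin_left, Rmax_right by lra. intros; apply H; lra.
Qed.

Lemma ex_CInt_ext (g h : R -> C) (a b : R) : a <= b ->
  (forall x, a <= x <= b -> g x = h x) -> ex_CInt g a b -> ex_CInt h a b.
Proof.
  intros Hab H. apply (@ex_RInt_ext C_R_NormedModule).
  rewrite Rmin_left, Rmax_right by lra. intros; apply H; lra.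
Qed.

Lemma CInt_translate (g : R -> C) (a b c : R) : ex_CInt g (a + c) (b + c) ->
  CInt (fun x => g (x + c)) a b = CInt g (a + c) (b + c).
Proof.
  intros H. apply CInt_unique.
  assert (K := CInt_correct _ _ _ H).
  replace (a + c) with (1 * a + c) in K at 1 by ring.
  replace (b + c) with (1 * b + c) in K at 1 by ring.
  apply (@is_RInt_comp_lin C_R_NormedModule) in K.
  revert K. apply (@is_RInt_ext C_R_NormedModule). intros x _.
  rewrite (@scal_one R_AbsRing C_R_ModuleSpace). now rewrite Rmult_1_l.
Qed.

Lemma CInt_FTC (g dg : R -> C) (a b : R) : a <= b ->
  (forall x, a <= x <= b -> rder g x (dg x)) ->
  (forall x, a <= x <= b -> scont dg x) ->
  CInt dg a b = (g b - g a)%C.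
Proof.
  intros Hab Hd Hc. apply CInt_unique.
  apply (@is_RInt_derive C_R_CompleteNormedModule g dg a b);
    rewrite Rmin_left, Rmax_right by lra.
  - intros x Hx. now apply rder_is_derive, Hd.
  - intros x Hx. now apply scont_continuous, Hc.
Qed.

Global Opaque CInt ex_CInt.

(** The factor [Ci] in [vint] is that of [dw = i dv], so that [box] is the contour integral taken
    counterclockwise. *)
Definition hint (f : C -> C) (x1 x2 y : R) : C := CInt (fun u => f (u, y)) x1 x2.
Definition vint (f : C -> C) (x y1 y2 : R) : C := (Ci * CInt (fun v => f (x, v)) y1 y2)%C.

Definition box (f : C -> C) (x1 x2 y1 y2 : R) : C :=
  (hint f x1 x2 y1 + vint f x2 y1 y2 - hint f x1 x2 y2 - vint f x1 y1 y2)%C.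

Definition hcont (f : C -> C) (x1 x2 y : R) : Prop :=
  x1 <= x2 /\ forall u, x1 <= u <= x2 -> ccont f (u, y).
Definition vcont (f : C -> C) (x y1 y2 : R) : Prop :=
  y1 <= y2 /\ forall v, y1 <= v <= y2 -> ccont f (x, v).
Definition bcont (f : C -> C) (x1 x2 y1 y2 : R) : Prop :=
  hcont f x1 x2 y1 /\ hcont f x1 x2 y2 /\ vcont f x1 y1 y2 /\ vcont f x2 y1 y2.

Lemma hcont_ex f x1 x2 y : hcont f x1 x2 y -> ex_CInt (fun u => f (u, y)) x1 x2.
Proof. intros [H K]. apply ex_CInt_scont; auto. intros; now apply ccont_h, K. Qed.

Lemma vcont_ex f x y1 y2 : vcont f x y1 y2 -> ex_CInt (fun v => f (x, v)) y1 y2.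
Proof. intros [H K]. apply ex_CInt_scont; auto. intros; now apply ccont_v, K. Qed.

Lemma box_split_x f x1 x x2 y1 y2 : x1 <= x <= x2 ->
  hcont f x1 x2 y1 -> hcont f x1 x2 y2 ->
  box f x1 x2 y1 y2 = (box f x1 x y1 y2 + box f x x2 y1 y2)%C.
Proof.
  intros Hx [_ H1] [_ H2]. unfold box, hint.
  rewrite <- (CInt_Chasles (fun u => f (u, y1)) x1 x x2).
  rewrite <- (CInt_Chasles (fun u => f (u, y2)) x1 x x2). ring.
  all: apply hcont_ex; split; try lra; intros; try (apply H1; lra); try (apply H2; lra).
Qed.

Lemma box_split_y f x1 x2 y1 y y2 : y1 <= y <= y2 ->
  vcont f x1 y1 y2 -> vcont f x2 y1 y2 ->
  box f x1 x2 y1 y2 = (box f x1 x2 y1 y + box f x1 x2 y y2)%C.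
Proof.
  intros Hx [_ H1] [_ H2]. unfold box, vint.
  rewrite <- (CInt_Chasles (fun v => f (x1, v)) y1 y y2).
  rewrite <- (CInt_Chasles (fun v => f (x2, v)) y1 y y2). ring.
  all: apply vcont_ex; split; try lra; intros; try (apply H1; lra); try (apply H2; lra).
Qed.

Lemma box_bound f x1 x2 y1 y2 M : bcont f x1 x2 y1 y2 ->
  (forall u, x1 <= u <= x2 -> Cmod (f (u, y1)) <= M /\ Cmod (f (u, y2)) <= M) ->
  (forall v, y1 <= v <= y2 -> Cmod (f (x1, v)) <= M /\ Cmod (f (x2, v)) <= M) ->
  Cmod (box f x1 x2 y1 y2) <= 2 * ((x2 - x1) + (y2 - y1)) * M.
Proof.
  intros [H1 [H2 [H3 H4]]] Bh Bv. unfold box, Cminus, vint.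
  assert (L1 := CInt_bound (fun u => f (u, y1)) x1 x2 M (proj1 H1) (hcont_ex _ _ _ _ H1)
    (fun u hu => proj1 (Bh u hu))).
  assert (L2 := CInt_bound (fun u => f (u, y2)) x1 x2 M (proj1 H1) (hcont_ex _ _ _ _ H2)
    (fun u hu => proj2 (Bh u hu))).
  assert (L3 := CInt_bound (fun v => f (x1, v)) y1 y2 M (proj1 H3) (vcont_ex _ _ _ _ H3)
    (fun u hu => proj1 (Bv u hu))).
  assert (L4 := CInt_bound (fun v => f (x2, v)) y1 y2 M (proj1 H3) (vcont_ex _ _ _ _ H4)
    (fun u hu => proj2 (Bv u hu))).
  eapply Rle_trans. apply Cmod_triangle. rewrite Cmod_opp.
  eapply Rle_trans. apply Rplus_le_compat_r. apply Cmod_triangle. rewrite Cmod_opp.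
  eapply Rle_trans. apply Rplus_le_compat_r. apply Rplus_le_compat_r. apply Cmod_triangle.
  rewrite !Cmod_mult, !Cmod_Ci. unfold hint. lra.
Qed.

Lemma ccont_plus f g z : ccont f z -> ccont g z -> ccont (fun w => f w + g w)%C z.
Proof.
  intros Hf Hg eps Heps. destruct (Hf (eps / 2)) as [d [d0 Hd]]. lra.
  destruct (Hg (eps / 2)) as [e [e0 He]]. lra.
  exists (Rmin d e). split. now apply Rmin_pos. intros w Hw.
  specialize (Hd w (Rlt_le_trans _ _ _ Hw (Rmin_l _ _))).
  specialize (He w (Rlt_le_trans _ _ _ Hw (Rmin_r _ _))).
  replace (f w + g w - (f z + g z))%C with ((f w - f z) + (g w - g z))%C by ring.
  eapply Rle_lt_trans. apply Cmod_triangle. lra.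
Qed.

Lemma ccont_scal c f z : ccont f z -> ccont (fun w => c * f w)%C z.
Proof.
  intros Hf eps Heps. set (B := Cmod c + 1).
  assert (HB : 0 < B) by (generalize (Cmod_ge_0 c); unfold B; lra).
  destruct (Hf (eps / B)) as [d [d0 Hd]]. now apply Rdiv_lt_0_compat.
  exists d. split; auto. intros w Hw. specialize (Hd w Hw).
  replace (c * f w - c * f z)%C with (c * (f w - f z))%C by ring.
  rewrite Cmod_mult. apply Rle_lt_trans with (B * Cmod (f w - f z)).
  apply Rmult_le_compat_r. apply Cmod_ge_0. unfold B; lra.
  apply Rlt_le_trans with (B * (eps / B)). now apply Rmult_lt_compat_l. right; field; lra.
Qed.

Lemma ccont_mult f g z : ccont f z -> ccont g z -> ccont (fun w => f w * g w)%C z.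
Proof.
  intros A1 A2 e He. set (c1 := Cmod (f z) + 1). set (c2 := Cmod (g z) + 1).
  assert (c1p : 0 < c1) by (unfold c1; generalize (Cmod_ge_0 (f z)); lra).
  assert (c2p : 0 < c2) by (unfold c2; generalize (Cmod_ge_0 (g z)); lra).
  destruct (A1 (e / (2 * c2))) as [d1 [d10 D1]]. apply Rdiv_lt_0_compat; lra.
  destruct (A2 (Rmin 1 (e / (2 * c1)))) as [d2 [d20 D2]]. apply Rmin_pos. lra. apply Rdiv_lt_0_compat; lra.
  exists (Rmin d1 d2). split. now apply Rmin_pos. intros w Hw.
  specialize (D1 w (Rlt_le_trans _ _ _ Hw (Rmin_l _ _))). specialize (D2 w (Rlt_le_trans _ _ _ Hw (Rmin_r _ _))).
  assert (D3 := Rlt_le_trans _ _ _ D2 (Rmin_l _ _)). assert (D4 := Rlt_le_trans _ _ _ D2 (Rmin_r _ _)).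
  replace (f w * g w - f z * g z)%C with ((f w - f z) * g w + f z * (g w - g z))%C by ring.
  eapply Rle_lt_trans. apply Cmod_triangle. rewrite !Cmod_mult.
  assert (G1 : Cmod (g w) <= c2).
  { replace (g w) with (g z + (g w - g z))%C by ring. eapply Rle_trans. apply Cmod_triangle. unfold c2; lra. }
  assert (Cmod (f w - f z) * Cmod (g w) <= Cmod (f w - f z) * c2) by (apply Rmult_le_compat_l; auto; apply Cmod_ge_0).
  assert (Cmod (f w - f z) * c2 < e / (2 * c2) * c2) by (apply Rmult_lt_compat_r; auto).
  assert (Cmod (f z) * Cmod (g w - g z) <= c1 * Cmod (g w - g z)) by (apply Rmult_le_compat_r; [apply Cmod_ge_0|unfold c1; lra]).
  assert (c1 * Cmod (g w - g z) < c1 * (e / (2 * c1))) by (apply Rmult_lt_compat_l; auto).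
  replace (e / (2 * c2) * c2) with (e / 2) in * by (field; lra).
  replace (c1 * (e / (2 * c1))) with (e / 2) in * by (field; lra). lra.
Qed.

Lemma bcont_plus f g x1 x2 y1 y2 : bcont f x1 x2 y1 y2 -> bcont g x1 x2 y1 y2 ->
  bcont (fun w => f w + g w)%C x1 x2 y1 y2.
Proof.
  intros [[? ?] [[? ?] [[? ?] [? ?]]]] [[? ?] [[? ?] [[? ?] [? ?]]]].
  repeat split; auto; intros; apply ccont_plus; auto.
Qed.

Lemma bcont_scal c f x1 x2 y1 y2 : bcont f x1 x2 y1 y2 ->
  bcont (fun w => c * f w)%C x1 x2 y1 y2.
Proof.
  intros [[? ?] [[? ?] [[? ?] [? ?]]]].
  repeat split; auto; intros; apply ccont_scal; auto.
Qed.

Lemma box_plus f g x1 x2 y1 y2 : bcont f x1 x2 y1 y2 -> bcont g x1 x2 y1 y2 ->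
  box (fun w => f w + g w)%C x1 x2 y1 y2 = (box f x1 x2 y1 y2 + box g x1 x2 y1 y2)%C.
Proof.
  intros [H1 [H2 [H3 H4]]] [K1 [K2 [K3 K4]]]. unfold box, hint, vint.
  rewrite (CInt_plus (fun u => f (u, y1)) (fun u => g (u, y1))) by (now apply hcont_ex).
  rewrite (CInt_plus (fun u => f (u, y2)) (fun u => g (u, y2))) by (now apply hcont_ex).
  rewrite (CInt_plus (fun v => f (x1, v)) (fun v => g (x1, v))) by (now apply vcont_ex).
  rewrite (CInt_plus (fun v => f (x2, v)) (fun v => g (x2, v))) by (now apply vcont_ex).
  ring.
Qed.

Lemma box_scal c f x1 x2 y1 y2 : bcont f x1 x2 y1 y2 ->
  box (fun w => c * f w)%C x1 x2 y1 y2 = (c * box f x1 x2 y1 y2)%C.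
Proof.
  intros [H1 [H2 [H3 H4]]]. unfold box, hint, vint.
  rewrite (CInt_scal c (fun u => f (u, y1))) by (now apply hcont_ex).
  rewrite (CInt_scal c (fun u => f (u, y2))) by (now apply hcont_ex).
  rewrite (CInt_scal c (fun v => f (x1, v))) by (now apply vcont_ex).
  rewrite (CInt_scal c (fun v => f (x2, v))) by (now apply vcont_ex).
  ring.
Qed.

Lemma box_ext f g x1 x2 y1 y2 : x1 <= x2 -> y1 <= y2 ->
  (forall u, x1 <= u <= x2 -> f (u, y1) = g (u, y1) /\ f (u, y2) = g (u, y2)) ->
  (forall v, y1 <= v <= y2 -> f (x1, v) = g (x1, v) /\ f (x2, v) = g (x2, v)) ->
  box f x1 x2 y1 y2 = box g x1 x2 y1 y2.
Proof.
  intros Hx Hy Hh Hv. unfold box, hint, vint.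
  assert (E1 : CInt (fun u => f (u, y1)) x1 x2 = CInt (fun u => g (u, y1)) x1 x2)
    by (apply CInt_ext; auto; intros; now apply Hh).
  assert (E2 : CInt (fun u => f (u, y2)) x1 x2 = CInt (fun u => g (u, y2)) x1 x2)
    by (apply CInt_ext; auto; intros; now apply Hh).
  assert (E3 : CInt (fun v => f (x1, v)) y1 y2 = CInt (fun v => g (x1, v)) y1 y2)
    by (apply CInt_ext; auto; intros; now apply Hv).
  assert (E4 : CInt (fun v => f (x2, v)) y1 y2 = CInt (fun v => g (x2, v)) y1 y2)
    by (apply CInt_ext; auto; intros; now apply Hv).
  now rewrite E1, E2, E3, E4.
Qed.

Lemma box_translate g x1 x2 y1 y2 z :
  bcont g (x1 + Re z) (x2 + Re z) (y1 + Im z) (y2 + Im z) ->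
  box (fun w => g (w + z)%C) x1 x2 y1 y2 =
  box g (x1 + Re z) (x2 + Re z) (y1 + Im z) (y2 + Im z).
Proof.
  intros [H1 [H2 [H3 H4]]]. unfold box, hint, vint.
  rewrite <- (CInt_translate (fun u => g (u, y1 + Im z))) by (now apply hcont_ex).
  rewrite <- (CInt_translate (fun u => g (u, y2 + Im z))) by (now apply hcont_ex).
  rewrite <- (CInt_translate (fun v => g (x1 + Re z, v))) by (now apply vcont_ex).
  rewrite <- (CInt_translate (fun v => g (x2 + Re z, v))) by (now apply vcont_ex).
  reflexivity.
Qed.

Lemma hv_line (x y u : R) : (u, y) = ((0, y) + RtoC u * 1)%C /\ (x, u) = ((x, 0) + RtoC u * Ci)%C.
Proof. unfold Ci, RtoC, Cplus, Cmult; simpl; split; f_equal; ring. Qed.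

Lemma hint_FTC G g x1 x2 y : hcont g x1 x2 y ->
  (forall u, x1 <= u <= x2 -> cder G (u, y) (g (u, y))) ->
  hint g x1 x2 y = (G (x2, y) - G (x1, y))%C.
Proof.
  intros Hc Hd. unfold hint.
  apply (CInt_FTC (fun u => G (u, y))). apply Hc.
  - intros u Hu. specialize (Hd u Hu).
    rewrite (proj1 (hv_line 0 y u)) in Hd at 1. apply cder_line in Hd. rewrite Cmult_1_r in Hd.
    intros e He. destruct (Hd e He) as [d [d0 K]]. exists d; split; auto.
    intros v Hv. specialize (K v Hv). now rewrite <- !(proj1 (hv_line 0 y _)) in K.
  - intros u Hu. apply ccont_h. now apply Hc.
Qed.

Lemma vint_FTC G g x y1 y2 : vcont g x y1 y2 ->
  (forall v, y1 <= v <= y2 -> cder G (x, v) (g (x, v))) ->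
  vint g x y1 y2 = (G (x, y2) - G (x, y1))%C.
Proof.
  intros Hc Hd. unfold vint. rewrite <- (CInt_scal Ci (fun v => g (x, v))) by now apply vcont_ex.
  apply (CInt_FTC (fun v => G (x, v)) (fun v => Ci * g (x, v))%C). apply Hc.
  - intros u Hu. specialize (Hd u Hu).
    rewrite (proj2 (hv_line x 0 u)) in Hd at 1. apply cder_line in Hd. rewrite Cmult_comm in Hd.
    intros e He. destruct (Hd e He) as [d [d0 K]]. exists d; split; auto.
    intros v Hv. specialize (K v Hv). now rewrite <- !(proj2 (hv_line x 0 _)) in K.
  - intros u Hu. apply (ccont_v (fun w => Ci * g w)%C). apply ccont_scal. now apply Hc.
Qed.

Lemma box_FTC G g x1 x2 y1 y2 : bcont g x1 x2 y1 y2 -> (forall z, cder G z (g z)) ->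
  box g x1 x2 y1 y2 = RtoC 0.
Proof.
  intros [H1 [H2 [H3 H4]]] Hd. unfold box.
  rewrite (hint_FTC G), (hint_FTC G), (vint_FTC G), (vint_FTC G); auto. ring.
Qed.

Definition cdiff (f : C -> C) (z : C) : Prop := exists l, cder f z l.
Definition rdiff (f : C -> C) (x1 x2 y1 y2 : R) : Prop :=
  forall x y, x1 <= x <= x2 -> y1 <= y <= y2 -> cdiff f (x, y).

Lemma cdiff_ccont f z : cdiff f z -> ccont f z.
Proof. intros [l H]. now apply cder_ccont in H. Qed.

Lemma rdiff_bcont f x1 x2 y1 y2 : x1 <= x2 -> y1 <= y2 -> rdiff f x1 x2 y1 y2 -> bcont f x1 x2 y1 y2.
Proof.
  intros Hx Hy H. repeat split; auto; intros; apply cdiff_ccont, H; lra.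
Qed.

(** The choice made at each bisection. The fourth point is a safe default: if the first three values
    are below [e] and the four add up to at least [4 e], the fourth is at least [e]. *)
Definition pick (e : R) (B : C -> R) (p1 p2 p3 p4 : C) : C :=
  if Rle_dec e (B p1) then p1 else if Rle_dec e (B p2) then p2
  else if Rle_dec e (B p3) then p3 else p4.

Lemma pick_cases e B p1 p2 p3 p4 : let p := pick e B p1 p2 p3 p4 in
  p = p1 \/ p = p2 \/ p = p3 \/ p = p4.
Proof. unfold pick. repeat destruct Rle_dec; auto. Qed.

Lemma pick_large e B p1 p2 p3 p4 : 4 * e <= B p1 + B p2 + B p3 + B p4 ->
  e <= B (pick e B p1 p2 p3 p4).
Proof. unfold pick. intros H. repeat destruct Rle_dec; auto; lra. Qed.

Section Goursat.

Variables (f : C -> C) (x0 y0 a b : R).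
Hypothesis (Ha : 0 <= a) (Hb : 0 <= b).
Hypothesis Hf : rdiff f x0 (x0 + a) y0 (y0 + b).

Let hb (n : nat) : R := (/ 2) ^ n.
(** A rectangle of the bisection is represented by its lower left corner [p]; its sides are
    [a / 2^n] and [b / 2^n]. *)
Let sq (n : nat) (p : C) : C := box f (fst p) (fst p + a * hb n) (snd p) (snd p + b * hb n).

Let next (n : nat) (e : R) (p : C) : C :=
  let h := hb (S n) in
  pick e (fun q => Cmod (sq (S n) q)) p (fst p + a * h, snd p)
    (fst p, snd p + b * h) (fst p + a * h, snd p + b * h).

Let e0 : R := Cmod (box f x0 (x0 + a) y0 (y0 + b)).

Fixpoint goursat_seq (n : nat) : C :=
  match n with
  | O => (x0, y0)
  | S n => next n (e0 * (/ 4) ^ S n) (goursat_seq n)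
  end.

Lemma hb_pos n : 0 < hb n.
Proof. apply pow_lt. lra. Qed.

Lemma hb_S n : hb (S n) = hb n / 2.
Proof. unfold hb. simpl. field. Qed.

Lemma goursat_step n : let p := goursat_seq n in let p' := goursat_seq (S n) in
  (fst p' = fst p \/ fst p' = fst p + a * hb (S n)) /\
  (snd p' = snd p \/ snd p' = snd p + b * hb (S n)).
Proof.
  cbv zeta. cbn [goursat_seq]. set (p := goursat_seq n). unfold next.
  destruct (pick_cases (e0 * (/ 4) ^ S n) (fun q => Cmod (sq (S n) q)) p
    (fst p + a * hb (S n), snd p) (fst p, snd p + b * hb (S n))
    (fst p + a * hb (S n), snd p + b * hb (S n))) as [-> | [-> | [-> | ->]]]; cbn [fst snd]; auto.
Qed.

Lemma goursat_inv n : let p := goursat_seq n in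
  x0 <= fst p /\ fst p + a * hb n <= x0 + a /\ y0 <= snd p /\ snd p + b * hb n <= y0 + b.
Proof.
  induction n.
  - simpl. unfold hb; simpl. lra.
  - cbv zeta. destruct (goursat_step n) as [S1 S2]. cbv zeta in IHn. rewrite hb_S in *.
    assert (P := hb_pos n).
    assert (0 <= a * hb n) by (apply Rmult_le_pos; lra).
    assert (0 <= b * hb n) by (apply Rmult_le_pos; lra).
    destruct S1 as [-> | ->], S2 as [-> | ->]; lra.
Qed.

Lemma goursat_large n : e0 * (/ 4) ^ n <= Cmod (sq n (goursat_seq n)).
Proof.
  induction n.
  - simpl. unfold sq, e0, hb; simpl. rewrite !Rmult_1_r. lra.
  - assert (I := goursat_inv n). cbv zeta in I. assert (P := hb_pos n).
    cbn [goursat_seq]. set (p := goursat_seq n) in *. unfold next. apply (pick_large _ (fun q => Cmod (sq (S n) q))).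
    assert (A1 : 0 <= a * hb n) by (apply Rmult_le_pos; lra).
    assert (A2 : 0 <= b * hb n) by (apply Rmult_le_pos; lra).
    set (p2 := (fst p + a * hb (S n), snd p) : C).
    set (p3 := (fst p, snd p + b * hb (S n)) : C).
    set (p4 := (fst p + a * hb (S n), snd p + b * hb (S n)) : C).
    assert (E : sq n p = (sq (S n) p + sq (S n) p2 + sq (S n) p3 + sq (S n) p4)%C).
    { unfold sq, p2, p3, p4. cbn [fst snd]. rewrite hb_S.
      replace (fst p + a * (hb n / 2) + a * (hb n / 2)) with (fst p + a * hb n) by field.
      replace (snd p + b * (hb n / 2) + b * (hb n / 2)) with (snd p + b * hb n) by field.
      rewrite (box_split_x f (fst p) (fst p + a * (hb n / 2))) by
        (try lra; split; try lra; intros; apply cdiff_ccont, Hf; lra).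
      rewrite (box_split_y f (fst p) (fst p + a * (hb n / 2)) (snd p) (snd p + b * (hb n / 2))) by
        (try lra; split; try lra; intros; apply cdiff_ccont, Hf; lra).
      rewrite (box_split_y f _ (fst p + a * hb n) (snd p) (snd p + b * (hb n / 2))) by
        (try lra; split; try lra; intros; apply cdiff_ccont, Hf; lra).
      ring. }
    rewrite E in IHn.
    assert (T1 := Cmod_triangle (sq (S n) p + sq (S n) p2 + sq (S n) p3) (sq (S n) p4)).
    assert (T2 := Cmod_triangle (sq (S n) p + sq (S n) p2) (sq (S n) p3)).
    assert (T3 := Cmod_triangle (sq (S n) p) (sq (S n) p2)).
    cbn [pow]. lra.
Qed.

Lemma nested_limit (u : nat -> R) (c : R) : 0 <= c ->
  (forall n, u (S n) = u n \/ u (S n) = u n + c * hb (S n)) ->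
  exists l, forall n, u n <= l <= u n + c * hb n.
Proof.
  intros Hc Hu.
  assert (D : forall n, u n <= u (S n) /\ u (S n) + c * hb (S n) <= u n + c * hb n).
  { intros n. assert (P := hb_pos n). assert (0 <= c * hb n) by (apply Rmult_le_pos; lra).
    destruct (Hu n) as [E|E]; rewrite E, ?hb_S; lra. }
  assert (U : forall n k, u (n + k)%nat + c * hb (n + k)%nat <= u n + c * hb n).
  { intros n k. induction k. rewrite Nat.add_0_r; lra.
    rewrite Nat.add_succ_r. generalize (D (n + k)%nat). lra. }
  assert (N : forall n, 0 <= c * hb n) by (intros n; assert (P := hb_pos n); apply Rmult_le_pos; lra).
  destruct (ex_finite_lim_seq_incr u (u O + c * hb O)) as [l Hl].
  - intros n; apply D.
  - intros n. generalize (U O n) (N n). simpl. lra.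
  - exists l. intros n. split.
    + apply (is_lim_seq_incr_compare u l Hl). intros; apply D.
    + assert (Hl' : is_lim_seq (fun k => u (k + n)%nat) l) by now apply is_lim_seq_incr_n.
      generalize (is_lim_seq_le (fun k => u (k + n)%nat) (fun _ => u n + c * hb n) l (u n + c * hb n)).
      simpl. intros A. apply A; auto.
      * intros k. generalize (U n k) (N (n + k)%nat). rewrite (Nat.add_comm k). lra.
      * apply is_lim_seq_const.
Qed.

(** The integrals over the bisected rectangles stay at least [e0 / 4^n]. Near the common point, [f]
    is affine up to [eps] times the distance; the affine part integrates to 0 and the remainder
    contributes at most [2 eps c^2 / 4^n]. *)
Lemma goursat_sec : box f x0 (x0 + a) y0 (y0 + b) = RtoC 0.
Proof.
  apply Cmod_eq_0. fold e0. destruct (Rle_lt_or_eq_dec 0 e0) as [E|E]; auto.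
  { apply Cmod_ge_0. } exfalso.
  destruct (nested_limit (fun n => fst (goursat_seq n)) a Ha) as [x Hx].
  { intros n. apply (goursat_step n). }
  destruct (nested_limit (fun n => snd (goursat_seq n)) b Hb) as [y Hy].
  { intros n. apply (goursat_step n). }
  destruct (Hf x y) as [l Hl].
  { generalize (Hx O); simpl; unfold hb; simpl; lra. }
  { generalize (Hy O); simpl; unfold hb; simpl; lra. }
  set (c := a + b + 1). assert (Hc : 0 < c) by (unfold c; lra).
  (* This makes [2 eps c^2] equal to [e0 / 2], half of what the lower bound demands. *)
  set (eps := e0 / (4 * c * c)).
  assert (Heps : 0 < eps) by (apply Rdiv_lt_0_compat; nra).
  destruct (Hl eps Heps) as [d [d0 Hd]].
  destruct (pow_lt_1_zero (/ 2)) with (y := d / c) as [n Hn].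
  { rewrite Rabs_right; lra. } { now apply Rdiv_lt_0_compat. }
  specialize (Hn n (Nat.le_refl n)). fold (hb n) in Hn.
  rewrite Rabs_right in Hn by (generalize (hb_pos n); lra).
  assert (P := hb_pos n).
  assert (Hn' : c * hb n < d).
  { apply Rmult_lt_reg_l with (/ c). now apply Rinv_0_lt_compat.
    replace (/ c * (c * hb n)) with (hb n) by (field; lra). unfold Rdiv in Hn. lra. }
  assert (I := goursat_inv n). cbv zeta in I. assert (L := goursat_large n).
  specialize (Hx n). specialize (Hy n). simpl in Hx, Hy.
  set (p := goursat_seq n) in *.
  assert (N1 : 0 <= a * hb n) by (apply Rmult_le_pos; lra).
  assert (N2 : 0 <= b * hb n) by (apply Rmult_le_pos; lra).
  set (A := fun w : C => (f (x, y) + l * (w - (x, y)))%C).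
  set (r := fun w : C => (f w + (- 1) * A w)%C).
  assert (Ader : forall z, cder A z l).
  { intros z. unfold A. generalize (cder_plus _ _ _ _ _ (cder_const (f (x,y)) z)
      (cder_scal _ l _ _ (cder_minus _ _ _ _ _ (cder_id z) (cder_const (x,y) z)))).
    apply cder_val. ring. }
  assert (BA : bcont A (fst p) (fst p + a * hb n) (snd p) (snd p + b * hb n)).
  { apply rdiff_bcont; try lra. intros u v _ _. exists l. apply Ader. }
  assert (Bf : bcont f (fst p) (fst p + a * hb n) (snd p) (snd p + b * hb n)).
  { apply rdiff_bcont; try lra. intros u v ? ?. apply Hf; lra. }
  assert (Br : bcont r (fst p) (fst p + a * hb n) (snd p) (snd p + b * hb n)).
  { apply bcont_plus; auto. now apply bcont_scal. }
  assert (Ebox : sq n p = box r (fst p) (fst p + a * hb n) (snd p) (snd p + b * hb n)).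
  { unfold r. rewrite (box_plus f (fun w => (-1) * A w)%C) by (auto; now apply bcont_scal).
    rewrite box_scal by auto.
    (* The affine part has an explicit quadratic primitive. *)
    rewrite (box_FTC (fun w => f (x,y) * w + l * ((w * w) * / 2 - (x,y) * w))%C A); auto.
    { unfold sq. ring. }
    intros z. generalize (cder_plus _ _ _ _ _ (cder_scal _ (f (x,y)) _ _ (cder_id z))
      (cder_scal _ l _ _ (cder_minus _ _ _ _ _
       (cder_mult _ _ _ _ _ (cder_mult _ _ _ _ _ (cder_id z) (cder_id z)) (cder_const (/2)%C z))
       (cder_scal _ (x,y) _ _ (cder_id z))))).
    apply cder_val. unfold A. field. }
  assert (M : forall u v, fst p <= u <= fst p + a * hb n -> snd p <= v <= snd p + b * hb n ->
    Cmod (r (u, v)) <= eps * (c * hb n)).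
  { intros u v Hu Hv. assert (S : Cmod ((u, v) - (x, y)) <= c * hb n).
    { eapply Rle_trans. apply Cmod_le_sum. simpl.
      assert (Rabs (u + - x) <= a * hb n) by (apply Rabs_le; lra).
      assert (Rabs (v + - y) <= b * hb n) by (apply Rabs_le; lra).
      unfold c. lra. }
    unfold r, A. replace (f (u, v) + -1 * (f (x, y) + l * ((u, v) - (x, y))))%C
      with (f (u, v) - f (x, y) - l * ((u, v) - (x, y)))%C by ring.
    eapply Rle_trans. apply Hd. lra. apply Rmult_le_compat_l; lra. }
  assert (Q : Cmod (sq n p) <= 2 * (a * hb n + b * hb n) * (eps * (c * hb n))).
  { rewrite Ebox. eapply Rle_trans. apply (box_bound r _ _ _ _ (eps * (c * hb n))); auto.
    - intros; split; apply M; lra.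
    - intros; split; apply M; lra.
    - right. ring. }
  assert (F : (/ 4) ^ n = hb n * hb n).
  { unfold hb. rewrite <- Rpow_mult_distr. f_equal. field. }
  rewrite F in L.
  assert (Q2 : 2 * (a * hb n + b * hb n) * (eps * (c * hb n)) <= 2 * eps * (c * c) * (hb n * hb n)).
  { replace (2 * (a * hb n + b * hb n) * (eps * (c * hb n)))
      with (2 * eps * ((a + b) * c) * (hb n * hb n)) by ring.
    apply Rmult_le_compat_r. nra. apply Rmult_le_compat_l. lra. apply Rmult_le_compat_r; unfold c; lra. }
  replace (2 * eps * (c * c)) with (e0 / 2) in Q2.
  2:{ unfold eps. field. lra. }
  assert (0 < hb n * hb n) by nra. nra.
Qed.

End Goursat.

Lemma goursat f x1 x2 y1 y2 : x1 <= x2 -> y1 <= y2 -> rdiff f x1 x2 y1 y2 ->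
  box f x1 x2 y1 y2 = RtoC 0.
Proof.
  intros Hx Hy H. generalize (goursat_sec f x1 y1 (x2 - x1) (y2 - y1)).
  replace (x1 + (x2 - x1)) with x2 by ring. replace (y1 + (y2 - y1)) with y2 by ring.
  intros A; apply A; auto; lra.
Qed.

(** * Cauchy's formula and estimates *)

Definition punctured (f : C -> C) (x1 x2 y1 y2 : R) : Prop :=
  forall x y, x1 <= x <= x2 -> y1 <= y <= y2 -> (x <> 0 \/ y <> 0) -> cdiff f (x, y).

(** The region outside the small square is cut into four rectangles that miss 0. *)
Lemma box_shrink f x1 x2 y1 y2 r : 0 < r -> x1 <= - r -> r <= x2 -> y1 <= - r -> r <= y2 ->
  punctured f x1 x2 y1 y2 -> box f x1 x2 y1 y2 = box f (- r) r (- r) r.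
Proof.
  intros Hr H1 H2 H3 H4 Hf.
  rewrite (box_split_x f x1 (- r)).
  2: lra. 2: split; [lra|]; intros; apply cdiff_ccont, Hf; try lra; right; lra.
  2: split; [lra|]; intros; apply cdiff_ccont, Hf; try lra; right; lra.
  rewrite (box_split_x f (- r) r).
  2: lra. 2: split; [lra|]; intros; apply cdiff_ccont, Hf; try lra; right; lra.
  2: split; [lra|]; intros; apply cdiff_ccont, Hf; try lra; right; lra.
  rewrite (box_split_y f (- r) r y1 (- r)).
  2: lra. 2: split; [lra|]; intros; apply cdiff_ccont, Hf; try lra; left; lra.
  2: split; [lra|]; intros; apply cdiff_ccont, Hf; try lra; left; lra.
  rewrite (box_split_y f (- r) r (- r) r).
  2: lra. 2: split; [lra|]; intros; apply cdiff_ccont, Hf; try lra; left; lra.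
  2: split; [lra|]; intros; apply cdiff_ccont, Hf; try lra; left; lra.
  rewrite (goursat f x1 (- r)), (goursat f r x2), (goursat f (- r) r y1), (goursat f (- r) r r).
  ring.
  all: try lra; intros x y Hx Hy; apply Hf; try lra; try (left; lra); right; lra.
Qed.

Lemma cdiff_mult f g z : cdiff f z -> cdiff g z -> cdiff (fun w => f w * g w)%C z.
Proof. intros [l H] [m K]. eexists. apply cder_mult; eauto. Qed.

Lemma cdiff_plus f g z : cdiff f z -> cdiff g z -> cdiff (fun w => f w + g w)%C z.
Proof. intros [l H] [m K]. eexists. apply cder_plus; eauto. Qed.

Lemma cdiff_minus f g z : cdiff f z -> cdiff g z -> cdiff (fun w => f w - g w)%C z.
Proof. intros [l H] [m K]. eexists. apply cder_minus; eauto. Qed.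

Lemma cdiff_opp f z : cdiff f z -> cdiff (fun w => - f w)%C z.
Proof. intros [l H]. eexists. apply cder_opp; eauto. Qed.

Lemma cdiff_inv f z : f z <> RtoC 0 -> cdiff f z -> cdiff (fun w => / f w)%C z.
Proof. intros H0 [l H]. eexists. apply cder_inv; eauto. Qed.

Lemma cdiff_const a z : cdiff (fun _ => a) z.
Proof. eexists; apply cder_const. Qed.

Lemma cdiff_id z : cdiff (fun w => w) z.
Proof. eexists; apply cder_id. Qed.

Lemma cdiff_comp f g z : cdiff f (g z) -> cdiff g z -> cdiff (fun w => f (g w)) z.
Proof. intros [l H] [m K]. eexists. eapply cder_comp; eauto. Qed.

Lemma cdiff_pow f n z : cdiff f z -> cdiff (fun w => f w ^ n)%C z.
Proof.
  intros H. induction n. simpl. apply cdiff_const.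
  simpl. now apply cdiff_mult.
Qed.

Lemma pt_neq0 (x y : R) : (x <> 0 \/ y <> 0) -> (x, y) <> RtoC 0.
Proof. intros H E. injection E. intros. destruct H; auto. Qed.

(** The number [2 pi i], kept as a contour integral; what is used of its value is that it is nonzero
    and that [1 / kappa] has modulus at most 1. *)
Definition kappa : C := box Cinv (- 1) 1 (- 1) 1.

Lemma punctured_inv x1 x2 y1 y2 : punctured Cinv x1 x2 y1 y2.
Proof. intros x y _ _ H. apply (cdiff_inv (fun w => w)). now apply pt_neq0. apply cdiff_id. Qed.

Lemma kappa_small r : 0 < r <= 1 -> box Cinv (- r) r (- r) r = kappa.
Proof.
  intros H. unfold kappa. symmetry. apply box_shrink; try lra. apply punctured_inv.
Qed.

Lemma bcont_punctured f x1 x2 y1 y2 : x1 < 0 < x2 -> y1 < 0 < y2 ->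
  punctured f x1 x2 y1 y2 -> bcont f x1 x2 y1 y2.
Proof.
  intros Hx Hy Hf.
  repeat split; try lra; intros; apply cdiff_ccont, Hf; try lra;
    try (left; lra); right; lra.
Qed.

Lemma Cmod_pt_ge (x y : R) : Rabs x <= Cmod (x, y) /\ Rabs y <= Cmod (x, y).
Proof. split. exact (re_le_Cmod (x, y)). exact (Im_le_Cmod (x, y)). Qed.

(** [(f w - f 0) / w] is bounded by [|f'(0)| + 1] near 0. The difference of the two sides can be
    computed on any small square, of half-side [r], and is therefore [O(r)] for every small [r]. *)
Lemma box_residue f x1 x2 y1 y2 : x1 < 0 < x2 -> y1 < 0 < y2 -> rdiff f x1 x2 y1 y2 ->
  box (fun w => f w * / w)%C x1 x2 y1 y2 = (kappa * f 0)%C.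
Proof.
  intros Hx Hy Hf.
  assert (Hp : forall h x1 x2 y1 y2, rdiff h x1 x2 y1 y2 ->
    punctured (fun w => h w * / w)%C x1 x2 y1 y2).
  { intros h a1 a2 b1 b2 Hh x y ? ? ?. apply cdiff_mult. now apply Hh.
    now apply (punctured_inv a1 a2 b1 b2). }
  destruct (Hf 0 0) as [l Hl]; try lra. change (0, 0) with (RtoC 0) in Hl.
  destruct (Hl 1 Rlt_0_1) as [d [d0 Hd]].
  set (B := Cmod l + 1). assert (HB : 0 < B) by (generalize (Cmod_ge_0 l); unfold B; lra).
  set (e := (box (fun w => f w * / w) x1 x2 y1 y2 - kappa * f 0)%C).
  assert (S : forall r, 0 < r -> r <= 1 -> 2 * r < d -> r <= - x1 -> r <= x2 -> r <= - y1 -> r <= y2 ->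
    Cmod e <= 8 * r * B).
  { intros r r0 r1 rd H1 H2 H3 H4. unfold e.
    rewrite (box_shrink _ x1 x2 y1 y2 r) by (try lra; auto).
    rewrite <- (kappa_small r) by lra.
    assert (B1 : bcont (fun w => f w * / w)%C (- r) r (- r) r).
    { apply bcont_punctured; try lra. apply Hp. intros x y ? ?; apply Hf; lra. }
    assert (B2 : bcont Cinv (- r) r (- r) r).
    { apply bcont_punctured; try lra. apply punctured_inv. }
    replace (box (fun w => f w * / w)%C (- r) r (- r) r - box Cinv (- r) r (- r) r * f 0)%C
      with (box (fun w => f w * / w + (- f 0) * / w)%C (- r) r (- r) r).
    2:{ rewrite (box_plus (fun w => f w * / w)%C (fun w => (- f 0) * / w)%C); auto.
        2: now apply (bcont_scal _ Cinv).
        rewrite (box_scal (- f 0) Cinv) by auto. ring. }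
    replace (8 * r * B) with (2 * ((r - - r) + (r - - r)) * B) by ring.
    assert (Bd : forall w, w <> RtoC 0 -> Cmod w < d -> Cmod (f w * / w + - f 0 * / w) <= B).
    { intros w w0 wd. replace (f w * / w + - f 0 * / w)%C with ((f w - f 0) * / w)%C by ring.
      specialize (Hd w). replace (w - 0)%C with w in Hd by ring. specialize (Hd wd).
      assert (P : 0 < Cmod w) by now apply Cmod_gt_0.
      rewrite Cmod_mult, Cmod_inv by auto.
      assert (Cmod (f w - f 0) <= B * Cmod w).
      { replace (f w - f 0)%C with (f w - f 0 - l * w + l * w)%C by ring.
        eapply Rle_trans. apply Cmod_triangle. rewrite Cmod_mult. unfold B. lra. }
      apply Rmult_le_reg_r with (Cmod w); auto.
      rewrite Rmult_assoc, Rinv_l by lra. lra. }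
    assert (Sm : forall x y, - r <= x <= r -> - r <= y <= r -> Cmod (x, y) < d).
    { intros x y Hx' Hy'. eapply Rle_lt_trans. apply Cmod_le_sum. simpl.
      assert (Rabs x <= r) by (apply Rabs_le; lra).
      assert (Rabs y <= r) by (apply Rabs_le; lra). lra. }
    apply box_bound.
    - apply bcont_plus; auto. now apply (bcont_scal _ Cinv).
    - intros u Hu. split; (apply Bd; [apply pt_neq0; right; lra|apply Sm; lra]).
    - intros u Hu. split; (apply Bd; [apply pt_neq0; left; lra|apply Sm; lra]). }
  apply Ceq_minus. fold e. apply Cmod_eq_0.
  destruct (Rle_lt_or_eq_dec 0 (Cmod e) (Cmod_ge_0 e)) as [E|E]; auto. exfalso.
  set (m := Rmin (Rmin 1 (d / 3)) (Rmin (Rmin (- x1) x2) (Rmin (- y1) y2))).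
  assert (Hm : 0 < m) by (unfold m; repeat apply Rmin_pos; lra).
  assert (m <= 1) by (unfold m; eapply Rle_trans; [apply Rmin_l|apply Rmin_l]).
  assert (m <= d / 3) by (unfold m; eapply Rle_trans; [apply Rmin_l|apply Rmin_r]).
  assert (m <= - x1) by (unfold m; eapply Rle_trans; [apply Rmin_r|eapply Rle_trans; [apply Rmin_l|apply Rmin_l]]).
  assert (m <= x2) by (unfold m; eapply Rle_trans; [apply Rmin_r|eapply Rle_trans; [apply Rmin_l|apply Rmin_r]]).
  assert (m <= - y1) by (unfold m; eapply Rle_trans; [apply Rmin_r|eapply Rle_trans; [apply Rmin_r|apply Rmin_l]]).
  assert (m <= y2) by (unfold m; eapply Rle_trans; [apply Rmin_r|eapply Rle_trans; [apply Rmin_r|apply Rmin_r]]).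
  set (r := Rmin m (Cmod e / (16 * B))).
  assert (Hr : 0 < r) by (apply Rmin_pos; auto; apply Rdiv_lt_0_compat; lra).
  assert (Hr1 : r <= m) by apply Rmin_l.
  assert (Hr2 : r <= Cmod e / (16 * B)) by apply Rmin_r.
  assert (Q : Cmod e <= 8 * r * B) by (apply S; lra).
  assert (8 * r * B <= Cmod e / 2).
  { apply Rle_trans with (8 * (Cmod e / (16 * B)) * B). nra. right; field; lra. }
  lra.
Qed.

Lemma scont_const_div (x : R) : scont (fun u => RtoC (2 * / (1 + u * u))) x.
Proof.
  assert (H : continuity_pt (fun u => 2 * / (1 + u * u)) x).
  { apply continuity_pt_filterlim. apply (ex_derive_continuous (fun u => 2 * / (1 + u * u))).
    auto_derive. nra. }
  intros eps Heps. destruct (H eps Heps) as [d [d0 Hd]]. exists d; split; auto.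
  intros y Hy. rewrite <- RtoC_minus, Cmod_R.
  destruct (Req_dec y x) as [->|N]. rewrite Rminus_diag, Rabs_R0; auto.
  refine (Hd y (conj (conj I _) Hy)). auto.
Qed.

(** Opposite sides are paired: each pair gives [i] times the integral of [2 / (1 + u^2)] over
    [[-1, 1]], that is [i pi]. *)
Lemma kappa_value : kappa = (2 * PI * Ci)%C.
Proof.
  assert (A : CInt (fun u => RtoC (2 * / (1 + u * u))) (- 1) 1 = RtoC PI).
  { rewrite (CInt_FTC (fun u => RtoC (2 * atan u)) (fun u => RtoC (2 * / (1 + u * u)))); try lra.
    - rewrite <- RtoC_minus. f_equal. replace (-1) with (- (1)) by ring. rewrite atan_opp, atan_1. field.
    - intros x _. apply rder_pair; simpl.
      + auto_derive; auto. unfold Rsqr, RtoC; simpl. field. nra.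
      + auto_derive; auto.
    - intros; apply scont_const_div. }
  assert (B := bcont_punctured Cinv (- 1) 1 (- 1) 1 ltac:(lra) ltac:(lra) (punctured_inv _ _ _ _)).
  destruct B as [B1 [B2 [B3 B4]]].
  assert (H1 : (hint Cinv (- 1) 1 (- 1) - hint Cinv (- 1) 1 1 = Ci * PI)%C).
  { unfold hint. replace (CInt (fun u => / (u, -1))%C (- 1) 1 - CInt (fun u => / (u, 1%R))%C (- 1) 1)%C
      with (CInt (fun u => / (u, -1) + (-1) * / (u, 1%R))%C (- 1) 1).
    2:{ rewrite (CInt_plus (fun u => / (u, -1))%C (fun u => (-1) * / (u, 1%R))%C).
        rewrite (CInt_scal (-1)%C (fun u => / (u, 1%R))%C). ring.
        now apply (hcont_ex Cinv). now apply (hcont_ex Cinv).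
        apply ex_CInt_scal. now apply (hcont_ex Cinv). }
    rewrite <- A, <- CInt_scal.
    2:{ apply ex_CInt_scont. lra. intros; apply scont_const_div. }
    apply CInt_ext. lra. intros x _.
    unfold Cinv, RtoC, Ci, Cplus, Cmult; simpl. f_equal; field; nra. }
  assert (H2 : (vint Cinv 1 (- 1) 1 - vint Cinv (- 1) (- 1) 1 = Ci * PI)%C).
  { unfold vint. replace (Ci * CInt (fun v => / (1%R, v))%C (- 1) 1 - Ci * CInt (fun v => / (-1, v))%C (- 1) 1)%C
      with (Ci * CInt (fun v => / (1%R, v) + (-1) * / (-1, v))%C (- 1) 1)%C.
    2:{ rewrite (CInt_plus (fun v => / (1%R, v))%C (fun v => (-1) * / (-1, v))%C).
        rewrite (CInt_scal (-1)%C (fun v => / (-1, v))%C). ring.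
        now apply (vcont_ex Cinv). now apply (vcont_ex Cinv).
        apply ex_CInt_scal. now apply (vcont_ex Cinv). }
    f_equal. rewrite <- A.
    apply CInt_ext. lra. intros x _.
    unfold Cinv, RtoC, Ci, Cplus, Cmult; simpl. f_equal; field; nra. }
  unfold kappa, box.
  replace (hint Cinv (-1) 1 (-1) + vint Cinv 1 (-1) 1 - hint Cinv (-1) 1 1 - vint Cinv (-1) (-1) 1)%C
    with ((hint Cinv (-1) 1 (-1) - hint Cinv (-1) 1 1) + (vint Cinv 1 (-1) 1 - vint Cinv (-1) (-1) 1))%C by ring.
  rewrite H1, H2. ring.
Qed.

Lemma kappa_neq0 : kappa <> RtoC 0.
Proof.
  rewrite kappa_value. repeat apply Cmult_neq_0.
  - intros E. injection E. lra.
  - intros E. injection E. generalize PI_RGT_0. lra.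
  - apply Ci_nz.
Qed.

Lemma cdiff_translate g z w : cdiff g (w + z) -> cdiff (fun x => g (x + z)%C) w.
Proof.
  intros H. apply (cdiff_comp g (fun x => x + z)%C); auto.
  apply cdiff_plus. apply cdiff_id. apply cdiff_const.
Qed.

Lemma Cadd_sub (a b : C) : (a + b - b)%C = a.
Proof. ring. Qed.

Lemma box_cauchy f x1 x2 y1 y2 z : x1 < Re z < x2 -> y1 < Im z < y2 -> rdiff f x1 x2 y1 y2 ->
  box (fun w => f w * / (w - z))%C x1 x2 y1 y2 = (kappa * f z)%C.
Proof.
  intros Hx Hy Hf.
  assert (H := box_residue (fun w => f (w + z)%C) (x1 - Re z) (x2 - Re z) (y1 - Im z) (y2 - Im z)).
  cbv beta in H. rewrite Cplus_0_l in H. rewrite <- H; try lra.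
  - set (g := (fun w => f w * / (w - z))%C).
    assert (E : box (fun w => f (w + z) * / w)%C (x1 - Re z) (x2 - Re z) (y1 - Im z) (y2 - Im z) =
      box (fun w => g (w + z)%C) (x1 - Re z) (x2 - Re z) (y1 - Im z) (y2 - Im z)).
    { unfold g. apply box_ext; try lra; intros; split;
        match goal with |- (_ * / ?w = _)%C => rewrite (Cadd_sub w z) end; reflexivity. }
    rewrite E, box_translate.
    + now replace (x1 - Re z + Re z) with x1 by ring; replace (x2 - Re z + Re z) with x2 by ring;
      replace (y1 - Im z + Im z) with y1 by ring; replace (y2 - Im z + Im z) with y2 by ring.
    + assert (Q : forall x y, x1 <= x <= x2 -> y1 <= y <= y2 -> x <> Re z \/ y <> Im z -> ccont g (x, y)).
      { intros x y ? ? N. apply cdiff_ccont, cdiff_mult. now apply Hf.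
        apply (cdiff_inv (fun w => w - z)%C).
        - intros E0. apply Ceq_minus in E0. destruct z as [a b]. injection E0. intros; simpl in *; destruct N; auto.
        - apply cdiff_minus. apply cdiff_id. apply cdiff_const. }
      repeat split; try lra; intros; apply Q; try lra; (try (left; lra)); right; lra.
  - intros x y ? ?. apply cdiff_translate.
    replace ((x, y) + z)%C with ((x + Re z, y + Im z) : C).
    apply Hf; lra. destruct z; reflexivity.
Qed.

Definition insq (z : C) (r : R) (w : C) : Prop :=
  Rabs (Re w - Re z) <= r /\ Rabs (Im w - Im z) <= r.

Lemma insq_center z r : 0 <= r -> insq z r z.
Proof. intros; split; rewrite Rminus_diag, Rabs_R0; auto. Qed.

Lemma insq_Cmod z r w : Cmod (w - z) <= r -> insq z r w.
Proof.
  intros H. split; eapply Rle_trans; try exact H.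
  - change (Re w - Re z) with (Re (w - z)). apply re_le_Cmod.
  - change (Im w - Im z) with (Im (w - z)). apply Im_le_Cmod.
Qed.

Lemma Cmod_insq z r w : insq z r w -> Cmod (w - z) <= 2 * r.
Proof.
  intros [H K]. eapply Rle_trans. apply Cmod_le_sum.
  change (Re (w - z)) with (Re w - Re z). change (Im (w - z)) with (Im w - Im z). lra.
Qed.

Lemma Rabs_pt a b r : Rabs (a - b) <= r <-> b - r <= a <= b + r.
Proof. split. intros H. apply Rabs_le_between in H. lra. intros; apply Rabs_le; lra. Qed.

Lemma insq_trans z r w r' v : insq z r w -> insq w r' v -> insq z (r + r') v.
Proof. intros [A B] [A' B']. rewrite Rabs_pt in *. split; rewrite Rabs_pt; lra. Qed.

Lemma insq_le z r r' w : r <= r' -> insq z r w -> insq z r' w.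
Proof. intros L [A B]. split; lra. Qed.

Lemma box_lin_bound F G K h x1 x2 y1 y2 B :
  bcont F x1 x2 y1 y2 -> bcont G x1 x2 y1 y2 -> bcont K x1 x2 y1 y2 ->
  (forall x y, x1 <= x <= x2 -> y1 <= y <= y2 -> (x = x1 \/ x = x2 \/ y = y1 \/ y = y2) ->
     Cmod (F (x, y) - G (x, y) - h * K (x, y)) <= B) ->
  Cmod (box F x1 x2 y1 y2 - box G x1 x2 y1 y2 - h * box K x1 x2 y1 y2)
    <= 2 * ((x2 - x1) + (y2 - y1)) * B.
Proof.
  intros HF HG HK HB.
  assert (HG' := bcont_scal (-1)%C _ _ _ _ _ HG). assert (HK' := bcont_scal (- h)%C _ _ _ _ _ HK).
  assert (HGK := bcont_plus _ _ _ _ _ _ HG' HK').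
  replace (box F x1 x2 y1 y2 - box G x1 x2 y1 y2 - h * box K x1 x2 y1 y2)%C
    with (box (fun w => F w + (-1 * G w + - h * K w))%C x1 x2 y1 y2).
  2:{ rewrite (box_plus F (fun w => -1 * G w + - h * K w)%C) by auto.
      rewrite (box_plus (fun w => -1 * G w)%C (fun w => - h * K w)%C) by auto.
      rewrite (box_scal (-1)%C G), (box_scal (- h)%C K) by auto. ring. }
  assert (E : forall w, (F w + (-1 * G w + - h * K w))%C = (F w - G w - h * K w)%C) by (intros; ring).
  assert (HFGK := bcont_plus _ _ _ _ _ _ HF HGK).
  destruct HF as [[? ?] [? [[? ?] ?]]].
  apply box_bound.
  - exact HFGK.
  - intros u Hu. rewrite !E. split; apply HB; auto; lra.
  - intros u Hu. rewrite !E. split; apply HB; auto; lra.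
Qed.

Section CauchyEstimates.

Variables (f : C -> C) (z0 : C) (r M : R).
Hypothesis Hr : 0 < r.
Hypothesis Hf : forall w, insq z0 r w -> cdiff f w.
Hypothesis HM : forall w, insq z0 r w -> Cmod (f w) <= M.

Let x1 := Re z0 - r. Let x2 := Re z0 + r. Let y1 := Im z0 - r. Let y2 := Im z0 + r.
Let bx (g : C -> C) := box g x1 x2 y1 y2.

(** Cauchy's integrals for the first and second derivatives. That they are derivatives is proved
    below, by estimating difference quotients under the integral. *)
Let d1 (z : C) : C := (/ kappa * bx (fun w => f w * / ((w - z) * (w - z))))%C.
Let d2 (z : C) : C := (/ kappa * bx (fun w => f w * (2 * / ((w - z) * (w - z) * (w - z)))))%C.

Lemma contour_far (z : C) (x y : R) : insq z0 (3 / 4 * r) z ->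
  (x = x1 \/ x = x2 \/ y = y1 \/ y = y2) -> r / 4 <= Cmod ((x, y) - z).
Proof.
  intros [Ha Hb] H. rewrite Rabs_pt in Ha, Hb.
  destruct (Cmod_pt_ge (x - Re z) (y - Im z)) as [A B].
  change ((x, y) - z)%C with ((x - Re z, y - Im z) : C).
  destruct H as [->|[->|[->| ->]]].
  - eapply Rle_trans. 2: exact A. rewrite Rabs_left1; unfold x1; lra.
  - eapply Rle_trans. 2: exact A. rewrite Rabs_right; unfold x2; lra.
  - eapply Rle_trans. 2: exact B. rewrite Rabs_left1; unfold y1; lra.
  - eapply Rle_trans. 2: exact B. rewrite Rabs_right; unfold y2; lra.
Qed.

Lemma contour_neq (z : C) (x y : R) : insq z0 (3 / 4 * r) z ->
  (x = x1 \/ x = x2 \/ y = y1 \/ y = y2) -> ((x, y) - z)%C <> RtoC 0.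
Proof. intros H H'. apply Cmod_neq0. generalize (contour_far z x y H H'). lra. Qed.

Lemma contour_insq (x y : R) : x1 <= x <= x2 -> y1 <= y <= y2 -> insq z0 r (x, y).
Proof. unfold x1, x2, y1, y2. intros; split; simpl; rewrite Rabs_pt; lra. Qed.

Lemma contour_bcont (k : C -> C) :
  (forall x y, (x = x1 \/ x = x2 \/ y = y1 \/ y = y2) -> cdiff k (x, y)) ->
  bcont (fun w => f w * k w)%C x1 x2 y1 y2.
Proof.
  intros Hk. assert (x1 <= x2) by (unfold x1, x2; lra). assert (y1 <= y2) by (unfold y1, y2; lra).
  repeat split; auto; intros; apply cdiff_ccont, cdiff_mult; auto; apply Hf, contour_insq; lra.
Qed.

Lemma cauchy_integrand_cdiff (z : C) (x y : R) : insq z0 (3 / 4 * r) z ->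
  (x = x1 \/ x = x2 \/ y = y1 \/ y = y2) ->
  cdiff (fun w => / (w - z))%C (x, y) /\ cdiff (fun w => / ((w - z) * (w - z)))%C (x, y) /\
  cdiff (fun w => 2 * / ((w - z) * (w - z) * (w - z)))%C (x, y).
Proof.
  intros Hz Hb. assert (N := contour_neq z x y Hz Hb).
  assert (D : cdiff (fun w => w - z)%C (x, y)) by (apply cdiff_minus; [apply cdiff_id|apply cdiff_const]).
  repeat split.
  - now apply (cdiff_inv (fun w => w - z)%C).
  - apply (cdiff_inv (fun w => (w - z) * (w - z))%C). now apply Cmult_neq_0. now apply cdiff_mult.
  - apply cdiff_mult. apply cdiff_const.
    apply (cdiff_inv (fun w => (w - z) * (w - z) * (w - z))%C).
    repeat apply Cmult_neq_0; auto. repeat apply cdiff_mult; auto.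
Qed.

Lemma cauchy_formula (z : C) : insq z0 (3 / 4 * r) z -> f z = (/ kappa * bx (fun w => f w * / (w - z)))%C.
Proof.
  intros [H H']. rewrite Rabs_pt in H, H'. unfold bx.
  rewrite box_cauchy. field. apply kappa_neq0. unfold x1, x2; lra. unfold y1, y2; lra.
  intros x y ? ?. apply Hf. now apply contour_insq.
Qed.

Lemma kappa_inv_le : Cmod (/ kappa) <= 1.
Proof.
  rewrite Cmod_inv by apply kappa_neq0. rewrite kappa_value, !Cmod_mult, Cmod_Ci, !Cmod_R.
  rewrite Rabs_right by lra. rewrite (Rabs_right PI) by (generalize PI_RGT_0; lra).
  rewrite <- Rinv_1. apply Rinv_le_contravar. lra. generalize PI_RGT_0 PI2_1. lra.
Qed.

Lemma sup_bound_ge0 : 0 <= M.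
Proof. eapply Rle_trans. apply Cmod_ge_0. apply (HM z0). apply insq_center; lra. Qed.

(** [1/(w-z-h) - 1/(w-z) - h/(w-z)^2 = h^2 / ((w-z-h) (w-z)^2)]. On the contour, of length [8 r],
    each of the three factors is at least [r / 4] in modulus. The remainder is explicit because it
    will be used uniformly along a sequence of functions. *)
Lemma cauchy_taylor1 (z h : C) : insq z0 (r / 2) z -> Cmod h <= r / 4 ->
  Cmod (f (z + h) - f z - d1 z * h) <= 512 * M / r ^ 2 * Cmod h ^ 2.
Proof.
  intros Hz Hh. assert (Hz' : insq z0 (3 / 4 * r) z) by (apply insq_le with (r / 2); auto; lra).
  assert (Hzh : insq z0 (3 / 4 * r) (z + h)).
  { apply insq_le with (r / 2 + r / 4). lra. apply insq_trans with z; auto.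
    apply insq_Cmod. replace (z + h - z)%C with h by ring. auto. }
  rewrite (cauchy_formula _ Hz'), (cauchy_formula _ Hzh). unfold d1.
  replace (/ kappa * bx (fun w => f w * / (w - (z + h))) - / kappa * bx (fun w => f w * / (w - z)) -
    / kappa * bx (fun w => f w * / ((w - z) * (w - z))) * h)%C with
   (/ kappa * (bx (fun w => f w * / (w - (z + h))) - bx (fun w => f w * / (w - z)) -
    h * bx (fun w => f w * / ((w - z) * (w - z)))))%C by ring.
  rewrite Cmod_mult.
  eapply Rle_trans. apply Rmult_le_compat. apply Cmod_ge_0. apply Cmod_ge_0. apply kappa_inv_le.
  apply (box_lin_bound _ _ _ _ _ _ _ _ (64 * M / r ^ 3 * Cmod h ^ 2)).
  - apply contour_bcont. intros x y Hb. now apply cauchy_integrand_cdiff.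
  - apply contour_bcont. intros x y Hb. now apply cauchy_integrand_cdiff.
  - apply contour_bcont. intros x y Hb. now apply cauchy_integrand_cdiff.
  - intros x y Hx Hy Hb. assert (N1 := contour_neq _ _ _ Hz' Hb). assert (N2 := contour_neq _ _ _ Hzh Hb).
    assert (F1 := contour_far _ _ _ Hz' Hb). assert (F2 := contour_far _ _ _ Hzh Hb).
    set (w := (x, y) : C) in *.
    replace (f w * / (w - (z + h)) - f w * / (w - z) - h * (f w * / ((w - z) * (w - z))))%C
      with (f w * ((h * h) * (/ (w - (z + h)) * (/ (w - z) * / (w - z)))))%C by (field; auto).
    rewrite !Cmod_mult, !Cmod_inv by auto.
    assert (I : forall a, r / 4 <= a -> 0 <= / a <= / (r / 4)).
    { intros a Ha. split. left; apply Rinv_0_lt_compat; lra. apply Rinv_le_contravar; lra. }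
    apply Rle_trans with (M * ((Cmod h * Cmod h) * (/ (r / 4) * (/ (r / 4) * / (r / 4))))).
    2: right; field; lra.
    apply Rmult_le_compat. apply Cmod_ge_0. 2: apply HM, contour_insq; auto.
    apply Rmult_le_pos. apply Rmult_le_pos; apply Cmod_ge_0.
    apply Rmult_le_pos. now apply I. apply Rmult_le_pos; now apply I.
    apply Rmult_le_compat_l. apply Rmult_le_pos; apply Cmod_ge_0.
    apply Rmult_le_compat; try now apply I. apply Rmult_le_pos; now apply I.
    apply Rmult_le_compat; now apply I.
  - right. unfold x1, x2, y1, y2. field. lra.
Qed.

Lemma cauchy_cder (z : C) : insq z0 (r / 2) z -> cder f z (d1 z).
Proof.
  intros Hz eps Heps. set (B := 512 * M / r ^ 2 + 1). assert (P := sup_bound_ge0).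
  assert (HB : 0 < B).
  { unfold B. assert (0 <= 512 * M / r ^ 2); [|lra].
    apply Rmult_le_pos. lra. left; apply Rinv_0_lt_compat. now apply pow_lt. }
  exists (Rmin (r / 4) (eps / B)). split. apply Rmin_pos. lra. now apply Rdiv_lt_0_compat.
  intros w Hw. assert (H1 := Rlt_le_trans _ _ _ Hw (Rmin_l _ _)).
  assert (H2 := Rlt_le_trans _ _ _ Hw (Rmin_r _ _)).
  generalize (cauchy_taylor1 z (w - z) Hz). replace (z + (w - z))%C with w by ring. intros T.
  eapply Rle_trans. apply T. lra.
  assert (Q := Cmod_ge_0 (w - z)). set (x := Cmod (w - z)) in *.
  apply Rle_trans with (B * x * x). unfold B. simpl. nra.
  apply Rmult_le_compat_r; auto. apply Rle_trans with (B * (eps / B)). apply Rmult_le_compat_l; lra.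
  right; field; lra.
Qed.

Lemma cauchy_derivative_bound : Cmod (d1 z0) <= 128 * M / r.
Proof.
  unfold d1. rewrite Cmod_mult. assert (Hz : insq z0 (3 / 4 * r) z0) by (apply insq_center; lra).
  assert (P := sup_bound_ge0).
  apply Rle_trans with (1 * (2 * ((x2 - x1) + (y2 - y1)) * (16 * M / r ^ 2))).
  - apply Rmult_le_compat; try apply Cmod_ge_0. apply kappa_inv_le.
    assert (B : forall x y, x1 <= x <= x2 -> y1 <= y <= y2 -> (x = x1 \/ x = x2 \/ y = y1 \/ y = y2) ->
      Cmod (f (x, y) * / (((x, y) - z0) * ((x, y) - z0))) <= 16 * M / r ^ 2).
    { intros x y Hx Hy Hb. assert (N := contour_neq _ _ _ Hz Hb). assert (F := contour_far _ _ _ Hz Hb).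
      rewrite Cmod_mult, Cmod_inv, Cmod_mult by now apply Cmult_neq_0.
      replace (16 * M / r ^ 2) with (M * / (r / 4 * (r / 4))) by (field; lra).
      apply Rmult_le_compat. apply Cmod_ge_0. left; apply Rinv_0_lt_compat; nra.
      apply HM, contour_insq; auto. apply Rinv_le_contravar; nra. }
    assert (x1 <= x2) by (unfold x1, x2; lra). assert (y1 <= y2) by (unfold y1, y2; lra).
    unfold bx. apply (box_bound (fun w => f w * / ((w - z0) * (w - z0)))%C x1 x2 y1 y2 (16 * M / r ^ 2)).
    + apply (contour_bcont (fun w => / ((w - z0) * (w - z0)))%C). intros x y Hb. now apply cauchy_integrand_cdiff.
    + intros u Hu; split; cbv beta; (apply B; [lra|lra|right; right]); [left|right]; reflexivity.
    + intros u Hu; split; cbv beta; (apply B; [lra|lra|]); [left|right; left]; reflexivity.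
  - right. unfold x1, x2, y1, y2. field. lra.
Qed.

(** The same argument one order higher, by [1/(w-z-h)^2 - 1/(w-z)^2 - 2h/(w-z)^3 = h^2 (3(w-z) - 2h)
    / ((w-z-h)^2 (w-z)^3)]. It shows that a derivative is again differentiable, so that all
    derivatives exist. *)
Lemma cauchy_cder2 (z : C) : insq z0 (r / 2) z -> cder d1 z (d2 z).
Proof.
  intros Hz eps Heps. assert (P := sup_bound_ge0).
  set (A := 8 * r * (M * (20 * r * (/ (r / 4)) ^ 5)) + 1).
  assert (HA : 0 < A).
  { unfold A. assert (0 <= 8 * r * (M * (20 * r * (/ (r / 4)) ^ 5))); [|lra].
    apply Rmult_le_pos. lra. apply Rmult_le_pos; auto. apply Rmult_le_pos. lra.
    apply pow_le. left; apply Rinv_0_lt_compat; lra. }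
  exists (Rmin (r / 4) (eps / A)). split. apply Rmin_pos. lra. now apply Rdiv_lt_0_compat.
  intros v Hv. assert (H1 := Rlt_le_trans _ _ _ Hv (Rmin_l _ _)).
  assert (H2 := Rlt_le_trans _ _ _ Hv (Rmin_r _ _)).
  assert (Hz' : insq z0 (3 / 4 * r) z) by (apply insq_le with (r / 2); auto; lra).
  set (h := (v - z)%C) in *. replace v with (z + h)%C by (unfold h; ring).
  assert (Hzh : insq z0 (3 / 4 * r) (z + h)).
  { apply insq_le with (r / 2 + r / 4). lra. apply insq_trans with z; auto.
    apply insq_Cmod. replace (z + h - z)%C with h by ring. lra. }
  unfold d1, d2.
  set (a := bx (fun w => f w * / ((w - (z + h)) * (w - (z + h))))%C).
  set (b := bx (fun w => f w * / ((w - z) * (w - z)))%C).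
  set (c := bx (fun w => f w * (2 * / ((w - z) * (w - z) * (w - z))))%C).
  replace (/ kappa * a - / kappa * b - / kappa * c * h)%C with (/ kappa * (a - b - h * c))%C by ring.
  rewrite Cmod_mult. unfold a, b, c.
  eapply Rle_trans. apply Rmult_le_compat. apply Cmod_ge_0. apply Cmod_ge_0. apply kappa_inv_le.
  apply (box_lin_bound _ _ _ _ _ _ _ _ (M * (20 * r * (/ (r / 4)) ^ 5) * Cmod h ^ 2)).
  - apply contour_bcont. intros x y Hb. now apply cauchy_integrand_cdiff.
  - apply contour_bcont. intros x y Hb. now apply cauchy_integrand_cdiff.
  - apply contour_bcont. intros x y Hb. now apply cauchy_integrand_cdiff.
  - intros x y Hx Hy Hb. assert (N1 := contour_neq _ _ _ Hz' Hb). assert (N2 := contour_neq _ _ _ Hzh Hb).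
    assert (F1 := contour_far _ _ _ Hz' Hb). assert (F2 := contour_far _ _ _ Hzh Hb).
    assert (U : Cmod (3 * ((x, y) - z) - 2 * h) <= 20 * r).
    { unfold Cminus at 1. eapply Rle_trans. apply Cmod_triangle. rewrite Cmod_opp, !Cmod_mult, !Cmod_R.
      rewrite !Rabs_right by lra.
      assert (Cmod ((x, y) - z) <= 2 * r + 2 * r).
      { replace ((x, y) - z)%C with (((x, y) - z0) + (z0 - z))%C by ring.
        eapply Rle_trans. apply Cmod_triangle. rewrite (Cmod_minus_sym z0).
        assert (Q1 := Cmod_insq _ _ _ (contour_insq x y Hx Hy)). assert (Q2 := Cmod_insq _ _ _ Hz). lra. }
      lra. }
    set (w := (x, y) : C) in *.
    replace (f w * / ((w - (z + h)) * (w - (z + h))) - f w * / ((w - z) * (w - z)) -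
       h * (f w * (2 * / ((w - z) * (w - z) * (w - z)))))%C
      with (f w * ((3 * (w - z) - 2 * h) * ((/ (w - (z + h))) ^ 2 * (/ (w - z)) ^ 3)) * (h * h))%C
      by (simpl; field; auto).
    rewrite !Cmod_mult, !Cmod_pow, !Cmod_inv by auto.
    assert (I : forall a, r / 4 <= a -> 0 <= / a <= / (r / 4)).
    { intros t Ht. split. left; apply Rinv_0_lt_compat; lra. apply Rinv_le_contravar; lra. }
    replace (Cmod h ^ 2) with (Cmod h * Cmod h) by ring.
    apply Rmult_le_compat_r. apply Rmult_le_pos; apply Cmod_ge_0.
    assert (I1 := I _ F1). assert (I2 := I _ F2).
    apply Rmult_le_compat. apply Cmod_ge_0. 2: apply HM, contour_insq; auto.
    apply Rmult_le_pos. apply Cmod_ge_0. apply Rmult_le_pos; apply pow_le; lra.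
    apply Rmult_le_compat; auto. apply Cmod_ge_0. apply Rmult_le_pos; apply pow_le; lra.
    replace ((/ (r / 4)) ^ 5) with ((/ (r / 4)) ^ 2 * (/ (r / 4)) ^ 3) by ring.
    apply Rmult_le_compat; try (apply pow_le; lra); apply pow_incr; lra.
  - assert (Q := Cmod_ge_0 h). set (x := Cmod h) in *.
    replace (1 * (2 * (x2 - x1 + (y2 - y1)) * (M * (20 * r * (/ (r / 4)) ^ 5) * x ^ 2)))
      with ((A - 1) * x * x) by (unfold A, x1, x2, y1, y2; ring).
    apply Rle_trans with (A * x * x). nra.
    apply Rmult_le_compat_r; auto. apply Rle_trans with (A * (eps / A)). apply Rmult_le_compat_l; lra.
    right; field; lra.
Qed.

Lemma cauchy_C_derive (z : C) : insq z0 (r / 2) z -> C_derive f z = d1 z.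
Proof. intros H. apply cder_C_derive. now apply cauchy_cder. Qed.

Lemma cauchy_taylor (h : C) : Cmod h <= r / 4 ->
  Cmod (f (z0 + h) - f z0 - C_derive f z0 * h) <= 512 * M / r ^ 2 * Cmod h ^ 2.
Proof.
  intros Hh. rewrite cauchy_C_derive by (apply insq_center; lra). apply cauchy_taylor1; auto. apply insq_center; lra.
Qed.

Lemma cauchy_bound : Cmod (C_derive f z0) <= 128 * M / r.
Proof. rewrite cauchy_C_derive by (apply insq_center; lra). apply cauchy_derivative_bound. Qed.

Lemma cauchy_cdiff : cdiff (C_derive f) z0.
Proof.
  exists (d2 z0). apply cder_ext_loc with d1 (r / 2). lra.
  - intros w Hw. symmetry. apply cauchy_C_derive. apply insq_Cmod. lra.
  - apply cauchy_cder2. apply insq_center; lra.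
Qed.

End CauchyEstimates.

(** * Iterated derivatives on open sets *)

Definition copen (U : C -> Prop) : Prop :=
  forall z, U z -> exists r, 0 < r /\ forall w, Cmod (w - z) < r -> U w.
Definition holo (U : C -> Prop) (f : C -> C) : Prop := forall z, U z -> cdiff f z.

Lemma cdiff_cder f z : cdiff f z -> cder f z (C_derive f z).
Proof. intros [l H]. now rewrite (cder_C_derive _ _ _ H). Qed.

Lemma holo_C_derive U f : copen U -> holo U f -> holo U (C_derive f).
Proof.
  intros HU Hf z Hz. destruct (HU z Hz) as [r [r0 Hr]].
  destruct (cdiff_ccont _ _ (Hf z Hz) 1 Rlt_0_1) as [d [d0 Hd]].
  set (s := Rmin r d / 4). assert (S0 : 0 < Rmin r d) by now apply Rmin_pos.
  assert (S1 := Rmin_l r d). assert (S2 := Rmin_r r d).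
  apply (cauchy_cdiff f z s (Cmod (f z) + 1)). unfold s; lra.
  - intros w Hw. apply Cmod_insq in Hw. apply Hf, Hr. unfold s in Hw. lra.
  - intros w Hw. apply Cmod_insq in Hw.
    replace (f w) with (f z + (f w - f z))%C by ring.
    eapply Rle_trans. apply Cmod_triangle. assert (Cmod (f w - f z) < 1); [|lra].
    apply Hd. unfold s in Hw. lra.
Qed.

Lemma holo_C_derive_n U f m : copen U -> holo U f -> holo U (C_derive_n f m).
Proof. intros HU Hf. induction m; simpl; auto. now apply holo_C_derive. Qed.

Lemma C_derive_n_cder U f m z : copen U -> holo U f -> U z ->
  cder (C_derive_n f m) z (C_derive_n f (S m) z).
Proof.
  intros HU Hf Hz. apply cdiff_cder. now apply (holo_C_derive_n U).
Qed.

(** Each derivative halves the radius. The constant is chosen before the function, since the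
    estimate is applied to an error term that depends on [y1] and [y2]. *)
Lemma cauchy_estimate_n (m : nat) : forall r, 0 < r -> exists K, 0 <= K /\
  forall U f z0 M, copen U -> holo U f -> (forall w, insq z0 r w -> U w) ->
    (forall w, insq z0 r w -> Cmod (f w) <= M) -> Cmod (C_derive_n f m z0) <= K * M.
Proof.
  induction m; intros r Hr.
  - exists 1. split. lra. intros U f z0 M HU Hf Hin HM. simpl. rewrite Rmult_1_l.
    apply HM. apply insq_center; lra.
  - destruct (IHm (r / 2)) as [K [K0 HK]]. lra.
    exists (128 * K / (r / 2)). split.
    { apply Rmult_le_pos. lra. left; apply Rinv_0_lt_compat; lra. }
    intros U f z0 M HU Hf Hin HM. simpl.
    assert (T : forall w, insq z0 (r / 2) w -> forall v, insq w (r / 2) v -> insq z0 r v).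
    { intros w Hw v Hv. replace r with (r / 2 + r / 2) by field. now apply insq_trans with w. }
    replace (128 * K / (r / 2) * M) with (128 * (K * M) / (r / 2)) by (field; lra).
    apply cauchy_bound. lra.
    + intros w Hw. apply (holo_C_derive_n U); auto. apply Hin.
      apply insq_le with (r / 2); auto; lra.
    + intros w Hw. apply (HK U); auto; intros v Hv; [apply Hin|apply HM]; now apply T with w.
Qed.

(** * The Gamma function off the real axis *)

Definition clim (u : nat -> C) (l : C) : Prop :=
  forall eps, 0 < eps -> exists N, forall n, (N <= n)%nat -> Cmod (u n - l) < eps.

Lemma clim_const a : clim (fun _ => a) a.
Proof. intros e He. exists O. intros. replace (a - a)%C with (RtoC 0) by ring. now rewrite Cmod_0. Qed.

Lemma clim_plus u v l m : clim u l -> clim v m -> clim (fun n => u n + v n)%C (l + m)%C.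
Proof.
  intros Hu Hv e He. destruct (Hu (e / 2)) as [N HN]. lra. destruct (Hv (e / 2)) as [N' HN']. lra.
  exists (max N N'). intros n Hn. specialize (HN n ltac:(lia)). specialize (HN' n ltac:(lia)).
  replace (u n + v n - (l + m))%C with ((u n - l) + (v n - m))%C by ring.
  eapply Rle_lt_trans. apply Cmod_triangle. lra.
Qed.

Lemma clim_mult u v l m : clim u l -> clim v m -> clim (fun n => u n * v n)%C (l * m)%C.
Proof.
  intros Hu Hv e He. set (A := Cmod l + 1). set (B := Cmod m + 1).
  assert (HA : 0 < A) by (generalize (Cmod_ge_0 l); unfold A; lra).
  assert (HB : 0 < B) by (generalize (Cmod_ge_0 m); unfold B; lra).
  destruct (Hu (e / (2 * B))) as [N HN]. apply Rdiv_lt_0_compat; lra.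
  destruct (Hv (Rmin 1 (e / (2 * A)))) as [N' HN']. apply Rmin_pos. lra. apply Rdiv_lt_0_compat; lra.
  exists (max N N'). intros n Hn. specialize (HN n ltac:(lia)). specialize (HN' n ltac:(lia)).
  assert (H1 := Rlt_le_trans _ _ _ HN' (Rmin_l _ _)). assert (H2 := Rlt_le_trans _ _ _ HN' (Rmin_r _ _)).
  replace (u n * v n - l * m)%C with ((u n - l) * v n + l * (v n - m))%C by ring.
  eapply Rle_lt_trans. apply Cmod_triangle. rewrite !Cmod_mult.
  assert (V : Cmod (v n) <= B).
  { replace (v n) with (m + (v n - m))%C by ring. eapply Rle_trans. apply Cmod_triangle. unfold B; lra. }
  assert (Cmod (u n - l) * Cmod (v n) <= Cmod (u n - l) * B) by (apply Rmult_le_compat_l; auto; apply Cmod_ge_0).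
  assert (Cmod (u n - l) * B < e / (2 * B) * B) by (apply Rmult_lt_compat_r; auto).
  assert (Cmod l * Cmod (v n - m) <= A * Cmod (v n - m)) by (apply Rmult_le_compat_r; [apply Cmod_ge_0|unfold A; lra]).
  assert (A * Cmod (v n - m) < A * (e / (2 * A))) by (apply Rmult_lt_compat_l; auto).
  replace (e / (2 * B) * B) with (e / 2) in * by (field; lra).
  replace (A * (e / (2 * A))) with (e / 2) in * by (field; lra). lra.
Qed.

Lemma clim_bound u l a B N : clim u l -> (forall n, (N <= n)%nat -> Cmod (u n - a) <= B) -> Cmod (l - a) <= B.
Proof.
  intros Hu HB. apply le_epsilon. intros e He. destruct (Hu e He) as [N' HN'].
  specialize (HB (max N N') ltac:(lia)). specialize (HN' (max N N') ltac:(lia)).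
  set (n := max N N') in *. replace (l - a)%C with ((u n - a) - (u n - l))%C by ring.
  unfold Cminus at 1. eapply Rle_trans. apply Cmod_triangle. rewrite Cmod_opp. lra.
Qed.

Lemma clim_lower u l B N : clim u l -> (forall n, (N <= n)%nat -> B <= Cmod (u n)) -> B <= Cmod l.
Proof.
  intros Hu HB. apply le_epsilon. intros e He. destruct (Hu e He) as [N' HN'].
  specialize (HB (max N N') ltac:(lia)). specialize (HN' (max N N') ltac:(lia)).
  set (n := max N N') in *. assert (T := Cmod_triangle_inv (u n) l). lra.
Qed.

Lemma clim_re u l : clim u l -> is_lim_seq (fun n => Re (u n)) (Re l).
Proof.
  intros H. apply is_lim_seq_spec. intros e. destruct (H e (cond_pos e)) as [N HN].
  exists N. intros n Hn. eapply Rle_lt_trans. 2: apply (HN n Hn).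
  change (Re (u n) - Re l) with (Re (u n - l)). apply re_le_Cmod.
Qed.

Lemma clim_im u l : clim u l -> is_lim_seq (fun n => Im (u n)) (Im l).
Proof.
  intros H. apply is_lim_seq_spec. intros e. destruct (H e (cond_pos e)) as [N HN].
  exists N. intros n Hn. eapply Rle_lt_trans. 2: apply (HN n Hn).
  change (Im (u n) - Im l) with (Im (u n - l)). apply Im_le_Cmod.
Qed.

Lemma clim_pair u l : is_lim_seq (fun n => Re (u n)) (Re l) -> is_lim_seq (fun n => Im (u n)) (Im l) -> clim u l.
Proof.
  intros H K e He. apply is_lim_seq_spec in H. apply is_lim_seq_spec in K.
  destruct (H (mkposreal (e / 2) ltac:(lra))) as [N HN]. destruct (K (mkposreal (e / 2) ltac:(lra))) as [N' HN'].
  exists (max N N'). intros n Hn. specialize (HN n ltac:(lia)). specialize (HN' n ltac:(lia)).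
  simpl in *. eapply Rle_lt_trans. apply Cmod_le_sum.
  change (Re (u n - l)) with (Re (u n) - Re l). change (Im (u n - l)) with (Im (u n) - Im l). lra.
Qed.

Lemma RtoC_neq0 (x : R) : x <> 0 -> RtoC x <> RtoC 0.
Proof. intros H E. apply H. exact (f_equal fst E). Qed.

Lemma inv_sq_telescope (n : nat) : (2 <= n)%nat -> / INR n ^ 2 <= / INR (n - 1) - / INR n.
Proof.
  intros Hn. rewrite minus_INR by lia. simpl (INR 1).
  assert (2 <= INR n) by (apply (le_INR 2); lia).
  replace (/ (INR n - 1) - / INR n) with (/ ((INR n - 1) * INR n)) by (field; lra).
  apply Rinv_le_contravar; nra.
Qed.

(** The increments are dominated by [A (1/(n-1) - 1/n)], which telescopes; the sequence is
    Cauchy. *)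
Lemma clim_summable u A n0 : 0 <= A -> (2 <= n0)%nat ->
  (forall n, (n0 <= n)%nat -> Cmod (u (S n) - u n) <= A * / INR n ^ 2) -> exists l, clim u l.
Proof.
  intros HA H2 Hu.
  assert (T : forall n k, (n0 <= n)%nat -> Cmod (u (n + k)%nat - u n) <= A * (/ INR (n - 1) - / INR (n + k - 1))).
  { intros n k Hn. induction k.
    - rewrite Nat.add_0_r. replace (u n - u n)%C with (RtoC 0) by ring. rewrite Cmod_0. lra.
    - rewrite Nat.add_succ_r. replace (S (n + k) - 1)%nat with (n + k)%nat by lia.
      replace (u (S (n + k)) - u n)%C with ((u (S (n + k)) - u (n + k)%nat) + (u (n + k)%nat - u n))%C by ring.
      eapply Rle_trans. apply Cmod_triangle.
      assert (Q := Hu (n + k)%nat ltac:(lia)). assert (Q2 := inv_sq_telescope (n + k) ltac:(lia)).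
      assert (A * / INR (n + k) ^ 2 <= A * (/ INR (n + k - 1) - / INR (n + k))) by (apply Rmult_le_compat_l; auto).
      lra. }
  assert (Cau : forall e, 0 < e -> exists N, forall n m, (N <= n)%nat -> (N <= m)%nat -> Cmod (u n - u m) < e).
  { intros e He. destruct (nfloor_ex (4 * (A + 1) / e)) as [N0 HN0].
    { left. apply Rdiv_lt_0_compat; lra. }
    set (N := (n0 + N0 + 2)%nat).
    assert (S : forall m, (N <= m)%nat -> Cmod (u m - u N) < e / 2).
    { intros m Hm. replace m with (N + (m - N))%nat by lia.
      eapply Rle_lt_trans. apply T. unfold N; lia.
      assert (0 < / INR (N + (m - N) - 1)). { apply Rinv_0_lt_compat. apply (lt_INR 0). unfold N in *; lia. }
      assert (L : 4 * (A + 1) / e < INR (N - 1)).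
      { eapply Rlt_le_trans. apply HN0. rewrite <- S_INR. apply le_INR. unfold N. lia. }
      assert (0 < 4 * (A + 1) / e) by (apply Rdiv_lt_0_compat; lra).
      assert (L2 : / INR (N - 1) <= / (4 * (A + 1) / e)) by (apply Rinv_le_contravar; lra).
      apply Rle_lt_trans with (A * / (4 * (A + 1) / e)). apply Rmult_le_compat_l; lra.
      replace (A * / (4 * (A + 1) / e)) with (A * / (A + 1) * (e / 4)) by (field; lra).
      assert (A * / (A + 1) <= 1). { apply Rmult_le_reg_r with (A + 1). lra. rewrite Rmult_assoc, Rinv_l; lra. }
      nra. }
    exists N. intros n m Hn Hm. replace (u n - u m)%C with ((u n - u N) - (u m - u N))%C by ring.
    unfold Cminus at 1. eapply Rle_lt_trans. apply Cmod_triangle. rewrite Cmod_opp.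
    assert (S1 := S n Hn). assert (S2 := S m Hm). lra. }
  assert (R1 : ex_finite_lim_seq (fun n => Re (u n))).
  { apply ex_lim_seq_cauchy_corr. intros e. destruct (Cau e (cond_pos e)) as [N HN]. exists N.
    intros n m Hn Hm. eapply Rle_lt_trans. 2: apply (HN n m Hn Hm). apply (re_le_Cmod (u n - u m)). }
  assert (R2 : ex_finite_lim_seq (fun n => Im (u n))).
  { apply ex_lim_seq_cauchy_corr. intros e. destruct (Cau e (cond_pos e)) as [N HN]. exists N.
    intros n m Hn Hm. eapply Rle_lt_trans. 2: apply (HN n m Hn Hm). apply (Im_le_Cmod (u n - u m)). }
  destruct R1 as [a Ha]. destruct R2 as [b Hb]. exists (a, b). now apply clim_pair.
Qed.

(** [Iter.iter] peels off the first factor, whereas the recurrences for partial products need the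
    last one. *)
Lemma iter_iota_snoc (T : Type) (op : T -> T -> T) (e : T) (f : nat -> T) :
  (forall x y z, op x (op y z) = op (op x y) z) -> (forall x, op x e = op e x) ->
  (forall x, op e x = x) -> forall n a,
  Iter.iter op e (seq.iota a (S n)) f = op (Iter.iter op e (seq.iota a n) f) (f (a + n)%nat).
Proof.
  intros A C1 E. induction n; intros a.
  - simpl. rewrite Nat.add_0_r. apply C1.
  - change (seq.iota a (S (S n))) with (cons a (seq.iota (S a) (S n))).
    change (seq.iota a (S n)) with (cons a (seq.iota (S a) n)).
    cbn [Iter.iter]. rewrite IHn, A. now replace (S a + n)%nat with (a + S n)%nat by lia.
Qed.

Definition gprod (z : C) (n : nat) : C := Iter.iter_nat Cmult 1 (fun k => z + INR k)%C 0 n.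

Lemma gprod_S z n : gprod z (S n) = (gprod z n * (z + INR (S n)))%C.
Proof.
  unfold gprod, Iter.iter_nat. replace (S (S n) - 0)%nat with (S (S n)) by lia.
  replace (S n - 0)%nat with (S n) by lia.
  rewrite (iter_iota_snoc C Cmult); auto.
  intros; ring. intros; ring. intros; ring.
Qed.

Lemma gprod_0 z : gprod z 0 = z.
Proof. unfold gprod, Iter.iter_nat. simpl. change (RtoC (INR 0)) with (RtoC 0). ring. Qed.

Lemma im_shift (z : C) (n : nat) : Im (z + INR n) = Im z.
Proof. rewrite im_plus, im_RtoC. ring. Qed.

Lemma im_neq0 (z : C) : Im z <> 0 -> z <> RtoC 0.
Proof. intros H E. apply H. now rewrite E. Qed.

Lemma gprod_neq0 z n : Im z <> 0 -> gprod z n <> RtoC 0.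
Proof.
  intros H. induction n. rewrite gprod_0. now apply im_neq0.
  rewrite gprod_S. apply Cmult_neq_0; auto. apply im_neq0. now rewrite im_shift.
Qed.

Fixpoint hsum (z : C) (n : nat) : C :=
  match n with O => / z | S p => hsum z p + / (z + INR (S p)) end%C.

Lemma gprod_cder z n : Im z <> 0 -> cder (fun w => gprod w n) z (gprod z n * hsum z n)%C.
Proof.
  intros H. induction n.
  - apply cder_ext with (fun w => w). intros; now rewrite gprod_0.
    generalize (cder_id z). apply cder_val. rewrite gprod_0. simpl. field. now apply im_neq0.
  - apply cder_ext with (fun w => gprod w n * (w + INR (S n)))%C. intros; now rewrite gprod_S.
    generalize (cder_mult _ _ _ _ _ IHn (cder_plus _ _ _ _ _ (cder_id z) (cder_const (INR (S n)) z))).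
    apply cder_val. rewrite gprod_S. cbn [hsum]. field. apply im_neq0. now rewrite im_shift.
Qed.

(** The logarithmic derivative of Gauss's approximation; its limit is the digamma function. *)
Definition psi_approx (z : C) (n : nat) : C := (ln (INR n) - hsum z n)%C.

Lemma Gamma_approx_eq z n : Gamma_approx z n = (INR (fact n) * Cexp (z * ln (INR n)) * / gprod z n)%C.
Proof. reflexivity. Qed.

Lemma Gamma_approx_cder z n : Im z <> 0 ->
  cder (fun w => Gamma_approx w n) z (Gamma_approx z n * psi_approx z n)%C.
Proof.
  intros H. apply cder_ext with (fun w => INR (fact n) * Cexp (w * ln (INR n)) * / gprod w n)%C.
  { intros; now rewrite Gamma_approx_eq. }
  generalize (cder_mult _ _ _ _ _ (cder_scal _ (INR (fact n)) _ _
    (cder_comp Cexp (fun w => w * ln (INR n))%C z _ _ (cder_Cexp _)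
      (cder_mult _ _ _ _ _ (cder_id z) (cder_const (ln (INR n)) z))))
    (cder_inv (fun w => gprod w n) _ _ (gprod_neq0 z n H) (gprod_cder z n H))).
  apply cder_val. rewrite Gamma_approx_eq. unfold psi_approx. field. now apply gprod_neq0.
Qed.

Definition gratio (z : C) (n : nat) : C :=
  (INR (S n) * Cexp (z * (ln (INR (S n)) - ln (INR n))%R) * / (z + INR (S n)))%C.

Lemma Gamma_approx_S z n : Im z <> 0 -> Gamma_approx z (S n) = (Gamma_approx z n * gratio z n)%C.
Proof.
  intros H. rewrite !Gamma_approx_eq. unfold gratio. rewrite gprod_S.
  replace (z * ln (INR (S n)))%C with (z * ln (INR n) + z * (ln (INR (S n)) - ln (INR n))%R)%C
    by (rewrite RtoC_minus; ring).
  rewrite Cexp_plus. rewrite fact_simpl, mult_INR, RtoC_mult.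
  assert (N1 := gprod_neq0 z n H).
  assert (N2 : (z + INR (S n))%C <> RtoC 0) by (apply im_neq0; now rewrite im_shift).
  field. auto.
Qed.

Lemma ln_step (n : nat) : (1 <= n)%nat ->
  / INR (S n) <= ln (INR (S n)) - ln (INR n) <= / INR n /\ / INR n - / INR (S n) <= / INR n ^ 2.
Proof.
  intros Hn. assert (1 <= INR n) by (apply (le_INR 1); lia). rewrite S_INR.
  set (x := INR n) in *.
  assert (B : forall t, 0 < t -> ln t <= t - 1).
  { intros t Ht. generalize (exp_ineq1_le (ln t)). rewrite exp_ln by auto. lra. }
  assert (E1 : ln (x + 1) - ln x = ln ((x + 1) / x)) by (rewrite ln_div; lra).
  assert (E2 : ln x - ln (x + 1) = ln (x / (x + 1))) by (rewrite ln_div; lra).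
  assert (B1 := B ((x + 1) / x) ltac:(apply Rdiv_lt_0_compat; lra)).
  assert (B2 := B (x / (x + 1)) ltac:(apply Rdiv_lt_0_compat; lra)).
  replace ((x + 1) / x - 1) with (/ x) in B1 by (field; lra).
  replace (x / (x + 1) - 1) with (- / (x + 1)) in B2 by (field; lra).
  split. lra. replace (/ x - / (x + 1)) with (/ (x * (x + 1))) by (field; lra).
  apply Rinv_le_contravar; nra.
Qed.

Lemma exp_half_le : exp (1 / 2) <= 2.
Proof.
  apply Rsqr_incr_0_var; [|lra]. unfold Rsqr. rewrite <- exp_plus.
  replace (1 / 2 + 1 / 2) with 1 by field. generalize exp_le_3. lra.
Qed.

Section GammaLimit.

Variables (Z : R) (n : nat) (z : C).
Hypotheses (HZ : 1 <= Z) (Hz : Cmod z <= Z) (Hn : 2 * Z <= INR n).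

Lemma gamma_index_ge1 : (1 <= n)%nat.
Proof. apply INR_le. simpl. lra. Qed.

Lemma gamma_shift_inv : / Cmod (z + INR (S n)) <= 2 * / INR (S n) /\ (z + INR (S n))%C <> RtoC 0.
Proof.
  assert (T := Cmod_triangle_inv (INR (S n)) (- z)). rewrite Cmod_opp, Cmod_R in T.
  replace (INR (S n) - - z)%C with (z + INR (S n))%C in T by ring.
  rewrite S_INR in *. rewrite Rabs_right in T by lra.
  assert (L : (INR n + 1) / 2 <= Cmod (z + (INR n + 1)%R)) by lra.
  split. 2: apply Cmod_neq0; lra.
  replace (2 * / (INR n + 1)) with (/ ((INR n + 1) / 2)) by (field; lra).
  apply Rinv_le_contravar; lra.
Qed.

(** The first-order terms cancel. With [l = ln (n + 1) - ln n], what remains is the second-order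
    error of [Cexp (z l)] and [z (l - 1/(n + 1))], both [O(1/n^2)]. *)
Lemma gratio_sub1 : Cmod (gratio z n - 1) <= 6 * Z ^ 2 * / INR n ^ 2.
Proof.
  destruct (ln_step n gamma_index_ge1) as [[L1 L2] L3]. destruct gamma_shift_inv as [D1 D2].
  unfold gratio. set (l := ln (INR (S n)) - ln (INR n)) in *.
  replace (INR (S n) * Cexp (z * l) * / (z + INR (S n)) - 1)%C with
    (((Cexp (z * l) - 1 - z * l) + z * (l - / INR (S n))) * (INR (S n) * / (z + INR (S n))))%C.
  2:{ field. split; auto. apply RtoC_neq0, not_0_INR. lia. }
  assert (N0 : 0 < / INR (S n)). { apply Rinv_0_lt_compat. apply (lt_INR 0). lia. }
  assert (N1 : 0 < INR n) by lra.
  assert (Hl : Cmod (z * l) <= Z * / INR n).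
  { rewrite Cmod_mult, Cmod_R, Rabs_right by lra. apply Rmult_le_compat; auto. apply Cmod_ge_0. lra. }
  assert (Hl2 : Z * / INR n <= 1 / 2).
  { apply Rmult_le_reg_r with (INR n); auto. rewrite Rmult_assoc, Rinv_l; lra. }
  assert (P1 : Cmod (Cexp (z * l) - 1 - z * l) <= 2 * Z ^ 2 * / INR n ^ 2).
  { eapply Rle_trans. apply Cexp_sub1_lin.
    assert (E : exp (Cmod (z * l)) <= 2).
    { eapply Rle_trans. 2: apply exp_half_le. destruct (Rle_lt_or_eq_dec _ _ (Rle_trans _ _ _ Hl Hl2)) as [Q|Q].
      left; now apply exp_increasing. rewrite Q; lra. }
    replace (2 * Z ^ 2 * / INR n ^ 2) with ((Z * / INR n) ^ 2 * 2) by (field; lra).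
    apply Rmult_le_compat; auto. apply pow2_ge_0. left; apply exp_pos.
    apply pow_incr. split; auto. apply Cmod_ge_0. }
  assert (P2 : Cmod (z * (l - / INR (S n))) <= Z * / INR n ^ 2).
  { rewrite <- RtoC_inv by (apply not_0_INR; lia). rewrite <- RtoC_minus, Cmod_mult, Cmod_R.
    rewrite Rabs_right by lra. apply Rmult_le_compat; auto. apply Cmod_ge_0. lra. lra. }
  assert (P3 : Cmod (INR (S n) * / (z + INR (S n))) <= 2).
  { rewrite Cmod_mult, Cmod_R, Cmod_inv by auto. rewrite Rabs_right by (apply Rle_ge, pos_INR).
    apply Rle_trans with (INR (S n) * (2 * / INR (S n))). apply Rmult_le_compat_l; auto. apply pos_INR.
    right. field. apply not_0_INR. lia. }
  rewrite Cmod_mult. assert (0 < / INR n ^ 2) by (apply Rinv_0_lt_compat, pow_lt; lra).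
  apply Rle_trans with ((2 * Z ^ 2 * / INR n ^ 2 + Z * / INR n ^ 2) * 2).
  - apply Rmult_le_compat; auto; try apply Cmod_ge_0. eapply Rle_trans. apply Cmod_triangle. lra.
  - assert (Z <= Z ^ 2) by nra. nra.
Qed.

Lemma psi_step : Cmod (psi_approx z (S n) - psi_approx z n) <= 3 * Z * / INR n ^ 2.
Proof.
  destruct (ln_step n gamma_index_ge1) as [[L1 L2] L3]. destruct gamma_shift_inv as [D1 D2].
  unfold psi_approx. cbn [hsum].
  assert (N2 : INR (S n) <> 0) by (apply not_0_INR; lia).
  replace (ln (INR (S n)) - (hsum z n + / (z + INR (S n))) - (ln (INR n) - hsum z n))%C with
    (((ln (INR (S n)) - ln (INR n)) - / INR (S n))%R + z * (/ (z + INR (S n)) * (/ INR (S n))%R))%C.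
  2:{ rewrite !RtoC_minus, RtoC_inv by auto. field. split; auto. now apply RtoC_neq0. }
  assert (N0 : 0 < / INR (S n)). { apply Rinv_0_lt_compat. apply (lt_INR 0). lia. }
  assert (N1 : 0 < INR n) by lra.
  eapply Rle_trans. apply Cmod_triangle. rewrite !Cmod_mult, !Cmod_R, Cmod_inv by auto.
  rewrite (Rabs_right (/ INR (S n))), Rabs_right by lra.
  assert (0 < / INR n ^ 2) by (apply Rinv_0_lt_compat, pow_lt; lra).
  assert (Q : / Cmod (z + INR (S n)) * / INR (S n) <= 2 * / INR n ^ 2).
  { apply Rle_trans with (2 * / INR (S n) * / INR (S n)). apply Rmult_le_compat_r; lra.
    rewrite Rmult_assoc. apply Rmult_le_compat_l. lra. simpl pow. rewrite Rmult_1_r, Rinv_mult.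
    assert (/ INR (S n) <= / INR n). { apply Rinv_le_contravar; auto. apply le_INR; lia. }
    apply Rmult_le_compat; lra. }
  assert (Q2 : Cmod z * (/ Cmod (z + INR (S n)) * / INR (S n)) <= Z * (2 * / INR n ^ 2)).
  { apply Rmult_le_compat; auto. apply Cmod_ge_0. apply Rmult_le_pos. left; apply Rinv_0_lt_compat.
    now apply Cmod_gt_0. lra. }
  nra.
Qed.

End GammaLimit.

(** One step changes the modulus by a factor within [6 Z^2 / n^2] of 1. The lower weight
    [1/2 + 12 Z^2 / n] decreases, and the upper weight [2 - 24 Z^2 / n] increases, by at least what
    such a step can cost, so the induction closes. The bounds are uniform in [n] and in [|z| <= Z],
    as needed for Cauchy's estimates. *)
Lemma Gamma_growth (Z : R) (n0 : nat) (z : C) : 1 <= Z -> Cmod z <= Z -> 24 * Z ^ 2 <= INR n0 -> Im z <> 0 ->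
  forall n, (n0 <= n)%nat ->
  (1 / 2 + 12 * Z ^ 2 * / INR n) * Cmod (Gamma_approx z n0) <= Cmod (Gamma_approx z n)
    <= (2 - 24 * Z ^ 2 * / INR n) * Cmod (Gamma_approx z n0).
Proof.
  intros HZ Hz Hn0 Hi n Hn.
  assert (Z2 : Z <= Z ^ 2) by nra.
  assert (IP : forall k, (n0 <= k)%nat -> 24 * Z ^ 2 <= INR k).
  { intros k Hk. apply Rle_trans with (INR n0); auto. now apply le_INR. }
  assert (G := Cmod_ge_0 (Gamma_approx z n0)). set (g := Cmod (Gamma_approx z n0)) in *.
  assert (I1 : forall k, (n0 <= k)%nat -> 0 <= 24 * Z ^ 2 * / INR k <= 1).
  { intros k Hk. specialize (IP k Hk). split.
    apply Rmult_le_pos. nra. left; apply Rinv_0_lt_compat; nra.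
    apply Rmult_le_reg_r with (INR k). nra. rewrite Rmult_assoc, Rinv_l by nra. lra. }
  induction n as [|n IHn] using nat_ind; [|destruct (Nat.eq_dec (S n) n0) as [E|E]].
  - replace n0 with O in * by lia. simpl in Hn0. nra.
  - rewrite E in *. fold g. specialize (I1 n0 (Nat.le_refl _)). nra.
  - specialize (IHn ltac:(lia)). specialize (IP n ltac:(lia)).
    assert (J := I1 n ltac:(lia)). assert (J2 := I1 (S n) ltac:(lia)).
    rewrite Gamma_approx_S by auto. rewrite Cmod_mult.
    assert (R1 := gratio_sub1 Z n z HZ Hz ltac:(nra)).
    set (G' := Cmod (Gamma_approx z n)) in *.
    assert (Rl : 1 - 6 * Z ^ 2 * / INR n ^ 2 <= Cmod (gratio z n) <= 1 + 6 * Z ^ 2 * / INR n ^ 2).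
    { assert (T := Cmod_triangle_inv 1 (gratio z n)). rewrite Cmod_minus_sym, Cmod_1 in T.
      assert (T2 := Cmod_triangle (gratio z n - 1) 1). rewrite Cmod_1 in T2.
      replace (gratio z n - 1 + 1)%C with (gratio z n) in T2 by ring. lra. }
    set (a := 6 * Z ^ 2) in *. set (N := INR n) in *.
    assert (a0 : 0 < a) by (unfold a; nra).
    assert (Np : 0 < N) by nra. assert (N1 : 1 <= N) by nra.
    assert (E1 : / INR (S n) = / N - / (N * (N + 1))).
    { rewrite S_INR. fold N. field. lra. }
    assert (E2 : / N ^ 2 <= 2 * / (N * (N + 1))).
    { replace (2 * / (N * (N + 1))) with (/ (N * (N + 1) / 2)) by (field; lra).
      apply Rinv_le_contravar; nra. }
    assert (E3 : 0 < / N ^ 2) by (apply Rinv_0_lt_compat, pow_lt; lra).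
    rewrite E1. set (v := / (N * (N + 1))) in *. set (u := / N) in *. set (q := / N ^ 2) in *.
    replace (12 * Z ^ 2) with (2 * a) in * by (unfold a; ring).
    replace (24 * Z ^ 2) with (4 * a) in * by (unfold a; ring).
    assert (aq : a * q <= 1).
    { assert (q <= u). { unfold q, u. apply Rinv_le_contravar; nra. } nra. }
    assert (av : a * q <= 2 * (a * v)) by nra.
    split.
    + apply Rle_trans with ((1 / 2 + 2 * a * u) * g * (1 - a * q)).
      * assert (0 <= a * u <= 1 / 4) by nra. assert (0 <= a * q) by nra.
        assert ((1 / 2 + 2 * a * u) * (1 - a * q) >= 1 / 2 + 2 * a * (u - v)) by nra. nra.
      * apply Rmult_le_compat; nra.
    + apply Rle_trans with ((2 - 4 * a * u) * g * (1 + a * q)).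
      * apply Rmult_le_compat; try (unfold G'; apply Cmod_ge_0); nra.
      * assert ((2 - 4 * a * u) * (1 + a * q) <= 2 - 4 * a * (u - v)) by nra. nra.
Qed.

Lemma big_nat (x : R) : exists n : nat, (2 <= n)%nat /\ x <= INR n.
Proof.
  destruct (nfloor_ex (Rmax 0 x)) as [n [_ Hn]]. apply Rmax_l.
  exists (S (S n)). split. lia. rewrite !S_INR. generalize (Rmax_r 0 x). lra.
Qed.

Lemma Gamma_approx_neq0 z n : Im z <> 0 -> Gamma_approx z n <> RtoC 0.
Proof.
  intros H. rewrite Gamma_approx_eq. repeat apply Cmult_neq_0.
  - apply RtoC_neq0, not_0_INR, fact_neq_0.
  - apply Cexp_neq0.
  - intros E. apply (gprod_neq0 z n H). rewrite <- (Cmult_1_r (gprod z n)).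
    rewrite <- (Cinv_l (gprod z n)) by now apply gprod_neq0. rewrite E. ring.
Qed.

Lemma CGamma_lim z l : clim (Gamma_approx z) l -> CGamma z = l.
Proof.
  intros H. unfold CGamma.
  rewrite (is_lim_seq_unique _ _ (clim_re _ _ H)), (is_lim_seq_unique _ _ (clim_im _ _ H)).
  simpl. now destruct l.
Qed.

(** The increments [Gamma_approx z n * (gratio z n - 1)] are summable by the two preceding bounds;
    the lower bound of [Gamma_growth] survives in the limit and keeps it away from 0. *)
Lemma Gamma_converges z : Im z <> 0 -> clim (Gamma_approx z) (CGamma z) /\ CGamma z <> RtoC 0.
Proof.
  intros H. set (Z := Cmod z + 1). assert (HZ : 1 <= Z) by (generalize (Cmod_ge_0 z); unfold Z; lra).
  assert (Hz : Cmod z <= Z) by (unfold Z; lra).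
  destruct (big_nat (24 * Z ^ 2)) as [n0 [N2 Hn0]].
  assert (GG := Gamma_growth Z n0 z HZ Hz Hn0 H).
  assert (Z2 : Z <= Z ^ 2) by nra.
  assert (g0 : 0 < Cmod (Gamma_approx z n0)) by (apply Cmod_gt_0; now apply Gamma_approx_neq0).
  set (g := Cmod (Gamma_approx z n0)) in *.
  assert (I : forall n, (n0 <= n)%nat -> 0 < INR n /\ 2 * Z <= INR n).
  { intros n Hn. assert (INR n0 <= INR n) by now apply le_INR. nra. }
  assert (E : exists l, clim (Gamma_approx z) l).
  { apply clim_summable with (2 * g * (6 * Z ^ 2)) n0; auto. { apply Rmult_le_pos; nra. }
    intros n Hn. rewrite Gamma_approx_S by auto. destruct (I n Hn) as [I1 I2].
    replace (Gamma_approx z n * gratio z n - Gamma_approx z n)%C with (Gamma_approx z n * (gratio z n - 1))%C by ring.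
    rewrite Cmod_mult, Rmult_assoc. apply Rmult_le_compat; try apply Cmod_ge_0.
    - eapply Rle_trans. apply (GG n Hn). assert (0 < / INR n) by now apply Rinv_0_lt_compat.
      assert (0 < Z ^ 2 * / INR n) by (apply Rmult_lt_0_compat; nra). nra.
    - apply gratio_sub1; auto. }
  destruct E as [l Hl]. rewrite (CGamma_lim z l Hl). split; auto.
  apply Cmod_neq0. apply Rlt_le_trans with (g / 2). lra.
  apply (clim_lower _ _ _ n0 Hl). intros n Hn. destruct (I n Hn) as [I1 I2].
  eapply Rle_trans. 2: apply (GG n Hn).
  assert (0 < / INR n) by now apply Rinv_0_lt_compat.
  assert (0 < Z ^ 2 * / INR n) by (apply Rmult_lt_0_compat; nra). nra.
Qed.

Lemma psi_converges z : exists p, clim (psi_approx z) p.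
Proof.
  set (Z := Cmod z + 1). assert (HZ : 1 <= Z) by (generalize (Cmod_ge_0 z); unfold Z; lra).
  assert (Hz : Cmod z <= Z) by (unfold Z; lra).
  destruct (big_nat (2 * Z)) as [n0 [N2 Hn0]].
  apply clim_summable with (3 * Z) n0; auto. lra.
  intros n Hn. apply psi_step; auto. apply Rle_trans with (INR n0); auto. now apply le_INR.
Qed.

(** Cauchy's estimates give the approximations a Taylor remainder [B |h|^2] with [B] independent of
    [n], so that the first-order expansion passes to the limit. *)
Lemma CGamma_cder z p : Im z <> 0 -> clim (psi_approx z) p -> cder CGamma z (CGamma z * p)%C.
Proof.
  intros H Hp. set (Z := Cmod z + 2). assert (HZ : 1 <= Z) by (generalize (Cmod_ge_0 z); unfold Z; lra).
  destruct (big_nat (24 * Z ^ 2)) as [n0 [N2 Hn0]].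
  destruct (cder_continuous _ _ _ (Gamma_approx_cder z n0 H) 1 Rlt_0_1) as [d [d0 Hd]].
  assert (Hy : 0 < Rabs (Im z)) by now apply Rabs_pos_lt.
  set (r := Rmin (Rmin 1 (d / 3)) (Rabs (Im z) / 2)).
  assert (r0 : 0 < r) by (unfold r; repeat apply Rmin_pos; lra).
  assert (r1 : r <= 1) by (unfold r; eapply Rle_trans; [apply Rmin_l|apply Rmin_l]).
  assert (r2 : r <= d / 3) by (unfold r; eapply Rle_trans; [apply Rmin_l|apply Rmin_r]).
  assert (r3 : r <= Rabs (Im z) / 2) by (unfold r; apply Rmin_r).
  assert (Q : forall w, insq z r w -> Im w <> 0 /\ Cmod w <= Z /\ Cmod (w - z) < d).
  { intros w Hw. assert (A := Cmod_insq _ _ _ Hw). destruct Hw as [_ B]. repeat split.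
    - intros E. rewrite E in B. rewrite Rminus_0_l, Rabs_Ropp in B. lra.
    - replace w with (z + (w - z))%C by ring. eapply Rle_trans. apply Cmod_triangle. unfold Z; lra.
    - lra. }
  set (M := 2 * (Cmod (Gamma_approx z n0) + 1)).
  assert (M0 : 0 < M) by (unfold M; generalize (Cmod_ge_0 (Gamma_approx z n0)); lra).
  assert (T : forall h n, (n0 <= n)%nat -> Cmod h <= r / 4 ->
    Cmod (Gamma_approx (z + h) n - Gamma_approx z n - Gamma_approx z n * psi_approx z n * h) <= 512 * M / r ^ 2 * Cmod h ^ 2).
  { intros h n Hn Hh. rewrite <- (cder_C_derive _ _ _ (Gamma_approx_cder z n H)).
    apply (cauchy_taylor (fun w => Gamma_approx w n) z r M); auto.
    - intros w Hw. eexists. apply Gamma_approx_cder. now apply Q.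
    - intros w Hw. destruct (Q w Hw) as [Q1 [Q2 Q3]].
      eapply Rle_trans. apply (Gamma_growth Z n0 w HZ Q2 Hn0 Q1 n Hn).
      specialize (Hd w Q3).
      assert (Cmod (Gamma_approx w n0) <= Cmod (Gamma_approx z n0) + 1).
      { replace (Gamma_approx w n0) with (Gamma_approx z n0 + (Gamma_approx w n0 - Gamma_approx z n0))%C by ring.
        eapply Rle_trans. apply Cmod_triangle. lra. }
      assert (0 <= 24 * Z ^ 2 * / INR n <= 1).
      { assert (INR n0 <= INR n) by now apply le_INR. split.
        apply Rmult_le_pos. nra. left; apply Rinv_0_lt_compat; nra.
        apply Rmult_le_reg_r with (INR n). nra. rewrite Rmult_assoc, Rinv_l by nra. lra. }
      assert (P := Cmod_ge_0 (Gamma_approx w n0)). unfold M. nra. }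
  set (B := 512 * M / r ^ 2) in *.
  assert (B0 : 0 < B) by (unfold B; apply Rdiv_lt_0_compat; [lra|now apply pow_lt]).
  assert (T2 : forall h, Cmod h <= r / 4 ->
    Cmod (CGamma (z + h) - CGamma z - CGamma z * p * h) <= B * Cmod h ^ 2).
  { intros h Hh. assert (Hw : insq z r (z + h)).
    { apply insq_Cmod. replace (z + h - z)%C with h by ring. lra. }
    destruct (Gamma_converges z H) as [C1 _]. destruct (Gamma_converges (z + h) (proj1 (Q _ Hw))) as [C2 _].
    assert (L : clim (fun n => Gamma_approx (z + h) n + ((-1) * Gamma_approx z n + (- h) * (Gamma_approx z n * psi_approx z n)))%C
      (CGamma (z + h) + ((-1) * CGamma z + (- h) * (CGamma z * p)))%C).
    { apply clim_plus; auto. apply clim_plus; apply clim_mult; auto using clim_const. now apply clim_mult. }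
    replace (CGamma (z + h) - CGamma z - CGamma z * p * h)%C with
     ((CGamma (z + h) + ((-1) * CGamma z + (- h) * (CGamma z * p))) - 0)%C by ring.
    apply (clim_bound _ _ _ _ n0 L). intros n Hn.
    replace (Gamma_approx (z + h) n + ((-1) * Gamma_approx z n + (- h) * (Gamma_approx z n * psi_approx z n)) - 0)%C
      with (Gamma_approx (z + h) n - Gamma_approx z n - Gamma_approx z n * psi_approx z n * h)%C by ring.
    now apply T. }
  intros eps Heps. exists (Rmin (r / 4) (eps / B)). split. apply Rmin_pos. lra. now apply Rdiv_lt_0_compat.
  intros w Hw. assert (H1 := Rlt_le_trans _ _ _ Hw (Rmin_l _ _)).
  assert (H2 := Rlt_le_trans _ _ _ Hw (Rmin_r _ _)).
  specialize (T2 (w - z)%C ltac:(lra)). replace (z + (w - z))%C with w in T2 by ring.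
  eapply Rle_trans. apply T2. assert (P := Cmod_ge_0 (w - z)). set (x := Cmod (w - z)) in *.
  replace (B * x ^ 2) with (B * x * x) by ring. apply Rmult_le_compat_r; auto.
  apply Rle_trans with (B * (eps / B)). apply Rmult_le_compat_l; lra. right; field; lra.
Qed.

Lemma Cconj_RtoC (x : R) : Cconj x = RtoC x.
Proof. unfold Cconj, RtoC; simpl. f_equal. ring. Qed.

Lemma gprod_conj z n : gprod (Cconj z) n = Cconj (gprod z n).
Proof.
  induction n. now rewrite !gprod_0. rewrite !gprod_S, IHn, Cmult_conj, Cplus_conj, Cconj_RtoC. reflexivity.
Qed.

Lemma Cinv_conj_gen (a : C) : Cconj (/ a) = (/ Cconj a)%C.
Proof.
  destruct (Ceq_dec a 0) as [->|H]. 2: now apply Cinv_conj.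
  unfold Cinv, Cconj, RtoC; simpl. f_equal; f_equal; unfold Rdiv; ring.
Qed.

Lemma Gamma_approx_conj z n : Gamma_approx (Cconj z) n = Cconj (Gamma_approx z n).
Proof.
  rewrite !Gamma_approx_eq, gprod_conj, !Cmult_conj, Cinv_conj_gen, Cconj_RtoC, <- Cexp_conj, Cmult_conj, Cconj_RtoC.
  reflexivity.
Qed.

Lemma CGamma_conj z : CGamma (Cconj z) = Cconj (CGamma z).
Proof.
  unfold CGamma.
  rewrite (Lim_seq_ext (fun n => Re (Gamma_approx (Cconj z) n)) (fun n => Re (Gamma_approx z n))).
  2:{ intros n. now rewrite Gamma_approx_conj. }
  rewrite (Lim_seq_ext (fun n => Im (Gamma_approx (Cconj z) n)) (fun n => - Im (Gamma_approx z n))).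
  2:{ intros n. now rewrite Gamma_approx_conj, im_conj. }
  rewrite Lim_seq_opp. unfold Cconj; simpl. f_equal.
  (* [real] sends both infinities to 0, so the sign passes through even where there is no finite
     limit. *)
  destruct (Lim_seq _); simpl; ring.
Qed.

(** * Asymptotics of the logarithmic derivative of Gamma *)

Lemma ln_le_sub1 (t : R) : 0 < t -> ln t <= t - 1.
Proof. intros Ht. generalize (exp_ineq1_le (ln t)). rewrite exp_ln by auto. lra. Qed.

Lemma atan_pos_le (x : R) : 0 <= x -> 0 <= atan x <= x.
Proof.
  intros Hx. destruct (MVT_gen atan 0 x (fun t => / (1 + t ^ 2))) as [c [Hc E]].
  - intros t _. auto_derive; auto. unfold Rsqr; field; nra.
  - intros t _. apply continuity_pt_filterlim. apply (ex_derive_continuous atan). auto_derive. auto.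
  - rewrite atan_0, !Rminus_0_r in E. rewrite E.
    assert (0 < / (1 + c ^ 2) <= 1).
    { split. apply Rinv_0_lt_compat; nra. rewrite <- Rinv_1. apply Rinv_le_contravar; nra. }
    nra.
Qed.

Lemma Rabs_atan_le (x : R) : Rabs (atan x) <= Rabs x.
Proof.
  destruct (Rle_lt_dec 0 x) as [H|H].
  - destruct (atan_pos_le x H). rewrite !Rabs_right; lra.
  - destruct (atan_pos_le (- x) ltac:(lra)) as [A B]. rewrite atan_opp in A, B.
    rewrite !Rabs_left1; lra.
Qed.

Section PsiStep.

Variables (y u : R).
Hypothesis Hy : 1 <= y.

Lemma sq_compare (c : R) : u <= c <= u + 1 -> c ^ 2 + y ^ 2 <= 3 * (u ^ 2 + y ^ 2) /\ u ^ 2 + y ^ 2 <= 3 * (c ^ 2 + y ^ 2).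
Proof.
  intros Hc. assert (H2 := pow2_ge_0 (c - 2 * u)). assert (H3 := pow2_ge_0 (u - 2 * c)).
  split; nra.
Qed.

(** The sum of [1 / (z + k)] is compared with an integral: [1/2 ln (u^2 + y^2)] and [- atan (u / y)]
    are primitives in [u] of the real and imaginary parts of [1 / (u + i y)]. By the mean value
    theorem one unit step costs [2 / (u^2 + y^2)]. *)
Lemma psi_step_log :
  Rabs (/ 2 * ln ((u + 1) ^ 2 + y ^ 2) - / 2 * ln (u ^ 2 + y ^ 2) - u / (u ^ 2 + y ^ 2)) <= 2 / (u ^ 2 + y ^ 2).
Proof.
  destruct (MVT_gen (fun t => / 2 * ln (t ^ 2 + y ^ 2)) u (u + 1) (fun t => t / (t ^ 2 + y ^ 2))) as [c [Hc E]].
  - intros t _. auto_derive. nra. field. nra.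
  - intros t _. apply continuity_pt_filterlim.
    apply (ex_derive_continuous (fun t => / 2 * ln (t ^ 2 + y ^ 2))). auto_derive. nra.
  - rewrite Rmin_left, Rmax_right in Hc by lra. rewrite E.
    destruct (sq_compare c Hc) as [S1 S2].
    set (U := u ^ 2 + y ^ 2) in *. set (W := c ^ 2 + y ^ 2) in *.
    assert (U0 : 0 < U) by (unfold U; nra). assert (W0 : 0 < W) by (unfold W; nra).
    replace (c / W * (u + 1 - u) - u / U) with ((c - u) * (y ^ 2 - c * u) / (U * W)).
    2:{ unfold U, W. field. unfold U, W in *; lra. }
    apply Rabs_le_between. unfold Rdiv.
    assert (I : 0 < / (U * W)) by (apply Rinv_0_lt_compat; nra).
    assert (V : -2 * W <= (c - u) * (y ^ 2 - c * u) <= 2 * W).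
    { assert (Q : - (2 * W) <= y ^ 2 - c * u <= 2 * W) by (unfold U, W in *; split; nra). nra. }
    replace (2 * / U) with (2 * W * / (U * W)) by (field; lra). split; nra.
Qed.

(** The second inequality makes the errors summable: each is [1 / y] times an increment of the
    bounded function [atan (u / y)], so the total is [O(1 / y)]. *)
Lemma psi_step_atan :
  Rabs (atan ((u + 1) / y) - atan (u / y) - y / (u ^ 2 + y ^ 2)) <= 2 / (u ^ 2 + y ^ 2) /\
  1 / (u ^ 2 + y ^ 2) <= 3 / y * (atan ((u + 1) / y) - atan (u / y)).
Proof.
  destruct (MVT_gen (fun t => atan (t / y)) u (u + 1) (fun t => y / (t ^ 2 + y ^ 2))) as [c [Hc E]].
  - intros t _. auto_derive. auto. unfold Rsqr. field. split; nra.
  - intros t _. apply continuity_pt_filterlim.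
    apply (ex_derive_continuous (fun t => atan (t / y))). auto_derive. auto.
  - rewrite Rmin_left, Rmax_right in Hc by lra. rewrite E.
    destruct (sq_compare c Hc) as [S1 S2].
    set (U := u ^ 2 + y ^ 2) in *. set (W := c ^ 2 + y ^ 2) in *.
    assert (U0 : 0 < U) by (unfold U; nra). assert (W0 : 0 < W) by (unfold W; nra).
    assert (I : 0 < / (U * W)) by (apply Rinv_0_lt_compat; nra).
    split.
    + replace (y / W * (u + 1 - u) - y / U) with ((c - u) * (- y * (c + u)) / (U * W)).
      2:{ unfold U, W. field. unfold U, W in *; lra. }
      apply Rabs_le_between. unfold Rdiv.
      assert (V : -2 * W <= (c - u) * (- y * (c + u)) <= 2 * W).
      { assert (Q : - (2 * W) <= - y * (c + u) <= 2 * W).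
        { assert (P1 := pow2_ge_0 (y - c)). assert (P2 := pow2_ge_0 (y + c)).
          assert (P3 := pow2_ge_0 (y - u)). assert (P4 := pow2_ge_0 (y + u)). unfold U, W in *; split; nra. }
        nra. }
      replace (2 * / U) with (2 * W * / (U * W)) by (field; lra). split; nra.
    + replace (3 / y * (y / W * (u + 1 - u))) with (3 * U * / (U * W)) by (field; lra).
      replace (1 / U) with (W * / (U * W)) by (field; lra). apply Rmult_le_compat_r; lra.
Qed.

End PsiStep.

Section PsiBound.

Variable z : C.
Let x := Re z. Let y := Im z.
Hypothesis Hy : 1 <= y.

Let gr (k : nat) : R := / 2 * ln ((x + INR k) ^ 2 + y ^ 2).
Let at' (k : nat) : R := atan ((x + INR k) / y).

Lemma re_inv_shift k : Re (/ (z + INR k)) = (x + INR k) / ((x + INR k) ^ 2 + y ^ 2) /\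
  Im (/ (z + INR k)) = - (y / ((x + INR k) ^ 2 + y ^ 2)).
Proof.
  unfold x, y. destruct z as [a b]. unfold y in Hy. simpl in Hy.
  unfold Cinv, Cplus, RtoC, Re, Im; cbn [fst snd]. rewrite Rplus_0_r. unfold Rdiv. split; ring.
Qed.

Lemma hsum_step k : Rabs (Re (/ (z + INR k)) - (gr (S k) - gr k)) <= 6 / y * (at' (S k) - at' k) /\
  Rabs (Im (/ (z + INR k)) + (at' (S k) - at' k)) <= 6 / y * (at' (S k) - at' k).
Proof.
  destruct (re_inv_shift k) as [-> ->]. unfold gr, at'. rewrite S_INR, <- Rplus_assoc.
  set (u := x + INR k). assert (A := psi_step_log y u Hy). destruct (psi_step_atan y u Hy) as [B D].
  replace (6 / y * (atan ((u + 1) / y) - atan (u / y))) with (2 * (3 / y * (atan ((u + 1) / y) - atan (u / y)))) by (field; lra).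
  replace (2 / (u ^ 2 + y ^ 2)) with (2 * (1 / (u ^ 2 + y ^ 2))) in A, B by (field; nra).
  split.
  - rewrite <- Rabs_Ropp.
    replace (- (u / (u ^ 2 + y ^ 2) - (/ 2 * ln ((u + 1) ^ 2 + y ^ 2) - / 2 * ln (u ^ 2 + y ^ 2))))
     with (/ 2 * ln ((u + 1) ^ 2 + y ^ 2) - / 2 * ln (u ^ 2 + y ^ 2) - u / (u ^ 2 + y ^ 2)) by ring. lra.
  - replace (- (y / (u ^ 2 + y ^ 2)) + (atan ((u + 1) / y) - atan (u / y)))
     with (atan ((u + 1) / y) - atan (u / y) - y / (u ^ 2 + y ^ 2)) by ring. lra.
Qed.

Lemma hsum_bound n : Rabs (Re (hsum z n) - (gr (S n) - gr 0)) <= 6 / y * (at' (S n) - at' 0) /\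
  Rabs (Im (hsum z n) + (at' (S n) - at' 0)) <= 6 / y * (at' (S n) - at' 0).
Proof.
  induction n.
  - destruct (hsum_step 0) as [A B]. cbn [hsum].
    change (INR 0) with 0 in A, B. rewrite Cplus_0_r in A, B. auto.
  - destruct (hsum_step (S n)) as [A B]. destruct IHn as [I1 I2]. cbn [hsum]. rewrite re_plus, im_plus.
    rewrite Rmult_minus_distr_l in *. split.
    + replace (Re (hsum z n) + Re (/ (z + INR (S n))) - (gr (S (S n)) - gr 0))
       with ((Re (hsum z n) - (gr (S n) - gr 0)) + (Re (/ (z + INR (S n))) - (gr (S (S n)) - gr (S n)))) by ring.
      eapply Rle_trans. apply Rabs_triang. lra.
    + replace (Im (hsum z n) + Im (/ (z + INR (S n))) + (at' (S (S n)) - at' 0))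
       with ((Im (hsum z n) + (at' (S n) - at' 0)) + (Im (/ (z + INR (S n))) + (at' (S (S n)) - at' (S n)))) by ring.
      eapply Rle_trans. apply Rabs_triang. lra.
Qed.

Lemma gr0_bound : Rabs (gr 0 - ln y) <= Rabs x / y.
Proof.
  unfold gr. change (INR 0) with 0. rewrite Rplus_0_r.
  assert (E : / 2 * ln (x ^ 2 + y ^ 2) - ln y = / 2 * ln (1 + (Rabs x / y) ^ 2)).
  { replace (x ^ 2 + y ^ 2) with ((1 + (Rabs x / y) ^ 2) * (y * y)).
    2:{ unfold Rdiv. rewrite Rpow_mult_distr, pow2_abs. field. lra. }
    rewrite ln_mult, ln_mult; try nra. }
  rewrite E. set (q := Rabs x / y).
  assert (q0 : 0 <= q). { unfold q. apply Rmult_le_pos. apply Rabs_pos. left; apply Rinv_0_lt_compat; lra. }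
  assert (0 <= ln (1 + q ^ 2)).
  { rewrite <- ln_1. destruct (Req_dec q 0) as [->|N]. right; f_equal; ring. left. apply ln_increasing; nra. }
  rewrite Rabs_right by lra.
  assert (L : ln (1 + q ^ 2) <= ln (exp (2 * q))).
  { assert (1 + q ^ 2 <= exp (2 * q)).
    { replace (2 * q) with (q + q) by ring. rewrite exp_plus. generalize (exp_ineq1_le q). nra. }
    destruct (Rle_lt_or_eq_dec _ _ H0) as [K|K]. left; apply ln_increasing; auto; nra. rewrite K; lra. }
  rewrite ln_exp in L. lra.
Qed.

(** At the upper end of the comparison [ln n] cancels [gr (n + 1)] and the angle tends to [pi / 2];
    only the contributions of [k = 0] remain in the limit. *)
Lemma psi_tail e : 0 < e -> exists N, forall n, (N <= n)%nat ->
  Rabs (ln (INR n) - gr (S n)) <= e /\ Rabs (at' (S n) - PI / 2) <= e.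
Proof.
  intros He. set (A := 2 * Rabs (x + 1) + (x + 1) ^ 2 + y ^ 2).
  assert (HA : 0 < A).
  { unfold A. assert (P1 := Rabs_pos (x + 1)). assert (P2 := pow2_ge_0 (x + 1)).
    assert (0 < y ^ 2) by (apply pow_lt; lra). lra. }
  destruct (big_nat (2 * A + A / e + 2 * Rabs x + y / e)) as [N [N2 HN]].
  exists N. intros n Hn. assert (Hn' : INR N <= INR n) by now apply le_INR.
  assert (n2 : 2 <= INR n) by (apply (le_INR 2); lia).
  set (v := INR n) in *.
  assert (p1 : 0 < A / e) by (now apply Rdiv_lt_0_compat).
  assert (p2 : 0 < y / e) by (apply Rdiv_lt_0_compat; lra).
  assert (p3 := Rabs_pos x).
  assert (V1 : 2 * A <= v) by lra. assert (V2 : A / e <= v) by lra. assert (V3 : 2 * Rabs x + y / e <= v) by lra.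
  split.
  - unfold gr. rewrite S_INR. fold v. replace (x + (v + 1)) with (v + (x + 1)) by ring.
    set (q := ((v + (x + 1)) ^ 2 + y ^ 2) / (v * v)).
    assert (Eq : q - 1 = (2 * (x + 1) * v + (x + 1) ^ 2 + y ^ 2) / (v * v)) by (unfold q; field; lra).
    assert (Iv : 0 < / v) by (apply Rinv_0_lt_compat; lra).
    assert (B1 : Rabs (q - 1) <= A / v).
    { rewrite Eq. unfold Rdiv. rewrite Rinv_mult, Rabs_mult, (Rabs_right (/ v * / v)) by nra.
      rewrite <- Rmult_assoc. apply Rmult_le_compat_r. lra.
      apply Rmult_le_reg_r with v. lra. rewrite Rmult_assoc, Rinv_l, Rmult_1_r by lra.
      replace (2 * (x + 1) * v + (x + 1) ^ 2 + y ^ 2) with (2 * (x + 1) * v + ((x + 1) ^ 2 + y ^ 2)) by ring.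
      eapply Rle_trans. apply Rabs_triang. rewrite !Rabs_mult, (Rabs_right 2), (Rabs_right v) by lra.
      assert (S0 : 0 <= (x + 1) ^ 2 + y ^ 2) by (generalize (pow2_ge_0 (x + 1)) (pow2_ge_0 y); lra).
      rewrite (Rabs_right ((x + 1) ^ 2 + y ^ 2)) by lra. unfold A.
      set (S := (x + 1) ^ 2 + y ^ 2) in *. rewrite Rplus_assoc. fold S. nra. }
    assert (B2 : A / v <= 1 / 2).
    { apply Rmult_le_reg_r with v. lra. unfold Rdiv. rewrite Rmult_assoc, Rinv_l; lra. }
    assert (B3 : A / v <= e).
    { apply Rmult_le_reg_r with v. lra. unfold Rdiv at 1. rewrite Rmult_assoc, Rinv_l by lra.
      apply Rmult_le_compat_l with (r := e) in V2; [|lra]. replace (e * (A / e)) with A in V2 by (field; lra). lra. }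
    apply Rabs_le_between in B1.
    assert (q0 : 0 < q) by lra.
    assert (El : ln v - / 2 * ln ((v + (x + 1)) ^ 2 + y ^ 2) = - (/ 2 * ln q)).
    { replace ((v + (x + 1)) ^ 2 + y ^ 2) with (q * (v * v)) by (unfold q; field; lra).
      rewrite !ln_mult by nra. field. }
    rewrite El, Rabs_Ropp. assert (L1 := ln_le_sub1 q q0).
    assert (L2 := ln_le_sub1 (/ q) ltac:(now apply Rinv_0_lt_compat)). rewrite ln_Rinv in L2 by auto.
    assert (L3 : / q - 1 <= 2 * (A / v)).
    { assert (E3 : / q - 1 = (1 - q) * / q) by (field; lra). rewrite E3.
      assert (/ q <= 2). { replace 2 with (/ (1 / 2)) by field. apply Rinv_le_contravar; lra. }
      assert (0 < / q) by now apply Rinv_0_lt_compat. nra. }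
    apply Rabs_le. lra.
  - unfold at'. rewrite S_INR. fold v. assert (Hx := Rle_abs (- x)). rewrite Rabs_Ropp in Hx.
    set (w := (x + (v + 1)) / y). assert (w0 : 0 < w) by (unfold w; apply Rdiv_lt_0_compat; lra).
    assert (E := atan_inv w w0). destruct (atan_pos_le (/ w)) as [T1 T2]. left; now apply Rinv_0_lt_compat.
    replace (atan w - PI / 2) with (- atan (/ w)) by lra. rewrite Rabs_Ropp, Rabs_right by lra.
    eapply Rle_trans. apply T2. unfold w. replace (/ ((x + (v + 1)) / y)) with (y / (x + (v + 1))) by (field; lra).
    apply Rmult_le_reg_r with (x + (v + 1)). lra. unfold Rdiv. rewrite Rmult_assoc, Rinv_l by lra.
    assert (V4 : y / e <= x + (v + 1)) by lra.
    apply Rmult_le_compat_l with (r := e) in V4; [|lra]. replace (e * (y / e)) with y in V4 by (field; lra). lra.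
Qed.

(** The telescoped errors are [6 / y] times a variation of [atan], at most 4, in each of the two
    parts, whence 48; [ln |z| - ln y] and [atan (x / y)] contribute [|x| / y] each. *)
Lemma psi_bound_upper p : clim (psi_approx z) p -> Cmod (p - (ln y, PI / 2)) <= (48 + 2 * Rabs x) / y.
Proof.
  intros Hp. apply le_epsilon. intros e He.
  destruct (psi_tail (e / 2) ltac:(lra)) as [N HN].
  apply (clim_bound _ _ _ _ N Hp). intros n Hn. destruct (HN n Hn) as [T1 T2].
  destruct (hsum_bound n) as [B1 B2]. assert (G := gr0_bound).
  assert (At : 6 / y * (at' (S n) - at' 0) <= 24 / y).
  { replace (24 / y) with (6 / y * 4) by (field; lra). apply Rmult_le_compat_l.
    left; apply Rdiv_lt_0_compat; lra. unfold at'.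
    generalize (atan_bound ((x + INR (S n)) / y)) (atan_bound ((x + INR 0) / y)) PI_4. lra. }
  assert (A0 : Rabs (at' 0) <= Rabs x / y).
  { unfold at'. change (INR 0) with 0. rewrite Rplus_0_r. eapply Rle_trans. apply Rabs_atan_le.
    unfold Rdiv. rewrite Rabs_mult, (Rabs_right (/ y)). lra. apply Rle_ge. left; apply Rinv_0_lt_compat; lra. }
  replace ((48 + 2 * Rabs x) / y) with (24 / y + Rabs x / y + (24 / y + Rabs x / y)) by (field; lra).
  eapply Rle_trans. apply Cmod_le_sum. unfold psi_approx.
  change (Re (ln (INR n) - hsum z n - (ln y, PI / 2))) with (ln (INR n) - Re (hsum z n) - ln y).
  change (Im (ln (INR n) - hsum z n - (ln y, PI / 2))) with (0 - Im (hsum z n) - PI / 2).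
  assert (Q1 : Rabs (ln (INR n) - Re (hsum z n) - ln y) <= 24 / y + Rabs x / y + e / 2).
  { replace (ln (INR n) - Re (hsum z n) - ln y) with
     ((ln (INR n) - gr (S n)) + ((gr 0 - ln y) + - (Re (hsum z n) - (gr (S n) - gr 0)))) by ring.
    eapply Rle_trans. apply Rabs_triang. eapply Rle_trans. apply Rplus_le_compat_l, Rabs_triang.
    rewrite Rabs_Ropp. lra. }
  assert (Q2 : Rabs (0 - Im (hsum z n) - PI / 2) <= 24 / y + Rabs x / y + e / 2).
  { replace (0 - Im (hsum z n) - PI / 2) with
     ((at' (S n) - PI / 2) + (- at' 0 + - (Im (hsum z n) + (at' (S n) - at' 0)))) by ring.
    eapply Rle_trans. apply Rabs_triang. eapply Rle_trans. apply Rplus_le_compat_l, Rabs_triang.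
    rewrite !Rabs_Ropp. lra. }
  lra.
Qed.

End PsiBound.

Lemma hsum_conj z n : hsum (Cconj z) n = Cconj (hsum z n).
Proof.
  induction n; cbn [hsum]. now rewrite Cinv_conj_gen.
  rewrite IHn, Cplus_conj, Cinv_conj_gen, Cplus_conj, Cconj_RtoC. reflexivity.
Qed.

Lemma clim_conj u l : clim u l -> clim (fun n => Cconj (u n)) (Cconj l).
Proof.
  intros H e He. destruct (H e He) as [N HN]. exists N. intros n Hn.
  rewrite <- Cminus_conj, Cmod_conj. auto.
Qed.

(** The limiting argument of [z] far up or far down the plane, according to the sign of [Im z]. *)
Definition half_turn (v : R) : R := if Rlt_dec 0 v then PI / 2 else - (PI / 2).

(** The lower half plane is reduced to the upper one by conjugation. *)
Lemma Gamma_logder (z : C) : Im z <> 0 -> exists p, cder CGamma z (CGamma z * p)%C /\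
  (1 <= Rabs (Im z) -> Cmod (p - (ln (Rabs (Im z)), half_turn (Im z))) <= 48 * (Rabs (Re z) + 1) / Rabs (Im z)).
Proof.
  intros H. destruct (psi_converges z) as [p Hp]. exists p. split. now apply CGamma_cder.
  intros H1. assert (X := Rabs_pos (Re z)).
  apply Rle_trans with ((48 + 2 * Rabs (Re z)) / Rabs (Im z)).
  2:{ unfold Rdiv. apply Rmult_le_compat_r. left; apply Rinv_0_lt_compat; lra. lra. }
  unfold half_turn. destruct (Rlt_dec 0 (Im z)) as [L|L].
  - rewrite (Rabs_right (Im z)) in * by lra. now apply psi_bound_upper.
  - rewrite (Rabs_left1 (Im z)) in * by lra.
    assert (C1 : clim (psi_approx (Cconj z)) (Cconj p)).
    { intros e He. destruct (clim_conj _ _ Hp e He) as [N HN]. exists N. intros n Hn.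
      specialize (HN n Hn). unfold psi_approx in *. rewrite hsum_conj.
      rewrite Cminus_conj, Cconj_RtoC in HN. exact HN. }
    generalize (psi_bound_upper (Cconj z)). rewrite im_conj, re_conj. intros B.
    specialize (B H1 _ C1). rewrite <- Cmod_conj, Cminus_conj.
    unfold Cconj at 2. cbn [fst snd]. rewrite Ropp_involutive. exact B.
Qed.

(** * The factor chi *)

Definition cprod (g : nat -> C) (q : nat) : C := Iter.iter_nat Cmult 1 g 1 q.

Lemma cprod_S g q : cprod g (S q) = (cprod g q * g (S q))%C.
Proof.
  unfold cprod, Iter.iter_nat. rewrite !Nat.sub_succ, !Nat.sub_0_r.
  rewrite (iter_iota_snoc C Cmult). reflexivity. intros; ring. intros; ring. intros; ring.
Qed.

Lemma cprod_0 g : cprod g 0 = RtoC 1.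
Proof. reflexivity. Qed.

Lemma rprod_S g q : Iter.iter_nat Rmult 1 g 1 (S q) = Iter.iter_nat Rmult 1 g 1 q * g (S q).
Proof.
  unfold Iter.iter_nat. rewrite !Nat.sub_succ, !Nat.sub_0_r.
  rewrite (iter_iota_snoc R Rmult). reflexivity. intros; ring. intros; ring. intros; ring.
Qed.

Lemma cprod_ext g h q : (forall j, (1 <= j <= q)%nat -> g j = h j) -> cprod g q = cprod h q.
Proof.
  induction q; intros H; auto. rewrite !cprod_S, IHq, H; auto. lia. intros; apply H; lia.
Qed.

Lemma cprod_mult g h q : cprod (fun j => g j * h j)%C q = (cprod g q * cprod h q)%C.
Proof. induction q. rewrite !cprod_0; ring. rewrite !cprod_S, IHq. ring. Qed.

Lemma cprod_conj g q : Cconj (cprod g q) = cprod (fun j => Cconj (g j)) q.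
Proof.
  induction q. rewrite !cprod_0. apply Cconj_RtoC. rewrite !cprod_S, Cmult_conj, IHq. reflexivity.
Qed.

Lemma cprod_neq0 g q : (forall j, (1 <= j <= q)%nat -> g j <> RtoC 0) -> cprod g q <> RtoC 0.
Proof.
  induction q; intros H. rewrite cprod_0. apply RtoC_neq0; lra.
  rewrite cprod_S. apply Cmult_neq_0. apply IHq. intros; apply H; lia. apply H; lia.
Qed.

Lemma cprod_mod1 g q : (forall j, (1 <= j <= q)%nat -> Cmod (g j) = 1) -> Cmod (cprod g q) = 1.
Proof.
  induction q; intros H. rewrite cprod_0. apply Cmod_1.
  rewrite cprod_S, Cmod_mult, IHq, H. ring. lia. intros; apply H; lia.
Qed.

Global Opaque cprod.

Section GammaFactors.

Variables (la : nat -> R) (mu : nat -> C).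

Definition gnum (j : nat) (s : C) : C := CGamma (la j * (1 - s) + Cconj (mu j)).
Definition gden (j : nat) (s : C) : C := CGamma (la j * s + mu j).

Lemma gden_im j s : Im (la j * s + mu j) = la j * Im s + Im (mu j).
Proof. now rewrite im_plus, im_scal_l. Qed.

Lemma gnum_im j s : Im (la j * (1 - s) + Cconj (mu j)) = - (la j * Im s + Im (mu j)).
Proof. rewrite im_plus, im_scal_l, im_conj. unfold Cminus. rewrite im_plus, im_opp, im_RtoC. ring. Qed.

(** [gnum] and [gden] are taken at points with opposite imaginary parts [- Y] and [Y], so the half
    turns cancel in [l = - la (p1 + p2)] and [- 2 la ln |Y|] remains; replacing [|Y|] by [la |Im s|]
    costs [O(1 / |Im s|)]. *)
Lemma factor_logder j : 0 < la j -> exists T K, 1 <= T /\ 0 <= K /\ forall s, T <= Rabs (Im s) ->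
  la j * Im s + Im (mu j) <> 0 /\
  gnum j s <> RtoC 0 /\ gden j s <> RtoC 0 /\
  exists l, cder (fun w => gnum j w / gden j w)%C s (gnum j s / gden j s * l)%C /\
    Cmod (l + (2 * la j * (ln (la j) + ln (Rabs (Im s))))%R) <= K * (Rabs (Re s) + 1) / Rabs (Im s).
Proof.
  intros Hl. set (m1 := Re (mu j)). set (m2 := Im (mu j)).
  set (T := Rmax 1 (2 * (Rabs m2 + 1) / la j)). set (K := 192 * (la j + Rabs m1 + 1) + 4 * Rabs m2).
  assert (A1 := Rabs_pos m1). assert (A2 := Rabs_pos m2).
  exists T, K. split. apply Rmax_l. split. unfold K; lra.
  intros s Hs. assert (t1 : 1 <= Rabs (Im s)) by (eapply Rle_trans; [apply Rmax_l|exact Hs]).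
  assert (t2 : 2 * (Rabs m2 + 1) <= la j * Rabs (Im s)).
  { assert (Q : 2 * (Rabs m2 + 1) / la j <= Rabs (Im s)) by (eapply Rle_trans; [apply Rmax_r|exact Hs]).
    apply Rmult_le_compat_l with (r := la j) in Q; [|lra].
    replace (la j * (2 * (Rabs m2 + 1) / la j)) with (2 * (Rabs m2 + 1)) in Q by (field; lra). lra. }
  set (Y := la j * Im s + m2). set (L := la j * Rabs (Im s)) in *.
  assert (EL : L = Rabs (la j * Im s)) by (unfold L; rewrite Rabs_mult, (Rabs_right (la j)); lra).
  assert (Y1 : L - Rabs m2 <= Rabs Y <= L + Rabs m2).
  { unfold Y. rewrite EL. split. 2: apply Rabs_triang.
    assert (Q := Rabs_triang (la j * Im s + m2) (- m2)). rewrite Rabs_Ropp in Q.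
    replace (la j * Im s + m2 + - m2) with (la j * Im s) in Q by ring. lra. }
  assert (Y0 : Y <> 0). { intros E. rewrite E, Rabs_R0 in Y1. lra. }
  set (z1 := (la j * (1 - s) + Cconj (mu j))%C). set (z2 := (la j * s + mu j)%C).
  assert (I1 : Im z1 = - Y) by apply gnum_im. assert (I2 : Im z2 = Y) by apply gden_im.
  assert (N1 : Im z1 <> 0) by (rewrite I1; lra). assert (N2 : Im z2 <> 0) by (rewrite I2; lra).
  split; [exact Y0|]. destruct (Gamma_converges _ N1) as [_ G1]. destruct (Gamma_converges _ N2) as [_ G2].
  split; [exact G1|]. split; [exact G2|].
  destruct (Gamma_logder _ N1) as [p1 [D1 B1]]. destruct (Gamma_logder _ N2) as [p2 [D2 B2]].
  exists (- (la j * (p1 + p2)))%C. split.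
  - assert (E1 : cder (gnum j) s (gnum j s * (- la j * p1))%C).
    { generalize (cder_comp CGamma (fun w => la j * (1 - w) + Cconj (mu j))%C s _ _ D1
       (cder_plus _ _ _ _ _ (cder_scal _ (la j) _ _ (cder_minus _ _ _ _ _ (cder_const 1 s) (cder_id s)))
         (cder_const (Cconj (mu j)) s))).
      apply cder_val. change (CGamma z1) with (gnum j s). ring. }
    assert (E2 : cder (gden j) s (gden j s * (la j * p2))%C).
    { generalize (cder_comp CGamma (fun w => la j * w + mu j)%C s _ _ D2
       (cder_plus _ _ _ _ _ (cder_scal _ (la j) _ _ (cder_id s)) (cder_const (mu j) s))).
      apply cder_val. change (CGamma z2) with (gden j s). ring. }
    generalize (cder_mult _ _ _ _ _ E1 (cder_inv (gden j) s _ G2 E2)).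
    apply cder_val. change (CGamma z2) with (gden j s). field. exact G2.
  - rewrite I1, Rabs_Ropp in B1. rewrite I2 in B2.
    specialize (B1 ltac:(lra)). specialize (B2 ltac:(lra)).
    assert (HT : half_turn (- Y) = - half_turn Y).
    { unfold half_turn. destruct (Rlt_dec 0 (- Y)), (Rlt_dec 0 Y); lra. }
    set (t := Rabs (Im s)) in *. set (Lt := ln (la j) + ln t).
    assert (ELt : Lt = ln L) by (unfold Lt, L; rewrite ln_mult; lra).
    replace (- (la j * (p1 + p2)) + (2 * la j * Lt)%R)%C with
      (- (la j * ((p1 - (ln (Rabs Y), half_turn (- Y))) + (p2 - (ln (Rabs Y), half_turn Y))
         + (2 * (ln (Rabs Y) - Lt))%R)))%C.
    2:{ rewrite HT. destruct p1 as [p11 p12], p2 as [p21 p22].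
        unfold RtoC, Cplus, Copp, Cminus, Cmult; simpl. f_equal; ring. }
    rewrite Cmod_opp, Cmod_mult, Cmod_R, (Rabs_right (la j)) by lra.
    set (R0 := la j * (Rabs (Re s) + 1) + Rabs m1 + 1).
    assert (S0 := Rabs_pos (Re s)).
    assert (R1 : Rabs (Re z1) + 1 <= R0).
    { unfold z1. rewrite re_plus, re_scal_l, re_conj. unfold Cminus. rewrite re_plus, re_opp, re_RtoC.
      fold m1. unfold R0. apply Rplus_le_compat_r. eapply Rle_trans. apply Rabs_triang.
      apply Rplus_le_compat_r. rewrite Rabs_mult, (Rabs_right (la j)) by lra. apply Rmult_le_compat_l. lra.
      eapply Rle_trans. apply Rabs_triang. rewrite Rabs_Ropp, Rabs_R1. lra. }
    assert (R2 : Rabs (Re z2) + 1 <= R0).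
    { unfold z2. rewrite re_plus, re_scal_l.
      fold m1. unfold R0. apply Rplus_le_compat_r. eapply Rle_trans. apply Rabs_triang.
      apply Rplus_le_compat_r. rewrite Rabs_mult, (Rabs_right (la j)) by lra. apply Rmult_le_compat_l; lra. }
    assert (L0 : 0 < L) by lra.
    assert (IY : 0 < / Rabs Y <= 2 * / L).
    { split. apply Rinv_0_lt_compat; lra. replace (2 * / L) with (/ (L / 2)) by (field; lra).
      apply Rinv_le_contravar; lra. }
    assert (IL : 0 < / L) by now apply Rinv_0_lt_compat.
    assert (C1 : forall x, 0 <= x -> x <= R0 -> 48 * x / Rabs Y <= 96 * R0 * / L).
    { intros x x0 Hx. unfold Rdiv. apply Rle_trans with (48 * R0 * (2 * / L)). 2: lra.
      apply Rmult_le_compat; lra. }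
    assert (C2 : Rabs (ln (Rabs Y) - Lt) <= 2 * Rabs m2 * / L).
    { rewrite ELt. set (rr := Rabs Y / L). assert (Er : ln (Rabs Y) - ln L = ln rr) by (unfold rr; rewrite ln_div; lra).
      rewrite Er. assert (r1 : - (Rabs m2 * / L) <= rr - 1 <= Rabs m2 * / L).
      { unfold rr. replace (Rabs Y / L - 1) with ((Rabs Y - L) * / L) by (field; lra). split; nra. }
      assert (r2 : Rabs m2 * / L <= 1 / 2).
      { apply Rmult_le_reg_r with L; auto. rewrite Rmult_assoc, Rinv_l; lra. }
      assert (rp : 0 < rr) by lra.
      assert (L1 := ln_le_sub1 rr rp).
      assert (L2 := ln_le_sub1 (/ rr) ltac:(now apply Rinv_0_lt_compat)). rewrite ln_Rinv in L2 by auto.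
      assert (E3 : / rr - 1 = (1 - rr) * / rr) by (field; lra).
      assert (0 < / rr <= 2). { split. now apply Rinv_0_lt_compat. replace 2 with (/ (1 / 2)) by field. apply Rinv_le_contravar; lra. }
      assert (0 <= Rabs m2 * / L) by nra.
      apply Rabs_le. split; nra. }
    assert (P1 := Rabs_pos (Re z1)). assert (P2 := Rabs_pos (Re z2)).
    assert (C3 : Cmod ((p1 - (ln (Rabs Y), half_turn (- Y))) + (p2 - (ln (Rabs Y), half_turn Y))
         + (2 * (ln (Rabs Y) - Lt))%R) <= 192 * R0 * / L + 4 * Rabs m2 * / L).
    { eapply Rle_trans. apply Cmod_triangle. eapply Rle_trans. apply Rplus_le_compat_r, Cmod_triangle.
      rewrite Cmod_R, Rabs_mult, (Rabs_right 2) by lra.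
      assert (Q1 := C1 (Rabs (Re z1) + 1) ltac:(lra) R1). assert (Q2 := C1 (Rabs (Re z2) + 1) ltac:(lra) R2). lra. }
    apply Rle_trans with (la j * (192 * R0 * / L + 4 * Rabs m2 * / L)). apply Rmult_le_compat_l; lra.
    replace (la j * (192 * R0 * / L + 4 * Rabs m2 * / L)) with ((192 * R0 + 4 * Rabs m2) * / t).
    2:{ unfold L. field. split; lra. }
    unfold Rdiv. apply Rmult_le_compat_r. left; apply Rinv_0_lt_compat; lra.
    unfold K, R0. assert (0 <= Rabs m1 * Rabs (Re s)) by nra. assert (0 <= Rabs m2 * Rabs (Re s)) by nra.
    lra.
Qed.

Lemma product_logder q : (forall j, (1 <= j <= q)%nat -> 0 < la j) ->
  exists T K, 1 <= T /\ 0 <= K /\ forall s, T <= Rabs (Im s) ->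
  (forall j, (1 <= j <= q)%nat -> la j * Im s + Im (mu j) <> 0 /\ gnum j s <> RtoC 0 /\ gden j s <> RtoC 0) /\
  exists l, cder (fun w => cprod (fun j => gnum j w / gden j w)%C q) s
    (cprod (fun j => gnum j s / gden j s)%C q * l)%C /\
    Cmod (l + sum_n_m (fun j => 2 * la j * (ln (la j) + ln (Rabs (Im s)))) 1 q)
     <= K * (Rabs (Re s) + 1) / Rabs (Im s).
Proof.
  induction q; intros Hq.
  - exists 1, 0. split. lra. split. lra. intros s Hs. split. intros; lia.
    exists (RtoC 0). split.
    + apply cder_ext with (fun _ => RtoC 1). intros; now rewrite cprod_0.
      generalize (cder_const 1 s). apply cder_val. ring.
    + rewrite sum_n_m_zero by lia. change (RtoC zero) with (RtoC 0). rewrite Cplus_0_r, Cmod_0. right. field. lra.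
  - destruct IHq as [T [K [T1 [K0 H]]]]. intros; apply Hq; lia.
    destruct (factor_logder (S q)) as [T' [K' [T1' [K0' H']]]]. apply Hq; lia.
    exists (Rmax T T'), (K + K'). split. eapply Rle_trans. exact T1. apply Rmax_l. split. lra.
    intros s Hs. specialize (H s (Rle_trans _ _ _ (Rmax_l _ _) Hs)). specialize (H' s (Rle_trans _ _ _ (Rmax_r _ _) Hs)).
    destruct H as [N [l [D B]]]. destruct H' as [Y [N1 [N2 [l' [D' B']]]]]. split.
    + intros j Hj. destruct (Nat.eq_dec j (S q)) as [->|Hn]; auto. apply N; lia.
    + exists (l + l')%C. split.
      * apply cder_ext with (fun w => cprod (fun j => gnum j w / gden j w) q * (gnum (S q) w / gden (S q) w))%C.
        intros; now rewrite cprod_S.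
        generalize (cder_mult _ _ _ _ _ D D'). apply cder_val. rewrite cprod_S. ring.
      * rewrite sum_n_Sm by lia. change (@plus R_AbelianMonoid) with Rplus. rewrite RtoC_plus.
        match goal with |- Cmod (l + l' + (RtoC ?a + RtoC ?b)) <= _ =>
          replace (l + l' + (RtoC a + RtoC b))%C with ((l + RtoC a) + (l' + RtoC b))%C by ring end.
        eapply Rle_trans. apply Cmod_triangle.
        replace ((K + K') * (Rabs (Re s) + 1) / Rabs (Im s)) with
          (K * (Rabs (Re s) + 1) / Rabs (Im s) + K' * (Rabs (Re s) + 1) / Rabs (Im s)) by (unfold Rdiv; ring).
        now apply Rplus_le_compat.
Qed.

(** The terms [2 la_j (ln la_j + ln t)] of the single factors add up to twice the logarithm of the
    product of the [la_j^la_j], plus the degree times [ln t]. With the [Q] of [chi] this is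
    [log_conductor_at]. *)
Lemma log_conductor q : (forall j, (1 <= j <= q)%nat -> 0 < la j) -> forall x,
  0 < Iter.iter_nat Rmult 1 (fun j => Rpower (la j) (la j)) 1 q /\
  sum_n_m (fun j => 2 * la j * (ln (la j) + x)) 1 q =
  2 * ln (Iter.iter_nat Rmult 1 (fun j => Rpower (la j) (la j)) 1 q) + 2 * sum_n_m la 1 q * x.
Proof.
  intros Hq x. induction q.
  - rewrite !sum_n_m_zero by lia. change (Iter.iter_nat Rmult 1 (fun j => Rpower (la j) (la j)) 1 0) with 1.
    rewrite ln_1. change (@zero R_AbelianMonoid) with 0. split; lra.
  - destruct IHq as [P E]. intros; apply Hq; lia. rewrite !sum_n_Sm by lia. rewrite E, rprod_S.
    change (@plus R_AbelianMonoid) with Rplus.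
    assert (0 < Rpower (la (S q)) (la (S q))) by apply exp_pos.
    split. now apply Rmult_lt_0_compat. rewrite ln_mult by auto.
    replace (ln (Rpower (la (S q)) (la (S q)))) with (la (S q) * ln (la (S q))) by (symmetry; apply ln_exp).
    match goal with |- ?a = ?b => change (@eq R a b) end. ring.
Qed.

End GammaFactors.

Lemma cpow_cder (x : R) (u : C -> C) (s l : C) : cder u s l ->
  cder (fun w => cpow x (u w)) s (cpow x (u s) * (l * ln x))%C.
Proof.
  intros H. unfold cpow.
  generalize (cder_comp Cexp (fun w => u w * ln x)%C s _ _ (cder_Cexp _)
    (cder_mult _ _ _ _ _ H (cder_const (ln x) s))).
  apply cder_val. ring.
Qed.

Lemma cpow_neq0 x s : cpow x s <> RtoC 0.
Proof. apply Cexp_neq0. Qed.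

Lemma cpow_conj x s : Cconj (cpow x s) = cpow x (Cconj s).
Proof. unfold cpow. now rewrite <- Cexp_conj, Cmult_conj, Cconj_RtoC. Qed.

Lemma cpow_plus x s w : cpow x (s + w) = (cpow x s * cpow x w)%C.
Proof. unfold cpow. rewrite <- Cexp_plus. f_equal. ring. Qed.

Lemma Cmod_cpow x s : Cmod (cpow x s) = Rpower x (Re s).
Proof. unfold cpow. rewrite Cmod_Cexp, re_scal_r. reflexivity. Qed.

Section Selberg.

Variable F : selberg_class.

Let lam_pos := sel_lambda_gt0 F.

(** The logarithm of [c^2 t^d], the value prescribed for [y1 y2]. *)
Definition log_conductor_at (t : R) : R := 2 * ln (conductor_root F) + degree F * ln t.

Lemma conductor_root_pos : 0 < conductor_root F.
Proof.
  apply Rmult_lt_0_compat. apply sel_Q_gt0. apply (log_conductor _ _ lam_pos 0).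
Qed.

Lemma chi_eq s : chi F s = (sel_omega F * cpow (sel_Q F) (1 - 2 * s) *
  cprod (fun j => gnum (sel_lambda F) (sel_mu F) j s / gden (sel_lambda F) (sel_mu F) j s) (sel_q F))%C.
Proof. reflexivity. Qed.

Lemma omega_neq0 : sel_omega F <> RtoC 0.
Proof. apply Cmod_neq0. rewrite sel_omega_mod. lra. Qed.

(** What the sequel uses of the Gamma factors. For large [|Im s|] their arguments are off the real
    axis, where Gamma has neither pole nor zero, so the functional equation may be divided by them.
    On [Re s = 1/2] each [gnum] is the conjugate of [gden], whence [|chi| = 1]. *)
Lemma chi_facts : exists T K, 1 <= T /\ 0 <= K /\ forall s, T <= Rabs (Im s) ->
  chi F s <> RtoC 0 /\
  (exists l, cder (chi F) s (chi F s * l)%C /\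
    Cmod (l + log_conductor_at (Rabs (Im s))) <= K * (Rabs (Re s) + 1) / Rabs (Im s)) /\
  F s = (chi F s * Cconj (F (1 - Cconj s)))%C /\
  (Re s = 1 / 2 -> Cmod (chi F s) = 1).
Proof.
  destruct (product_logder (sel_lambda F) (sel_mu F) (sel_q F) lam_pos) as [T [K [T1 [K0 H]]]].
  exists T, K. split; auto. split; auto. intros s Hs. destruct (H s Hs) as [N [l [D B]]].
  set (P := cprod (fun j => gnum (sel_lambda F) (sel_mu F) j s / gden (sel_lambda F) (sel_mu F) j s)%C (sel_q F)) in *.
  assert (PN : P <> RtoC 0).
  { apply cprod_neq0. intros j Hj. destruct (N j Hj) as [_ [N1 N2]]. unfold Cdiv. apply Cmult_neq_0; auto.
    intros E. apply C1_nz. rewrite <- (Cinv_r _ N2), E. ring. }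
  repeat split.
  - rewrite chi_eq. repeat apply Cmult_neq_0; auto. apply omega_neq0. apply cpow_neq0.
  - exists (l - 2 * ln (sel_Q F))%C. split.
    + assert (E1 : cder (fun w => cpow (sel_Q F) (1 - 2 * w)) s (cpow (sel_Q F) (1 - 2 * s) * ((0 - 2 * 1) * ln (sel_Q F)))%C).
      { apply (cpow_cder (sel_Q F) (fun w => 1 - 2 * w)%C).
        apply cder_minus. apply cder_const. apply cder_scal. apply cder_id. }
      apply cder_ext with (fun w => sel_omega F * cpow (sel_Q F) (1 - 2 * w) *
        cprod (fun j => gnum (sel_lambda F) (sel_mu F) j w / gden (sel_lambda F) (sel_mu F) j w) (sel_q F))%C.
      intros; now rewrite chi_eq.
      generalize (cder_mult _ _ _ _ _ (cder_scal _ (sel_omega F) _ _ E1) D).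
      apply cder_val. rewrite chi_eq. fold P. ring.
    + destruct (log_conductor (sel_lambda F) (sel_q F) lam_pos (ln (Rabs (Im s)))) as [W E].
      rewrite E in B. replace (l - 2 * ln (sel_Q F) + log_conductor_at (Rabs (Im s)))%C with
       (l + (2 * ln (Iter.iter_nat Rmult 1 (fun j => Rpower (sel_lambda F j) (sel_lambda F j)) 1 (sel_q F)) +
        2 * sum_n_m (sel_lambda F) 1 (sel_q F) * ln (Rabs (Im s)))%R)%C; auto.
      unfold log_conductor_at, degree, conductor_root. rewrite ln_mult; auto. 2: apply sel_Q_gt0.
      rewrite !RtoC_plus, !RtoC_mult, RtoC_plus. ring.
  - assert (S0 : Im s <> 0). { intros E. rewrite E, Rabs_R0 in Hs. lra. }
    assert (FE := sel_functional_equation F s).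
    assert (FE' : completed F (sel_q F) (sel_Q F) (sel_lambda F) (sel_mu F) s =
      (sel_omega F * Cconj (completed F (sel_q F) (sel_Q F) (sel_lambda F) (sel_mu F) (1 - Cconj s)))%C).
    { apply FE.
      - now apply im_neq0.
      - intros E. apply S0. rewrite E. apply im_RtoC.
      - intros j Hj. destruct (N j Hj) as [Y _]. split; intros [k E]; apply Y.
        + rewrite <- gden_im, E. apply im_RtoC.
        + assert (E2 := f_equal Im E). rewrite im_plus, im_scal_l, im_RtoC in E2.
          unfold Cminus in E2. rewrite im_plus, im_opp, im_conj, im_RtoC in E2. lra. }
    clear FE. unfold completed in FE'.
    change (Iter.iter_nat Cmult 1 (fun j => CGamma (sel_lambda F j * s + sel_mu F j)%C) 1 (sel_q F))
      with (cprod (fun j => gden (sel_lambda F) (sel_mu F) j s) (sel_q F)) in FE'.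
    change (Iter.iter_nat Cmult 1 (fun j => CGamma (sel_lambda F j * (1 - Cconj s) + sel_mu F j)%C) 1 (sel_q F))
      with (cprod (fun j => CGamma (sel_lambda F j * (1 - Cconj s) + sel_mu F j)%C) (sel_q F)) in FE'.
    rewrite !Cmult_conj, cprod_conj, cpow_conj in FE'.
    rewrite (cprod_ext (fun j => Cconj (CGamma (sel_lambda F j * (1 - Cconj s) + sel_mu F j)))%C
      (fun j => gnum (sel_lambda F) (sel_mu F) j s)) in FE'.
    2:{ intros j _. rewrite <- CGamma_conj. unfold gnum. f_equal.
        rewrite Cplus_conj, Cmult_conj, Cconj_RtoC, Cminus_conj, Cconj_conj, Cconj_RtoC. reflexivity. }
    rewrite Cminus_conj, Cconj_conj, Cconj_RtoC in FE'.
    set (Gd := cprod (fun j => gden (sel_lambda F) (sel_mu F) j s) (sel_q F)) in *.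
    set (Gn := cprod (fun j => gnum (sel_lambda F) (sel_mu F) j s) (sel_q F)) in *.
    assert (GdN : Gd <> RtoC 0). { apply cprod_neq0. intros j Hj. now apply N. }
    assert (EP : (P * Gd = Gn)%C).
    { unfold P, Gd, Gn. rewrite <- cprod_mult. apply cprod_ext. intros j Hj. field. now apply N. }
    assert (EQ : (cpow (sel_Q F) (1 - 2 * s) * cpow (sel_Q F) s = cpow (sel_Q F) (1 - s))%C).
    { rewrite <- cpow_plus. f_equal. ring. }
    rewrite chi_eq. fold P.
    assert (QN := cpow_neq0 (sel_Q F) s).
    assert (X : (cpow (sel_Q F) s * Gd * F s = cpow (sel_Q F) s * Gd *
      (sel_omega F * cpow (sel_Q F) (1 - 2 * s) * P * Cconj (F (1 - Cconj s))))%C).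
    { rewrite FE', <- EQ, <- EP. ring. }
    assert (Z : forall a b : C, (cpow (sel_Q F) s * Gd * a = cpow (sel_Q F) s * Gd * b)%C -> a = b).
    { intros a b E. assert (V : (cpow (sel_Q F) s * Gd)%C <> RtoC 0) by now apply Cmult_neq_0.
      set (V' := (cpow (sel_Q F) s * Gd)%C) in *.
      assert (R : forall x, (/ V' * (V' * x))%C = x) by (intros x; field; auto).
      rewrite <- (R a), <- (R b), E. reflexivity. }
    now apply Z.
  - intros Hre. rewrite chi_eq, !Cmod_mult, sel_omega_mod, Cmod_cpow.
    replace (Re (1 - 2 * s)) with 0.
    2:{ unfold Cminus. rewrite re_plus, re_opp, re_scal_l, re_RtoC, Hre. field. }
    unfold Rpower. rewrite Rmult_0_l, exp_0, cprod_mod1. ring.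
    intros j Hj. destruct (N j Hj) as [_ [N1 N2]]. rewrite Cmod_div by auto.
    assert (E : gnum (sel_lambda F) (sel_mu F) j s = Cconj (gden (sel_lambda F) (sel_mu F) j s)).
    { unfold gnum, gden. rewrite <- CGamma_conj. f_equal.
      rewrite Cplus_conj, Cmult_conj, Cconj_RtoC. f_equal. f_equal.
      destruct s as [a b]. unfold Re in Hre; simpl in Hre. subst a.
      unfold Cconj, Cminus, Cplus, Copp, RtoC; simpl. f_equal; field. }
    rewrite E, Cmod_conj. apply Rinv_r. apply Cmod_gt_0 in N2. lra.
Qed.

End Selberg.

(** * Sums with a peak *)

Fixpoint csum (f : nat -> C) (N : nat) : C :=
  match N with O => RtoC 0 | S p => (csum f p + f (S p))%C end.
Fixpoint rsum (f : nat -> R) (N : nat) : R :=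
  match N with O => 0 | S p => rsum f p + f (S p) end.

Lemma csum_bound f g N : (forall n, (1 <= n <= N)%nat -> Cmod (f n) <= g n) -> Cmod (csum f N) <= rsum g N.
Proof.
  induction N; intros H; simpl. rewrite Cmod_0; lra.
  eapply Rle_trans. apply Cmod_triangle. apply Rplus_le_compat. apply IHN; intros; apply H; lia. apply H; lia.
Qed.

Lemma rsum_le f g N : (forall n, (1 <= n <= N)%nat -> f n <= g n) -> rsum f N <= rsum g N.
Proof.
  induction N; intros H; simpl. lra. apply Rplus_le_compat. apply IHN; intros; apply H; lia. apply H; lia.
Qed.

Lemma rsum_scal c f N : rsum (fun n => c * f n) N = c * rsum f N.
Proof. induction N; simpl. ring. rewrite IHN. ring. Qed.

Lemma rsum_plus f g N : rsum (fun n => f n + g n) N = rsum f N + rsum g N.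
Proof. induction N; simpl. ring. rewrite IHN. ring. Qed.

Lemma csum_ext f g N : (forall n, (1 <= n <= N)%nat -> f n = g n) -> csum f N = csum g N.
Proof.
  induction N; intros H; simpl; auto. rewrite IHN, H; auto. lia. intros; apply H; lia.
Qed.

Lemma csum_minus f g N : csum (fun n => f n - g n)%C N = (csum f N - csum g N)%C.
Proof. induction N; simpl. ring. rewrite IHN. ring. Qed.

Lemma csum_scal c f N : csum (fun n => c * f n)%C N = (c * csum f N)%C.
Proof. induction N; simpl. ring. rewrite IHN. ring. Qed.

Lemma csum_conj f N : Cconj (csum f N) = csum (fun n => Cconj (f n)) N.
Proof. induction N; simpl. apply Cconj_RtoC. now rewrite Cplus_conj, IHN. Qed.

Lemma exp_le (x y : R) : x <= y -> exp x <= exp y.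
Proof. intros [H|H]. left; now apply exp_increasing. rewrite H; lra. Qed.

Lemma exp_le_1 (x : R) : x <= 0 -> exp x <= 1.
Proof. intros H. rewrite <- exp_0. now apply exp_le. Qed.

Lemma Rpower_ratio_ge (p : R) (N : nat) : 0 <= p -> (1 <= N)%nat ->
  1 + p / INR (S N) <= exp (p * (ln (INR (S N)) - ln (INR N))).
Proof.
  intros Hp HN. destruct (ln_step N HN) as [[L _] _].
  apply Rle_trans with (exp (p / INR (S N))). apply exp_ineq1_le.
  apply exp_le. unfold Rdiv. now apply Rmult_le_compat_l.
Qed.

(** For [n >= 1] this is [(n / y)^p] when [n <= y] and [(y / n)^p] when [n >= y]. With [p = sqrt t]
    it measures the error of the sharp cut-off at the [n]-th term. *)
Definition peak (p y : R) (n : nat) : R := exp (- p * Rabs (ln y - ln (INR n))).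

Section PeakSum.

Variables (p y : R).
Hypotheses (Hp : 1 < p) (Hy : 0 < y).

Lemma peak_left n : (1 <= n)%nat -> INR n <= y -> peak p y n = exp (p * (ln (INR n) - ln y)).
Proof.
  intros Hn H. unfold peak. assert (0 < INR n) by (apply (lt_INR 0); lia).
  assert (ln (INR n) <= ln y). { destruct H as [H|H]. left; now apply ln_increasing. rewrite H; lra. }
  rewrite Rabs_right by lra. f_equal. ring.
Qed.

Lemma peak_right n : y <= INR n -> peak p y n = exp (p * (ln y - ln (INR n))).
Proof.
  intros H. unfold peak.
  assert (ln y <= ln (INR n)). { destruct H as [H|H]. left; now apply ln_increasing. rewrite H; lra. }
  rewrite Rabs_left1 by lra. f_equal. ring.
Qed.

(** The factor [1 + 2 N / (p + 1)] reproduces itself: passing to [N + 1] multiplies [(N / y)^p] by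
    at least [1 + p / (N + 1)], which pays for the new term. *)
Lemma peak_sum_left N : INR N <= y ->
  rsum (peak p y) N <= exp (p * (ln (INR N) - ln y)) * (1 + 2 * INR N / (p + 1)).
Proof.
  induction N; intros H.
  - simpl. apply Rmult_le_pos. left; apply exp_pos. unfold Rdiv. rewrite Rmult_0_r, Rmult_0_l. lra.
  - simpl rsum. rewrite peak_left by (auto; lia).
    assert (HN : INR N <= y) by (rewrite S_INR in H; lra). specialize (IHN HN).
    destruct (Nat.eq_dec N 0) as [->|N0].
    + simpl rsum. rewrite Rplus_0_l. assert (E := exp_pos (p * (ln (INR 1) - ln y))).
      assert (0 <= 2 * INR 1 / (p + 1)). { simpl. left. apply Rdiv_lt_0_compat; lra. } nra.
    + assert (E : exp (p * (ln (INR (S N)) - ln y)) =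
        exp (p * (ln (INR N) - ln y)) * exp (p * (ln (INR (S N)) - ln (INR N)))).
      { rewrite <- exp_plus. f_equal. ring. }
      assert (G := Rpower_ratio_ge p N ltac:(lra) ltac:(lia)).
      rewrite E in *. set (e := exp (p * (ln (INR N) - ln y))) in *.
      set (q := exp (p * (ln (INR (S N)) - ln (INR N)))) in *.
      assert (e0 : 0 < e) by apply exp_pos.
      assert (n0 : 0 <= INR N) by apply pos_INR. rewrite S_INR in *.
      assert (K : 1 + 2 * INR N / (p + 1) <= q * (2 * (INR N + 1) / (p + 1))).
      { apply Rle_trans with ((1 + p / (INR N + 1)) * (2 * (INR N + 1) / (p + 1))).
        2:{ apply Rmult_le_compat_r; auto. left; apply Rdiv_lt_0_compat; lra. }
        replace ((1 + p / (INR N + 1)) * (2 * (INR N + 1) / (p + 1))) with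
          (1 + 2 * INR N / (p + 1) + / (p + 1) * (p + 1)) by (field; lra).
        rewrite Rinv_l; lra. }
      nra.
Qed.

(** About [y / p] integers around [y] carry terms of order 1; the 2 covers the terms adjacent to
    [y], present even when [y] is small. *)
Lemma peak_sum N : rsum (peak p y) N <= 2 + 3 * y / (p - 1).
Proof.
  assert (I1 : 0 < / (p + 1) <= / (p - 1)).
  { split. apply Rinv_0_lt_compat; lra. apply Rinv_le_contravar; lra. }
  assert (A : forall N, INR N <= y -> rsum (peak p y) N <= 1 + 2 * y / (p + 1)).
  { intros n Hn. destruct (Nat.eq_dec n 0) as [->|n0].
    { assert (0 < 2 * y / (p + 1)) by (apply Rdiv_lt_0_compat; lra). simpl. lra. }
    eapply Rle_trans. now apply peak_sum_left.
    assert (0 < INR n) by (apply (lt_INR 0); lia).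
    assert (E : exp (p * (ln (INR n) - ln y)) <= 1).
    { rewrite <- exp_0. apply exp_le.
      assert (ln (INR n) <= ln y). { destruct Hn as [Hn|Hn]. left; now apply ln_increasing. rewrite Hn; lra. } nra. }
    assert (2 * INR n / (p + 1) <= 2 * y / (p + 1)) by (unfold Rdiv; apply Rmult_le_compat_r; lra).
    assert (0 <= 2 * INR n / (p + 1)) by (left; apply Rdiv_lt_0_compat; lra).
    apply Rle_trans with (1 * (1 + 2 * INR n / (p + 1))). apply Rmult_le_compat_r; lra. lra. }
  (* The subtracted term [y / (p - 1) * (y / n)^(p - 1)] is the integral of [(y / x)^p] over
     [x >= n]; it carries the induction. *)
  assert (B : forall n, y < INR n -> rsum (peak p y) n <= 1 + 2 * y / (p + 1) + 1 + y / (p - 1) -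
    y / (p - 1) * exp ((p - 1) * (ln y - ln (INR n)))).
  { assert (c0 : 0 < y / (p - 1)) by (apply Rdiv_lt_0_compat; lra).
    induction n as [|n IHn]; intros Hn. simpl in Hn; lra.
    simpl rsum. rewrite (peak_right (S n)) by lra.
    assert (P : 0 < INR (S n)) by (apply (lt_INR 0); lia).
    assert (L : ln y < ln (INR (S n))) by now apply ln_increasing.
    destruct (Rle_lt_dec (INR n) y) as [Q|Q].
    - specialize (A n Q).
      assert (E1 : exp (p * (ln y - ln (INR (S n)))) <= 1) by (apply exp_le_1; nra).
      assert (E2 : exp ((p - 1) * (ln y - ln (INR (S n)))) <= 1) by (apply exp_le_1; nra).
      nra.
    - specialize (IHn Q). assert (n1 : (1 <= n)%nat). { destruct n; [simpl in Q; lra|lia]. }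
      assert (G := Rpower_ratio_ge (p - 1) n ltac:(lra) n1).
      assert (E : exp ((p - 1) * (ln y - ln (INR n))) =
        exp ((p - 1) * (ln y - ln (INR (S n)))) * exp ((p - 1) * (ln (INR (S n)) - ln (INR n)))).
      { rewrite <- exp_plus. f_equal. ring. }
      assert (E3 : exp (p * (ln y - ln (INR (S n)))) = exp ((p - 1) * (ln y - ln (INR (S n)))) * (y / INR (S n))).
      { replace (p * (ln y - ln (INR (S n)))) with ((p - 1) * (ln y - ln (INR (S n))) + (ln y - ln (INR (S n)))) by ring.
        rewrite exp_plus. f_equal. rewrite <- ln_div by lra. apply exp_ln. apply Rdiv_lt_0_compat; lra. }
      rewrite E in IHn. rewrite E3. set (e := exp ((p - 1) * (ln y - ln (INR (S n))))) in *.
      assert (e0 : 0 < e) by apply exp_pos.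
      set (q := exp ((p - 1) * (ln (INR (S n)) - ln (INR n)))) in *.
      assert (K : y / INR (S n) <= y / (p - 1) * (q - 1)).
      { apply Rle_trans with (y / (p - 1) * ((p - 1) / INR (S n))). right; field; split; lra.
        apply Rmult_le_compat_l; lra. }
      assert (e * (y / INR (S n)) <= e * (y / (p - 1) * (q - 1))) by (apply Rmult_le_compat_l; lra).
      lra. }
  assert (F : 2 * y / (p + 1) <= 2 * y / (p - 1)) by (unfold Rdiv; apply Rmult_le_compat_l; lra).
  assert (c0 : 0 < y / (p - 1)) by (apply Rdiv_lt_0_compat; lra).
  replace (3 * y / (p - 1)) with (2 * y / (p - 1) + y / (p - 1)) by (field; lra).
  destruct (Rle_lt_dec (INR N) y) as [Q|Q].
  - specialize (A N Q). lra.
  - specialize (B N Q). assert (0 < exp ((p - 1) * (ln y - ln (INR N)))) by apply exp_pos. nra.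
Qed.

End PeakSum.

(* The exponent shift is absorbed by the peak: [n^e <= y^e (n/y)^e] and [|e| <= 3]. *)
Lemma weighted_peak_sum (M y e : R) (N : nat) : 8 <= M -> 0 < y -> Rabs e <= 3 ->
  rsum (fun n => Rpower (INR n) e * peak M y n) N <= 6 * Rpower y e * (1 + y / M).
Proof.
  intros HM Hy He.
  apply Rle_trans with (rsum (fun n => Rpower y e * peak (M - 3) y n) N).
  - apply rsum_le. intros n Hn. unfold peak, Rpower. rewrite <- !exp_plus. apply exp_le.
    set (d := ln y - ln (INR n)).
    replace (e * ln (INR n)) with (e * ln y - e * d) by (unfold d; ring).
    assert (- e * d <= 3 * Rabs d).
    { eapply Rle_trans. apply Rle_abs. rewrite Rabs_mult, Rabs_Ropp.
      apply Rmult_le_compat_r; auto. apply Rabs_pos. }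
    lra.
  - rewrite rsum_scal. rewrite (Rmult_comm 6), Rmult_assoc. apply Rmult_le_compat_l.
    left; apply exp_pos.
    eapply Rle_trans. apply peak_sum; lra.
    assert (3 * y / (M - 3 - 1) <= 6 * (y / M)).
    { replace (6 * (y / M)) with (3 * y * / (M / 2)) by (field; lra).
      unfold Rdiv at 1. apply Rmult_le_compat_l. lra. apply Rinv_le_contravar; lra. }
    lra.
Qed.

(** * Smoothed truncation of Dirichlet series *)

Lemma cpow_cdiff x w : cdiff (cpow x) w.
Proof. eexists. apply (cpow_cder x (fun w => w)). apply cder_id. Qed.

Lemma Cmod_cpow_exp x u v : Cmod (cpow x (u, v)) = exp (u * ln x).
Proof. now rewrite Cmod_cpow. Qed.

Lemma is_RInt_cauchy_kernel (M H : R) : 0 < M -> 0 <= H ->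
  is_RInt (fun v => / (1 + v ^ 2 / (M * M))) (- H) H (M * (atan (H / M) - atan (- H / M))).
Proof.
  intros HM HH. replace (M * (atan (H / M) - atan (- H / M))) with (minus (M * atan (H / M)) (M * atan (- H / M))).
  2:{ unfold minus, plus, opp; simpl. ring. }
  apply (is_RInt_derive (fun v => M * atan (v / M))).
  - intros v _. auto_derive; auto. unfold Rsqr. field. split; [lra|nra].
  - intros v _. apply (ex_derive_continuous (fun v => / (1 + v ^ 2 / (M * M)))). auto_derive.
    assert (0 < / (M * M)) by (apply Rinv_0_lt_compat; nra).
    assert (0 <= v * (v * 1) * / (M * M)) by (apply Rmult_le_pos; nra).
    unfold Rdiv in *. simpl in *. lra.
Qed.

Section Window.

Variables (t a B : R) (k : C -> C).
Let M := sqrt t.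
Let H := t / 2.
Hypotheses (Ht : 64 <= t) (Ha : 0 < a <= 3).
Hypothesis Hk : forall u v, Rabs u <= M -> Rabs v <= H -> cdiff k (u, v).
Hypothesis Hb : forall u v, Rabs u <= M -> Rabs v <= H -> Cmod (k (u, v)) <= B * / (1 + v ^ 2 / t).
Hypothesis He : forall u v, Rabs u <= M -> Rabs v = H -> Cmod (k (u, v)) <= B * exp (- t).

Definition window_fun (x : R) (w : C) : C := (k w * cpow x w * / w)%C.
Definition window (x : R) : C := vint (window_fun x) a (- H) H.

Lemma sqrt_ge8 : 8 <= M /\ M * M = t.
Proof.
  assert (E : M * M = t) by (apply sqrt_sqrt; lra). split; auto.
  replace 8 with (sqrt 64). apply sqrt_le_1; lra.
  replace 64 with (8 * 8) by ring. apply sqrt_square. lra.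
Qed.

Lemma window_fun_cdiff x u v : Rabs u <= M -> Rabs v <= H -> (u <> 0 \/ v <> 0) -> cdiff (window_fun x) (u, v).
Proof.
  intros Hu Hv N. apply cdiff_mult. apply cdiff_mult. now apply Hk. apply cpow_cdiff.
  apply (cdiff_inv (fun w => w)). now apply pt_neq0. apply cdiff_id.
Qed.

Lemma window_bound_ge0 : 0 <= B.
Proof.
  destruct sqrt_ge8. assert (Q : Cmod (k (0, 0)) <= B * / (1 + 0 ^ 2 / t)).
  { apply Hb; rewrite Rabs_R0; unfold H; lra. }
  replace (/ (1 + 0 ^ 2 / t)) with 1 in Q by (field; lra).
  generalize (Cmod_ge_0 (k (0, 0))). lra.
Qed.

Lemma Rabs_le_sym u b : - b <= u <= b -> Rabs u <= b.
Proof. apply Rabs_le. Qed.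

Lemma window_hint_bound x u1 u2 v : - M <= u1 -> u1 <= u2 -> u2 <= M -> u2 - u1 <= 2 * M ->
  (forall u, u1 <= u <= u2 -> u * ln x <= a * ln x) -> Rabs v = H ->
  Cmod (hint (window_fun x) u1 u2 v) <= B * exp (- t) * exp (a * ln x).
Proof.
  intros H1 H2 H3 H4 Hx Hv. destruct sqrt_ge8 as [M8 MM]. assert (B0 := window_bound_ge0).
  assert (Hpos : 0 < H) by (unfold H; lra).
  assert (v0 : v <> 0) by (intros E; rewrite E, Rabs_R0 in Hv; lra).
  assert (C0 : hcont (window_fun x) u1 u2 v).
  { split; auto. intros u Hu. apply cdiff_ccont, window_fun_cdiff; auto. apply Rabs_le_sym; lra. lra. }
  unfold hint. eapply Rle_trans. apply (CInt_bound _ u1 u2 (B * exp (- t) * exp (a * ln x) * / H)).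
  - auto.
  - now apply hcont_ex.
  - intros u Hu. unfold window_fun.
    assert (Wn : (u, v) <> RtoC 0) by (apply pt_neq0; auto).
    rewrite !Cmod_mult, Cmod_inv, Cmod_cpow_exp by auto.
    assert (L : / Cmod (u, v) <= / H).
    { apply Rinv_le_contravar; auto. rewrite <- Hv. apply Cmod_pt_ge. }
    assert (P1 := exp_pos (- t)). assert (P2 := exp_pos (u * ln x)).
    assert (L2 := exp_le _ _ (Hx u Hu)).
    assert (0 < / Cmod (u, v)) by (apply Rinv_0_lt_compat; now apply Cmod_gt_0).
    apply Rmult_le_compat; try lra. apply Rmult_le_pos. apply Cmod_ge_0. lra.
    apply Rmult_le_compat; try lra. apply Cmod_ge_0. apply He; auto. apply Rabs_le_sym; lra.
  - assert (P : 0 <= B * exp (- t) * exp (a * ln x)).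
    { repeat apply Rmult_le_pos; auto; left; apply exp_pos. }
    set (X := B * exp (- t) * exp (a * ln x)) in *.
    assert (E : (u2 - u1) * / H <= 1).
    { apply Rmult_le_reg_r with H; auto. rewrite Rmult_assoc, Rinv_l by lra. unfold H. nra. }
    replace ((u2 - u1) * (X * / H)) with (X * ((u2 - u1) * / H)) by ring.
    rewrite <- (Rmult_1_r X) at 2. apply Rmult_le_compat_l; auto.
Qed.

(** On [|Re w| = M] the factor [1 / |w| <= 1 / M] cancels the mass [O(M)] of the kernel, so that
    moving the line costs no power of [t]. *)
Lemma window_vint_bound x u : Rabs u = M -> Cmod (vint (window_fun x) u (- H) H) <= 4 * B * exp (u * ln x).
Proof.
  intros Hu. destruct sqrt_ge8 as [M8 MM]. assert (B0 := window_bound_ge0).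
  assert (u0 : u <> 0) by (intros E; rewrite E, Rabs_R0 in Hu; lra).
  assert (Hpos : 0 < H) by (unfold H; lra).
  unfold vint. rewrite Cmod_mult, Cmod_Ci, Rmult_1_l.
  apply Rle_trans with (B * / M * exp (u * ln x) * (M * (atan (H / M) - atan (- H / M)))).
  - apply (CInt_bound_fun _ (fun v => B * / M * exp (u * ln x) * / (1 + v ^ 2 / (M * M)))).
    + lra.
    + apply vcont_ex. split. lra. intros v Hv. apply cdiff_ccont, window_fun_cdiff; try lra. apply Rabs_le_sym; lra.
    + intros v Hv. assert (Hv' : Rabs v <= H) by (apply Rabs_le_sym; lra).
      unfold window_fun. assert (Wn : (u, v) <> RtoC 0) by (apply pt_neq0; auto).
      rewrite !Cmod_mult, Cmod_inv, Cmod_cpow_exp by auto.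
      assert (L : / Cmod (u, v) <= / M).
      { apply Rinv_le_contravar. lra. rewrite <- Hu. apply Cmod_pt_ge. }
      assert (0 < / Cmod (u, v)) by (apply Rinv_0_lt_compat; now apply Cmod_gt_0).
      assert (P2 := exp_pos (u * ln x)). assert (Q := Hb u v ltac:(lra) Hv').
      rewrite MM. assert (Q0 := Cmod_ge_0 (k (u, v))).
      replace (B * / M * exp (u * ln x) * / (1 + v ^ 2 / t)) with (B * / (1 + v ^ 2 / t) * exp (u * ln x) * / M) by ring.
      apply Rmult_le_compat; try lra. apply Rmult_le_pos; lra. apply Rmult_le_compat_r; lra.
    + apply (is_RInt_scal (V := R_NormedModule)). apply is_RInt_cauchy_kernel; lra.
  - assert (P := exp_pos (u * ln x)).
    replace (B * / M * exp (u * ln x) * (M * (atan (H / M) - atan (- H / M)))) with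
      (B * exp (u * ln x) * (atan (H / M) - atan (- H / M))) by (field; lra).
    replace (4 * B * exp (u * ln x)) with (B * exp (u * ln x) * 4) by ring.
    apply Rmult_le_compat_l. nra.
    generalize (atan_bound (H / M)) (atan_bound (- H / M)) PI_4. lra.
Qed.

(** The line moves to the side where [x^w] is small: left across the pole for [x >= 1], right
    otherwise. The tie [x = 1] goes with the residue, so that for [x = y / n] the indicator is that
    of [n <= y]. *)
Lemma window_value x : 0 < x ->
  Cmod (window x - (if Rle_dec 1 x then kappa * k 0 else 0)) <=
  4 * B * (exp (- M * Rabs (ln x)) + exp (- t) * exp (a * ln x)).
Proof.
  intros Hx. destruct sqrt_ge8 as [M8 MM]. assert (B0 := window_bound_ge0).
  assert (Hpos : 0 < H) by (unfold H; lra).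
  assert (P1 := exp_pos (- t)). assert (P2 := exp_pos (a * ln x)).
  assert (P3 : 0 < exp (- t) * exp (a * ln x)) by now apply Rmult_lt_0_compat.
  destruct (Rle_dec 1 x) as [L|L].
  - assert (l0 : 0 <= ln x). { rewrite <- ln_1. destruct L as [L|L]. left; apply ln_increasing; lra. rewrite L; lra. }
    assert (E : box (window_fun x) (- M) a (- H) H = (kappa * k 0)%C).
    { unfold window_fun. rewrite (box_residue (fun w => k w * cpow x w)%C); try lra.
      - unfold cpow. rewrite Cmult_0_l, Cexp_0. ring.
      - intros u v Hu Hv. apply cdiff_mult. apply Hk; apply Rabs_le_sym; lra. apply cpow_cdiff. }
    rewrite <- E. unfold box, window.
    set (h1 := hint (window_fun x) (- M) a (- H)). set (h2 := hint (window_fun x) (- M) a H).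
    set (v1 := vint (window_fun x) (- M) (- H) H). set (v2 := vint (window_fun x) a (- H) H).
    replace (v2 - (h1 + v2 - h2 - v1))%C with (v1 + h2 + - h1)%C by ring.
    eapply Rle_trans. apply Cmod_triangle. eapply Rle_trans. apply Rplus_le_compat_r, Cmod_triangle.
    rewrite Cmod_opp.
    assert (Q1 : Cmod h1 <= B * exp (- t) * exp (a * ln x)).
    { apply window_hint_bound; try lra. intros; apply Rmult_le_compat_r; lra. rewrite Rabs_Ropp, Rabs_right; lra. }
    assert (Q2 : Cmod h2 <= B * exp (- t) * exp (a * ln x)).
    { apply window_hint_bound; try lra. intros; apply Rmult_le_compat_r; lra. rewrite Rabs_right; lra. }
    assert (Q3 : Cmod v1 <= 4 * B * exp (- M * ln x)).
    { apply window_vint_bound. rewrite Rabs_Ropp, Rabs_right; lra. }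
    rewrite (Rabs_right (ln x)) by lra. rewrite Rmult_assoc in Q1, Q2.
    assert (0 <= B * (exp (- t) * exp (a * ln x))) by (apply Rmult_le_pos; lra). lra.
  - assert (l0 : ln x < 0). { rewrite <- ln_1. apply ln_increasing; lra. }
    assert (E : box (window_fun x) a M (- H) H = RtoC 0).
    { apply goursat; try lra. intros u v Hu Hv. apply window_fun_cdiff; try (apply Rabs_le_sym; lra). left; lra. }
    unfold box in E. unfold window.
    set (h1 := hint (window_fun x) a M (- H)) in *. set (h2 := hint (window_fun x) a M H) in *.
    set (v1 := vint (window_fun x) M (- H) H) in *. set (v2 := vint (window_fun x) a (- H) H) in *.
    replace (v2 - 0)%C with (v1 + h1 + - h2 - (h1 + v1 - h2 - v2))%C by ring. rewrite E.
    replace (v1 + h1 + - h2 - 0)%C with (v1 + h1 + - h2)%C by ring.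
    eapply Rle_trans. apply Cmod_triangle. eapply Rle_trans. apply Rplus_le_compat_r, Cmod_triangle.
    rewrite Cmod_opp.
    assert (Q1 : Cmod h1 <= B * exp (- t) * exp (a * ln x)).
    { apply window_hint_bound; try lra. intros; nra. rewrite Rabs_Ropp, Rabs_right; lra. }
    assert (Q2 : Cmod h2 <= B * exp (- t) * exp (a * ln x)).
    { apply window_hint_bound; try lra. intros; nra. rewrite Rabs_right; lra. }
    assert (Q3 : Cmod v1 <= 4 * B * exp (M * ln x)).
    { apply window_vint_bound. rewrite Rabs_right; lra. }
    rewrite (Rabs_left (ln x)) by lra. replace (- M * - ln x) with (M * ln x) by ring. rewrite Rmult_assoc in Q1, Q2.
    assert (0 <= B * (exp (- t) * exp (a * ln x))) by (apply Rmult_le_pos; lra). lra.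
Qed.

Section Truncate.

Variables (al : nat -> C) (s0 : C) (y : R) (Phi : C -> C).
Hypothesis Hy : 0 < y.
Hypothesis HPc : forall v, Rabs v <= H -> ccont Phi (a, v).
Hypothesis HP : forall e, 0 < e -> exists N0, forall N, (N0 <= N)%nat -> forall v, Rabs v <= H ->
  Cmod (Phi (a, v) - csum (fun n => al n * cpow (INR n) (- s0) * cpow (INR n) (- (a, v)))%C N) <= e.

Lemma cpow_ratio n w : (1 <= n)%nat -> cpow (y / INR n) w = (cpow y w * cpow (INR n) (- w))%C.
Proof.
  intros Hn. assert (0 < INR n) by (apply (lt_INR 0); lia).
  unfold cpow. rewrite <- Cexp_plus. f_equal. rewrite ln_div by auto. rewrite RtoC_minus. ring.
Qed.

Lemma trunc_series N :
  vint (fun w => csum (fun n => al n * cpow (INR n) (- s0) * cpow (INR n) (- w)) N * (k w * cpow y w * / w))%C a (- H) H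
  = csum (fun n => al n * cpow (INR n) (- s0) * window (y / INR n))%C N /\
  vcont (fun w => csum (fun n => al n * cpow (INR n) (- s0) * cpow (INR n) (- w)) N * (k w * cpow y w * / w))%C a (- H) H.
Proof.
  destruct sqrt_ge8 as [M8 MM]. assert (Hpos : 0 < H) by (unfold H; lra).
  assert (W : forall x, vcont (window_fun x) a (- H) H).
  { intros x. split. lra. intros v Hv. apply cdiff_ccont, window_fun_cdiff; try (apply Rabs_le_sym; lra). left; lra. }
  induction N.
  - simpl csum. split.
    + unfold vint. rewrite (CInt_ext _ (fun _ => 0 * 0)%C) by (try lra; intros; ring).
      rewrite (CInt_scal 0 (fun _ => RtoC 0)). ring.
      apply ex_CInt_scont. lra. intros x _ e He0. exists 1. split. lra. intros.
      replace (0 - 0)%C with (RtoC 0) by ring. now rewrite Cmod_0.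
    + split. lra. intros v _ e He0. exists 1. split. lra. intros w _.
      replace (_ - _)%C with (RtoC 0) by ring. now rewrite Cmod_0.
  - destruct IHN as [E Cn].
    set (c := (al (S N) * cpow (INR (S N)) (- s0))%C).
    assert (Ef : forall w, (csum (fun n => al n * cpow (INR n) (- s0) * cpow (INR n) (- w)) (S N) * (k w * cpow y w * / w))%C =
      (csum (fun n => al n * cpow (INR n) (- s0) * cpow (INR n) (- w)) N * (k w * cpow y w * / w) +
        c * window_fun (y / INR (S N)) w)%C).
    { intros w. unfold window_fun. rewrite cpow_ratio by lia. cbn [csum]. unfold c. ring. }
    assert (V2 : vcont (fun w => c * window_fun (y / INR (S N)) w)%C a (- H) H).
    { destruct (W (y / INR (S N))) as [W1 W2]. split; auto. intros; apply ccont_scal; auto. }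
    split.
    + unfold vint. rewrite (CInt_ext _ _ _ _ (proj1 Cn) (fun v _ => Ef (a, v))).
      rewrite (CInt_plus (fun v => csum (fun n => al n * cpow (INR n) (- s0) * cpow (INR n) (- (a, v))) N *
        (k (a, v) * cpow y (a, v) * / (a, v)))%C (fun v => c * window_fun (y / INR (S N)) (a, v))%C).
      2: now apply vcont_ex in Cn. 2: now apply vcont_ex in V2.
      rewrite (CInt_scal c (fun v => window_fun (y / INR (S N)) (a, v))).
      2: now apply vcont_ex.
      cbn [csum]. rewrite <- E. unfold window, vint, c. ring.
    + split. lra. intros v Hv. destruct Cn as [_ Cn]. destruct V2 as [_ V2].
      intros e He0. destruct (ccont_plus _ _ _ (Cn v Hv) (V2 v Hv) e He0) as [d [d0 Hd]].
      exists d. split; auto. intros w Hw. rewrite !Ef. now apply Hd.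
Qed.

(** Uniform convergence on the line allows term by term integration. The target [X] is free: it is a
    sharp partial sum in [truncate_main], and a single term in the proof that the degree is at least
    1. *)
Lemma truncate_limit X S N1 :
  (forall N, (N1 <= N)%nat -> Cmod (csum (fun n => al n * cpow (INR n) (- s0) * window (y / INR n))%C N - X) <= S) ->
  Cmod (vint (fun w => Phi w * (k w * cpow y w * / w))%C a (- H) H - X) <= S.
Proof.
  intros HS. destruct sqrt_ge8 as [M8 MM]. assert (B0 := window_bound_ge0). assert (Hpos : 0 < H) by (unfold H; lra).
  apply le_epsilon. intros e He0.
  (* A bound for [k(w) y^w / w] on [Re w = a]; the added 1 makes it positive. *)
  set (Bm := B * exp (a * ln y) * / a + 1).
  assert (Ia : 0 < / a) by (apply Rinv_0_lt_compat; lra).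
  assert (P2 := exp_pos (a * ln y)).
  assert (HBm : 0 < Bm).
  { unfold Bm. assert (0 <= B * exp (a * ln y) * / a). { apply Rmult_le_pos; [apply Rmult_le_pos|]; lra. } lra. }
  destruct (HP (e / (2 * H * Bm))) as [N0 HN0].
  { apply Rdiv_lt_0_compat; auto. apply Rmult_lt_0_compat; lra. }
  set (N := max N0 N1). specialize (HN0 N ltac:(unfold N; lia)). specialize (HS N ltac:(unfold N; lia)).
  destruct (trunc_series N) as [E Cn]. rewrite <- E in HS.
  set (fN := fun w => csum (fun n => al n * cpow (INR n) (- s0) * cpow (INR n) (- w))%C N) in *.
  set (g := fun w => (k w * cpow y w * / w)%C) in *.
  assert (Gc : forall v, - H <= v <= H -> ccont g (a, v)).
  { intros v Hv. apply cdiff_ccont. apply (window_fun_cdiff y); try (apply Rabs_le_sym; lra). left; lra. }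
  assert (Vp : vcont (fun w => Phi w * g w)%C a (- H) H).
  { split. lra. intros v Hv. assert (A1 := HPc v (Rabs_le_sym v H Hv)). assert (A2 := Gc v Hv).
    now apply ccont_mult. }
  assert (D : Cmod (vint (fun w => Phi w * g w)%C a (- H) H - vint (fun w => fN w * g w)%C a (- H) H) <= e).
  { assert (Vm : vcont (fun w => -1 * (fN w * g w))%C a (- H) H).
    { destruct Cn as [q1 q2]. split; auto. intros; apply (ccont_scal (-1)%C (fun w => fN w * g w)%C); auto. }
    replace (vint (fun w => Phi w * g w)%C a (- H) H - vint (fun w => fN w * g w)%C a (- H) H)%C
      with (Ci * CInt (fun v => (Phi (a, v) - fN (a, v)) * g (a, v)) (- H) H)%C.
    2:{ rewrite (CInt_ext _ (fun v => Phi (a, v) * g (a, v) + -1 * (fN (a, v) * g (a, v)))%C) by (try lra; intros; ring).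
        rewrite (CInt_plus (fun v => Phi (a, v) * g (a, v))%C (fun v => -1 * (fN (a, v) * g (a, v)))%C).
        2: now apply vcont_ex in Vp. 2: now apply vcont_ex in Vm.
        rewrite (CInt_scal (-1)%C (fun v => fN (a, v) * g (a, v))%C).
        2: now apply vcont_ex in Cn. unfold vint. ring. }
    rewrite Cmod_mult, Cmod_Ci, Rmult_1_l.
    eapply Rle_trans. apply (CInt_bound _ (- H) H (e / (2 * H * Bm) * Bm)). lra.
    { apply ex_CInt_ext with (fun v => Phi (a, v) * g (a, v) + -1 * (fN (a, v) * g (a, v)))%C. lra. intros; ring.
      apply ex_CInt_plus. now apply vcont_ex in Vp. now apply vcont_ex in Vm. }
    { intros v Hv. rewrite Cmod_mult. assert (Hv' := Rabs_le_sym v H Hv).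
      apply Rmult_le_compat; try apply Cmod_ge_0. now apply HN0.
      unfold g. assert (Wn : (a, v) <> RtoC 0) by (apply pt_neq0; left; lra).
      rewrite !Cmod_mult, Cmod_inv, Cmod_cpow_exp by auto.
      assert (K1 : Cmod (k (a, v)) <= B).
      { eapply Rle_trans. apply Hb; auto. apply Rabs_le_sym; lra. rewrite <- (Rmult_1_r B) at 2.
        apply Rmult_le_compat_l; auto. rewrite <- Rinv_1. apply Rinv_le_contravar. lra.
        assert (0 <= v ^ 2 / t). { apply Rmult_le_pos. apply pow2_ge_0. left; apply Rinv_0_lt_compat; lra. } lra. }
      assert (K2 : / Cmod (a, v) <= / a).
      { apply Rinv_le_contravar. lra. eapply Rle_trans. 2: apply (proj1 (Cmod_pt_ge a v)). apply Rle_abs. }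
      assert (0 < / Cmod (a, v)) by (apply Rinv_0_lt_compat; now apply Cmod_gt_0).
      unfold Bm. assert (Cmod (k (a, v)) * exp (a * ln y) * / Cmod (a, v) <= B * exp (a * ln y) * / a); [|lra].
      assert (K0 := Cmod_ge_0 (k (a, v))).
      apply Rmult_le_compat; try lra. apply Rmult_le_pos; lra. apply Rmult_le_compat_r; lra. }
    right. field. lra. }
  change (Cmod (vint (fun w => Phi w * g w)%C a (- H) H - X) <= S + e).
  change (Cmod (vint (fun w => fN w * g w)%C a (- H) H - X) <= S) in HS.
  set (V1 := vint (fun w => Phi w * g w)%C a (- H) H) in *.
  set (V2 := vint (fun w => fN w * g w)%C a (- H) H) in *.
  replace (V1 - X)%C with ((V1 - V2) + (V2 - X))%C by ring.
  eapply Rle_trans. apply Cmod_triangle. lra.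
Qed.

End Truncate.

End Window.

Lemma floor_spec (y : R) (n : nat) : 0 < y -> (1 <= n)%nat ->
  (n <= Z.to_nat (Int_part y))%nat <-> INR n <= y.
Proof.
  intros Hy Hn. destruct (base_Int_part y) as [B1 B2].
  assert (P : (0 <= Int_part y)%Z).
  { apply Z.lt_succ_r. apply lt_IZR. unfold Z.succ. rewrite plus_IZR. simpl. lra. }
  split; intros H.
  - apply Rle_trans with (INR (Z.to_nat (Int_part y))). now apply le_INR.
    rewrite INR_IZR_INZ, Z2Nat.id; auto.
  - apply Nat2Z.inj_le. rewrite Z2Nat.id by auto. apply Z.lt_succ_r. apply lt_IZR.
    unfold Z.succ. rewrite plus_IZR, <- INR_IZR_INZ. simpl. lra.
Qed.

Lemma csum_indicator (f : nat -> C) (y : R) (N : nat) : 0 < y -> (Z.to_nat (Int_part y) <= N)%nat ->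
  csum (fun n => if Rle_dec 1 (y / INR n) then f n else 0)%C N = csum f (Z.to_nat (Int_part y)).
Proof.
  intros Hy. set (m := Z.to_nat (Int_part y)). intros HN.
  assert (E : forall n, (1 <= n)%nat -> (1 <= y / INR n <-> (n <= m)%nat)).
  { intros n Hn. unfold m. rewrite floor_spec by auto. assert (0 < INR n) by (apply (lt_INR 0); lia). split; intros L.
    - apply Rmult_le_compat_r with (r := INR n) in L; [|lra]. replace (y / INR n * INR n) with y in L by (field; lra). lra.
    - apply Rmult_le_reg_r with (INR n); auto. replace (y / INR n * INR n) with y by (field; lra). lra. }
  replace N with (m + (N - m))%nat by lia. induction (N - m)%nat as [|d IH].
  - rewrite Nat.add_0_r. apply csum_ext. intros n Hn. destruct (Rle_dec 1 (y / INR n)) as [L|L]; auto.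
    exfalso. apply L. apply E; lia.
  - rewrite Nat.add_succ_r. cbn [csum]. rewrite IH.
    destruct (Rle_dec 1 (y / INR (S (m + d)))) as [L|L]. apply E in L; lia. ring.
Qed.

(** The line is placed where [s0 + w] has real part [1 + 2 dl], in the region of absolute
    convergence. The peaks are summed against coefficients [O(n^dl)]; the edge errors carry
    [exp (- t)] and are summed by the absolutely convergent series, bounded by [A]. *)
Lemma truncate_main (t a B : R) (k : C -> C) (al : nat -> C) (s0 : C) (y dl Ka A : R) (Phi : C -> C) :
  let M := sqrt t in let H := t / 2 in
  64 <= t -> 0 < a <= 3 -> a = 1 + 2 * dl - Re s0 -> Rabs (dl - Re s0) <= 3 -> 0 < y ->
  (forall u v, Rabs u <= M -> Rabs v <= H -> cdiff k (u, v)) ->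
  (forall u v, Rabs u <= M -> Rabs v <= H -> Cmod (k (u, v)) <= B * / (1 + v ^ 2 / t)) ->
  (forall u v, Rabs u <= M -> Rabs v = H -> Cmod (k (u, v)) <= B * exp (- t)) ->
  (forall v, Rabs v <= H -> ccont Phi (a, v)) ->
  (forall e, 0 < e -> exists N0, forall N, (N0 <= N)%nat -> forall v, Rabs v <= H ->
    Cmod (Phi (a, v) - csum (fun n => al n * cpow (INR n) (- s0) * cpow (INR n) (- (a, v)))%C N) <= e) ->
  0 <= Ka -> (forall n, (1 <= n)%nat -> Cmod (al n) <= Ka * Rpower (INR n) dl) ->
  (forall N, rsum (fun n => Cmod (al n) * Rpower (INR n) (- (1 + 2 * dl))) N <= A) ->
  Cmod (vint (fun w => Phi w * (k w * cpow y w * / w))%C a (- H) H -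
    kappa * k 0 * csum (fun n => al n * cpow (INR n) (- s0))%C (Z.to_nat (Int_part y)))
  <= 4 * B * (6 * Ka * Rpower y (dl - Re s0) * (1 + y / M) + exp (- t) * Rpower y a * A).
Proof.
  intros M H Ht Ha Ea Hd Hy Hk Hb He HPc HP HK Hal HA.
  destruct (sqrt_ge8 t Ht) as [M8 MM]. fold M in M8, MM.
  assert (B0 := window_bound_ge0 t B k Ht Hb).
  apply (truncate_limit t a B k Ht Ha Hk Hb al s0 y Phi Hy HPc HP _ _ (Z.to_nat (Int_part y))).
  intros N HN. rewrite <- csum_scal, <- (csum_indicator _ y N) by auto.
  rewrite <- csum_minus.
  apply Rle_trans with (rsum (fun n => 4 * B * (Ka * (Rpower (INR n) (dl - Re s0) * peak M y n) +
    exp (- t) * Rpower y a * (Cmod (al n) * Rpower (INR n) (- (1 + 2 * dl))))) N).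
  - apply csum_bound. intros n Hn. assert (n0 : 0 < INR n) by (apply (lt_INR 0); lia).
    assert (W := window_value t a B k Ht Ha Hk Hb He (y / INR n) ltac:(now apply Rdiv_lt_0_compat)).
    set (x := y / INR n) in *. set (c := (al n * cpow (INR n) (- s0))%C).
    replace (c * window t a k x - (if Rle_dec 1 x then kappa * k 0 * c else 0))%C with
      (c * (window t a k x - (if Rle_dec 1 x then kappa * k 0 else 0)))%C.
    2:{ destruct (Rle_dec 1 x); ring. }
    rewrite Cmod_mult.
    assert (Ec : Cmod c = Cmod (al n) * Rpower (INR n) (- Re s0)).
    { unfold c. rewrite Cmod_mult, Cmod_cpow, re_opp. reflexivity. }
    assert (El : ln x = ln y - ln (INR n)) by (unfold x; apply ln_div; auto).
    fold M in W.
    assert (P1 : exp (- M * Rabs (ln x)) = peak M y n) by (unfold peak; now rewrite El).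
    rewrite P1 in W.
    assert (P2 : Rpower (INR n) (- Re s0) * exp (a * ln x) = Rpower y a * Rpower (INR n) (- (1 + 2 * dl))).
    { unfold Rpower. rewrite <- !exp_plus. f_equal. rewrite El, Ea. ring. }
    assert (P3 : Rpower (INR n) dl * Rpower (INR n) (- Re s0) = Rpower (INR n) (dl - Re s0)).
    { rewrite <- Rpower_plus. reflexivity. }
    assert (pk : 0 < peak M y n) by apply exp_pos.
    assert (rp : 0 < Rpower (INR n) (- Re s0)) by apply exp_pos.
    rewrite Ec. eapply Rle_trans. apply Rmult_le_compat_l. 2: exact W.
    { apply Rmult_le_pos. apply Cmod_ge_0. lra. }
    replace (Cmod (al n) * Rpower (INR n) (- Re s0) * (4 * B * (peak M y n + exp (- t) * exp (a * ln x)))) with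
      (4 * B * ((Cmod (al n) * Rpower (INR n) (- Re s0)) * peak M y n +
        exp (- t) * Cmod (al n) * (Rpower (INR n) (- Re s0) * exp (a * ln x)))) by ring.
    rewrite P2. apply Rmult_le_compat_l. lra. apply Rplus_le_compat. 2: right; ring.
    rewrite <- P3, <- !Rmult_assoc. apply Rmult_le_compat_r. lra. apply Rmult_le_compat_r. lra. apply Hal; lia.
  - rewrite rsum_scal, rsum_plus, !rsum_scal. apply Rmult_le_compat_l. lra. apply Rplus_le_compat.
    + replace (6 * Ka * Rpower y (dl - Re s0) * (1 + y / M)) with (Ka * (6 * Rpower y (dl - Re s0) * (1 + y / M))) by ring.
      apply Rmult_le_compat_l; auto. now apply weighted_peak_sum.
    + apply Rmult_le_compat_l; auto. apply Rmult_le_pos; left; apply exp_pos.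
Qed.

(** * The kernel *)

Lemma bernoulli_sub (r : R) (m : nat) : 1 <= r -> r ^ S m - INR (S m) * r ^ m <= (r - 1) ^ S m.
Proof.
  intros Hr. induction m.
  - simpl. lra.
  - assert (P : 0 <= r ^ m) by (apply pow_le; lra).
    change ((r - 1) ^ S (S m)) with ((r - 1) * (r - 1) ^ S m).
    apply Rle_trans with ((r - 1) * (r ^ S m - INR (S m) * r ^ m)). 2: apply Rmult_le_compat_l; lra.
    rewrite (S_INR (S m)). assert (0 <= INR (S m)) by apply pos_INR. simpl pow.
    set (q := r ^ m) in *. set (n := INR (S m)) in *.
    assert (0 <= n * q) by (now apply Rmult_le_pos).
    replace ((r - 1) * (r * q - n * q)) with (r * (r * q) - (n + 1) * (r * q) + n * q) by ring. lra.
Qed.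

(** With [n = 2 (j + 1)] and [|x| <= 1], the power [(y - i x)^n] differs from [y^n] by at most
    [n (1 + |y|)^(n - 1)]; for large [|y|] the nonnegative [y^n] dominates this and [c (1 + |y|)^j]
    together. *)
Lemma power_axis_lower (c : R) (j : nat) : 0 <= c -> exists m C1, forall x y : R, Rabs x <= 1 ->
  c * (1 + Rabs y) ^ j - C1 <= Re ((y, (- x)%R) ^ (2 * S m))%C.
Proof.
  intros Hc. exists j. set (m := (2 * j + 1)%nat).
  replace (2 * S j)%nat with (S m) by (unfold m; lia).
  (* With [r = 1 + |y|] it remains to see that [r^m (r - b) >= - b^(m + 1)], where the left side is
     negative only for [r < b]. *)
  set (b := 2 * INR (S m) + c). exists (b ^ S m). intros x y Hx.
  set (r := 1 + Rabs y). assert (A := Rabs_pos y). assert (r1 : 1 <= r) by (unfold r; lra).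
  assert (D : Cmod ((y, (- x)%R) ^ S m - (RtoC y) ^ S m) <= INR (S m) * r ^ m).
  { eapply Rle_trans.
    - apply (segment_mean_value (fun z => z ^ S m)%C (fun z => INR (S m) * z ^ m)%C _ _ (INR (S m) * r ^ m)).
      + intros v Hv. apply cder_pow.
      + intros v Hv. rewrite Cmod_mult, Cmod_R, Cmod_pow, (Rabs_right (INR (S m))) by (apply Rle_ge, pos_INR).
        apply Rmult_le_compat_l. apply pos_INR. apply pow_incr. split. apply Cmod_ge_0.
        eapply Rle_trans. apply Cmod_le_sum.
        replace (Re (RtoC y + RtoC v * ((y, (- x)%R) - RtoC y))) with y by (unfold Re, RtoC, Cplus, Cmult, Cminus, Copp; simpl; ring).
        replace (Im (RtoC y + RtoC v * ((y, (- x)%R) - RtoC y))) with (- (v * x)) by (unfold Im, RtoC, Cplus, Cmult, Cminus, Copp; simpl; ring).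
        rewrite Rabs_Ropp, Rabs_mult, (Rabs_right v) by lra. unfold r. assert (X := Rabs_pos x). nra.
    - rewrite <- (Rmult_1_r (INR (S m) * r ^ m)) at 2. apply Rmult_le_compat_l.
      apply Rmult_le_pos. apply pos_INR. apply pow_le; lra.
      replace ((y, (- x)%R) - RtoC y)%C with (- (Ci * RtoC x))%C.
      rewrite Cmod_opp, Cmod_mult, Cmod_Ci, Cmod_R. lra.
      unfold Ci, RtoC, Cmult, Cminus, Cplus, Copp; simpl. f_equal; ring. }
  assert (Ey : Re ((RtoC y) ^ S m) = (r - 1) ^ S m).
  { rewrite <- RtoC_pow, re_RtoC. unfold r. replace (1 + Rabs y - 1) with (Rabs y) by ring.
    rewrite RPow_abs. rewrite Rabs_right; auto.
    unfold m. replace (S (2 * j + 1)) with (2 * S j)%nat by lia. rewrite pow_mult.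
    apply Rle_ge, pow_le, pow2_ge_0. }
  assert (L : Re ((RtoC y) ^ S m) - INR (S m) * r ^ m <= Re ((y, (- x)%R) ^ S m)).
  { assert (Q := re_le_Cmod ((y, (- x)%R) ^ S m - RtoC y ^ S m)). unfold Cminus in Q at 1. rewrite re_plus, re_opp in Q.
    apply Rabs_le_between in Q. lra. }
  rewrite Ey in L. assert (Be := bernoulli_sub r m r1).
  assert (Rj : r ^ j <= r ^ m) by (apply Rle_pow; auto; unfold m; lia).
  assert (Cj : c * r ^ j <= c * r ^ m) by now apply Rmult_le_compat_l.
  assert (b0 : 0 <= b) by (unfold b; generalize (pos_INR (S m)); lra).
  assert (G : - b ^ S m <= r ^ m * (r - b)).
  { assert (P : 0 <= r ^ m) by (apply pow_le; lra).
    destruct (Rle_lt_dec b r) as [Q|Q].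
    - assert (0 <= b ^ S m) by now apply pow_le. assert (0 <= r ^ m * (r - b)) by (apply Rmult_le_pos; lra). lra.
    - assert (P2 : r ^ m <= b ^ m) by (apply pow_incr; lra). simpl pow. nra. }
  assert (r ^ m * (r - b) = r ^ S m - 2 * (INR (S m) * r ^ m) - c * r ^ m) by (unfold b; simpl pow; ring).
  lra.
Qed.

(* On the imaginary axis this is [exp (- (v / sqrt t) ^ n)]. For even [n] that decay
   persists on [|Re w| <= sqrt t], and for large [n] it beats the finite-order
   growth of [F] on the edges [|v| = t / 2]. *)
Definition kern (n : nat) (t : R) (w : C) : C := Cexp (- ((- Ci * w * / sqrt t) ^ n))%C.

Lemma kern_arg t u v : 0 < t -> (- Ci * (u, v) * / sqrt t)%C = ((v / sqrt t, - (u / sqrt t)) : C).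
Proof.
  intros Ht. assert (0 < sqrt t) by now apply sqrt_lt_R0.
  rewrite <- RtoC_inv by lra. unfold Ci, RtoC, Cmult, Copp; simpl. f_equal; unfold Rdiv; ring.
Qed.

Lemma kern_cdiff n t w : cdiff (kern n t) w.
Proof.
  apply (cdiff_comp Cexp (fun w => - ((- Ci * w * / sqrt t) ^ n))%C). eexists; apply cder_Cexp.
  apply (cdiff_opp (fun w => (- Ci * w * / sqrt t) ^ n)%C). apply cdiff_pow.
  apply (cdiff_mult (fun w => - Ci * w)%C). apply cdiff_mult. apply cdiff_const. apply cdiff_id. apply cdiff_const.
Qed.

Lemma kern_0 m t : kern (S m) t 0 = RtoC 1.
Proof.
  unfold kern. rewrite <- Cexp_0. f_equal. simpl Cpow. ring.
Qed.

Definition decay_r (t v : R) : R := 1 + Rabs v / sqrt t.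

Lemma decay_r_ge1 t v : 0 < t -> 1 <= decay_r t v.
Proof.
  intros Ht. unfold decay_r. assert (0 <= Rabs v / sqrt t).
  { apply Rmult_le_pos. apply Rabs_pos. left; apply Rinv_0_lt_compat. now apply sqrt_lt_R0. } lra.
Qed.

Lemma kern_bound (c : R) (j : nat) : 0 <= c -> exists m C1, forall t u v, 0 < t -> Rabs u <= sqrt t ->
  Cmod (kern (2 * S m) t (u, v)) <= exp C1 * exp (- c * decay_r t v ^ j).
Proof.
  intros Hc. destruct (power_axis_lower c j Hc) as [m [C1 H]]. exists m, C1. intros t u v Ht Hu.
  assert (q0 : 0 < sqrt t) by now apply sqrt_lt_R0.
  unfold kern. rewrite Cmod_Cexp, re_opp, kern_arg by auto. rewrite <- exp_plus. apply exp_le.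
  assert (Hx : Rabs (u / sqrt t) <= 1).
  { unfold Rdiv. rewrite Rabs_mult, (Rabs_right (/ sqrt t)). 2: apply Rle_ge; left; now apply Rinv_0_lt_compat.
    apply Rmult_le_reg_r with (sqrt t); auto. rewrite Rmult_assoc, Rinv_l; lra. }
  specialize (H (u / sqrt t) (v / sqrt t) Hx). unfold decay_r.
  replace (Rabs v / sqrt t) with (Rabs (v / sqrt t)). lra.
  unfold Rdiv. rewrite Rabs_mult, (Rabs_right (/ sqrt t)); auto. apply Rle_ge; left; now apply Rinv_0_lt_compat.
Qed.

Lemma decay_r_sq t v : 0 < t -> 1 + v ^ 2 / t <= decay_r t v ^ 2.
Proof.
  intros Ht. assert (q0 : 0 < sqrt t) by now apply sqrt_lt_R0.
  assert (E : v ^ 2 / t = (Rabs v / sqrt t) ^ 2).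
  { unfold Rdiv. rewrite Rpow_mult_distr, pow2_abs, pow_inv. f_equal. f_equal. rewrite pow2_sqrt; lra. }
  unfold decay_r. rewrite E. assert (0 <= Rabs v / sqrt t).
  { apply Rmult_le_pos. apply Rabs_pos. left; now apply Rinv_0_lt_compat. } nra.
Qed.

Lemma decay_cauchy t v : 0 < t -> exp (- 5 * decay_r t v ^ 2) <= / (1 + v ^ 2 / t).
Proof.
  intros Ht. assert (Q := decay_r_sq t v Ht). assert (0 <= v ^ 2 / t).
  { apply Rmult_le_pos. apply pow2_ge_0. left; now apply Rinv_0_lt_compat. }
  replace (- 5 * decay_r t v ^ 2) with (- (5 * decay_r t v ^ 2)) by ring. rewrite exp_Ropp.
  apply Rinv_le_contravar. lra. generalize (exp_ineq1_le (5 * decay_r t v ^ 2)). nra.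
Qed.

(** On the edges [r^2 >= 1 + t / 4], so the rate 5 is ample for [exp (- t)]; the inequality
    [t <= 4 r^2] serves to express the growth of [F] there in terms of [r]. *)
Lemma decay_edge t v : 0 < t -> Rabs v = t / 2 -> exp (- 5 * decay_r t v ^ 2) <= exp (- t) /\ t <= 4 * decay_r t v ^ 2.
Proof.
  intros Ht Hv. assert (Q := decay_r_sq t v Ht).
  assert (E : v ^ 2 / t = t / 4). { rewrite <- pow2_abs, Hv. field. lra. }
  rewrite E in Q. split. apply exp_le. nra. lra.
Qed.

(** Since [|z - 1| >= 1] here, dividing the continuation by [(z - 1)^k] does not increase the
    modulus. The order is rounded up to a natural number to be matched by integer powers in the
    kernel. *)
Lemma selberg_growth (F : selberg_class) : exists T K A, 1 <= T /\ 0 <= K /\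
  forall z, T <= Rabs (Im z) -> Cmod (F z) <= K * exp (Cmod z ^ A).
Proof.
  destruct (sel_continuation F) as [k [G [_ [[A [K [r [r0 HG]]]] HF]]]].
  destruct (big_nat A) as [n [_ Hn]].
  exists (Rmax 1 r), (Rabs K), n. split. apply Rmax_l. split. apply Rabs_pos.
  intros z Hz. assert (z1 : 1 <= Rabs (Im z)) by (eapply Rle_trans; [apply Rmax_l|exact Hz]).
  assert (z2 : r <= Rabs (Im z)) by (eapply Rle_trans; [apply Rmax_r|exact Hz]).
  assert (I := Im_le_Cmod z).
  assert (N : z <> RtoC 1). { intros E. rewrite E, im_RtoC, Rabs_R0 in z1. lra. }
  specialize (HF z N). specialize (HG z ltac:(lra)). rewrite HF, Cmod_mult, Cmod_pow in HG.
  assert (L : 1 <= Cmod (z - 1)).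
  { eapply Rle_trans. exact z1. eapply Rle_trans. 2: apply Im_le_Cmod.
    unfold Cminus. rewrite im_plus, im_opp, im_RtoC. rewrite Ropp_0, Rplus_0_r. lra. }
  assert (P : 1 <= Cmod (z - 1) ^ k) by now apply pow_R1_Rle.
  assert (Fz := Cmod_ge_0 (F z)).
  apply Rle_trans with (Cmod (z - 1) ^ k * Cmod (F z)). nra. eapply Rle_trans. exact HG.
  assert (E1 : exp (Rpower (Cmod z) A) <= exp (Cmod z ^ n)).
  { apply exp_le. rewrite <- Rpower_pow by lra. apply Rle_Rpower; lra. }
  assert (E0 := exp_pos (Rpower (Cmod z) A)).
  apply Rle_trans with (Rabs K * exp (Rpower (Cmod z) A)).
  apply Rmult_le_compat_r. lra. apply Rle_abs. apply Rmult_le_compat_l; auto. apply Rabs_pos.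
Qed.

Lemma dirichlet_sum_eq (a : nat -> C) (z : C) (N : nat) :
  @sum_n C_AbelianMonoid (dirichlet_term a z) N = csum (fun n => a n * cpow (INR n) (- z))%C (S N).
Proof.
  induction N. rewrite sum_O. cbn [csum]. unfold dirichlet_term. now rewrite Cplus_0_l.
  rewrite sum_Sn, IHN. reflexivity.
Qed.

Lemma Cmod_dirichlet_term a z k : Cmod (dirichlet_term a z k) = Cmod (a (S k)) * Rpower (INR (S k)) (- Re z).
Proof. unfold dirichlet_term. now rewrite Cmod_mult, Cmod_cpow, re_opp. Qed.

(** On the line [Re z = s1] every tail is dominated by that of the series of moduli, which does not
    depend on [Im z]. *)
Lemma series_uniform (F : selberg_class) (s1 : R) : 1 < s1 -> exists A,
  (forall N, rsum (fun n => Cmod (sel_a F n) * Rpower (INR n) (- s1)) N <= A) /\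
  forall e, 0 < e -> exists N0, forall N, (N0 <= N)%nat -> forall z, Re z = s1 ->
    Cmod (F z - csum (fun n => sel_a F n * cpow (INR n) (- z))%C N) <= e.
Proof.
  intros Hs. destruct (sel_abs_cv F (RtoC s1)) as [A HA]. now rewrite re_RtoC.
  set (g := fun n => Cmod (sel_a F n) * Rpower (INR n) (- s1)).
  assert (E : forall N, sum_n (fun k => Cmod (dirichlet_term (sel_a F) (RtoC s1) k)) N = rsum g (S N)).
  { induction N. rewrite sum_O, Cmod_dirichlet_term, re_RtoC. cbn [rsum]. rewrite Rplus_0_l. reflexivity.
    rewrite sum_Sn, IHN, Cmod_dirichlet_term, re_RtoC. reflexivity. }
  assert (L : is_lim_seq (fun N => rsum g (S N)) A).
  { apply is_lim_seq_ext with (2 := HA). exact E. }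
  assert (g0 : forall n, 0 <= g n).
  { intros n. apply Rmult_le_pos. apply Cmod_ge_0. left; apply exp_pos. }
  assert (Le : forall N, rsum g N <= A).
  { assert (U := is_lim_seq_incr_compare _ _ L). intros N. apply Rle_trans with (rsum g (S N)).
    cbn [rsum]. generalize (g0 (S N)); lra. apply U. intros n. cbn [rsum]. generalize (g0 (S (S n))); lra. }
  exists A. split; auto. intros e He.
  apply is_lim_seq_spec in L. destruct (L (mkposreal e He)) as [N0 HN0]. exists (S N0).
  intros N HN z Hz. destruct N as [|N]. lia. specialize (HN0 N ltac:(lia)). simpl pos in HN0.
  assert (Dif : forall m, Cmod (csum (fun n => sel_a F n * cpow (INR n) (- z))%C (S N + m) -
     csum (fun n => sel_a F n * cpow (INR n) (- z))%C (S N)) <= rsum g (S N + m) - rsum g (S N)).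
  { induction m. rewrite Nat.add_0_r, Rminus_diag. replace (_ - _)%C with (RtoC 0) by ring. rewrite Cmod_0; lra.
    rewrite Nat.add_succ_r. cbn [csum rsum].
    set (x := csum (fun n => sel_a F n * cpow (INR n) (- z))%C (S N + m)) in *.
    set (c := (sel_a F (S (S N + m)) * cpow (INR (S (S N + m))) (- z))%C).
    change (csum (fun n => sel_a F n * cpow (INR n) (- z))%C N + sel_a F (S N) * cpow (INR (S N)) (- z))%C
      with (csum (fun n => sel_a F n * cpow (INR n) (- z))%C (S N)).
    change (rsum g N + g (S N)) with (rsum g (S N)).
    set (y := csum (fun n => sel_a F n * cpow (INR n) (- z))%C (S N)) in *.
    replace (x + c - y)%C with ((x - y) + c)%C by ring.
    eapply Rle_trans. apply Cmod_triangle.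
    assert (Ec : Cmod c = g (S (S N + m))). { unfold c, g. now rewrite Cmod_mult, Cmod_cpow, re_opp, Hz. }
    rewrite Ec. lra. }
  assert (Tail : forall m, Cmod (csum (fun n => sel_a F n * cpow (INR n) (- z))%C (S N + m) -
     csum (fun n => sel_a F n * cpow (INR n) (- z))%C (S N)) <= e).
  { intros m. eapply Rle_trans. apply Dif. apply Rabs_lt_between in HN0. generalize (Le (S N + m)%nat). lra. }
  assert (Ser := sel_series F z ltac:(lra)).
  apply le_epsilon. intros e1 He1.
  destruct (Ser (fun w => @ball C_UniformSpace (F z) (e1 / 2) w)) as [N1 HN1].
  { exists (mkposreal (e1 / 2) ltac:(lra)). intros w Hw. exact Hw. }
  specialize (HN1 (N + N1)%nat ltac:(lia)).
  rewrite dirichlet_sum_eq in HN1. destruct HN1 as [B1 B2].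
  specialize (Tail N1). change (S N + N1)%nat with (S (N + N1)) in Tail.
  set (x := csum (fun n => sel_a F n * cpow (INR n) (- z))%C (S (N + N1))) in *.
  set (y := csum (fun n => sel_a F n * cpow (INR n) (- z))%C (S N)) in *.
  replace (F z - y)%C with ((F z - x) + (x - y))%C by ring.
  eapply Rle_trans. apply Cmod_triangle.
  assert (Cmod (F z - x) <= e1); [|lra].
  rewrite Cmod_minus_sym. eapply Rle_trans. apply Cmod_le_sum.
  change (Rabs (fst x - fst (F z)) < e1 / 2) in B1. change (Rabs (snd x - snd (F z)) < e1 / 2) in B2.
  change (Re (x - F z)) with (fst x - fst (F z)). change (Im (x - F z)) with (snd x - snd (F z)). lra.
Qed.

(** * The smoothed approximate functional equation *)

Lemma sum_pos (f : nat -> R) q : (1 <= q)%nat -> (forall j, (1 <= j <= q)%nat -> 0 < f j) -> 0 < sum_n_m f 1 q.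
Proof.
  intros Hq. induction Hq as [|q Hq IH]; intros H.
  - rewrite sum_n_n. apply H. lia.
  - rewrite sum_n_Sm by lia. change (@plus R_AbelianMonoid) with Rplus.
    assert (0 < sum_n_m f 1 q) by (apply IH; intros; apply H; lia).
    assert (0 < f (S q)) by (apply H; lia). lra.
Qed.

Lemma degree_pos (F : selberg_class) : 0 < degree F.
Proof.
  unfold degree. assert (0 < sum_n_m (sel_lambda F) 1 (sel_q F)); [|lra].
  apply sum_pos. apply sel_q_ge1. apply sel_lambda_gt0.
Qed.

Lemma ln_ratio_bound (x t w : R) : 0 < t -> Rabs (x - t) <= w -> w <= t / 2 -> Rabs (ln x - ln t) <= 2 * w / t.
Proof.
  intros Ht Hx Hw. apply Rabs_le_between in Hx. assert (x0 : 0 < x) by lra.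
  rewrite <- ln_div by auto. set (q := x / t). assert (Iq : 0 < / t) by now apply Rinv_0_lt_compat.
  assert (q0 : 0 < q) by now apply Rdiv_lt_0_compat.
  assert (q1 : - (w / t) <= q - 1 <= w / t).
  { unfold q. replace (x / t - 1) with ((x - t) / t) by (field; lra). unfold Rdiv. split; nra. }
  assert (q2 : w / t <= 1 / 2).
  { apply Rmult_le_reg_r with t; auto. unfold Rdiv. rewrite Rmult_assoc, Rinv_l; lra. }
  assert (L1 := ln_le_sub1 q q0). assert (L2 := ln_le_sub1 (/ q) ltac:(now apply Rinv_0_lt_compat)).
  rewrite ln_Rinv in L2 by auto.
  assert (E3 : / q - 1 = (1 - q) * / q) by (field; lra).
  assert (0 < / q <= 2). { split. now apply Rinv_0_lt_compat. replace 2 with (/ (1 / 2)) by field. apply Rinv_le_contravar; lra. }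
  replace (2 * w / t) with (2 * (w / t)) by (field; lra).
  apply Rabs_le. split; nra.
Qed.

Lemma F_cdiff (F : selberg_class) (z : C) : Im z <> 0 -> cdiff F z.
Proof.
  intros Hz. destruct (sel_continuation F) as [n [G [HG [_ HF]]]].
  assert (N : forall w, Im w <> 0 -> (w - 1)%C <> RtoC 0).
  { intros w Hw E. apply Hw. assert (X := f_equal Im E). unfold Cminus in X.
    rewrite im_plus, im_opp, !im_RtoC in X. lra. }
  destruct (HG z) as [l Hl]. apply cder_is_derive in Hl.
  assert (C : cdiff (fun w => G w * / (w - 1) ^ n)%C z).
  { apply cdiff_mult. now exists l. apply (cdiff_inv (fun w => (w - 1) ^ n)%C). apply Cpow_nz. now apply N.
    apply cdiff_pow. apply cdiff_minus. apply cdiff_id. apply cdiff_const. }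
  destruct C as [m Hm]. exists m. apply cder_ext_loc with (3 := Hm) (r := Rabs (Im z)). now apply Rabs_pos_lt.
  intros w Hw. assert (Iw : Im w <> 0).
  { intros E. assert (Q := Im_le_Cmod (w - z)). change (Im (w - z)) with (Im w - Im z) in Q. rewrite E in Q.
    rewrite Rminus_0_l, Rabs_Ropp in Q. lra. }
  assert (W1 : w <> RtoC 1). { intros E. apply Iw. rewrite E. apply im_RtoC. }
  rewrite (HF w W1). field. apply Cpow_nz. now apply N.
Qed.

Lemma CInt_reflect (g : R -> C) (h : R) : ex_CInt g (- h) h ->
  CInt (fun v => g (- v)) (- h) h = CInt g (- h) h.
Proof.
  intros Hg. assert (K := CInt_correct _ _ _ Hg). apply CInt_unique.
  apply (@is_RInt_swap C_R_NormedModule) in K.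
  replace h with (-1 * (- h) + 0) in K at 1 by ring. replace (- h) with (-1 * h + 0) in K at 2 by ring.
  apply (@is_RInt_comp_lin C_R_NormedModule) in K.
  apply (@is_RInt_opp C_R_NormedModule) in K. rewrite (@opp_opp C_R_NormedModule) in K.
  revert K. apply (@is_RInt_ext C_R_NormedModule). intros x _.
  replace (-1 * x + 0) with (- x) by ring.
  destruct (g (- x)) as [p q]. apply injective_projections; simpl; unfold scal, opp, mult; simpl; unfold mult; simpl; ring.
Qed.

Lemma rsum_eq f g N : (forall n, f n = g n) -> rsum f N = rsum g N.
Proof. intros E. induction N; simpl; auto. now rewrite IHN, E. Qed.

Section AFE.

Variable F : selberg_class.
Variables (T1 K1 TG KG : R) (AG : nat) (dl c2 : R).
Hypotheses (HT1 : 1 <= T1) (HK1 : 0 <= K1) (HTG : 1 <= TG) (HKG : 0 <= KG) (Hdl : 0 < dl <= 1 / 4) (Hc2 : 0 <= c2).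
Hypothesis Hchi : forall s, T1 <= Rabs (Im s) ->
  chi F s <> RtoC 0 /\
  (exists l, cder (chi F) s (chi F s * l)%C /\
    Cmod (l + log_conductor_at F (Rabs (Im s))) <= K1 * (Rabs (Re s) + 1) / Rabs (Im s)) /\
  F s = (chi F s * Cconj (F (1 - Cconj s)))%C /\
  (Re s = 1 / 2 -> Cmod (chi F s) = 1).
Hypothesis Hgrow : forall z, TG <= Rabs (Im z) -> Cmod (F z) <= KG * exp (Cmod z ^ AG).

(** [6 * K1] comes from the error in [chi' / chi], [c2] from the deviation of [ln D] from
    [log_conductor_at], and [2 * degree F] from the variation of [ln |Im|] along the segment. *)
Definition ratio_const : R := 6 * K1 + c2 + 2 * degree F.

Lemma ratio_const_pos : 0 <= ratio_const.
Proof. unfold ratio_const. generalize (degree_pos F). lra. Qed.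

(** Gronwall's inequality for [chi (s + z) D^z] on the segment from 0 to [w]: in its logarithmic
    derivative [chi' / chi + ln D] the main terms cancel and [O((1 + |w|) / t)] remains.
    [|Im w| <= t / 2] keeps the segment where [chi] is controlled. *)
Lemma ratio_bound (s w : C) (D : R) : let t := Rabs (Im s) in
  2 * T1 <= t -> Rabs (Re s) <= 2 -> Rabs (ln D - log_conductor_at F t) <= c2 / t -> Rabs (Im w) <= t / 2 ->
  Cmod (chi F (s + w) * cpow D w) <= Cmod (chi F s) * exp (ratio_const * (1 + Cmod w) * Cmod w / t).
Proof.
  intros t Ht Hs HD Hw. assert (t0 : 0 < t) by lra.
  set (f := fun z => (chi F (s + z) * cpow D z)%C).
  set (l := fun z => (C_derive (chi F) (s + z) / chi F (s + z) + ln D)%C).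
  assert (Seg : forall x, 0 <= x <= 1 -> let z := (0 + RtoC x * (w - 0))%C in
    Rabs (Re (s + z)) <= 2 + Cmod w /\ Rabs (Rabs (Im (s + z)) - t) <= Rabs (Im w)).
  { intros x Hx z. unfold z. replace (0 + RtoC x * (w - 0))%C with (RtoC x * w)%C by ring.
    rewrite re_plus, re_scal_l, im_plus, im_scal_l. assert (R1 := re_le_Cmod w). split.
    - eapply Rle_trans. apply Rabs_triang. rewrite Rabs_mult, (Rabs_right x) by lra.
      assert (P := Rabs_pos (Re w)). nra.
    - eapply Rle_trans. apply Rabs_triang_inv2. replace (Im s + x * Im w - Im s) with (x * Im w) by ring.
      rewrite Rabs_mult, (Rabs_right x) by lra. assert (P := Rabs_pos (Im w)). nra. }
  assert (G := segment_gronwall f l 0 w (ratio_const * (1 + Cmod w) / t)).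
  assert (W0 : Cmod (w - 0) = Cmod w) by (f_equal; ring). rewrite W0 in G.
  unfold f in G at 3 4. rewrite Cplus_0_r in G.
  replace (cpow D 0) with (RtoC 1) in G by (unfold cpow; now rewrite Cmult_0_l, Cexp_0).
  rewrite Cmult_1_r in G.
  replace (ratio_const * (1 + Cmod w) / t * Cmod w) with (ratio_const * (1 + Cmod w) * Cmod w / t) in G by (field; lra).
  apply G.
  - intros x Hx. destruct (Seg x Hx) as [S1 S2]. set (z := (0 + RtoC x * (w - 0))%C) in *.
    apply Rabs_le_between in S2.
    destruct (Hchi (s + z)%C ltac:(lra)) as [N [[l0 [D0 _]] _]].
    assert (Ed := cder_C_derive _ _ _ D0).
    assert (E1 : cder (fun z => chi F (s + z)%C) z (chi F (s + z) * l0 * (0 + 1))%C).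
    { apply (cder_comp (chi F) (fun z => s + z)%C); auto. apply cder_plus. apply cder_const. apply cder_id. }
    generalize (cder_mult _ _ _ _ _ E1 (cpow_cder D (fun z => z) z _ (cder_id z))).
    apply cder_val. unfold f, l. rewrite Ed. field. exact N.
  - intros x Hx. destruct (Seg x Hx) as [S1 S2]. set (z := (0 + RtoC x * (w - 0))%C) in *.
    assert (S3 := S2). apply Rabs_le_between in S2.
    destruct (Hchi (s + z)%C ltac:(lra)) as [N [[l0 [D0 B0]] _]].
    assert (Ed := cder_C_derive _ _ _ D0). unfold l. rewrite Ed.
    replace (chi F (s + z) * l0 / chi F (s + z))%C with l0 by (field; exact N).
    set (t' := Rabs (Im (s + z))) in *.
    assert (LR := ln_ratio_bound t' t (Rabs (Im w)) t0 S3 Hw).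
    replace (l0 + ln D)%C with ((l0 + log_conductor_at F t') + ((ln D - log_conductor_at F t) + degree F * (ln t - ln t'))%R)%C.
    2:{ unfold log_conductor_at. repeat (rewrite RtoC_plus || rewrite RtoC_minus || rewrite RtoC_mult). ring. }
    eapply Rle_trans. apply Cmod_triangle. rewrite Cmod_R.
    assert (dp := degree_pos F). assert (Iw := Im_le_Cmod w). assert (Pw := Cmod_ge_0 w).
    assert (It : 0 < / t) by now apply Rinv_0_lt_compat.
    assert (Q1 : Cmod (l0 + log_conductor_at F t') <= K1 * (3 + Cmod w) * (2 * / t)).
    { eapply Rle_trans. apply B0. unfold Rdiv. assert (0 < / t' <= 2 * / t).
      { split. apply Rinv_0_lt_compat; lra. replace (2 * / t) with (/ (t / 2)) by (field; lra). apply Rinv_le_contravar; lra. }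
      assert (R0 := Rabs_pos (Re (s + z))).
      apply Rmult_le_compat; try lra. apply Rmult_le_pos; lra. apply Rmult_le_compat_l; lra. }
    assert (Q2 : Rabs (ln D - log_conductor_at F t + degree F * (ln t - ln t')) <= c2 / t + degree F * (2 * Cmod w / t)).
    { eapply Rle_trans. apply Rabs_triang. apply Rplus_le_compat; auto.
      rewrite Rabs_mult, (Rabs_right (degree F)), Rabs_minus_sym by lra. apply Rmult_le_compat_l. lra.
      eapply Rle_trans. exact LR. unfold Rdiv. apply Rmult_le_compat_r; lra. }
    replace (ratio_const * (1 + Cmod w) / t) with (ratio_const * (1 + Cmod w) * / t) by reflexivity.
    unfold Rdiv in Q2. replace (c2 * / t + degree F * (2 * Cmod w * / t)) with ((c2 + 2 * degree F * Cmod w) * / t) in Q2 by ring.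
    replace (K1 * (3 + Cmod w) * (2 * / t)) with ((6 * K1 + 2 * K1 * Cmod w) * / t) in Q1 by ring.
    eapply Rle_trans. apply Rplus_le_compat. apply Q1. apply Q2.
    rewrite <- Rmult_plus_distr_r. apply Rmult_le_compat_r. lra. unfold ratio_const.
    assert (0 <= K1 * Cmod w) by (now apply Rmult_le_pos). assert (0 <= c2 * Cmod w) by (now apply Rmult_le_pos). nra.
Qed.

(** With [r = decay_r t v] one has [|w| <= sqrt t * r], so [(1 + |w|) |w| / t] is at most [2 r^2]: a
    bound in the variable in which the kernel decays, with no [t] left. *)
Lemma ratio_bound_r (s : C) (u v D : R) : let t := Rabs (Im s) in
  2 * T1 <= t -> Rabs (Re s) <= 2 -> Rabs (ln D - log_conductor_at F t) <= c2 / t ->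
  Rabs u <= sqrt t -> Rabs v <= t / 2 ->
  Cmod (chi F (s + (u, v)) * cpow D (u, v)) <= Cmod (chi F s) * exp (2 * ratio_const * decay_r t v ^ 2).
Proof.
  intros t Ht Hs HD Hu Hv. assert (t1 : 1 <= t) by lra.
  eapply Rle_trans. apply ratio_bound; auto. apply Rmult_le_compat_l. apply Cmod_ge_0. apply exp_le.
  assert (q1 : 1 <= sqrt t). { rewrite <- sqrt_1. apply sqrt_le_1; lra. }
  assert (qq : sqrt t * sqrt t = t) by (apply sqrt_sqrt; lra).
  set (m := Cmod (u, v)). set (r := decay_r t v). fold t.
  assert (m1 : m <= sqrt t * r).
  { unfold m, r, decay_r. eapply Rle_trans. apply Cmod_le_sum. simpl.
    replace (sqrt t * (1 + Rabs v / sqrt t)) with (sqrt t + Rabs v) by (field; lra). lra. }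
  assert (m0 : 0 <= m) by apply Cmod_ge_0. assert (r1 : 1 <= r) by (apply decay_r_ge1; lra).
  assert (rc := ratio_const_pos).
  assert (B : (1 + m) * m <= 2 * r ^ 2 * t).
  { apply Rle_trans with ((2 * (sqrt t * r)) * (sqrt t * r)). apply Rmult_le_compat; try nra.
    right. rewrite <- qq at 3. ring. }
  replace (ratio_const * (1 + m) * m / t) with (ratio_const * (((1 + m) * m) / t)) by (field; lra).
  rewrite (Rmult_comm 2), Rmult_assoc. apply Rmult_le_compat_l; auto.
  apply Rmult_le_reg_r with t. lra. unfold Rdiv. rewrite Rmult_assoc, Rinv_l by lra. lra.
Qed.

(** Horizontal use of [ratio_bound] from the point of the critical line at the same height, where
    [|chi| = 1]. The distance is at most [3 / 2], so the exponent is [O(1 / t)]. *)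
Lemma chi_size (s : C) (D : R) : let t := Rabs (Im s) in
  2 * T1 <= t -> -1 <= Re s <= 2 -> Rabs (ln D - log_conductor_at F t) <= c2 / t ->
  Cmod (chi F s) <= exp (4 * ratio_const) * Rpower D (1 / 2 - Re s).
Proof.
  intros t Ht Hs HD. destruct s as [sg y]. change (Re (sg, y)) with sg in *.
  unfold t in *. change (Im (sg, y)) with y in *. clear t. set (t := Rabs y) in *. assert (t0 : 2 <= t) by lra.
  assert (R := ratio_bound (1 / 2, y) (sg - 1 / 2, 0) D). cbv zeta in R.
  change (Im (1 / 2, y)) with y in R. change (Re (1 / 2, y)) with (1 / 2) in R. change (Im (sg - 1 / 2, 0)) with 0 in R.
  fold t in R. assert (Ep : (((1 / 2)%R, y) + ((sg - 1 / 2)%R, 0%R))%C = ((sg, y) : C)).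
  { unfold Cplus; simpl; f_equal; field. }
  rewrite Ep in R.
  specialize (R Ht ltac:(rewrite Rabs_right; lra) HD ltac:(rewrite Rabs_R0; lra)).
  destruct (Hchi (1 / 2, y)) as [_ [_ [_ C1]]]. { change (Im (1 / 2, y)) with y. fold t. lra. }
  rewrite (C1 eq_refl), Rmult_1_l, Cmod_mult, Cmod_cpow in R. change (Re (sg - 1 / 2, 0)) with (sg - 1 / 2) in R.
  set (m := Cmod (sg - 1 / 2, 0)) in *.
  assert (m0 : 0 <= m <= 3 / 2).
  { split. apply Cmod_ge_0. unfold m. change (sg - 1 / 2, 0) with (RtoC (sg - 1 / 2)). rewrite Cmod_R. apply Rabs_le. lra. }
  assert (rc := ratio_const_pos).
  assert (E : exp (ratio_const * (1 + m) * m / t) <= exp (4 * ratio_const)).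
  { apply exp_le. assert (It : 0 < / t <= 1). { split. apply Rinv_0_lt_compat; lra. rewrite <- Rinv_1. apply Rinv_le_contravar; lra. }
    assert (0 <= (1 + m) * m <= 15 / 4) by nra. unfold Rdiv.
    replace (ratio_const * (1 + m) * m * / t) with (ratio_const * (((1 + m) * m) * / t)) by ring.
    rewrite (Rmult_comm 4). apply Rmult_le_compat_l; auto. nra. }
  assert (P := exp_pos ((sg - 1 / 2) * ln D)). change (exp ((sg - 1 / 2) * ln D)) with (Rpower D (sg - 1 / 2)) in P.
  assert (X : Rpower D (sg - 1 / 2) * Rpower D (1 / 2 - sg) = 1).
  { rewrite <- Rpower_plus. unfold Rpower. replace ((sg - 1 / 2 + (1 / 2 - sg)) * ln D) with 0 by ring. apply exp_0. }
  assert (P2 : 0 < Rpower D (1 / 2 - sg)) by apply exp_pos.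
  replace (Cmod (chi F (sg, y))) with (Cmod (chi F (sg, y)) * Rpower D (sg - 1 / 2) * Rpower D (1 / 2 - sg)).
  2:{ rewrite Rmult_assoc, X; ring. }
  apply Rmult_le_compat_r; lra.
Qed.

(** [8 ^ AG] pays for the growth of [F] on the edges, where [|s + w| <= 8 r^2]; [2 * ratio_const]
    pays for [chi (s + w) D^w / chi s]; the rate 5 is left for [decay_cauchy] and [decay_edge]. The
    degree [2 AG + 2] is at least [2 AG] and at least 2. *)
Definition kernel_rate : R := 8 ^ AG + 2 * ratio_const + 5.
Definition kernel_deg : nat := (2 * AG + 2)%nat.

Lemma rate_absorb (r x : R) : 1 <= r -> 0 <= x -> x <= 8 ^ AG * r ^ (2 * AG) + 2 * ratio_const * r ^ 2 ->
  exp x * exp (- kernel_rate * r ^ kernel_deg) <= exp (- 5 * r ^ 2).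
Proof.
  intros Hr x0 Hx. rewrite <- exp_plus. apply exp_le. unfold kernel_rate, kernel_deg.
  assert (rc := ratio_const_pos).
  assert (A1 : r ^ (2 * AG) <= r ^ (2 * AG + 2)) by (apply Rle_pow; auto; lia).
  assert (A2 : r ^ 2 <= r ^ (2 * AG + 2)) by (apply Rle_pow; auto; lia).
  assert (8 ^ AG * r ^ (2 * AG) <= 8 ^ AG * r ^ (2 * AG + 2)) by (apply Rmult_le_compat_l; auto; apply pow_le; lra).
  assert (ratio_const * r ^ 2 <= ratio_const * r ^ (2 * AG + 2)) by (now apply Rmult_le_compat_l).
  nra.
Qed.

Section AtPoint.

Variables (s : C) (y1 y2 B0 : R) (k : C -> C).
Let t := Rabs (Im s).
Let sg := Re s.
Let M := sqrt t.
Let H := t / 2.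
Let a := 1 + 2 * dl - sg.
Let b := sg + 2 * dl.
Let D := y1 * y2.
Hypotheses (Ht64 : 64 <= t) (HtT : 2 * T1 <= t) (HtG : 2 * TG <= t).
Hypothesis Hsg : - dl <= sg <= 1 + dl.
Hypotheses (Hy1 : 0 < y1) (Hy2 : 0 < y2).
Hypothesis HD : Rabs (ln D - log_conductor_at F t) <= c2 / t.
Hypothesis Hk : forall w, cdiff k w.
Hypothesis HB0 : 0 <= B0.
Hypothesis Hkb : forall u v, Rabs u <= M -> Cmod (k (u, v)) <= B0 * exp (- kernel_rate * decay_r t v ^ kernel_deg).

Lemma point_sqrt_ge8 : 8 <= M /\ M * M = t.
Proof. apply sqrt_ge8; auto. Qed.

(* What becomes of the kernel when the functional equation moves the edge
   [Re w = - b] to [Re w = b]; the choice [D = y1 y2] makes it of size about [k (- w)]. *)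
Definition kdual (w : C) : C := (chi F (s - w) * cpow D (- w) * / chi F s * k (- w))%C.
Definition Fright (w : C) : C := F (s + w)%C.
(** For [Re w] large this is the Dirichlet series with conjugated coefficients at [1 - s + w]. *)
Definition Fleft (w : C) : C := Cconj (F (1 - Cconj (s - w))%C).

Lemma point_decay_ge1 v : 1 <= decay_r t v.
Proof. apply decay_r_ge1. lra. Qed.

Lemma k_small u v : Rabs u <= M -> Cmod (k (u, v)) <= B0 * exp (- 5 * decay_r t v ^ 2).
Proof.
  intros Hu. eapply Rle_trans. now apply Hkb. apply Rmult_le_compat_l; auto.
  rewrite <- (Rmult_1_l (exp (- kernel_rate * _))), <- exp_0. apply rate_absorb. apply point_decay_ge1. lra.
  apply Rplus_le_le_0_compat. apply Rmult_le_pos; apply pow_le. lra. generalize (point_decay_ge1 v); lra.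
  assert (rc := ratio_const_pos). apply Rmult_le_pos. lra. apply pow2_ge_0.
Qed.

Lemma kdual_eq u v : kdual (u, v) = (chi F (s + ((- u)%R, (- v)%R)) * cpow D ((- u)%R, (- v)%R) * / chi F s * k ((- u)%R, (- v)%R))%C.
Proof. reflexivity. Qed.

Lemma chi_s_neq0 : chi F s <> RtoC 0.
Proof. apply Hchi. fold t. lra. Qed.

Lemma kdual_small u v : Rabs u <= M -> Rabs v <= H -> Cmod (kdual (u, v)) <= B0 * exp (- 5 * decay_r t v ^ 2).
Proof.
  intros Hu Hv. rewrite kdual_eq.
  assert (N := chi_s_neq0). assert (P : 0 < Cmod (chi F s)) by now apply Cmod_gt_0.
  rewrite !(Cmod_mult (_ * _)), Cmod_inv by auto.
  assert (Dv : decay_r t (- v) = decay_r t v) by (unfold decay_r; now rewrite Rabs_Ropp).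
  assert (R := ratio_bound_r s (- u) (- v) D HtT). fold t in R. rewrite !Rabs_Ropp, Dv in R.
  specialize (R ltac:(apply Rabs_le; unfold sg in Hsg; lra) HD Hu Hv).
  assert (K := Hkb (- u) (- v) ltac:(now rewrite Rabs_Ropp)). rewrite Dv in K.
  set (r := decay_r t v) in *. assert (r1 : 1 <= r) by apply point_decay_ge1.
  assert (rc := ratio_const_pos).
  assert (A := rate_absorb r (2 * ratio_const * r ^ 2) r1).
  assert (R2 : Cmod (chi F (s + ((- u)%R, (- v)%R)) * cpow D ((- u)%R, (- v)%R)) * / Cmod (chi F s) <= exp (2 * ratio_const * r ^ 2)).
  { apply Rmult_le_reg_r with (Cmod (chi F s)); auto. rewrite Rmult_assoc, Rinv_l by lra. lra. }
  eapply Rle_trans. apply Rmult_le_compat. 3: exact R2. 3: exact K.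
  apply Rmult_le_pos. apply Cmod_ge_0. left; now apply Rinv_0_lt_compat. apply Cmod_ge_0.
  replace (exp (2 * ratio_const * r ^ 2) * (B0 * exp (- kernel_rate * r ^ kernel_deg))) with
    (B0 * (exp (2 * ratio_const * r ^ 2) * exp (- kernel_rate * r ^ kernel_deg))) by ring.
  apply Rmult_le_compat_l; auto. apply A.
  apply Rmult_le_pos. lra. apply pow2_ge_0.
  assert (0 <= 8 ^ AG * r ^ (2 * AG)) by (apply Rmult_le_pos; apply pow_le; lra). lra.
Qed.

Lemma small_to_window (g : C -> C) :
  (forall u v, Rabs u <= M -> Rabs v <= H -> Cmod (g (u, v)) <= B0 * exp (- 5 * decay_r t v ^ 2)) ->
  (forall u v, Rabs u <= M -> Rabs v <= H -> Cmod (g (u, v)) <= B0 * / (1 + v ^ 2 / t)) /\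
  (forall u v, Rabs u <= M -> Rabs v = H -> Cmod (g (u, v)) <= B0 * exp (- t)).
Proof.
  intros Hg. split; intros u v Hu Hv.
  - eapply Rle_trans. now apply Hg. apply Rmult_le_compat_l; auto. apply decay_cauchy; lra.
  - eapply Rle_trans. apply Hg; auto. lra. apply Rmult_le_compat_l; auto. apply decay_edge; auto. lra.
Qed.

Lemma im_shift_ge v : Rabs v <= H -> H <= Rabs (Im s + v) /\ H <= Rabs (Im s + - v).
Proof.
  intros Hv. assert (A := Rabs_triang_inv (Im s) (- v)). assert (B := Rabs_triang_inv (Im s) v).
  rewrite Rabs_Ropp in A. unfold Rminus in *. rewrite Ropp_involutive in A. fold t in A, B. unfold H in *. lra.
Qed.

Lemma im_s_shift u v : Rabs v <= H -> Im (s + (u, v)) <> 0 /\ TG <= Rabs (Im (s + (u, v))) /\ T1 <= Rabs (Im (s + (u, v))).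
Proof.
  intros Hv. destruct (im_shift_ge v Hv) as [A _]. rewrite im_plus. change (Im (u, v)) with v.
  unfold H in A. repeat split; try lra. intros E. rewrite E, Rabs_R0 in A. lra.
Qed.

Definition main_fun (w : C) : C := (Fright w * (k w * cpow y1 w) * / w)%C.

Lemma Fright_cdiff u v : Rabs v <= H -> cdiff Fright (u, v).
Proof.
  intros Hv. apply (cdiff_comp F (fun w => s + w)%C). apply F_cdiff. now apply im_s_shift.
  apply cdiff_plus. apply cdiff_const. apply cdiff_id.
Qed.

Lemma abscissas_range : 0 < a <= 3 /\ 0 < b <= 3 /\ a + b <= 2 /\ a <= M /\ b <= M.
Proof. destruct point_sqrt_ge8. unfold a, b. lra. Qed.

(** On the edges [|s + w| <= 3 + 3 t / 2 <= 8 r^2], so finite order gives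
    [|F| <= KG exp (8^AG r^(2 AG))], and the kernel wins by a factor [exp (- t)]. The sum of two
    exponentials covers both signs of [ln y1]. *)
Lemma main_hint v : Rabs v = H ->
  Cmod (hint main_fun (- b) a v) <= KG * B0 * exp (- t) * (exp (a * ln y1) + exp (- b * ln y1)) / 2.
Proof.
  intros Hv. destruct abscissas_range as [Ha [Hb [Hab [HaM HbM]]]].
  assert (v0 : v <> 0). { intros E. rewrite E, Rabs_R0 in Hv. unfold H in Hv; lra. }
  assert (HC : hcont main_fun (- b) a v).
  { split. lra. intros u Hu. apply cdiff_ccont, cdiff_mult. apply cdiff_mult. apply Fright_cdiff; lra.
    apply cdiff_mult. apply Hk. apply cpow_cdiff.
    apply (cdiff_inv (fun w => w)). apply pt_neq0; auto. apply cdiff_id. }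
  unfold hint.
  set (X := KG * B0 * exp (- t) * (exp (a * ln y1) + exp (- b * ln y1))).
  assert (P1 := exp_pos (a * ln y1)). assert (P2 := exp_pos (- b * ln y1)). assert (P3 := exp_pos (- t)).
  assert (X0 : 0 <= X). { unfold X. repeat apply Rmult_le_pos; lra. }
  assert (Hp : 4 <= H) by (unfold H; lra).
  eapply Rle_trans. apply (CInt_bound _ (- b) a (X * / H)). lra. now apply hcont_ex.
  - intros u Hu. unfold main_fun. assert (Wn : (u, v) <> RtoC 0) by (apply pt_neq0; auto).
    rewrite !Cmod_mult, Cmod_inv, Cmod_cpow_exp by auto.
    assert (L : / Cmod (u, v) <= / H). { apply Rinv_le_contravar. lra. rewrite <- Hv. apply Cmod_pt_ge. }
    assert (L0 : 0 < / Cmod (u, v)) by (apply Rinv_0_lt_compat; now apply Cmod_gt_0).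
    assert (E1 : exp (u * ln y1) <= exp (a * ln y1) + exp (- b * ln y1)).
    { destruct (Rle_lt_dec 0 (ln y1)) as [Q|Q].
      - assert (exp (u * ln y1) <= exp (a * ln y1)) by (apply exp_le; apply Rmult_le_compat_r; lra). lra.
      - assert (exp (u * ln y1) <= exp (- b * ln y1)) by (apply exp_le; nra). lra. }
    assert (Hu' : Rabs u <= M) by (apply Rabs_le; lra).
    assert (FK : Cmod (Fright (u, v)) * Cmod (k (u, v)) <= KG * B0 * exp (- t)).
    { destruct (im_s_shift u v ltac:(lra)) as [_ [G _]]. assert (Gr := Hgrow _ G). assert (Kb := Hkb u v Hu').
      destruct (decay_edge t v ltac:(lra) Hv) as [De1 De2].
      assert (r1 := point_decay_ge1 v). set (r := decay_r t v) in *.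
      assert (Sz : Cmod (s + (u, v)) <= 8 * r ^ 2).
      { eapply Rle_trans. apply Cmod_le_sum. rewrite re_plus, im_plus. change (Re (u, v)) with u. change (Im (u, v)) with v.
        assert (Rabs (Re s + u) <= 3). { apply Rabs_le. fold sg. clear - Hu Hsg Hdl. unfold a, b in Hu. lra. }
        assert (Rabs (Im s + v) <= t + H). { eapply Rle_trans. apply Rabs_triang. fold t. lra. }
        unfold H in *. lra. }
      assert (Ab := rate_absorb r (Cmod (s + (u, v)) ^ AG) r1).
      assert (Ab2 : exp (Cmod (s + (u, v)) ^ AG) * exp (- kernel_rate * r ^ kernel_deg) <= exp (- 5 * r ^ 2)).
      { apply Ab. apply pow_le, Cmod_ge_0.
        assert (Cmod (s + (u, v)) ^ AG <= 8 ^ AG * r ^ (2 * AG)).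
        { rewrite pow_mult, <- Rpow_mult_distr. apply pow_incr. split; auto. apply Cmod_ge_0. }
        assert (rc := ratio_const_pos). assert (0 <= 2 * ratio_const * r ^ 2). { apply Rmult_le_pos. lra. apply pow2_ge_0. } lra. }
      eapply Rle_trans. apply Rmult_le_compat; try apply Cmod_ge_0. apply Gr. apply Kb.
      replace (KG * exp (Cmod (s + (u, v)) ^ AG) * (B0 * exp (- kernel_rate * r ^ kernel_deg))) with
        (KG * B0 * (exp (Cmod (s + (u, v)) ^ AG) * exp (- kernel_rate * r ^ kernel_deg))) by ring.
      apply Rmult_le_compat_l. now apply Rmult_le_pos. lra. }
    replace (Cmod (Fright (u, v)) * (Cmod (k (u, v)) * exp (u * ln y1)) * / Cmod (u, v)) with
      ((Cmod (Fright (u, v)) * Cmod (k (u, v))) * exp (u * ln y1) * / Cmod (u, v)) by ring.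
    assert (P4 := exp_pos (u * ln y1)).
    assert (Z1 : 0 <= Cmod (Fright (u, v)) * Cmod (k (u, v))) by (apply Rmult_le_pos; apply Cmod_ge_0).
    apply Rmult_le_compat; try lra. apply Rmult_le_pos; lra. unfold X. apply Rmult_le_compat; lra.
  - assert (IH : 0 < / H <= / 4). { split. apply Rinv_0_lt_compat; lra. apply Rinv_le_contravar; lra. }
    assert (0 <= X * / H <= X * / 4) by (split; [apply Rmult_le_pos; lra|apply Rmult_le_compat_l; lra]).
    fold X. nra.
Qed.

Lemma Fleft_ccont u v : Rabs v <= H -> ccont Fleft (u, v).
Proof.
  intros Hv e He. set (z0 := (1 - Cconj (s - (u, v)))%C).
  assert (I0 : Im z0 <> 0).
  { unfold z0, Cminus. rewrite im_plus, im_opp, im_RtoC, im_conj, im_plus, im_opp. change (Im (u, v)) with v.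
    destruct (im_shift_ge v Hv) as [_ A]. intros E. replace (Im s + - v) with 0 in A by lra.
    rewrite Rabs_R0 in A. unfold H in A; lra. }
  destruct (cdiff_ccont _ _ (F_cdiff F z0 I0) e He) as [d [d0 Hd]]. exists d. split; auto. intros w Hw.
  unfold Fleft. fold z0. rewrite <- Cminus_conj, Cmod_conj. apply Hd. unfold z0.
  replace (1 - Cconj (s - w) - (1 - Cconj (s - (u, v))))%C with (Cconj (w - (u, v)))%C.
  now rewrite Cmod_conj. rewrite !Cminus_conj. ring.
Qed.

Lemma kdual_cdiff u v : Rabs v <= H -> cdiff kdual (u, v).
Proof.
  intros Hv. assert (Dn : cdiff (fun w => - w)%C (u, v)) by (apply cdiff_opp, cdiff_id).
  unfold kdual. apply cdiff_mult; [apply cdiff_mult; [apply cdiff_mult|]|].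
  - apply (cdiff_comp (chi F) (fun w => s - w)%C).
    + destruct (Hchi (s - (u, v))%C) as [_ [[l [Hl _]] _]]. 2: now exists (chi F (s - (u, v)) * l)%C.
      unfold Cminus. rewrite im_plus, im_opp. change (Im (u, v)) with v.
      destruct (im_shift_ge v Hv) as [_ A]. unfold H in A. lra.
    + apply cdiff_minus. apply cdiff_const. apply cdiff_id.
  - apply (cdiff_comp (cpow D) (fun w => - w)%C); auto. apply cpow_cdiff.
  - apply cdiff_const.
  - apply (cdiff_comp k (fun w => - w)%C); auto.
Qed.

Lemma kdual_0 : kdual 0 = k 0.
Proof.
  unfold kdual. replace (s - 0)%C with s by ring. replace (- 0)%C with (RtoC 0) by ring.
  unfold cpow. rewrite Cmult_0_l, Cexp_0. field. apply chi_s_neq0.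
Qed.

Definition left_fun (w : C) : C := (Fleft w * (kdual w * cpow y2 w * / w))%C.

(** The functional equation at [s - w] brings in [chi (s - w)], [y1^(- w)] equals [D^(- w) y2^w],
    and the sign comes from [1 / w]. *)
Lemma main_reflect v : Rabs v <= H -> main_fun ((- b)%R, (- v)%R) = (- chi F s * left_fun (b, v))%C.
Proof.
  intros Hv. destruct abscissas_range as [_ [Hb _]]. set (w := (b, v) : C).
  assert (Wn : w <> RtoC 0) by (apply pt_neq0; left; lra).
  change (((- b)%R, (- v)%R) : C) with (- w)%C.
  unfold main_fun, left_fun, Fright, Fleft, kdual.
  assert (E : F (s - w)%C = (chi F (s - w) * Cconj (F (1 - Cconj (s - w))%C))%C).
  { apply Hchi. unfold Cminus, w. rewrite im_plus, im_opp. change (Im (b, v)) with v.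
    destruct (im_shift_ge v Hv) as [_ A]. unfold H in A. lra. }
  change (s + - w)%C with (s - w)%C. rewrite E.
  assert (E2 : cpow y1 (- w) = (cpow D (- w) * cpow y2 w)%C).
  { unfold cpow, D. rewrite ln_mult by auto. rewrite RtoC_plus, <- Cexp_plus. f_equal. ring. }
  rewrite E2. assert (N := chi_s_neq0). field. auto.
Qed.

Lemma left_vcont : vcont left_fun b (- H) H.
Proof.
  destruct abscissas_range as [_ [Hb _]]. split. unfold H; lra. intros v Hv.
  assert (Hv' : Rabs v <= H) by (apply Rabs_le; lra).
  assert (A1 := Fleft_ccont b v Hv').
  assert (A2 : ccont (fun w => kdual w * cpow y2 w * / w)%C (b, v)).
  { apply cdiff_ccont. apply cdiff_mult. apply cdiff_mult. now apply kdual_cdiff. apply cpow_cdiff.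
    apply (cdiff_inv (fun w => w)). apply pt_neq0; left; lra. apply cdiff_id. }
  now apply ccont_mult.
Qed.

Definition Vright : C := vint (fun w => Fright w * (k w * cpow y1 w * / w))%C a (- H) H.
Definition Vleft : C := vint left_fun b (- H) H.

Lemma main_identity : Cmod (kappa * k 0 * F s - Vright - chi F s * Vleft)
  <= KG * B0 * exp (- t) * (exp (a * ln y1) + exp (- b * ln y1)).
Proof.
  destruct abscissas_range as [Ha [Hb [Hab [HaM HbM]]]].
  assert (Hp : 4 <= H) by (unfold H; lra).
  assert (R : box main_fun (- b) a (- H) H = (kappa * k 0 * F s)%C).
  { unfold main_fun. rewrite (box_residue (fun w => Fright w * (k w * cpow y1 w))%C); try lra.
    - unfold Fright, cpow. rewrite Cmult_0_l, Cexp_0, Cplus_0_r. ring.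
    - intros u v Hu Hv. apply cdiff_mult. apply Fright_cdiff, Rabs_le; lra.
      apply cdiff_mult. apply Hk. apply cpow_cdiff. }
  assert (Vr : vint main_fun a (- H) H = Vright).
  { unfold Vright, vint. f_equal. apply CInt_ext. lra. intros v _. unfold main_fun. ring. }
  assert (Vl : vint main_fun (- b) (- H) H = (- chi F s * Vleft)%C).
  { unfold vint. rewrite <- (CInt_reflect (fun v => main_fun ((- b)%R, v))).
    2:{ apply vcont_ex. split. lra. intros v Hv. apply cdiff_ccont. apply cdiff_mult. apply cdiff_mult.
        apply Fright_cdiff, Rabs_le; lra. apply cdiff_mult. apply Hk. apply cpow_cdiff.
        apply (cdiff_inv (fun w => w)). apply pt_neq0; left; lra. apply cdiff_id. }
    rewrite (CInt_ext _ (fun v => - chi F s * left_fun (b, v))%C) by (try lra; intros v Hv; apply main_reflect, Rabs_le; lra).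
    rewrite (CInt_scal (- chi F s)%C (fun v => left_fun (b, v))) by (apply vcont_ex, left_vcont).
    unfold Vleft, vint. ring. }
  rewrite <- R. unfold box. rewrite Vr, Vl.
  assert (H1 := main_hint (- H) ltac:(rewrite Rabs_Ropp, Rabs_right; lra)).
  assert (H2 := main_hint H ltac:(rewrite Rabs_right; lra)).
  set (h1 := hint main_fun (- b) a (- H)) in *. set (h2 := hint main_fun (- b) a H) in *.
  replace (h1 + Vright - h2 - - chi F s * Vleft - Vright - chi F s * Vleft)%C with (h1 - h2)%C by ring.
  unfold Cminus. eapply Rle_trans. apply Cmod_triangle. rewrite Cmod_opp. lra.
Qed.

Variables (Ka A : R).
Hypothesis HKa : 0 <= Ka.
Hypothesis Hcoef : forall n, (1 <= n)%nat -> Cmod (sel_a F n) <= Ka * Rpower (INR n) dl.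
Hypothesis HA : forall N, rsum (fun n => Cmod (sel_a F n) * Rpower (INR n) (- (1 + 2 * dl))) N <= A.
Hypothesis Hunif : forall e, 0 < e -> exists N0, forall N, (N0 <= N)%nat -> forall z, Re z = 1 + 2 * dl ->
    Cmod (F z - csum (fun n => sel_a F n * cpow (INR n) (- z))%C N) <= e.

Definition P1sum : C := csum (fun n => sel_a F n * cpow (INR n) (- s))%C (Z.to_nat (Int_part y1)).
Definition P2sum : C := csum (fun n => Cconj (sel_a F n) * cpow (INR n) (- (1 - s)))%C (Z.to_nat (Int_part y2)).

Lemma right_series e : 0 < e -> exists N0, forall N, (N0 <= N)%nat -> forall v, Rabs v <= H ->
  Cmod (Fright (a, v) - csum (fun n => sel_a F n * cpow (INR n) (- s) * cpow (INR n) (- (a, v)))%C N) <= e.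
Proof.
  intros He. destruct (Hunif e He) as [N0 HN0]. exists N0. intros N HN v _.
  assert (Q := HN0 N HN (s + (a, v))%C). unfold Fright.
  rewrite (csum_ext _ (fun n => sel_a F n * cpow (INR n) (- (s + (a, v))))%C).
  - apply Q. rewrite re_plus. change (Re (a, v)) with a. fold sg. unfold a. ring.
  - intros n _. set (w := (a, v) : C). replace (- (s + w))%C with (- s + - w)%C by ring. rewrite cpow_plus. ring.
Qed.

Lemma left_series e : 0 < e -> exists N0, forall N, (N0 <= N)%nat -> forall v, Rabs v <= H ->
  Cmod (Fleft (b, v) - csum (fun n => Cconj (sel_a F n) * cpow (INR n) (- (1 - s)) * cpow (INR n) (- (b, v)))%C N) <= e.
Proof.
  intros He. destruct (Hunif e He) as [N0 HN0]. exists N0. intros N HN v _.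
  set (z := (1 - Cconj (s - (b, v)))%C).
  assert (Q := HN0 N HN z). unfold Fleft. fold z.
  rewrite (csum_ext _ (fun n => Cconj (sel_a F n * cpow (INR n) (- z)))%C).
  - rewrite <- csum_conj, <- Cminus_conj, Cmod_conj. apply Q. unfold z, Cminus.
    rewrite re_plus, re_opp, re_conj, re_RtoC, re_plus, re_opp. change (Re (b, v)) with b. fold sg. unfold b. ring.
  - intros n _. unfold z. set (w := (b, v) : C). rewrite Cmult_conj, cpow_conj, Copp_conj, Cminus_conj, Cconj_conj, Cconj_RtoC.
    replace (- (1 - (s - w)))%C with (- (1 - s) + - w)%C by ring. rewrite cpow_plus. ring.
Qed.

Lemma right_trunc : Cmod (Vright - kappa * k 0 * P1sum) <=
  4 * B0 * (6 * Ka * Rpower y1 (dl - sg) * (1 + y1 / M) + exp (- t) * Rpower y1 a * A).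
Proof.
  destruct abscissas_range as [Ha [Hb [Hab [HaM HbM]]]].
  destruct (small_to_window k) as [W1 W2]. { intros; now apply k_small. }
  apply (truncate_main t a B0 k (sel_a F) s y1 dl Ka A Fright); auto.
  - fold sg. apply Rabs_le. lra.
  - intros v Hv. apply cdiff_ccont, Fright_cdiff. exact Hv.
  - exact right_series.
Qed.

(** The truncation of [right_trunc] with the kernel [kdual] and the point [1 - s]; the residue is
    the same because [kdual 0 = k 0]. *)
Lemma left_trunc : Cmod (Vleft - kappa * k 0 * P2sum) <=
  4 * B0 * (6 * Ka * Rpower y2 (dl - (1 - sg)) * (1 + y2 / M) + exp (- t) * Rpower y2 b * A).
Proof.
  destruct abscissas_range as [Ha [Hb [Hab [HaM HbM]]]].
  destruct (small_to_window kdual) as [W1 W2]. { intros; now apply kdual_small. }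
  assert (Er : Re (1 - s) = 1 - sg). { unfold Cminus. rewrite re_plus, re_opp, re_RtoC. reflexivity. }
  rewrite <- Er, <- kdual_0.
  apply (truncate_main t b B0 kdual (fun n => Cconj (sel_a F n)) (1 - s)%C y2 dl Ka A Fleft); auto.
  - rewrite Er. unfold b. ring.
  - rewrite Er. apply Rabs_le. lra.
  - intros u v _ Hv. now apply kdual_cdiff.
  - intros v Hv. now apply Fleft_ccont.
  - exact left_series.
  - intros n Hn. rewrite Cmod_conj. auto.
  - intros N. rewrite (rsum_eq _ (fun n => Cmod (sel_a F n) * Rpower (INR n) (- (1 + 2 * dl)))); auto.
    intros n. now rewrite Cmod_conj.
Qed.

End AtPoint.
End AFE.

Lemma coef_bound (F : selberg_class) (dl : R) : 0 < dl -> exists Ka, 0 <= Ka /\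
  forall n, (1 <= n)%nat -> Cmod (sel_a F n) <= Ka * Rpower (INR n) dl.
Proof.
  intros H. destruct (sel_ramanujan F dl H) as [K HK]. exists (Rabs K). split. apply Rabs_pos.
  intros n Hn. eapply Rle_trans. now apply HK. apply Rmult_le_compat_r. left; apply exp_pos. apply Rle_abs.
Qed.

(* The value [k 0] is left free: [k 0 = 1] gives the approximate functional
   equation, [k 0 = 0] the lower bound on the degree. *)
Lemma smoothed_equation (F : selberg_class) (dl c2 : R) : 0 < dl <= 1 / 4 -> 0 <= c2 ->
  exists T KG Ka A E kr kd, 64 <= T /\ 0 <= KG /\ 0 <= Ka /\ 0 <= A /\ 0 <= E /\ 0 <= kr /\ (1 <= kd)%nat /\
  (forall r, 1 <= r -> exp (- kr * r ^ kd) <= exp (- 5 * r ^ 2)) /\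
  (forall n, (1 <= n)%nat -> Cmod (sel_a F n) <= Ka * Rpower (INR n) dl) /\
  (forall N, rsum (fun n => Cmod (sel_a F n) * Rpower (INR n) (- (1 + 2 * dl))) N <= A) /\
  forall (s : C) (y1 y2 B0 : R) (k : C -> C),
  let t := Rabs (Im s) in let sg := Re s in let D := y1 * y2 in
  let a := 1 + 2 * dl - sg in let b := sg + 2 * dl in
  T <= t -> - dl <= sg <= 1 + dl -> 0 < y1 -> 0 < y2 ->
  Rabs (ln D - log_conductor_at F t) <= c2 / t ->
  (forall w, cdiff k w) -> 0 <= B0 ->
  (forall u v, Rabs u <= sqrt t -> Cmod (k (u, v)) <= B0 * exp (- kr * decay_r t v ^ kd)) ->
  Cmod (chi F s) <= E * Rpower D (1 / 2 - sg) /\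
  Cmod (kappa * k 0 * F s - Vright F dl s y1 k - chi F s * Vleft F dl s y1 y2 k)
    <= KG * B0 * exp (- t) * (Rpower y1 a + Rpower y1 (- b)) /\
  Cmod (Vright F dl s y1 k - kappa * k 0 * P1sum F s y1) <=
    4 * B0 * (6 * Ka * Rpower y1 (dl - sg) * (1 + y1 / sqrt t) + exp (- t) * Rpower y1 a * A) /\
  Cmod (Vleft F dl s y1 y2 k - kappa * k 0 * P2sum F s y2) <=
    4 * B0 * (6 * Ka * Rpower y2 (dl - (1 - sg)) * (1 + y2 / sqrt t) + exp (- t) * Rpower y2 b * A) /\
  (forall v, Rabs v <= t / 2 -> ccont (Fright F s) (a, v)) /\
  (forall e, 0 < e -> exists N0, forall N, (N0 <= N)%nat -> forall v, Rabs v <= t / 2 ->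
    Cmod (Fright F s (a, v) - csum (fun n => sel_a F n * cpow (INR n) (- s) * cpow (INR n) (- (a, v)))%C N) <= e).
Proof.
  intros Hdl Hc2. destruct (chi_facts F) as [T1 [K1 [HT1 [HK1 Hchi]]]].
  destruct (selberg_growth F) as [TG [KG [AG [HTG [HKG Hgrow]]]]].
  destruct (coef_bound F dl) as [Ka [HKa Hcoef]]. lra.
  destruct (series_uniform F (1 + 2 * dl)) as [A [HA Hunif]]. lra.
  assert (A0 : 0 <= A) by (apply (HA O)).
  assert (rc := ratio_const_pos F K1 c2 HK1 Hc2).
  set (T := Rmax 64 (Rmax (2 * T1) (2 * TG))).
  exists T, KG, Ka, A, (exp (4 * ratio_const F K1 c2)), (kernel_rate F K1 AG c2), (kernel_deg AG).
  assert (HT : 64 <= T /\ 2 * T1 <= T /\ 2 * TG <= T).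
  { unfold T. split. apply Rmax_l. split; (eapply Rle_trans; [|apply Rmax_r]). apply Rmax_l. apply Rmax_r. }
  split. apply HT. split; auto. split; auto. split; auto. split. left; apply exp_pos.
  split. { unfold kernel_rate. assert (0 <= 8 ^ AG) by (apply pow_le; lra). lra. }
  split. unfold kernel_deg; lia.
  split. { intros r Hr. rewrite <- (Rmult_1_l (exp (- kernel_rate _ _ _ _ * _))), <- exp_0. apply rate_absorb; auto. lra.
    apply Rplus_le_le_0_compat. apply Rmult_le_pos; apply pow_le; lra. apply Rmult_le_pos. lra. apply pow2_ge_0. }
  split; auto. split; auto.
  intros s y1 y2 B0 k t sg D a b Ht Hsg Hy1 Hy2 HD Hk HB0 Hkb.
  assert (Ht64 : 64 <= t) by lra. assert (HtT : 2 * T1 <= t) by lra. assert (HtG : 2 * TG <= t) by lra.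
  split. { refine (chi_size F T1 K1 dl c2 _ _ _ _ _ s D _ _ _); auto. fold sg. lra. }
  split. { refine (main_identity F T1 K1 TG KG AG dl c2 _ _ _ _ _ _ s y1 y2 B0 k _ _ _ _ _ _ _ _ _); auto. }
  split. { refine (right_trunc F T1 K1 TG AG dl c2 _ _ _ s y1 B0 k _ _ _ _ _ _ _ _ Ka A _ _ _ _); auto. }
  split. { refine (left_trunc F T1 K1 AG dl c2 _ _ _ _ _ s y1 y2 B0 k _ _ _ _ _ _ _ _ Ka A _ _ _ _); auto. }
  split. { intros v Hv. apply cdiff_ccont. eapply Fright_cdiff; eauto. }
  intros e He. eapply right_series; eauto.
Qed.

(** * The degree is at least 1 *)

Lemma CInt_re_ge (g : R -> C) (a b c : R) : a <= b -> ex_CInt g a b ->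
  (forall x, a <= x <= b -> c <= Re (g x)) -> (b - a) * c <= Re (CInt g a b).
Proof.
  intros Hab Hg Hc. assert (K := CInt_correct _ _ _ Hg).
  apply (@is_RInt_fct_extend_fst R_NormedModule R_NormedModule) in K.
  apply (is_RInt_le (fun _ => c) (fun t => fst (g t)) a b); auto.
  - apply @is_RInt_const.
  - intros x Hx. apply Hc. lra.
Qed.

Lemma Cmod_le_decay (t u v : R) : 0 < t -> Rabs u <= sqrt t -> Cmod (u, v) <= sqrt t * decay_r t v.
Proof.
  intros Ht Hu. assert (0 < sqrt t) by now apply sqrt_lt_R0.
  unfold decay_r. eapply Rle_trans. apply Cmod_le_sum. simpl.
  replace (sqrt t * (1 + Rabs v / sqrt t)) with (sqrt t + Rabs v) by (field; lra). lra.
Qed.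

(** It vanishes at 0, so no residue appears, and division by [sqrt t] keeps it of order 1 where
    [kern] is concentrated. At [x = 1] its window is the integral of [kern] over a vertical line,
    divided by [sqrt t]. *)
Definition flat_kernel (n : nat) (t : R) (w : C) : C := (w * kern n t w * / sqrt t)%C.

Lemma flat_kernel_bound (c : R) (j : nat) : 0 <= c -> (1 <= j)%nat -> exists m C1, forall t u v, 0 < t -> Rabs u <= sqrt t ->
  Cmod (kern (2 * S m) t (u, v)) <= exp C1 * exp (- c * decay_r t v ^ j) /\
  Cmod (flat_kernel (2 * S m) t (u, v)) <= exp C1 * exp (- c * decay_r t v ^ j).
Proof.
  (* The extra 1 in the rate absorbs the factor [|w| / sqrt t <= r]. *)
  intros Hc Hj. destruct (kern_bound (c + 1) j) as [m [C1 H]]. lra. exists m, C1. intros t u v Ht Hu.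
  specialize (H t u v Ht Hu). assert (q0 : 0 < sqrt t) by now apply sqrt_lt_R0.
  set (r := decay_r t v) in *. assert (r1 : 1 <= r) by now apply decay_r_ge1.
  assert (P := exp_pos C1). assert (rj : r <= r ^ j).
  { rewrite <- (pow_1 r) at 1. now apply Rle_pow. }
  assert (E : exp (- (c + 1) * r ^ j) = exp (- c * r ^ j) * exp (- r ^ j)) by (rewrite <- exp_plus; f_equal; ring).
  assert (Q := exp_pos (- c * r ^ j)).
  assert (E1 : r * exp (- r ^ j) <= 1).
  { rewrite exp_Ropp. apply Rmult_le_reg_r with (exp (r ^ j)). apply exp_pos. rewrite Rmult_assoc, Rinv_l.
    generalize (exp_ineq1_le (r ^ j)). lra. generalize (exp_pos (r ^ j)); lra. }
  assert (E2 := exp_pos (- r ^ j)). assert (E3 : exp (- r ^ j) <= 1) by (apply exp_le_1; lra).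
  rewrite E in H. split.
  - eapply Rle_trans. exact H. apply Rmult_le_compat_l. lra. nra.
  - unfold flat_kernel. rewrite !Cmod_mult, Cmod_inv, Cmod_R by (apply RtoC_neq0; lra).
    rewrite (Rabs_right (sqrt t)) by lra. assert (W := Cmod_le_decay t u v Ht Hu). fold r in W.
    assert (W0 := Cmod_ge_0 (u, v)).
    apply Rle_trans with (sqrt t * r * (exp C1 * (exp (- c * r ^ j) * exp (- r ^ j))) * / sqrt t).
    + apply Rmult_le_compat_r. left; now apply Rinv_0_lt_compat. apply Rmult_le_compat; auto; apply Cmod_ge_0.
    + replace (sqrt t * r * (exp C1 * (exp (- c * r ^ j) * exp (- r ^ j))) * / sqrt t)
        with (exp C1 * exp (- c * r ^ j) * (r * exp (- r ^ j))) by (field; lra).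
      rewrite <- (Rmult_1_r (exp C1 * exp (- c * r ^ j))) at 2. apply Rmult_le_compat_l; auto. nra.
Qed.

Lemma kern_imag (m : nat) (t v : R) : 0 < t -> kern (2 * S m) t (0, v) = RtoC (exp (- (v / sqrt t) ^ (2 * S m))).
Proof.
  intros Ht. unfold kern. rewrite kern_arg by auto.
  assert (0 < sqrt t) by now apply sqrt_lt_R0.
  replace ((v / sqrt t, - (0 / sqrt t)) : C) with (RtoC (v / sqrt t)).
  2:{ unfold RtoC. f_equal. field. lra. }
  rewrite <- RtoC_pow, <- RtoC_opp. apply Cexp_RtoC.
Qed.

(* Integrating [kern] itself over the critical line keeps a quantity of order [sqrt t]. *)
Lemma flat_window_lower (m : nat) (t a B : R) : 64 <= t -> 0 < a <= 3 -> 0 <= B ->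
  (forall u v, Rabs u <= sqrt t -> Rabs v = t / 2 -> Cmod (kern (2 * S m) t (u, v)) <= B * exp (- t)) ->
  2 / 3 - 6 * B * exp (- t) <= Cmod (window t a (flat_kernel (2 * S m) t) 1).
Proof.
  intros Ht Ha HB Hk. destruct (sqrt_ge8 t Ht) as [M8 MM]. set (M := sqrt t) in *. set (H := t / 2) in *.
  set (n := (2 * S m)%nat) in *. set (K := kern n t).
  assert (Hp : 0 < H) by (unfold H; lra). assert (MH : M <= H) by (unfold H; nra).
  assert (Kc : forall w, ccont K w) by (intros w; apply cdiff_ccont, kern_cdiff).
  assert (E1 : window t a (flat_kernel n t) 1 = (/ M * vint K a (- H) H)%C).
  { unfold window, vint, window_fun. fold H.
    rewrite (CInt_ext _ (fun v => / M * K (a, v))%C).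
    - rewrite (CInt_scal (/ M)%C (fun v => K (a, v))). ring. apply vcont_ex. split; auto. lra.
    - lra.
    - intros v _. unfold flat_kernel, cpow. rewrite ln_1. fold K M.
      replace ((a, v) * 0)%C with (RtoC 0) by ring. rewrite Cexp_0.
      assert (N1 : (a, v) <> RtoC 0) by (apply pt_neq0; left; lra).
      assert (N2 : RtoC M <> RtoC 0) by (apply RtoC_neq0; lra). field. auto. }
  assert (G : box K 0 a (- H) H = RtoC 0).
  { apply goursat; try lra. intros x y _ _. apply kern_cdiff. }
  assert (HB' : forall v, Rabs v = H -> Cmod (hint K 0 a v) <= 3 * B * exp (- t)).
  { intros v Hv. unfold hint. assert (P := exp_pos (- t)).
    eapply Rle_trans. apply (CInt_bound _ 0 a (B * exp (- t))). lra.
    apply hcont_ex. split; auto. lra.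
    intros u Hu. apply Hk; auto. apply Rabs_le. lra.
    assert (0 <= B * exp (- t)) by (apply Rmult_le_pos; lra). nra. }
  assert (Hl := HB' (- H) ltac:(rewrite Rabs_Ropp, Rabs_right; lra)). assert (Hu := HB' H ltac:(rewrite Rabs_right; lra)).
  assert (E2 : vint K a (- H) H = (vint K 0 (- H) H - (hint K 0 a (- H) - hint K 0 a H))%C).
  { unfold box in G. set (h1 := hint K 0 a (- H)) in *. set (h2 := hint K 0 a H) in *.
    set (v1 := vint K a (- H) H) in *. set (v2 := vint K 0 (- H) H) in *.
    replace v1 with ((h1 + v1 - h2 - v2) + (v2 - (h1 - h2)))%C by ring. rewrite G. ring. }
  assert (exH : forall p q, p <= q -> ex_CInt (fun v => K (0, v)) p q).
  { intros p q Hpq. apply vcont_ex. split; auto. }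
  assert (Kre : forall v, 0 <= Re (K (0, v))).
  { intros v. unfold K, n. rewrite kern_imag, re_RtoC by lra. left; apply exp_pos. }
  assert (Kre1 : forall v, - M <= v <= M -> exp (- 1) <= Re (K (0, v))).
  { intros v Hv. unfold K, n. rewrite kern_imag, re_RtoC by lra. fold M. apply exp_le.
    assert (Q : (v / M) ^ (2 * S m) <= 1); [|lra].
    rewrite pow_mult. rewrite <- (pow1 (S m)). apply pow_incr. split. apply pow2_ge_0.
    assert (X : - 1 <= v / M <= 1).
    { split; apply Rmult_le_reg_r with M; try lra; unfold Rdiv; rewrite Rmult_assoc, Rinv_l; lra. }
    set (x := v / M) in *. nra. }
  assert (L : 2 * M * exp (- 1) <= Cmod (vint K 0 (- H) H)).
  { unfold vint. rewrite Cmod_mult, Cmod_Ci, Rmult_1_l.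
    eapply Rle_trans. 2: apply re_le_Cmod. eapply Rle_trans. 2: apply Rle_abs.
    rewrite <- (CInt_Chasles (fun v => K (0, v)) (- H) (- M) H) by (apply exH; lra).
    rewrite <- (CInt_Chasles (fun v => K (0, v)) (- M) M H) by (apply exH; lra).
    rewrite !re_plus.
    assert (I1 := CInt_re_ge (fun v => K (0, v)) (- H) (- M) 0 ltac:(lra) (exH (- H) (- M) ltac:(lra)) (fun v _ => Kre v)).
    assert (I2 := CInt_re_ge (fun v => K (0, v)) (- M) M (exp (- 1)) ltac:(lra) (exH (- M) M ltac:(lra)) (fun v hv => Kre1 v hv)).
    assert (I3 := CInt_re_ge (fun v => K (0, v)) M H 0 ltac:(lra) (exH M H ltac:(lra)) (fun v _ => Kre v)). lra. }
  assert (e3 : 1 / 3 <= exp (- 1)).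
  { replace (-1) with (- (1)) by ring. rewrite exp_Ropp. unfold Rdiv. rewrite Rmult_1_l. apply Rinv_le_contravar. apply exp_pos. apply exp_le_3. }
  rewrite E1, E2, Cmod_mult, Cmod_inv, Cmod_R, (Rabs_right M) by (try lra; apply RtoC_neq0; lra).
  set (V := vint K 0 (- H) H) in *. set (h := (hint K 0 a (- H) - hint K 0 a H)%C).
  assert (Hh : Cmod h <= 6 * B * exp (- t)).
  { unfold h, Cminus. eapply Rle_trans. apply Cmod_triangle. rewrite Cmod_opp. lra. }
  assert (T := Cmod_triangle_inv V h).
  assert (IM : 0 < / M <= 1). { split. apply Rinv_0_lt_compat; lra. rewrite <- Rinv_1. apply Rinv_le_contravar; lra. }
  assert (P := exp_pos (- t)). assert (X0 : 0 <= B * exp (- t)) by (apply Rmult_le_pos; lra).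
  apply Rle_trans with (/ M * (2 * M * exp (- 1) - 6 * B * exp (- t))).
  - rewrite Rmult_minus_distr_l. replace (/ M * (2 * M * exp (- 1))) with (2 * exp (- 1)) by (field; lra). nra.
  - apply Rmult_le_compat_l; lra.
Qed.

Definition tends0 (f : R -> R) : Prop := forall e, 0 < e -> exists T, forall t, T <= t -> Rabs (f t) <= e.

Lemma tends0_plus f g : tends0 f -> tends0 g -> tends0 (fun t => f t + g t).
Proof.
  intros Hf Hg e He. destruct (Hf (e / 2)) as [T1 H1]. lra. destruct (Hg (e / 2)) as [T2 H2]. lra.
  exists (Rmax T1 T2). intros t Ht. eapply Rle_trans. apply Rabs_triang.
  specialize (H1 t (Rle_trans _ _ _ (Rmax_l _ _) Ht)). specialize (H2 t (Rle_trans _ _ _ (Rmax_r _ _) Ht)). lra.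
Qed.

Lemma tends0_scal c f : tends0 f -> tends0 (fun t => c * f t).
Proof.
  intros Hf e He. assert (P := Rabs_pos c). destruct (Hf (e / (Rabs c + 1))) as [T H]. apply Rdiv_lt_0_compat; lra.
  exists T. intros t Ht. rewrite Rabs_mult. specialize (H t Ht).
  apply Rle_trans with ((Rabs c + 1) * (e / (Rabs c + 1))). 2: right; field; lra.
  apply Rmult_le_compat; try apply Rabs_pos; lra.
Qed.

Lemma tends0_le f g T0 : tends0 g -> (forall t, T0 <= t -> Rabs (f t) <= g t) -> tends0 f.
Proof.
  intros Hg H e He. destruct (Hg e He) as [T HT]. exists (Rmax T0 T). intros t Ht.
  eapply Rle_trans. apply H. eapply Rle_trans; [apply Rmax_l|exact Ht].
  eapply Rle_trans. apply Rle_abs. apply HT. eapply Rle_trans; [apply Rmax_r|exact Ht].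
Qed.

Lemma tends0_Rpower k : k < 0 -> tends0 (fun t => Rpower t k).
Proof.
  intros Hk e He. exists (exp (ln e / k)). intros t Ht.
  assert (t0 : 0 < t) by (eapply Rlt_le_trans; [apply exp_pos|exact Ht]).
  unfold Rpower. rewrite Rabs_right by (apply Rle_ge; left; apply exp_pos).
  rewrite <- (exp_ln e) by auto. apply exp_le.
  assert (L : ln e / k <= ln t).
  { rewrite <- (ln_exp (ln e / k)). destruct Ht as [Ht|Ht]. left; apply ln_increasing; auto. apply exp_pos. rewrite Ht; lra. }
  apply Rmult_le_compat_l with (r := - k) in L; [|lra].
  replace (- k * (ln e / k)) with (- ln e) in L by (field; lra). lra.
Qed.

Lemma tends0_exp_Rpower p : p <= 1 -> tends0 (fun t => exp (- t) * Rpower t p).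
Proof.
  intros Hp. apply tends0_le with (fun t => 4 * Rpower t (-1)) 1.
  - apply tends0_scal, tends0_Rpower. lra.
  - intros t Ht. assert (P1 := exp_pos (- t)). assert (P2 : 0 < Rpower t p) by apply exp_pos.
    rewrite Rabs_right by (apply Rle_ge; apply Rmult_le_pos; lra).
    assert (R1 : Rpower t p <= t). { rewrite <- (Rpower_1 t) at 2 by lra. apply Rle_Rpower; lra. }
    replace (Rpower t (-1)) with (/ t). 2:{ replace (-1) with (- (1)) by ring. rewrite Rpower_Ropp, Rpower_1; lra. }
    assert (Q : exp (- t) <= 4 / (t * t)).
    { rewrite exp_Ropp. replace (4 / (t * t)) with (/ (t / 2 * (t / 2))) by (field; lra).
      apply Rinv_le_contravar. nra. replace t with (t / 2 + t / 2) at 3 by field. rewrite exp_plus.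
      assert (t / 2 <= exp (t / 2)) by (generalize (exp_ineq1_le (t / 2)); lra). nra. }
    replace (4 * / t) with (4 / (t * t) * t) by (field; lra). apply Rmult_le_compat; lra.
Qed.

Lemma tends0_exp_sqrt c : 0 < c -> tends0 (fun t => exp (- c * sqrt t)).
Proof.
  intros Hc. apply tends0_le with (fun t => / c * Rpower t (- / 2)) 1.
  - apply tends0_scal, tends0_Rpower. lra.
  - intros t Ht. rewrite Rabs_right by (apply Rle_ge; left; apply exp_pos).
    rewrite Rpower_Ropp, Rpower_sqrt by lra. assert (0 < sqrt t) by (apply sqrt_lt_R0; lra).
    rewrite <- Rinv_mult. replace (- c * sqrt t) with (- (c * sqrt t)) by ring. rewrite exp_Ropp.
    apply Rinv_le_contravar. nra. generalize (exp_ineq1_le (c * sqrt t)). lra.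
Qed.

(** By the Euler product [F 2] is an exponential, hence nonzero, so the coefficients cannot all
    vanish. *)
Lemma min_coef (F : selberg_class) : exists n0, (1 <= n0)%nat /\ sel_a F n0 <> RtoC 0 /\
  forall n, (1 <= n < n0)%nat -> sel_a F n = RtoC 0.
Proof.
  assert (E : exists n, (1 <= n)%nat /\ sel_a F n <> RtoC 0).
  { destruct (classic (exists n, (1 <= n)%nat /\ sel_a F n <> RtoC 0)) as [Q|Q]; auto. exfalso.
    assert (Z : forall n, (1 <= n)%nat -> sel_a F n = RtoC 0).
    { intros n Hn. destruct (Ceq_dec (sel_a F n) 0) as [e|e]; auto. exfalso. apply Q. eauto. }
    destruct (sel_euler F) as [b [th [_ [_ [_ HL]]]]]. destruct (HL (RtoC 2)) as [L [_ EL]]. rewrite re_RtoC; lra.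
    destruct (series_uniform F 2) as [A [_ HU]]. lra.
    apply (Cexp_neq0 L). rewrite EL. apply Cmod_eq_0. apply Rle_antisym. 2: apply Cmod_ge_0.
    apply le_epsilon. intros e He. destruct (HU e He) as [N0 HN]. specialize (HN N0 (Nat.le_refl _) (RtoC 2) (re_RtoC 2)).
    rewrite (csum_ext _ (fun _ => 0 * 0)%C) in HN. 2:{ intros n Hn. rewrite Z by lia. ring. }
    rewrite csum_scal in HN. replace (F (RtoC 2) - 0 * csum (fun _ => RtoC 0) N0)%C with (F (RtoC 2)) in HN by ring. lra. }
  destruct E as [n [Hn Han]]. revert Hn Han. induction n as [n IH] using lt_wf_ind. intros Hn Han.
  destruct (classic (exists k, (1 <= k < n)%nat /\ sel_a F k <> RtoC 0)) as [[k [Hk Hak]]|Q].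
  - apply (IH k); auto; lia.
  - exists n. split; auto. split; auto. intros k Hk. destruct (Ceq_dec (sel_a F k) 0) as [e|e]; auto. exfalso. apply Q. eauto.
Qed.

(** Half of the exponent [M] becomes a factor exponentially small in [M], as [ln n] is at least
    [ln (n0 + 1) - ln n0] away from [ln n0]; the other half remains as a summable peak. *)
Lemma peak_gap (M : R) (n0 n : nat) : 0 <= M -> (1 <= n0)%nat -> (n0 < n)%nat ->
  peak M (INR n0) n <= exp (- (M / 2 * (ln (INR (S n0)) - ln (INR n0)))) * peak (M / 2) (INR n0) n.
Proof.
  intros HM H1 Hn. unfold peak. rewrite <- exp_plus. apply exp_le.
  assert (0 < INR n0) by (apply (lt_INR 0); lia).
  assert (A1 : ln (INR n0) < ln (INR (S n0))) by (apply ln_increasing; auto; apply lt_INR; lia).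
  assert (A2 : ln (INR (S n0)) <= ln (INR n)).
  { destruct (Nat.eq_dec (S n0) n) as [<-|E]. lra. left. apply ln_increasing. apply (lt_INR 0); lia. apply lt_INR; lia. }
  rewrite Rabs_left1 by lra. nra.
Qed.

Lemma Rpower_scaled (c x p q : R) : 0 < c -> 0 < x -> Rpower (c * Rpower x p) q = Rpower c q * Rpower x (p * q).
Proof.
  intros Hc Hx. rewrite <- Rpower_mult_distr by (auto; apply exp_pos). rewrite Rpower_mult. reflexivity.
Qed.

(* If the degree were below 1, the sum dual to a single coefficient would be too
   short to produce it: with the kernel [w K(w) / sqrt t], which vanishes at 0,
   the first nonzero coefficient is isolated on one side of the identity. *)
Lemma degree_ge1 (F : selberg_class) : 1 <= degree F.
Proof.
  destruct (Rle_lt_dec 1 (degree F)) as [Q|Hd]; auto. exfalso.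
  assert (dp := degree_pos F). set (d := degree F) in *.
  (* With this choice both bare powers of [t] in [f] below have negative exponents; the delicate one
     is [d (dl - 1/2) + d - 1/2 = - (1 - d) (2 - d) / 4]. *)
  set (dl := (1 - d) / 4). assert (Hdl : 0 < dl <= 1 / 4) by (unfold dl; lra).
  destruct (smoothed_equation F dl 0 Hdl (Rle_refl 0)) as
    [T [KG [Ka [A [E [kr [kd [HT [HKG [HKa [HA0 [HE [Hkr [Hkd [Hk5 [Hcoef [HA P]]]]]]]]]]]]]]]]].
  destruct (flat_kernel_bound kr kd Hkr Hkd) as [m [C1 HK]].
  set (B0 := exp C1) in *. assert (HB0 : 0 < B0) by apply exp_pos.
  destruct (min_coef F) as [n0 [Hn0 [Ha0 Hmin]]].
  set (N := INR n0). assert (HN : 1 <= N) by (unfold N; apply (le_INR 1); lia).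
  set (c := conductor_root F). assert (Hc : 0 < c) by apply conductor_root_pos.
  set (eta := ln (INR (S n0)) - ln (INR n0)).
  assert (Heta : 0 < eta).
  { unfold eta. assert (ln (INR n0) < ln (INR (S n0))); [|lra]. apply ln_increasing. fold N; lra. apply lt_INR; lia. }
  set (a := 1 / 2 + 2 * dl). set (g := Cmod (sel_a F n0) * Rpower N (- (1 / 2))).
  assert (Hg : 0 < g). { unfold g. apply Rmult_lt_0_compat. now apply Cmod_gt_0. apply exp_pos. }
  set (c' := c ^ 2 / N). assert (Hc' : 0 < c'). { apply Rdiv_lt_0_compat. now apply pow_lt. lra. }
  (* All error terms with their dependence on [t] made explicit, including the loss in
     [flat_window_lower]. The lower bound for the isolated term will read [2 g / 3 <= f t], against
     [f t <= g / 3]. *)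
  set (f := fun t =>
    (KG * B0 * (Rpower N a + Rpower N (- a))) * (exp (- t) * Rpower t 0) +
    ((E * (4 * B0 * (6 * Ka * Rpower c' (dl - 1 / 2)))) * Rpower t (d * (dl - 1 / 2)) +
    ((E * (4 * B0 * (6 * Ka * Rpower c' (dl - 1 / 2) * c'))) * Rpower t (d * (dl - 1 / 2) + d - / 2) +
    ((E * (4 * B0 * (Rpower c' a * A))) * (exp (- t) * Rpower t (d * a)) +
    ((4 * B0 * (Ka * (6 * Rpower N (dl - 1 / 2) * (1 + N)))) * exp (- (eta / 2) * sqrt t) +
    ((4 * B0 * (Rpower N a * A)) * (exp (- t) * Rpower t 0) +
     (g * (6 * B0)) * (exp (- t) * Rpower t 0))))))).
  assert (Hf : tends0 f).
  { assert (d1 : d * (dl - 1 / 2) < 0) by nra.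
    assert (d2 : d * (dl - 1 / 2) + d - / 2 < 0) by (unfold dl in *; nra).
    assert (d3 : d * a <= 1) by (unfold a, dl in *; nra).
    unfold f. repeat apply tends0_plus; apply tends0_scal;
      (apply tends0_exp_Rpower; lra) || (apply tends0_Rpower; lra) || (apply tends0_exp_sqrt; lra). }
  destruct (Hf (g / 3)) as [T2 HT2]. lra.
  set (t := Rmax (Rmax T T2) 256).
  assert (t1 : T <= t) by (unfold t; eapply Rle_trans; [apply Rmax_l|apply Rmax_l]).
  assert (t2 : T2 <= t) by (unfold t; eapply Rle_trans; [apply Rmax_r|apply Rmax_l]).
  assert (t3 : 256 <= t) by (unfold t; apply Rmax_r).
  specialize (HT2 t t2). assert (Ff := Rle_trans _ _ _ (Rle_abs _) HT2). clear HT2 Hf t2.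
  set (s := (1 / 2, t) : C).
  assert (Es : Rabs (Im s) = t) by (unfold s; change (Im (1 / 2, t)) with t; rewrite Rabs_right; lra).
  assert (Er : Re s = 1 / 2) by reflexivity.
  set (k := flat_kernel (2 * S m) t).
  set (y2 := c' * Rpower t d).
  assert (Hy2 : 0 < y2) by (apply Rmult_lt_0_compat; auto; apply exp_pos).
  assert (ED : N * y2 = c ^ 2 * Rpower t d) by (unfold y2, c'; field; lra).
  assert (HD : Rabs (ln (N * y2) - log_conductor_at F t) <= 0 / t).
  { rewrite ED. unfold log_conductor_at. fold c d. rewrite ln_mult by (try apply exp_pos; now apply pow_lt).
    unfold Rpower. rewrite ln_exp. replace (ln (c ^ 2)) with (2 * ln c) by (simpl; rewrite Rmult_1_r, ln_mult; lra).
    replace (_ - _) with 0 by ring. rewrite Rabs_R0. unfold Rdiv. lra. }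
  assert (Hk : forall w, cdiff k w).
  { intros w. unfold k, flat_kernel. apply cdiff_mult. apply cdiff_mult. apply cdiff_id. apply kern_cdiff. apply cdiff_const. }
  assert (K0 : k 0 = RtoC 0) by (unfold k, flat_kernel; ring).
  specialize (P s N y2 B0 k). cbv zeta in P. rewrite Es, Er in P.
  destruct P as [P1 [P2 [_ [P4 [P6 P7]]]]]; auto; try lra.
  { intros u v Hu. apply HK; auto. lra. }
  assert (P5 : forall u v, Rabs u <= sqrt t -> Cmod (k (u, v)) <= B0 * exp (- 5 * decay_r t v ^ 2)).
  { intros u v Hu. destruct (HK t u v ltac:(lra) Hu) as [_ HK2]. eapply Rle_trans. exact HK2. apply Rmult_le_compat_l. lra.
    apply Hk5. apply decay_r_ge1. lra. }
  replace (1 + 2 * dl - 1 / 2) with a in * by (unfold a; field).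
  replace (1 / 2 + 2 * dl) with a in * by reflexivity.
  replace (1 / 2 - 1 / 2) with 0 in P1 by ring.
  replace (dl - (1 - 1 / 2)) with (dl - 1 / 2) in P4 by field.
  assert (P1' : Cmod (chi F s) <= E).
  { replace (Rpower (N * y2) 0) with 1 in P1. lra. unfold Rpower. now rewrite Rmult_0_l, exp_0. }
  rewrite K0 in P2, P4. rewrite Cmult_0_r, Cmult_0_l in P2, P4.
  set (VR := Vright F dl s N k) in *. set (VL := Vleft F dl s N y2 k) in *.
  replace (VL - 0)%C with VL in P4 by ring.
  replace (0 - VR - chi F s * VL)%C with (- (VR + chi F s * VL))%C in P2 by ring. rewrite Cmod_opp in P2.
  assert (ha : 0 < a <= 3) by (unfold a; lra).
  assert (W1 : forall u v, Rabs u <= sqrt t -> Rabs v <= t / 2 -> Cmod (k (u, v)) <= B0 * / (1 + v ^ 2 / t)).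
  { intros u v Hu Hv. eapply Rle_trans. now apply P5. apply Rmult_le_compat_l. lra. apply decay_cauchy. lra. }
  assert (W2 : forall u v, Rabs u <= sqrt t -> Rabs v = t / 2 -> Cmod (k (u, v)) <= B0 * exp (- t)).
  { intros u v Hu Hv. eapply Rle_trans. now apply P5. apply Rmult_le_compat_l. lra. apply decay_edge; lra. }
  destruct (sqrt_ge8 t ltac:(lra)) as [M8 MM]. set (M := sqrt t) in *.
  assert (M16 : 16 <= M). { unfold M. replace 16 with (sqrt (16 * 16)). apply sqrt_le_1; lra. apply sqrt_square; lra. }
  set (X := (sel_a F n0 * cpow N (- s) * window t a k 1)%C).
  assert (TR : Cmod (VR - X) <= 4 * B0 * (Ka * (6 * Rpower N (dl - 1 / 2) * (1 + N)) * exp (- (eta / 2) * M) + Rpower N a * A * exp (- t))).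
  { unfold VR, Vright. rewrite Es.
    replace (1 + 2 * dl - Re s) with a by (rewrite Er; unfold a; field).
    apply (truncate_limit t a B0 k ltac:(lra) ha (fun u v _ _ => Hk (u, v)) W1 (sel_a F) s N (Fright F s) ltac:(lra) P6 P7 X _ n0).
    intros n Hn.
    (* [X] is written as a sum with a single term, so that the comparison is made term by term. *)
    assert (EX : X = csum (fun j => if Nat.eq_dec j n0 then X else 0)%C n).
    { clear - Hn Hn0. induction n. lia. destruct (Nat.eq_dec (S n) n0) as [e|e].
      - cbn [csum]. rewrite e. destruct (Nat.eq_dec n0 n0) as [_|bad]; [|now elim bad].
        rewrite (csum_ext _ (fun _ => 0 * 0)%C). rewrite csum_scal. ring.
        intros j Hj. destruct (Nat.eq_dec j n0). lia. ring.
      - cbn [csum]. rewrite <- IHn by lia. destruct (Nat.eq_dec (S n) n0). lia. ring. }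
    rewrite EX at 1. rewrite <- csum_minus.
    eapply Rle_trans. apply (csum_bound _ (fun j => 4 * B0 * ((Ka * exp (- (eta / 2) * M)) * (Rpower (INR j) (dl - 1 / 2) * peak (M / 2) N j) +
      (exp (- t) * Rpower N a) * (Cmod (sel_a F j) * Rpower (INR j) (- (1 + 2 * dl)))))).
    - intros j Hj. assert (j0 : 0 < INR j) by (apply (lt_INR 0); lia).
      assert (pe := exp_pos (- (eta / 2) * M)). assert (pt := exp_pos (- t)).
      assert (pk : 0 < peak (M / 2) N j) by apply exp_pos.
      assert (pj : 0 < Rpower (INR j) (dl - 1 / 2)) by apply exp_pos.
      assert (pj2 : 0 < Rpower (INR j) (- (1 + 2 * dl))) by apply exp_pos.
      assert (pn : 0 < Rpower N a) by apply exp_pos.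
      assert (Rhs : 0 <= 4 * B0 * ((Ka * exp (- (eta / 2) * M)) * (Rpower (INR j) (dl - 1 / 2) * peak (M / 2) N j) +
         (exp (- t) * Rpower N a) * (Cmod (sel_a F j) * Rpower (INR j) (- (1 + 2 * dl))))).
      { apply Rmult_le_pos. lra. assert (Q0 := Cmod_ge_0 (sel_a F j)).
        apply Rplus_le_le_0_compat; repeat apply Rmult_le_pos; try lra; auto. }
      (* [y1] is exactly [n0], so the window of this term is taken at 1 and the term is [X]
         itself. *)
      destruct (Nat.eq_dec j n0) as [->|e].
      { replace (sel_a F n0 * cpow (INR n0) (- s) * window t a k (N / INR n0) - X)%C with (RtoC 0).
        rewrite Cmod_0. exact Rhs. unfold X. fold N. replace (N / N) with 1 by (field; lra). ring. }
      (* Before [n0] the coefficients vanish by minimality; beyond it the peak is exponentially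
         small in [sqrt t]. *)
      destruct (le_lt_dec j n0) as [Hlt|Hgt].
      { replace (sel_a F j * cpow (INR j) (- s) * window t a k (N / INR j) - 0)%C with (RtoC 0).
        rewrite Cmod_0. exact Rhs. rewrite Hmin by lia. ring. }
      set (x := N / INR j). assert (x0 : 0 < x) by (apply Rdiv_lt_0_compat; lra).
      assert (x1 : x < 1). { apply Rmult_lt_reg_r with (INR j); auto. unfold x. replace (N / INR j * INR j) with N by (field; lra).
        rewrite Rmult_1_l. unfold N. apply lt_INR; lia. }
      assert (W := window_value t a B0 k ltac:(lra) ha (fun u v _ _ => Hk (u, v)) W1 W2 x x0).
      destruct (Rle_dec 1 x) as [bad|_]; [lra|]. fold M in W.
      replace (window t a k x - 0)%C with (window t a k x) in W by ring.
      assert (Elx : ln x = ln N - ln (INR j)) by (unfold x; apply ln_div; lra).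
      assert (Pk : exp (- M * Rabs (ln x)) = peak M N j) by (unfold peak; now rewrite Elx). rewrite Pk in W.
      assert (G := peak_gap M n0 j ltac:(lra) Hn0 Hgt).
      fold eta in G. fold N in G. replace (- (M / 2 * eta)) with (- (eta / 2) * M) in G by field.
      replace (sel_a F j * cpow (INR j) (- s) * window t a k x - 0)%C with (sel_a F j * cpow (INR j) (- s) * window t a k x)%C by ring.
      rewrite !Cmod_mult, Cmod_cpow, re_opp, Er.
      assert (Ex : exp (a * ln x) * Rpower (INR j) (- (1 / 2)) = Rpower N a * Rpower (INR j) (- (1 + 2 * dl))).
      { unfold Rpower. rewrite <- !exp_plus. f_equal. rewrite Elx. unfold a. field. }
      assert (Ej : Rpower (INR j) dl * Rpower (INR j) (- (1 / 2)) = Rpower (INR j) (dl - 1 / 2)) by (now rewrite <- Rpower_plus).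
      assert (pr : 0 < Rpower (INR j) (- (1 / 2))) by apply exp_pos.
      assert (Cj := Hcoef j ltac:(lia)). assert (Cj0 := Cmod_ge_0 (sel_a F j)).
      eapply Rle_trans. apply Rmult_le_compat_l. 2: exact W. apply Rmult_le_pos; lra.
      replace (Cmod (sel_a F j) * Rpower (INR j) (- (1 / 2)) * (4 * B0 * (peak M N j + exp (- t) * exp (a * ln x)))) with
        (4 * B0 * (Cmod (sel_a F j) * (Rpower (INR j) (- (1 / 2)) * peak M N j) + exp (- t) * Cmod (sel_a F j) * (exp (a * ln x) * Rpower (INR j) (- (1 / 2))))) by ring.
      rewrite Ex. apply Rmult_le_compat_l. lra. apply Rplus_le_compat. 2: right; ring.
      apply Rle_trans with (Ka * Rpower (INR j) dl * (Rpower (INR j) (- (1 / 2)) * (exp (- (eta / 2) * M) * peak (M / 2) N j))).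
      + assert (0 < peak M N j) by apply exp_pos.
        apply Rmult_le_compat; auto. apply Rmult_le_pos; left; auto. apply Rmult_le_compat_l. left; auto. exact G.
      + right. rewrite <- Ej. ring.
    - rewrite rsum_scal, rsum_plus, !rsum_scal. apply Rmult_le_compat_l. lra. apply Rplus_le_compat.
      + rewrite (Rmult_assoc Ka (6 * _ * _)), (Rmult_comm (6 * Rpower N (dl - 1 / 2) * (1 + N))), <- Rmult_assoc. apply Rmult_le_compat_l.
        { apply Rmult_le_pos; auto. left; apply exp_pos. }
        eapply Rle_trans. apply weighted_peak_sum. lra. lra. { apply Rabs_le. lra. }
        apply Rmult_le_compat_l. { assert (0 < Rpower N (dl - 1 / 2)) by apply exp_pos. lra. }
        apply Rplus_le_compat_l. apply Rmult_le_reg_r with (M / 2). lra. replace (N / (M / 2) * (M / 2)) with N by (field; lra). nra.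
      + replace (Rpower N a * A * exp (- t)) with (exp (- t) * Rpower N a * A) by ring.
        apply Rmult_le_compat_l; auto. apply Rmult_le_pos; left; apply exp_pos. }
  assert (LX : g * (2 / 3 - 6 * B0 * exp (- t)) <= Cmod X).
  { unfold X. rewrite !Cmod_mult, Cmod_cpow, re_opp, Er. fold g. apply Rmult_le_compat_l. lra.
    apply flat_window_lower; try lra. intros u v Hu Hv.
    destruct (HK t u v ltac:(lra) Hu) as [HK1 _]. eapply Rle_trans. exact HK1. apply Rmult_le_compat_l. lra.
    destruct (decay_edge t v ltac:(lra) Hv) as [De _]. eapply Rle_trans. 2: exact De.
    apply Hk5. apply decay_r_ge1. lra. }
  assert (e1 := exp_pos (- t)). assert (R0 : Rpower t 0 = 1) by (apply Rpower_O; lra).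
  assert (B1 : Cmod VR <= Cmod (VR + chi F s * VL) + E * Cmod VL).
  { replace VR with ((VR + chi F s * VL) - chi F s * VL)%C at 1 by ring. unfold Cminus at 1.
    eapply Rle_trans. apply Cmod_triangle. rewrite Cmod_opp, Cmod_mult. apply Rplus_le_compat_l.
    apply Rmult_le_compat_r; auto. apply Cmod_ge_0. }
  assert (B2 : Cmod X <= Cmod (VR - X) + Cmod VR).
  { replace X with (VR - (VR - X))%C at 1 by ring. unfold Cminus at 1.
    eapply Rle_trans. apply Cmod_triangle. rewrite Cmod_opp. lra. }
  assert (B3 : E * Cmod VL <= E * (4 * B0 * (6 * Ka * Rpower y2 (dl - 1 / 2) * (1 + y2 / M) + exp (- t) * Rpower y2 a * A))).
  { now apply Rmult_le_compat_l. }
  assert (Y1 : Rpower y2 (dl - 1 / 2) = Rpower c' (dl - 1 / 2) * Rpower t (d * (dl - 1 / 2))) by (apply Rpower_scaled; lra).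
  assert (Y2 : Rpower y2 a = Rpower c' a * Rpower t (d * a)) by (apply Rpower_scaled; lra).
  assert (Y3 : Rpower t (d * (dl - 1 / 2) + d - / 2) * M = Rpower t (d * (dl - 1 / 2)) * Rpower t d).
  { unfold M. rewrite <- Rpower_sqrt, <- !Rpower_plus by lra. f_equal. field. }
  (* Here the length [t^d] of the dual sum competes with the width [sqrt t] of the kernel. *)
  assert (Y4 : Rpower y2 (dl - 1 / 2) * (y2 / M) = Rpower c' (dl - 1 / 2) * c' * Rpower t (d * (dl - 1 / 2) + d - / 2)).
  { apply Rmult_eq_reg_r with M; [|lra]. rewrite (Rmult_assoc _ _ M), (Rmult_assoc _ _ M), Y3, Y1.
    unfold y2. field. lra. }
  replace (6 * Ka * Rpower y2 (dl - 1 / 2) * (1 + y2 / M)) with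
    (6 * Ka * (Rpower y2 (dl - 1 / 2) + Rpower y2 (dl - 1 / 2) * (y2 / M))) in B3 by ring.
  rewrite Y4, Y1, Y2 in B3. unfold f in Ff. rewrite !R0 in Ff. fold M in Ff.
  nra.
Qed.

(** * The approximate functional equation and its derivatives *)

Lemma Rpower_le_base (x y p : R) : 0 < x <= y -> 0 <= p -> Rpower x p <= Rpower y p.
Proof. intros H Hp. apply Rle_Rpower_l; lra. Qed.

(** Brings every term of [smoothed_equation] to [y1^(- sg)] times quantities free of [sg]. The key
    identity is [(y1 y2)^(1/2 - sg) y2^sg = q y1^(- sg)]; when [y1 < 1], its small negative powers
    are controlled by [1 / y1 <= y2]. *)
Lemma two_factor_powers (y1 y2 dl sg : R) : 0 < y1 -> 0 < y2 -> 0 < dl -> 1 <= y1 * y2 ->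
  let W := Rpower (Rmax y1 y2) (2 * dl) in let X := Rpower y1 (- sg) in let q := sqrt (y1 * y2) in
  1 <= q /\ q <= Rmax y1 y2 /\
  Rpower y1 (1 + 2 * dl - sg) <= X * W * y1 /\
  Rpower y1 (- (sg + 2 * dl)) <= X * W /\
  Rpower y1 (dl - sg) <= X * W /\
  Rpower (y1 * y2) (1 / 2 - sg) * Rpower y2 (dl - (1 - sg)) <= X * W * (q / y2) /\
  Rpower (y1 * y2) (1 / 2 - sg) * Rpower y2 (sg + 2 * dl) <= X * W * q.
Proof.
  intros H1 H2 Hdl HD W X q. set (Y := Rmax y1 y2) in *.
  assert (L1 : y1 <= Y) by apply Rmax_l. assert (L2 : y2 <= Y) by apply Rmax_r.
  assert (q1 : 1 <= q). { unfold q. rewrite <- sqrt_1. apply sqrt_le_1; lra. }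
  assert (qq : q * q = y1 * y2) by (apply sqrt_sqrt; nra).
  assert (qY : q <= Y). { apply Rsqr_incr_0_var; [|lra]. unfold Rsqr. rewrite qq. apply Rmult_le_compat; lra. }
  assert (pX : 0 < X) by apply exp_pos. assert (pW : 0 < W) by apply exp_pos.
  assert (D2 : forall y, 0 < y <= Y -> Rpower y dl <= W).
  { intros y Hy. apply Rle_trans with (Rpower Y dl). apply Rpower_le_base; lra. apply Rle_Rpower; lra. }
  assert (q2 : Rpower (y1 * y2) (/ 2) = q) by (apply Rpower_sqrt; nra).
  assert (S : Rpower (y1 * y2) (1 / 2 - sg) = q * X * Rpower y2 (- sg)).
  { replace (1 / 2 - sg) with (/ 2 + - sg) by field. rewrite Rpower_plus, q2, <- Rpower_mult_distr by auto. unfold X. ring. }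
  split; auto. split; auto. split; [|split; [|split; [|split]]].
  - replace (1 + 2 * dl - sg) with (- sg + (2 * dl + 1)) by ring. rewrite !Rpower_plus, (Rpower_1 y1) by auto. fold X.
    rewrite Rmult_assoc. apply Rmult_le_compat_l. lra. apply Rmult_le_compat_r. lra. apply Rpower_le_base; lra.
  - replace (- (sg + 2 * dl)) with (- sg + - (2 * dl)) by ring. rewrite Rpower_plus. fold X. apply Rmult_le_compat_l. lra.
    replace (Rpower y1 (- (2 * dl))) with (Rpower (/ y1) (2 * dl)).
    2:{ unfold Rpower. rewrite ln_Rinv by auto. f_equal. ring. }
    assert (P := Rinv_0_lt_compat _ H1). apply Rpower_le_base; [|lra]. split; auto.
    apply Rle_trans with y2; auto. apply Rmult_le_reg_l with y1; auto. rewrite Rinv_r; lra.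
  - replace (dl - sg) with (- sg + dl) by ring. rewrite Rpower_plus. fold X. apply Rmult_le_compat_l. lra. apply D2. lra.
  - rewrite S. replace (dl - (1 - sg)) with (sg + (- (1) + dl)) by ring. rewrite !Rpower_plus, !Rpower_Ropp, Rpower_1 by auto.
    assert (0 < Rpower y2 sg) by apply exp_pos.
    replace (q * X * / Rpower y2 sg * (Rpower y2 sg * (/ y2 * Rpower y2 dl))) with (X * Rpower y2 dl * (q / y2)) by (field; lra).
    apply Rmult_le_compat_r. left; apply Rdiv_lt_0_compat; lra. apply Rmult_le_compat_l. lra. apply D2; lra.
  - rewrite S. rewrite Rpower_plus, Rpower_Ropp.
    assert (0 < Rpower y2 sg) by apply exp_pos.
    replace (q * X * / Rpower y2 sg * (Rpower y2 sg * Rpower y2 (2 * dl))) with (X * Rpower y2 (2 * dl) * q) by (field; lra).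
    apply Rmult_le_compat_r. lra. apply Rmult_le_compat_l. lra. apply Rpower_le_base; lra.
Qed.

(** [t0] belongs to the final point and stays fixed with [y1] and [y2] while [s] ranges over a
    neighbourhood of it; this is why [|Im s|] is only required to be within 1 of [t0]. *)
Lemma afe_bound (F : selberg_class) (dl : R) : 0 < dl <= 1 / 4 -> exists T B, 1 <= T /\ 0 <= B /\
  forall (s : C) (y1 y2 t0 : R), T <= t0 -> Rabs (Rabs (Im s) - t0) <= 1 -> - dl <= Re s <= 1 + dl ->
  0 < y1 -> 0 < y2 -> y1 * y2 = conductor_root F ^ 2 * Rpower t0 (degree F) ->
  1 <= y1 * y2 /\
  Cmod (F s - P1sum F s y1 - chi F s * P2sum F s y2) <=
  B * (Rpower (Rmax y1 y2) (2 * dl) * Rpower y1 (- Re s) * (Rpower t0 (- / 2) * (y1 + sqrt (y1 * y2)))).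
Proof.
  intros Hdl. assert (d1 := degree_ge1 F). set (d := degree F) in *.
  assert (Hc := conductor_root_pos F). set (c := conductor_root F) in *.
  (* The value [2 d] of [c2] allows for [d |ln t0 - ln t| <= 2 d / t]. *)
  destruct (smoothed_equation F dl (2 * d) Hdl ltac:(lra)) as
    [T [KG [Ka [A [E [kr [kd [HT [HKG [HKa [HA0 [HE [Hkr [Hkd [_ [_ [_ P]]]]]]]]]]]]]]]]].
  destruct (kern_bound kr kd) as [m [C1 HK]]; auto.
  set (B0 := exp C1) in *. assert (HB0 : 0 < B0) by apply exp_pos.
  set (ic := / c). assert (Hic : 0 < ic) by now apply Rinv_0_lt_compat.
  set (B := B0 * (2 * KG + 24 * Ka * (ic + 2) + 8 * A + E * (24 * Ka * (ic + 2) + 8 * A))).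
  (* The 2 leaves room for [|Im s|] below [t0]; [ic ^ 2] ensures [c^2 t0 >= 1]. *)
  exists (T + 2 + ic ^ 2), B. assert (ic2 : 0 < ic ^ 2) by now apply pow_lt.
  split. lra. split.
  { unfold B. assert (0 <= Ka * (ic + 2)) by (apply Rmult_le_pos; lra).
    apply Rmult_le_pos. lra. assert (0 <= E * (24 * Ka * (ic + 2) + 8 * A)) by (apply Rmult_le_pos; lra). lra. }
  intros s y1 y2 t0 Ht0 Ht Hs Hy1 Hy2 HD0. set (t := Rabs (Im s)) in *.
  apply Rabs_le_between in Ht. set (sg := Re s) in *.
  (* The bound [degree F >= 1] enters here. *)
  assert (ED : c ^ 2 * t0 <= y1 * y2).
  { rewrite HD0. apply Rmult_le_compat_l. apply pow_le; lra. rewrite <- (Rpower_1 t0) at 1 by lra. apply Rle_Rpower; lra. }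
  assert (cic : c * ic = 1) by (apply Rinv_r; lra).
  assert (HD1 : 1 <= y1 * y2).
  { apply Rle_trans with (c ^ 2 * t0); auto. replace 1 with ((c * ic) ^ 2) by (rewrite cic; ring).
    rewrite Rpow_mult_distr. apply Rmult_le_compat_l. apply pow_le; lra. lra. }
  destruct (two_factor_powers y1 y2 dl sg Hy1 Hy2 ltac:(lra) HD1) as [q1 [qY [R1 [R2 [R3 [R4 R5]]]]]].
  set (W := Rpower (Rmax y1 y2) (2 * dl)) in *. set (X := Rpower y1 (- sg)) in *. set (q := sqrt (y1 * y2)) in *.
  assert (pX : 0 < X) by apply exp_pos. assert (pW : 0 < W) by apply exp_pos.
  split. lra.
  set (k := kern (2 * S m) t).
  assert (HD : Rabs (ln (y1 * y2) - log_conductor_at F t) <= (2 * d) / t).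
  { rewrite HD0. unfold log_conductor_at. fold c d. rewrite ln_mult by (try apply exp_pos; now apply pow_lt).
    unfold Rpower. rewrite ln_exp. replace (ln (c ^ 2)) with (2 * ln c) by (simpl; rewrite Rmult_1_r, ln_mult; lra).
    replace (2 * ln c + d * ln t0 - (2 * ln c + d * ln t)) with (d * (ln t0 - ln t)) by ring.
    rewrite Rabs_mult, (Rabs_right d) by lra.
    assert (LR : Rabs (ln t0 - ln t) <= 2 / t).
    { replace 2 with (2 * 1) by ring. apply ln_ratio_bound; try lra. apply Rabs_le; lra. }
    replace (2 * d / t) with (d * (2 / t)) by (field; lra). apply Rmult_le_compat_l; lra. }
  assert (K0 : k 0 = RtoC 1) by (unfold k; apply (kern_0 (m + (S m + 0))%nat)).
  specialize (P s y1 y2 B0 k). cbv zeta in P. fold t sg in P.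
  destruct P as [P1 [P2 [P3 [P4 _]]]]; auto; try lra.
  { intros w. apply kern_cdiff. }
  { intros u v Hu. apply HK; auto. lra. }
  rewrite K0, Cmult_1_r in P2, P3, P4.
  set (VR := Vright F dl s y1 k) in *. set (VL := Vleft F dl s y1 y2 k) in *.
  set (S1 := P1sum F s y1) in *. set (S2 := P2sum F s y2) in *.
  set (M := sqrt t) in *. set (h := Rpower t0 (- / 2)).
  assert (ph : 0 < h) by apply exp_pos.
  assert (hq : h * sqrt t0 = 1). { unfold h. rewrite Rpower_Ropp, Rpower_sqrt by lra. apply Rinv_l. assert (0 < sqrt t0) by (apply sqrt_lt_R0; lra). lra. }
  assert (st0 : 0 < sqrt t0) by (apply sqrt_lt_R0; lra).
  destruct (sqrt_ge8 t ltac:(lra)) as [M8 MM]. fold M in M8, MM.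
  assert (SS : sqrt t0 * sqrt t0 = t0) by (apply sqrt_sqrt; lra).
  assert (Mh : / M <= 2 * h).
  { apply Rmult_le_reg_r with (M * sqrt t0). apply Rmult_lt_0_compat; lra.
    replace (/ M * (M * sqrt t0)) with (sqrt t0) by (field; lra).
    replace (2 * h * (M * sqrt t0)) with (2 * M * (h * sqrt t0)) by ring. rewrite hq, Rmult_1_r.
    apply Rsqr_incr_0_var; [|lra]. unfold Rsqr. rewrite SS. nra. }
  assert (eh : exp (- t) <= 2 * h).
  { apply Rle_trans with (/ M); auto. rewrite exp_Ropp. apply Rinv_le_contravar. lra.
    generalize (exp_ineq1_le t). nra. }
  assert (e0 := exp_pos (- t)).
  assert (cq : c * sqrt t0 <= q).
  { apply Rsqr_incr_0_var; [|lra]. unfold Rsqr, q. rewrite sqrt_sqrt by nra.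
    replace (c * sqrt t0 * (c * sqrt t0)) with (c ^ 2 * (sqrt t0 * sqrt t0)) by ring. now rewrite SS. }
  (* A consequence of [y1 y2 >= c^2 t0]: a term without the saving [t0^(-1/2)] is absorbed into
     [h q] at the price of a factor [1 / c]. *)
  assert (hc : 1 <= ic * h * q).
  { replace 1 with (ic * h * (c * sqrt t0)). 2:{ replace (ic * h * (c * sqrt t0)) with ((c * ic) * (h * sqrt t0)) by ring. rewrite cic, hq. ring. }
    apply Rmult_le_compat_l; auto. apply Rmult_le_pos; lra. }
  assert (qq : q * q = y1 * y2) by (apply sqrt_sqrt; nra).
  assert (qy : q / y2 = y1 / q). { apply Rmult_eq_reg_r with (y2 * q). 2: nra. field_simplify; try lra. }
  assert (hy : y1 / q <= ic * h * y1).
  { apply Rmult_le_reg_r with q. lra. unfold Rdiv. rewrite Rmult_assoc, Rinv_l by lra. nra. }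
  assert (hp1 : 0 < h * y1) by (now apply Rmult_lt_0_compat). assert (hp2 : 0 < h * q) by (apply Rmult_lt_0_compat; lra).
  assert (hp3 : 0 < ic * (h * y1)) by (now apply Rmult_lt_0_compat). assert (hp4 : 0 < ic * (h * q)) by (now apply Rmult_lt_0_compat).
  assert (U2 : Cmod (kappa * F s - VR - chi F s * VL) <= B0 * (X * W) * (2 * KG * (h * (y1 + q)))).
  { eapply Rle_trans. exact P2.
    apply Rle_trans with (KG * B0 * (2 * h) * (X * W * y1 + X * W * q)).
    - apply Rmult_le_compat; try lra. repeat apply Rmult_le_pos; lra.
      assert (0 < Rpower y1 (1 + 2 * dl - sg)) by apply exp_pos. assert (0 < Rpower y1 (- (sg + 2 * dl))) by apply exp_pos. lra.
      apply Rmult_le_compat_l; auto. apply Rmult_le_pos; lra.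
      assert (0 < X * W) by now apply Rmult_lt_0_compat. nra.
    - right; ring. }
  assert (U3 : Cmod (VR - kappa * S1) <= B0 * (X * W) * ((24 * Ka * (ic + 2) + 8 * A) * (h * (y1 + q)))).
  { eapply Rle_trans. exact P3. rewrite (Rmult_comm 4 B0), (Rmult_assoc B0).
    apply Rle_trans with (B0 * (4 * (6 * Ka * (X * W) * ((ic + 2) * (h * (y1 + q))) + 2 * h * (X * W * y1) * A))).
    - apply Rmult_le_compat_l. lra. apply Rmult_le_compat_l. lra. apply Rplus_le_compat.
      + apply Rmult_le_compat; auto.
        * apply Rmult_le_pos. lra. left; apply exp_pos.
        * assert (0 < y1 / M) by (apply Rdiv_lt_0_compat; lra). lra.
        * apply Rmult_le_compat_l. lra. exact R3.
        * unfold Rdiv. assert (y1 * / M <= y1 * (2 * h)) by (apply Rmult_le_compat_l; lra). lra.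
      + apply Rmult_le_compat_r; auto. apply Rmult_le_compat; try (left; apply exp_pos); auto.
    - assert (hq0 : 0 < h * q) by (apply Rmult_lt_0_compat; lra). assert (pXW : 0 < X * W) by now apply Rmult_lt_0_compat.
      replace (B0 * (X * W) * ((24 * Ka * (ic + 2) + 8 * A) * (h * (y1 + q)))) with
        (B0 * (4 * (6 * Ka * (X * W) * ((ic + 2) * (h * (y1 + q))) + 2 * h * (X * W * y1) * A) + 8 * (X * W * (A * (h * q))))) by ring.
      apply Rmult_le_compat_l. lra. assert (0 <= X * W * (A * (h * q))) by (apply Rmult_le_pos; [lra|apply Rmult_le_pos; lra]). lra. }
  assert (U4 : Cmod (chi F s * (VL - kappa * S2)) <= B0 * (X * W) * (E * (24 * Ka * (ic + 2) + 8 * A) * (h * (y1 + q)))).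
  { rewrite Cmod_mult. set (RD := Rpower (y1 * y2) (1 / 2 - sg)) in *.
    set (Rp := Rpower y2 (dl - (1 - sg))) in *. set (Rb := Rpower y2 (sg + 2 * dl)) in *.
    eapply Rle_trans. apply Rmult_le_compat. apply Cmod_ge_0. apply Cmod_ge_0. exact P1. exact P4.
    replace (E * RD * (4 * B0 * (6 * Ka * Rp * (1 + y2 / M) + exp (- t) * Rb * A))) with
      (B0 * E * (24 * Ka * (RD * Rp * (1 + y2 / M)) + 4 * A * (exp (- t) * (RD * Rb)))) by ring.
    assert (V1 : RD * Rp * (1 + y2 / M) <= X * W * ((ic + 2) * (h * (y1 + q)))).
    { apply Rle_trans with (X * W * (q / y2) * (1 + y2 / M)).
      apply Rmult_le_compat_r; auto. assert (0 < y2 / M) by (apply Rdiv_lt_0_compat; lra). lra.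
      rewrite Rmult_assoc. apply Rmult_le_compat_l. nra.
      replace (q / y2 * (1 + y2 / M)) with (q / y2 + q * / M) by (field; lra). rewrite qy. assert (q * / M <= q * (2 * h)) by (apply Rmult_le_compat_l; lra). lra. }
    assert (V2 : exp (- t) * (RD * Rb) <= X * W * (2 * (h * (y1 + q)))).
    { apply Rle_trans with (2 * h * (X * W * q)). apply Rmult_le_compat; auto. lra.
      apply Rmult_le_pos; left; apply exp_pos.
      assert (0 < X * W * h * y1) by (repeat apply Rmult_lt_0_compat; auto). nra. }
    apply Rle_trans with (B0 * E * (24 * Ka * (X * W * ((ic + 2) * (h * (y1 + q)))) + 4 * A * (X * W * (2 * (h * (y1 + q)))))).
    2: right; ring. apply Rmult_le_compat_l. apply Rmult_le_pos; lra. apply Rplus_le_compat; apply Rmult_le_compat_l; auto; lra. }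
  assert (Z : (F s - S1 - chi F s * S2 = / kappa * ((kappa * F s - VR - chi F s * VL) + (VR - kappa * S1) + chi F s * (VL - kappa * S2)))%C).
  { field. apply kappa_neq0. }
  rewrite Z, Cmod_mult. assert (I := kappa_inv_le).
  set (Zs := ((kappa * F s - VR - chi F s * VL) + (VR - kappa * S1) + chi F s * (VL - kappa * S2))%C).
  apply Rle_trans with (1 * Cmod Zs). apply Rmult_le_compat_r; auto. apply Cmod_ge_0.
  rewrite Rmult_1_l. unfold Zs. eapply Rle_trans. apply Cmod_triangle. eapply Rle_trans. apply Rplus_le_compat_r. apply Cmod_triangle.
  eapply Rle_trans. apply Rplus_le_compat; [apply Rplus_le_compat|]; eassumption.
  right. unfold B. ring.
Qed.

(** * Derivatives of the main terms and of the error *)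

Lemma sum_n_m_csum (f : nat -> C) (N : nat) : sum_n_m f 1 N = csum f N.
Proof.
  induction N. rewrite sum_n_m_zero by lia. reflexivity.
  rewrite sum_n_Sm by lia. rewrite IHN. reflexivity.
Qed.

Lemma dirichlet_poly_csum (a : nat -> C) (r : nat) (y : R) (s : C) : dirichlet_poly a r y s =
  csum (fun n => a n * RtoC ((- ln (INR n)) ^ r) * cpow (INR n) (- s))%C (Z.to_nat (Int_part y)).
Proof.
  unfold dirichlet_poly. rewrite sum_n_m_csum. apply csum_ext. intros n _.
  assert (E : (cpow (INR n) (- s) * cpow (INR n) s = 1)%C).
  { rewrite <- cpow_plus. replace (- s + s)%C with (RtoC 0) by ring. unfold cpow. rewrite Cmult_0_l. apply Cexp_0. }
  assert (N := cpow_neq0 (INR n) s). rewrite <- (Cmult_1_r (cpow _ (- s))), <- (Cinv_r _ N), (Cmult_assoc (cpow _ (- s))), E.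
  unfold Cdiv. ring.
Qed.

Lemma cder_csum (f g : nat -> C -> C) (z : C) (N : nat) : (forall n, (1 <= n <= N)%nat -> cder (f n) z (g n z)) ->
  cder (fun w => csum (fun n => f n w) N) z (csum (fun n => g n z) N).
Proof.
  induction N; intros H. exact (cder_const 0 z). cbn [csum]. apply (cder_plus (fun w => csum (fun n => f n w) N)). apply IHN. intros; apply H; lia. apply H; lia.
Qed.

Lemma dirichlet_poly_cder (a : nat -> C) (r : nat) (y : R) (u : C -> C) (s l : C) : cder u s l ->
  cder (fun w => dirichlet_poly a r y (u w)) s (l * dirichlet_poly a (S r) y (u s))%C.
Proof.
  intros Hu. apply cder_ext with (fun w => csum (fun n => a n * RtoC ((- ln (INR n)) ^ r) * cpow (INR n) (- u w))%C (Z.to_nat (Int_part y))).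
  { intros w. now rewrite dirichlet_poly_csum. }
  rewrite dirichlet_poly_csum, <- csum_scal.
  apply (cder_csum (fun n w => a n * RtoC ((- ln (INR n)) ^ r) * cpow (INR n) (- u w))%C
    (fun n w => l * (a n * RtoC ((- ln (INR n)) ^ S r) * cpow (INR n) (- u w)))%C).
  intros n _. eapply cder_val. 2: apply cder_scal, (cpow_cder (INR n) (fun w => - u w)%C), cder_opp, Hu.
  simpl pow. rewrite RtoC_mult, RtoC_opp. ring.
Qed.

Lemma cder_sum_n_m (f g : nat -> C -> C) (z : C) (N : nat) : (forall n, (n <= N)%nat -> cder (f n) z (g n z)) ->
  cder (fun w => sum_n_m (fun n => f n w) 0 N) z (sum_n_m (fun n => g n z) 0 N).
Proof.
  induction N; intros H.
  - apply cder_ext with (f O). intros w. now rewrite sum_n_n. rewrite sum_n_n. apply H. lia.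
  - apply cder_ext with (fun w => sum_n_m (fun n => f n w) 0 N + f (S N) w)%C.
    intros w. rewrite sum_n_Sm by lia. reflexivity.
    rewrite sum_n_Sm by lia. apply (cder_plus (fun w => sum_n_m (fun n => f n w) 0 N)). apply IHN. intros; apply H; lia. apply H; lia.
Qed.

Lemma binom_0 n : Binomial.C n 0 = 1.
Proof. unfold Binomial.C. rewrite Nat.sub_0_r. simpl fact. simpl INR. field. apply INR_fact_neq_0. Qed.

Lemma binom_diag n : Binomial.C n n = 1.
Proof. unfold Binomial.C. rewrite Nat.sub_diag. simpl fact. simpl INR. field. apply INR_fact_neq_0. Qed.

(* The partial sums of both sides differ by one boundary term, by Pascal's rule. *)
Lemma leibniz_shift (x y : nat -> C) (m : nat) :
  sum_n_m (fun r => RtoC ((-1) ^ r * Binomial.C m r) * (x (S (m - r)) * y r - x (m - r)%nat * y (S r)))%C 0 m =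
  sum_n_m (fun r => RtoC ((-1) ^ r * Binomial.C (S m) r) * (x (S m - r)%nat * y r))%C 0 (S m).
Proof.
  set (p := fun r => RtoC ((-1) ^ r * Binomial.C m r)).
  assert (A : forall N, (N <= m)%nat ->
    (sum_n_m (fun r => RtoC ((-1) ^ r * Binomial.C (S m) r) * (x (S m - r)%nat * y r))%C 0 N =
     sum_n_m (fun r => p r * (x (S (m - r)) * y r - x (m - r)%nat * y (S r)))%C 0 N + p N * (x (m - N)%nat * y (S N)))%C).
  { induction N; intros HN.
    - rewrite !sum_n_n. unfold p. rewrite !binom_0. rewrite !Nat.sub_0_r. match goal with |- ?a = ?b => change (@eq C a b) end. ring.
    - rewrite !sum_n_Sm by lia. rewrite IHN by lia.
      assert (E : RtoC ((-1) ^ S N * Binomial.C (S m) (S N)) = (p (S N) - p N)%C).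
      { unfold p. rewrite <- pascal by lia. rewrite <- RtoC_minus. apply (f_equal RtoC). simpl. ring. }
      cbv beta. rewrite E. replace (S m - S N)%nat with (m - N)%nat by lia. replace (S (m - S N)) with (m - N)%nat by lia.
      change ((sum_n_m (fun r => p r * (x (S (m - r)) * y r - x (m - r)%nat * y (S r)))%C 0 N + p N * (x (m - N)%nat * y (S N)) +
        (p (S N) - p N) * (x (m - N)%nat * y (S N)) =
        sum_n_m (fun r => p r * (x (S (m - r)) * y r - x (m - r)%nat * y (S r)))%C 0 N +
         p (S N) * (x (m - N)%nat * y (S N) - x (m - S N)%nat * y (S (S N))) + p (S N) * (x (m - S N)%nat * y (S (S N))))%C).
      ring. }
  rewrite (sum_n_Sm _ 0 m) by lia. rewrite A by lia. unfold p. rewrite !binom_diag, Nat.sub_diag, Nat.sub_diag.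
  assert (Q : forall L v : C, (L = L + RtoC ((-1) ^ m * 1) * v + RtoC ((-1) ^ S m * 1) * v)%C).
  { intros L v. replace ((-1) ^ S m * 1) with (- ((-1) ^ m * 1)) by (simpl; ring). rewrite RtoC_opp. ring. }
  apply Q.
Qed.

(** The lengths of the sums do not depend on [s], so differentiation acts on the terms alone. Each
    derivative of [n^(- s)] gives a factor [- ln n], each one of [n^(s - 1)] its opposite; hence the
    signs [(-1)^r]. *)
Lemma afe_main_cder (F : selberg_class) (U : C -> Prop) (m : nat) (y1 y2 : R) (s : C) :
  copen U -> holo U (chi F) -> U s -> cder (afe_main F m y1 y2) s (afe_main F (S m) y1 y2 s).
Proof.
  intros HU Hchi Us. unfold afe_main.
  set (x := fun j => C_derive_n (chi F) j s). set (p := fun r => dirichlet_poly (fun n => Cconj (sel_a F n)) r y2 (1 - s)).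
  eapply cder_val. 2: { apply cder_plus.
    - apply (dirichlet_poly_cder (sel_a F) m y1 (fun w => w)). apply cder_id.
    - apply (cder_sum_n_m _ (fun r w => RtoC ((-1) ^ r * Binomial.C m r) *
        (C_derive_n (chi F) (S (m - r)) w * dirichlet_poly (fun n => Cconj (sel_a F n)) r y2 (1 - w) -
         C_derive_n (chi F) (m - r) w * dirichlet_poly (fun n => Cconj (sel_a F n)) (S r) y2 (1 - w)))%C).
      intros r Hr. apply cder_ext with (fun w => RtoC ((-1) ^ r * Binomial.C m r) *
        (C_derive_n (chi F) (m - r) w * dirichlet_poly (fun n => Cconj (sel_a F n)) r y2 (1 - w)))%C.
      intros w; ring. apply cder_scal.
      eapply cder_val. 2: { apply cder_mult. apply (C_derive_n_cder U); auto.
        apply (dirichlet_poly_cder _ r y2 (fun w => 1 - w)%C s (0 - 1)%C). apply cder_minus. apply cder_const. apply cder_id. }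
      cbv beta. ring. }
  eapply eq_trans. exact (f_equal (Cplus _) (leibniz_shift x p m)). rewrite Cmult_1_l. f_equal.
  apply sum_n_m_ext. intros r. unfold x, p. match goal with |- ?a = ?b => change (@eq C a b) end. ring.
Qed.

(** An identity on an open set may be differentiated. The chain [g] will be the errors of all orders
    [m]. *)
Lemma C_derive_n_ext (U : C -> Prop) (f : C -> C) (g : nat -> C -> C) : copen U -> (forall z, U z -> f z = g O z) ->
  (forall m z, U z -> cder (g m) z (g (S m) z)) -> forall m z, U z -> C_derive_n f m z = g m z.
Proof.
  intros HU H0 Hg. induction m; intros z Hz; simpl. now apply H0.
  apply cder_C_derive. destruct (HU z Hz) as [r [r0 Hr]].
  apply cder_ext_loc with (g m) r; auto. intros w Hw. symmetry. apply IHm. now apply Hr.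
Qed.

Lemma copen_strip T : copen (fun z => T < Rabs (Im z)).
Proof.
  intros z Hz. exists (Rabs (Im z) - T). split. lra. intros w Hw.
  assert (A := Im_le_Cmod (w - z)). unfold Cminus in A, Hw. rewrite im_plus, im_opp in A.
  assert (B := Rabs_triang_inv (Im z) (Im z - Im w)). replace (Im z - (Im z - Im w)) with (Im w) in B by ring.
  rewrite (Rabs_minus_sym (Im z)) in B. unfold Rminus in B. lra.
Qed.

(** The cost of moving the real part of [s] by at most [dl]. A negative power of [y1] is a positive
    power of [1 / y1 <= y2], so small [y1] are covered too. *)
Lemma Rpower_small_shift (y1 y2 dl e : R) : 0 < y1 -> 0 < y2 -> 1 <= y1 * y2 -> Rabs e <= dl ->
  Rpower y1 e <= Rpower (Rmax y1 y2) dl.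
Proof.
  intros H1 H2 HD He. apply Rabs_le_between in He.
  assert (L1 : y1 <= Rmax y1 y2) by apply Rmax_l. assert (L2 : y2 <= Rmax y1 y2) by apply Rmax_r.
  assert (Y1 : 1 <= Rmax y1 y2). { destruct (Rle_lt_dec 1 (Rmax y1 y2)); auto. nra. }
  assert (P : exists x, 0 < x <= Rmax y1 y2 /\ Rpower y1 e = Rpower x (Rabs e)).
  { destruct (Rle_lt_dec 0 e).
    - exists y1. rewrite Rabs_right by lra. split; auto.
    - exists (/ y1). assert (Q := Rinv_0_lt_compat _ H1). split. split; auto.
      apply Rle_trans with y2; auto. apply Rmult_le_reg_l with y1; auto. rewrite Rinv_r; lra.
      rewrite Rabs_left by lra. unfold Rpower. rewrite ln_Rinv by auto. f_equal. ring. }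
  destruct P as [x [Hx ->]]. apply Rle_trans with (Rpower (Rmax y1 y2) (Rabs e)).
  apply Rpower_le_base; auto. apply Rabs_pos. apply Rle_Rpower; auto. apply Rabs_le; lra.
Qed.

(** Cauchy's estimates on a square of fixed half-side [dl] cost a constant, which is why [afe_bound]
    reaches over [- dl <= Re s <= 1 + dl]. Replacing [Re w] by [sigma] in the exponent of [y1] turns
    [2 dl] into [3 dl]. *)
Lemma afe_derivative_bound (F : selberg_class) (m : nat) (dl : R) : 0 < dl <= 1 / 4 -> exists T B, 1 <= T /\ 0 <= B /\
  forall sigma t y1 y2 : R, 0 <= sigma <= 1 -> T <= Rabs t -> 0 < y1 -> 0 < y2 ->
  y1 * y2 = conductor_root F ^ 2 * Rpower (Rabs t) (degree F) ->
  1 <= y1 * y2 /\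
  Cmod (C_derive_n F m (sigma, t) - afe_main F m y1 y2 (sigma, t)) <=
  B * (Rpower (Rmax y1 y2) (3 * dl) * Rpower y1 (- sigma) * (Rpower (Rabs t) (- / 2) * (y1 + sqrt (y1 * y2)))).
Proof.
  intros Hdl. destruct (afe_bound F dl Hdl) as [T [B [HT [HB H]]]].
  destruct (chi_facts F) as [T1 [K1 [HT1 [HK1 Hchi]]]].
  destruct (cauchy_estimate_n m dl) as [K [HK HC]]. lra.
  exists (T + T1 + 2), (K * B). split. lra. split. now apply Rmult_le_pos.
  intros sg t y1 y2 Hsg Ht Hy1 Hy2 HD. set (z0 := (sg, t) : C). set (t0 := Rabs t) in *.
  assert (HD1 : 1 <= y1 * y2).
  { apply (H z0 y1 y2 t0); auto; try lra. unfold z0, Im, snd. fold t0. rewrite Rminus_diag, Rabs_R0; lra.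
    unfold z0, Re, fst. lra. }
  split; auto.
  set (U := fun z : C => T1 < Rabs (Im z)). assert (HU : copen U) by apply copen_strip.
  assert (HhF : holo U F).
  { intros z Hz. apply F_cdiff. intros E. unfold U in Hz. rewrite E, Rabs_R0 in Hz. lra. }
  assert (Hhc : holo U (chi F)).
  { intros z Hz. destruct (Hchi z) as [_ [[l [Hl _]] _]]. unfold U in Hz; lra. eexists; exact Hl. }
  set (Er := fun j z => (C_derive_n F j z - afe_main F j y1 y2 z)%C).
  assert (HE : forall j z, U z -> cder (Er j) z (Er (S j) z)).
  { intros j z Hz. apply cder_minus. now apply (C_derive_n_cder U). now apply (afe_main_cder F U). }
  assert (Uz : U z0). { unfold U, z0, Im, snd. fold t0. lra. }
  change (Cmod (Er m z0) <= K * B * (Rpower (Rmax y1 y2) (3 * dl) * Rpower y1 (- sg) * (Rpower t0 (- / 2) * (y1 + sqrt (y1 * y2))))).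
  rewrite <- (C_derive_n_ext U (Er 0%nat) Er HU (fun z _ => eq_refl) HE m z0 Uz).
  rewrite Rmult_assoc.
  assert (Sq : forall w, insq z0 dl w -> Rabs (Rabs (Im w) - t0) <= dl).
  { intros w [_ Hw]. eapply Rle_trans. apply Rabs_triang_inv2. exact Hw. }
  apply (HC U); auto.
  - intros z Hz. eexists. now apply HE.
  - intros w Hw. assert (S1 := Sq w Hw). apply Rabs_le_between in S1. unfold U. lra.
  - intros w Hw. assert (S1 := Sq w Hw). destruct Hw as [Hw _]. change (Re z0) with sg in Hw.
    assert (Hw' := Hw). apply Rabs_le_between in Hw'.
    destruct (H w y1 y2 t0) as [_ G]; auto; try lra.
    assert (EE : Er 0%nat w = (F w - P1sum F w y1 - chi F w * P2sum F w y2)%C).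
    { unfold Er, afe_main. rewrite sum_n_n, !dirichlet_poly_csum. simpl C_derive_n. rewrite binom_0.
      unfold P1sum, P2sum.
      rewrite (csum_ext (fun n => sel_a F n * RtoC ((- ln (INR n)) ^ 0) * cpow (INR n) (- w))%C (fun n => sel_a F n * cpow (INR n) (- w))%C).
      rewrite (csum_ext (fun n => Cconj (sel_a F n) * RtoC ((- ln (INR n)) ^ 0) * cpow (INR n) (- (1 - w)))%C (fun n => Cconj (sel_a F n) * cpow (INR n) (- (1 - w)))%C).
      simpl pow. rewrite Rmult_1_r. ring. intros; simpl; ring. intros; simpl; ring. }
    rewrite EE. eapply Rle_trans. exact G. apply Rmult_le_compat_l; auto.
    apply Rmult_le_compat_r. { apply Rmult_le_pos. left; apply exp_pos. assert (Q := sqrt_pos (y1 * y2)). lra. }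
    replace (- Re w) with (- sg + - (Re w - sg)) by ring. rewrite Rpower_plus.
    replace (3 * dl) with (2 * dl + dl) by ring. rewrite Rpower_plus.
    rewrite (Rmult_assoc (Rpower (Rmax y1 y2) (2 * dl)) (Rpower (Rmax y1 y2) dl)). apply Rmult_le_compat_l. left; apply exp_pos.
    rewrite (Rmult_comm (Rpower (Rmax y1 y2) dl)). apply Rmult_le_compat_l. left; apply exp_pos.
    apply Rpower_small_shift; auto. now rewrite Rabs_Ropp.
Qed.

Lemma Rpower_bounded_exponent (x e b : R) : Rabs e <= b -> Rpower x e <= exp (b * Rabs (ln x)).
Proof.
  intros H. unfold Rpower. apply exp_le. eapply Rle_trans. apply Rle_abs. rewrite Rabs_mult.
  apply Rmult_le_compat_r; auto. apply Rabs_pos.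
Qed.

(** The larger of [y1], [y2] decides which error term dominates. If [y2 <= y1], then
    [q = sqrt (y1 y2) <= y1] and the first one does. Otherwise [y1 <= q], and [y1^(- sigma) q = (y1
    y2)^(1/2 - sigma) y2^sigma] leads to the second one, up to a bounded power of the conductor. *)
Lemma afe_two_terms (F : selberg_class) (m : nat) (eps : R) : 0 < eps -> exists T K, 1 <= T /\ 0 <= K /\
  forall sigma t y1 y2 : R, 0 <= sigma <= 1 -> T <= Rabs t -> 0 < y1 -> 0 < y2 ->
  y1 * y2 = conductor_root F ^ 2 * Rpower (Rabs t) (degree F) ->
  Cmod (C_derive_n F m (sigma, t) - afe_main F m y1 y2 (sigma, t)) <=
  K * (Rpower y1 (1 - sigma + eps) * Rpower (Rabs t) (- (1 / 2)))
    + K * (Rpower y2 (sigma + eps) * Rpower (Rabs t) (degree F * (1 / 2 - sigma) - 1 / 2)).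
Proof.
  (* [3 dl <= eps] matches the loss in [afe_derivative_bound], whose range is [dl <= 1/4]. *)
  intros He. set (dl := Rmin (1 / 4) (eps / 3)).
  assert (Hdl : 0 < dl <= 1 / 4 /\ dl <= eps / 3).
  { unfold dl. split. split. apply Rmin_pos; lra. apply Rmin_l. apply Rmin_r. }
  destruct (afe_derivative_bound F m dl) as [T [B [HT [HB H]]]]. apply Hdl.
  set (c := conductor_root F) in *. assert (Hc : 0 < c) by apply conductor_root_pos.
  set (Cc := exp (1 / 2 * Rabs (ln (c ^ 2)))). assert (HCc : 0 < Cc) by apply exp_pos.
  exists T, (2 * B * (1 + Cc)). split; auto. split. { apply Rmult_le_pos; lra. }
  intros sg t y1 y2 Hsg Ht Hy1 Hy2 HD. destruct (H sg t y1 y2 Hsg Ht Hy1 Hy2 HD) as [HD1 G]. clear H.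
  set (t0 := Rabs t) in *. set (q := sqrt (y1 * y2)) in *.
  assert (q0 : 0 < q) by (apply sqrt_lt_R0; lra). assert (qq : q * q = y1 * y2) by (apply sqrt_sqrt; lra).
  replace (- (1 / 2)) with (- / 2) by field.
  assert (h0 : 0 < Rpower t0 (- / 2)) by apply exp_pos. assert (x0 : 0 < Rpower y1 (- sg)) by apply exp_pos.
  assert (Y1 : 0 < Rpower y1 (1 - sg + eps) * Rpower t0 (- / 2)) by (apply Rmult_lt_0_compat; apply exp_pos).
  assert (Y2 : 0 < Rpower y2 (sg + eps) * Rpower t0 (degree F * (1 / 2 - sg) - 1 / 2)) by (apply Rmult_lt_0_compat; apply exp_pos).
  set (h := Rpower t0 (- / 2)) in *.
  eapply Rle_trans. exact G. rewrite <- Rmult_plus_distr_l.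
  apply Rle_trans with (B * (2 * ((1 + Cc) * (Rpower y1 (1 - sg + eps) * h + Rpower y2 (sg + eps) * Rpower t0 (degree F * (1 / 2 - sg) - 1 / 2))))).
  2: right; ring. apply Rmult_le_compat_l; auto.
  destruct (Rle_lt_dec y2 y1) as [C|C].
  - rewrite Rmax_left by auto. assert (y11 : 1 <= y1) by nra.
    assert (qy : q <= y1). { apply Rsqr_incr_0_var; [|lra]. unfold Rsqr. nra. }
    assert (E : Rpower y1 (3 * dl) <= Rpower y1 eps) by (apply Rle_Rpower; lra).
    apply Rle_trans with (Rpower y1 eps * Rpower y1 (- sg) * (h * (2 * y1))).
    + assert (0 < Rpower y1 (3 * dl)) by apply exp_pos. apply Rmult_le_compat; try (apply Rmult_le_pos; lra).
      apply Rmult_le_compat_r; lra. apply Rmult_le_compat_l; lra.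
    + replace (Rpower y1 eps * Rpower y1 (- sg) * (h * (2 * y1))) with (2 * (Rpower y1 (1 - sg + eps) * h)).
      2:{ replace (1 - sg + eps) with (eps + (- sg + 1)) by ring. rewrite !Rpower_plus, Rpower_1 by lra. ring. }
      apply Rmult_le_compat_l. lra. nra.
  - rewrite Rmax_right by lra. assert (y21 : 1 <= y2) by nra.
    assert (qy : y1 <= q). { apply Rsqr_incr_0_var; [|lra]. unfold Rsqr. nra. }
    assert (E : Rpower y2 (3 * dl) <= Rpower y2 eps) by (apply Rle_Rpower; lra).
    assert (Z : Rpower y1 (- sg) * q = Rpower (c ^ 2) (1 / 2 - sg) * Rpower t0 (degree F * (1 / 2 - sg)) * Rpower y2 sg).
    { rewrite <- Rpower_scaled by (try apply pow_lt; lra). rewrite <- HD.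
      replace (1 / 2 - sg) with (- sg + / 2) by field. rewrite Rpower_plus, (Rpower_sqrt (y1 * y2)) by lra. fold q.
      rewrite <- (Rpower_mult_distr y1 y2 (- sg)) by auto. rewrite (Rpower_Ropp y2).
      assert (0 < Rpower y2 sg) by apply exp_pos. field. lra. }
    assert (Zc : Rpower (c ^ 2) (1 / 2 - sg) <= Cc). { apply Rpower_bounded_exponent. apply Rabs_le. lra. }
    apply Rle_trans with (Rpower y2 eps * Rpower y1 (- sg) * (h * (2 * q))).
    + assert (0 < Rpower y2 (3 * dl)) by apply exp_pos. apply Rmult_le_compat; try (apply Rmult_le_pos; lra).
      apply Rmult_le_compat_r; lra. apply Rmult_le_compat_l; lra.
    + replace (Rpower y2 eps * Rpower y1 (- sg) * (h * (2 * q))) with (2 * (Rpower y2 eps * h * (Rpower y1 (- sg) * q))) by ring.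
      apply Rmult_le_compat_l. lra. rewrite Z.
      replace (Rpower y2 eps * h * (Rpower (c ^ 2) (1 / 2 - sg) * Rpower t0 (degree F * (1 / 2 - sg)) * Rpower y2 sg)) with
        (Rpower (c ^ 2) (1 / 2 - sg) * (Rpower y2 (sg + eps) * Rpower t0 (degree F * (1 / 2 - sg) - 1 / 2))).
      2:{ replace (degree F * (1 / 2 - sg) - 1 / 2) with (degree F * (1 / 2 - sg) + - / 2) by field. rewrite !Rpower_plus. fold h. ring. }
      set (V := Rpower y2 (sg + eps) * Rpower t0 (degree F * (1 / 2 - sg) - 1 / 2)) in *.
      apply Rle_trans with (Cc * V). apply Rmult_le_compat_r; lra. nra.
Qed.

Theorem theorem2 (F : selberg_class) (m : nat) (eps : R) (heps : 0 < eps) :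
  (exists T K : R, forall sigma t y1 y2 : R,
     let s : C := (sigma, t) in
     0 <= sigma <= 1 -> T <= Rabs t -> 0 < y1 -> 0 < y2 ->
     y1 * y2 = (conductor_root F) ^ 2 * Rpower (Rabs t) (degree F) ->
     Cmod (C_derive_n F m s - afe_main F m y1 y2 s)%C
     <= K * (Rpower y1 (1 - sigma + eps) * Rpower (Rabs t) (- (1 / 2)))
        + K * (Rpower y2 (sigma + eps)
               * Rpower (Rabs t) (degree F * (1 / 2 - sigma) - 1 / 2)))
  /\
  (exists T K : R, forall sigma t : R,
     let s : C := (sigma, t) in
     let y : R := conductor_root F * Rpower (Rabs t) (degree F / 2) in
     0 <= sigma <= 1 -> T <= Rabs t ->
     Cmod (C_derive_n F m s - afe_main F m y y s)%C
     <= K * Rpower (Rabs t) (degree F / 2 * (1 - sigma) - 1 / 2 + eps)).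
Proof.
  split.
  - destruct (afe_two_terms F m eps heps) as [T [K [_ [_ H]]]]. exists T, K. exact H.
  (* [y] is of size [|t|^(d / 2)], so the exponent [2 eps / d] of [y] becomes [eps] as an exponent
     of [|t|]. *)
  - assert (dp := degree_pos F). set (d := degree F) in *. set (e := eps * 2 / d).
    assert (He : 0 < e) by (apply Rdiv_lt_0_compat; lra).
    destruct (afe_two_terms F m e He) as [T [K [HT [HK H]]]].
    set (c := conductor_root F) in *. assert (Hc : 0 < c) by apply conductor_root_pos.
    set (Cc := exp ((1 + e) * Rabs (ln c))).
    exists T, (2 * K * Cc). intros sg t s y Hsg Ht. unfold s. set (t0 := Rabs t) in *.
    assert (t1 : 0 < t0) by lra.
    assert (y0 : 0 < y) by (apply Rmult_lt_0_compat; auto; apply exp_pos).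
    eapply Rle_trans. apply H; auto.
    { unfold y. fold c d t0. replace d with (d / 2 + d / 2) at 3 by field. rewrite Rpower_plus. ring. }
    fold t0 d. set (g := Rpower t0 (d / 2 * (1 - sg) - 1 / 2 + eps)). assert (g0 : 0 < g) by apply exp_pos.
    assert (E1 : Rpower y (1 - sg + e) * Rpower t0 (- (1 / 2)) = Rpower c (1 - sg + e) * g).
    { unfold y. fold c d t0. rewrite Rpower_scaled by auto. rewrite Rmult_assoc, <- Rpower_plus. unfold g.
      f_equal. f_equal. unfold e. field. lra. }
    assert (E2 : Rpower y (sg + e) * Rpower t0 (d * (1 / 2 - sg) - 1 / 2) = Rpower c (sg + e) * g).
    { unfold y. fold c d t0. rewrite Rpower_scaled by auto. rewrite Rmult_assoc, <- Rpower_plus. unfold g.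
      f_equal. f_equal. unfold e. field. lra. }
    rewrite E1, E2.
    assert (C1 : Rpower c (1 - sg + e) <= Cc) by (apply Rpower_bounded_exponent; apply Rabs_le; lra).
    assert (C2 : Rpower c (sg + e) <= Cc) by (apply Rpower_bounded_exponent; apply Rabs_le; lra).
    assert (G1 : Rpower c (1 - sg + e) * g <= Cc * g) by (apply Rmult_le_compat_r; lra).
    assert (G2 : Rpower c (sg + e) * g <= Cc * g) by (apply Rmult_le_compat_r; lra).
    replace (2 * K * Cc * g) with (K * (Cc * g) + K * (Cc * g)) by ring.
    apply Rplus_le_compat; now apply Rmult_le_compat_l.
Qed.
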